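(* Let $Q\ge 16$ be an integer and $0<\delta<7/2$. There is a set $E(\delta)$ of primitive Dirichlet characters of conductor at most $Q$, with $\#E(\delta)\ll_\delta Q^\delta$, such that for every real $a$ with $\delta\log Q>28a\ge0$ and every primitive Dirichlet character $\chi$ of conductor $q\le Q$ with $\chi\notin E(\delta)$, \[ \log L(1-a/\log Q,\chi)=\sum_{p\le(\log Q)^{14/\delta}}\frac{\chi(p)}{p^{1-a/\log Q}}+C(1-a/\log Q,\chi)+O_\delta\Big(\frac{e^a\log\log Q}{\log Q}\Big), \] and consequently \[ L(1-a/\log Q,\chi)=\Big(1+O_\delta\Big(\frac{e^a\log\log Q}{\log Q}\Big)\Big)\prod_{p\le(\log Q)^{14/\delta}}\Big(1-\frac{\chi(p)}{p^{1-a/\log Q}}\Big)^{-1}. \]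
   Context: $L(s,\chi)$ is the Dirichlet $L$-function of $\chi$; $p$ runs over primes. For $\alpha>1/2$, $C(\alpha,\chi)=\sum_p\sum_{\ell=2}^\infty\frac{\chi(p)^\ell}{\ell p^{\ell\alpha}}$. For $\chi\notin E(\delta)$, $L(s,\chi)$ has no zero on the region $\{\sigma\ge1\}\cup\{1-\delta/7\le\sigma<1,|t|\le2(\log Q)^3\}$, and $\log L(s,\chi)$ denotes the branch of the logarithm holomorphic there and equal to $\sum_p\sum_{\ell\ge1}\frac{\chi(p)^\ell}{\ell p^{\ell s}}$ for $\sigma>1$. Implied constants depend only on $\delta$. *)

(* Defs.v *)
(* Stdlib reals and integers, with Coquelicot for complex analysis. *)
From Stdlib Require Import Reals ZArith Znumtheory List ClassicalEpsilon.
From Coquelicot Require Import Coquelicot.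

Open Scope R_scope.

Definition Cexp (z : C) : C :=
  (exp (Re z) * cos (Im z), exp (Re z) * sin (Im z)).

(* n^s for n >= 1, with the real logarithm of n. *)
Definition npow (n : nat) (s : C) : C := Cexp (s * RtoC (ln (INR n)))%C.

(* Coquelicot's [Series] is real-valued. *)
Definition CSeries (a : nat -> C) : C :=
  (Series (fun n => Re (a n)), Series (fun n => Im (a n))).

Definition prime_series (f : nat -> C) : C :=
  CSeries (fun n => if prime_dec (Z.of_nat n) then f n else RtoC 0).

Definition primes_le (y : R) : list nat :=
  filter (fun n => if prime_dec (Z.of_nat n) then true else false)
         (seq 0 (S (Z.to_nat (Zfloor y)))).

Definition prime_sum (y : R) (f : nat -> C) : C :=
  fold_right Cplus (RtoC 0) (map f (primes_le y)).

Definition prime_prod (y : R) (f : nat -> C) : C :=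
  fold_right Cmult (RtoC 1) (map f (primes_le y)).

Definition holomorphic_at (f : C -> C) (s : C) : Prop :=
  ex_derive (K := C_AbsRing) (V := C_NormedModule) f s.

Record dirichlet_character (q : nat) (chi : Z -> C) : Prop := {
  modulus_pos : (0 < q)%nat;
  chi_mult : forall m n : Z, chi (m * n)%Z = (chi m * chi n)%C;
  chi_periodic : forall n : Z, chi (n + Z.of_nat q)%Z = chi n;
  chi_support : forall n : Z, chi n <> RtoC 0 <-> rel_prime n (Z.of_nat q)
}.

Definition induced_by (q : nat) (chi : Z -> C) (d : nat) (psi : Z -> C) : Prop :=
  (Z.of_nat d | Z.of_nat q)%Z /\ dirichlet_character d psi /\
  forall n : Z, rel_prime n (Z.of_nat q) -> chi n = psi n.

(* The primitive characters of conductor q are those modulo q which are not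
   induced from a smaller modulus.  The trivial character is primitive of
   conductor 1.  As functions on Z, primitive characters of different
   conductors are different. *)
Definition primitive_character (q : nat) (chi : Z -> C) : Prop :=
  dirichlet_character q chi /\
  ~ exists (d : nat) (psi : Z -> C), (d < q)%nat /\ induced_by q chi d psi.

Definition principal (chi : Z -> C) : Prop :=
  forall n : Z, chi n <> RtoC 0 -> chi n = RtoC 1.

Definition dirichlet_series (chi : Z -> C) (s : C) : C :=
  CSeries (fun n => chi (Z.of_nat (S n)) / npow (S n) s)%C.

(* F is the continuation of the Dirichlet series of chi to the whole plane,
   with 1 as a possible pole when chi is principal. *)
Definition is_dirichlet_L (chi : Z -> C) (F : C -> C) : Prop :=
  (forall s : C, 1 < Re s -> F s = dirichlet_series chi s) /\
  (forall s : C, s <> RtoC 1 \/ ~ principal chi -> holomorphic_at F s).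

(* By the identity theorem [is_dirichlet_L chi] determines its solution, up to
   the (meaningless) value at the pole 1 when chi is principal. *)
Definition dirichlet_L (chi : Z -> C) : C -> C :=
  epsilon (inhabits (fun _ : C => RtoC 0)) (is_dirichlet_L chi).

Definition log_term (chi : Z -> C) (s : C) (p l : nat) : C :=
  (chi (Z.of_nat p) ^ l / (RtoC (INR l) * npow p (RtoC (INR l) * s)))%C.

Definition log_series (chi : Z -> C) (s : C) : C :=
  prime_series (fun p => CSeries (fun k => log_term chi s p (k + 1))).

Definition C_sum (alpha : R) (chi : Z -> C) : C :=
  prime_series (fun p => CSeries (fun k => log_term chi (RtoC alpha) p (k + 2))).

Definition region (delta : R) (Q : nat) (s : C) : Prop :=
  1 <= Re s \/
  (1 - delta / 7 <= Re s < 1 /\ Rabs (Im s) <= 2 * ln (INR Q) ^ 3).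

(* G is the branch on D of the logarithm of L(s, chi) given by the Euler product
   for Re s > 1.  As D need not be open, holomorphic on D means holomorphic on
   some open set containing D. *)
Definition is_log_L (D : C -> Prop) (chi : Z -> C) (G : C -> C) : Prop :=
  (exists U : C -> Prop, open U /\
     (forall s : C, D s -> U s) /\ (forall s : C, U s -> holomorphic_at G s)) /\
  (forall s : C, D s -> Cexp (G s) = dirichlet_L chi s) /\
  (forall s : C, 1 < Re s -> G s = log_series chi s).

(* Main.v *)
(** Let u = delta/28, L = log Q, y = L^(14/delta) and let P be the product of
    1 - chi(p) p^(-s) over p <= y.  Apart from the principal character, the exceptional
    set consists of the characters whose L-function has a zero with Re s >= 1 - delta/7 and
    |Im s| <= 2 L^3, and of those for which L(s, chi) P(s) differs from 1 by more than C/L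
    at some real s in [1-u, 3]; for bounded Q it contains all characters.

    Both kinds are counted with a mollifier M, the truncation at X of the product of
    1 - chi(p) p^(-s) over p <= z.  The coefficients of L M are those of the integers free of
    primes <= z up to X, and divisor bounded after X.  If L M is not close to 1, some
    dyadic block of coefficients is large at a point near the 1-line, and a large sieve
    inequality for primitive characters bounds how often this happens.  For zeros one takes
    z = X = Q^(2 - 3 delta/7), which leaves no block before X.  For the second kind z = y and
    X = Q^2; a block before X is raised to a power of length about Q^2, whose coefficients
    are small because integers free of primes <= y have few prime factors, and Rankin's
    trick replaces P by M.  The large sieve is elementary: products chi conj(psi) of distinct
    primitive characters have mean zero, so iterated summation makes them cancel over
    intervals of length Q^(2+eps).

    For the other characters the logarithm is continued along horizontal lines from
    Re s > 1, where it is the Euler product, the line Re s = 1 being free of zeros by the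
    3-4-1 inequality.  On the segment from 3 to 1 - a/L it equals
    log(L P) + sum over p <= y of -log(1 - chi(p) p^(-s)); the first term is O(1/L),
    and cutting the sum C(1 - a/L, chi) at y costs O(1/L). *)

Require Import Defs.
From Stdlib Require Import Reals ZArith Znumtheory List Lra Lia Classical ClassicalEpsilon FunctionalExtensionality Permutation Zwf.
From Coquelicot Require Import Coquelicot.
Import ListNotations.
Open Scope R_scope.

(** * Finite sums *)

(** [dirichlet_L] is an [epsilon]: nothing is known about it until a continuation has been built and
    shown to be unique. Hence the summation by parts to any order and the theorem of Goursat. No
    functional equation enters. L is only compared with its partial sums, with an error proportional
    to the conductor, so all lengths are fixed powers of Q.

    The constants come from exponents of Q. For zeros within v = delta/7 of the 1-line, blocks N
    between Q^(2-3v) and about Q^3 cost (N + Q^2) N^(2v-1), up to small powers at most Q^(7v). For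
    the second kind y = L^(1/(2u)), and k is the power taken of a block. Thresholds of size about
    1/L cost L^(2k), which is about Q^(9u) at worst. The factor N^(2uk) costs Q^(8.3u), and k^w,
    where w bounds the number of prime factors above y, costs Q^(8.4u). The total stays below
    Q^(28u). The thresholds also decay geometrically over the blocks, so that the deviation from 1
    is O(1/L) whatever the number of blocks. *)

Definition rsum {A : Type} (l : list A) (f : A -> R) : R :=
  fold_right Rplus 0 (map f l).

Definition csum {A : Type} (l : list A) (f : A -> C) : C :=
  fold_right Cplus (RtoC 0) (map f l).

Definition cprod {A : Type} (l : list A) (f : A -> C) : C :=
  fold_right Cmult (RtoC 1) (map f l).

Lemma rsum_cons {A} (a : A) l f : rsum (a :: l) f = f a + rsum l f.
Proof. reflexivity. Qed.

Lemma csum_cons {A} (a : A) l f : csum (a :: l) f = (f a + csum l f)%C.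
Proof. reflexivity. Qed.

Lemma rsum_app {A} (l1 l2 : list A) f : rsum (l1 ++ l2) f = rsum l1 f + rsum l2 f.
Proof.
  induction l1 as [|a l1 IH]; simpl; [unfold rsum; simpl; ring|].
  rewrite !rsum_cons, IH; ring.
Qed.

Lemma csum_app {A} (l1 l2 : list A) f : csum (l1 ++ l2) f = (csum l1 f + csum l2 f)%C.
Proof.
  induction l1 as [|a l1 IH]; simpl; [unfold csum; simpl; ring|].
  rewrite !csum_cons, IH; ring.
Qed.

Lemma rsum_map {A B} (g : A -> B) l f : rsum (map g l) f = rsum l (fun a => f (g a)).
Proof. unfold rsum; now rewrite map_map. Qed.

Lemma csum_map {A B} (g : A -> B) l f : csum (map g l) f = csum l (fun a => f (g a)).
Proof. unfold csum; now rewrite map_map. Qed.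

Lemma rsum_ext {A} (l : list A) f g : (forall a, In a l -> f a = g a) -> rsum l f = rsum l g.
Proof. intros H; unfold rsum; f_equal; now apply map_ext_in. Qed.

Lemma csum_ext {A} (l : list A) f g : (forall a, In a l -> f a = g a) -> csum l f = csum l g.
Proof. intros H; unfold csum; f_equal; now apply map_ext_in. Qed.

Lemma rsum_le {A} (l : list A) f g : (forall a, In a l -> f a <= g a) -> rsum l f <= rsum l g.
Proof.
  induction l as [|a l IH]; intros H; [apply Rle_refl|].
  rewrite !rsum_cons; apply Rplus_le_compat; [apply H; now left|].
  apply IH; intros b Hb; apply H; now right.
Qed.

Lemma rsum_0 {A} (l : list A) : rsum l (fun _ => 0) = 0.
Proof. induction l as [|a l IH]; [reflexivity|rewrite rsum_cons, IH; ring]. Qed.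

Lemma csum_0 {A} (l : list A) : csum l (fun _ => RtoC 0) = RtoC 0.
Proof. induction l as [|a l IH]; [reflexivity|rewrite csum_cons, IH; ring]. Qed.

Lemma rsum_const {A} (l : list A) c : rsum l (fun _ => c) = INR (length l) * c.
Proof.
  induction l as [|a l IH]; [simpl; unfold rsum; simpl; ring|].
  rewrite rsum_cons, IH. cbn [length]. rewrite S_INR. ring.
Qed.

Lemma csum_const {A} (l : list A) c : csum l (fun _ => c) = (RtoC (INR (length l)) * c)%C.
Proof.
  induction l as [|a l IH]; [simpl; unfold csum; simpl; ring|].
  rewrite csum_cons, IH. cbn [length]. rewrite S_INR, RtoC_plus. ring.
Qed.

Lemma rsum_ge0 {A} (l : list A) f : (forall a, In a l -> 0 <= f a) -> 0 <= rsum l f.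
Proof. intros H; rewrite <- (rsum_0 l); now apply rsum_le. Qed.

Lemma rsum_plus {A} (l : list A) f g : rsum l (fun a => f a + g a) = rsum l f + rsum l g.
Proof. induction l as [|a l IH]; [unfold rsum; simpl; ring|]; rewrite !rsum_cons, IH; ring. Qed.

Lemma csum_plus {A} (l : list A) f g :
  csum l (fun a => f a + g a)%C = (csum l f + csum l g)%C.
Proof. induction l as [|a l IH]; [unfold csum; simpl; ring|]; rewrite !csum_cons, IH; ring. Qed.

Lemma csum_minus {A} (l : list A) f g :
  csum l (fun a => f a - g a)%C = (csum l f - csum l g)%C.
Proof. induction l as [|a l IH]; [unfold csum; simpl; ring|]; rewrite !csum_cons, IH; ring. Qed.

Lemma rsum_scal {A} (l : list A) c f : rsum l (fun a => c * f a) = c * rsum l f.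
Proof. induction l as [|a l IH]; [unfold rsum; simpl; ring|]; rewrite !rsum_cons, IH; ring. Qed.

Lemma csum_scal {A} (l : list A) c f : csum l (fun a => c * f a)%C = (c * csum l f)%C.
Proof. induction l as [|a l IH]; [unfold csum; simpl; ring|]; rewrite !csum_cons, IH; ring. Qed.

Lemma csum_conj {A} (l : list A) f : Cconj (csum l f) = csum l (fun a => Cconj (f a)).
Proof.
  induction l as [|a l IH].
  - unfold csum; simpl; unfold Cconj; simpl; now rewrite Ropp_0.
  - rewrite !csum_cons, <- IH, Cplus_conj; reflexivity.
Qed.

Lemma rsum_swap {A B} (l : list A) (m : list B) (f : A -> B -> R) :
  rsum l (fun a => rsum m (f a)) = rsum m (fun b => rsum l (fun a => f a b)).
Proof.
  induction l as [|a l IH].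
  - unfold rsum at 1; simpl. symmetry; apply rsum_0.
  - rewrite rsum_cons, IH, <- rsum_plus. apply rsum_ext; intros; now rewrite rsum_cons.
Qed.

Lemma csum_swap {A B} (l : list A) (m : list B) (f : A -> B -> C) :
  csum l (fun a => csum m (f a)) = csum m (fun b => csum l (fun a => f a b)).
Proof.
  induction l as [|a l IH].
  - unfold csum at 1; simpl. symmetry; apply csum_0.
  - rewrite csum_cons, IH, <- csum_plus. apply csum_ext; intros; now rewrite csum_cons.
Qed.

Lemma csum_RtoC {A} (l : list A) f : csum l (fun a => RtoC (f a)) = RtoC (rsum l f).
Proof. induction l as [|a l IH]; [reflexivity|]; now rewrite csum_cons, rsum_cons, IH, RtoC_plus. Qed.

Lemma Cmod_csum {A} (l : list A) f : Cmod (csum l f) <= rsum l (fun a => Cmod (f a)).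
Proof.
  induction l as [|a l IH]; [unfold csum, rsum; simpl; rewrite Cmod_0; lra|].
  rewrite csum_cons, rsum_cons. eapply Rle_trans; [apply Cmod_triangle|]; lra.
Qed.

Lemma csum_mult {A B} (l : list A) (m : list B) f g :
  (csum l f * csum m g)%C = csum l (fun a => csum m (fun b => (f a * g b)%C)).
Proof.
  rewrite Cmult_comm, <- csum_scal. apply csum_ext; intros a _.
  rewrite csum_scal; ring.
Qed.

Lemma rsum_mult {A B} (l : list A) (m : list B) f g :
  rsum l f * rsum m g = rsum l (fun a => rsum m (fun b => f a * g b)).
Proof.
  rewrite Rmult_comm, <- rsum_scal. apply rsum_ext; intros a _.
  rewrite rsum_scal; ring.
Qed.

Lemma csum_perm {A} (l m : list A) f : Permutation l m -> csum l f = csum m f.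
Proof.
  induction 1; rewrite ?csum_cons; [reflexivity|now rewrite IHPermutation| |congruence].
  ring.
Qed.

Lemma rsum_perm {A} (l m : list A) f : Permutation l m -> rsum l f = rsum m f.
Proof.
  induction 1; rewrite ?rsum_cons; [reflexivity|now rewrite IHPermutation| |congruence].
  ring.
Qed.

Lemma rsum_CS {A} (l : list A) f g :
  rsum l (fun a => f a * g a) ^ 2 <= rsum l (fun a => f a ^ 2) * rsum l (fun a => g a ^ 2).
Proof.
  induction l as [|a l IH]; [unfold rsum; simpl; lra|].
  rewrite !rsum_cons.
  set (p := rsum l (fun a => f a * g a)) in *.
  assert (HX : 0 <= rsum l (fun a => f a ^ 2)) by (apply rsum_ge0; intros; apply pow2_ge_0).
  assert (HY : 0 <= rsum l (fun a => g a ^ 2)) by (apply rsum_ge0; intros; apply pow2_ge_0).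
  set (X := rsum l (fun a => f a ^ 2)) in *. set (Y := rsum l (fun a => g a ^ 2)) in *.
  generalize (f a) (g a); intros u v.
  (* X times the difference of the two sides is (u p - X v)^2 + u^2 (X Y - p^2), and the induction
     hypothesis makes X Y - p^2 nonnegative. If X = 0, then p = 0. *)
  assert (H2 : 2 * (u * v * p) <= u ^ 2 * Y + X * v ^ 2).
  { destruct (Req_dec X 0) as [E|E].
    - rewrite E in *. assert (p ^ 2 <= 0) by lra. assert (p = 0) by nra. subst; nra.
    - apply Rmult_le_reg_r with X; [lra|].
      assert (0 <= (u * p - X * v) ^ 2) by apply pow2_ge_0.
      assert (0 <= u ^ 2 * (X * Y - p ^ 2)) by (apply Rmult_le_pos; [apply pow2_ge_0|lra]).
      nra. }
  nra.
Qed.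

Lemma csum_CS {A} (l : list A) (f g : A -> C) :
  Cmod (csum l (fun a => f a * g a)%C) ^ 2
  <= rsum l (fun a => Cmod (f a) ^ 2) * rsum l (fun a => Cmod (g a) ^ 2).
Proof.
  eapply Rle_trans; [|apply rsum_CS].
  apply pow_incr; split; [apply Cmod_ge_0|].
  eapply Rle_trans; [apply Cmod_csum|]. apply Req_le, rsum_ext; intros; apply Cmod_mult.
Qed.

Lemma csum_sqr {A} (l : list A) (f : A -> C) :
  RtoC (Cmod (csum l f) ^ 2)
  = csum l (fun a => csum l (fun b => (f a * Cconj (f b))%C)).
Proof. rewrite Cmod2_conj, csum_conj, csum_mult; reflexivity. Qed.

Lemma rsum_incl {A} (l m : list A) f :
  NoDup l -> incl l m -> (forall a, In a m -> 0 <= f a) -> rsum l f <= rsum m f.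
Proof.
  revert m; induction l as [|a l IH]; intros m Hn Hi Hf.
  - apply rsum_ge0, Hf.
  - inversion Hn; subst.
    destruct (in_split a m) as [m1 [m2 E]]; [apply Hi; now left|].
    assert (P : Permutation m (a :: m1 ++ m2)) by (subst m; symmetry; apply Permutation_middle).
    rewrite (rsum_perm _ _ f P), !rsum_cons.
    apply Rplus_le_compat_l, IH; [assumption| |].
    + intros b Hb.
      assert (Hb' : In b (a :: m1 ++ m2)) by (eapply Permutation_in; [exact P|apply Hi; now right]).
      destruct Hb' as [<-|]; [contradiction|assumption].
    + intros b Hb; apply Hf. eapply Permutation_in; [symmetry; exact P|now right].
Qed.

Lemma csum_flat_map {A B} (l : list A) (g : A -> list B) f :
  csum (flat_map g l) f = csum l (fun a => csum (g a) f).
Proof. induction l as [|a l IH]; [reflexivity|]; simpl; now rewrite csum_app, csum_cons, IH. Qed.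

Lemma rsum_filter {A} (l : list A) (b : A -> bool) f :
  rsum (filter b l) f = rsum l (fun a => if b a then f a else 0).
Proof.
  induction l as [|a l IH]; [reflexivity|]; simpl; rewrite rsum_cons.
  destruct (b a); rewrite ?rsum_cons, IH; ring.
Qed.

Lemma csum_filter {A} (l : list A) (b : A -> bool) f :
  csum (filter b l) f = csum l (fun a => if b a then f a else RtoC 0).
Proof.
  induction l as [|a l IH]; [reflexivity|]; simpl; rewrite csum_cons.
  destruct (b a); rewrite ?csum_cons, IH; ring.
Qed.

Lemma csum_seq_S f a n :
  csum (seq a (S n)) f = (csum (seq a n) f + f (a + n)%nat)%C.
Proof. rewrite seq_S, csum_app; unfold csum at 2; simpl; ring. Qed.

Lemma rsum_seq_S f a n : rsum (seq a (S n)) f = rsum (seq a n) f + f (a + n)%nat.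
Proof. rewrite seq_S, rsum_app; unfold rsum at 2; simpl; ring. Qed.

Lemma csum_seq_add f a n m :
  csum (seq a (n + m)) f = (csum (seq a n) f + csum (seq (a + n) m) f)%C.
Proof. now rewrite seq_app, csum_app. Qed.

Lemma rsum_seq_shift f a n k : rsum (seq (a + k) n) f = rsum (seq a n) (fun i => f (i + k)%nat).
Proof.
  revert a; induction n as [|n IH]; intros a; [reflexivity|].
  rewrite !rsum_seq_S, IH; do 2 f_equal; lia.
Qed.

Lemma csum_seq_shift f a n k : csum (seq (a + k) n) f = csum (seq a n) (fun i => f (i + k)%nat).
Proof.
  revert a; induction n as [|n IH]; intros a; [reflexivity|].
  rewrite !csum_seq_S, IH; do 2 f_equal; lia.
Qed.

(** * Periodic functions and Dirichlet characters *)

Definition periodic (D : nat) (f : Z -> C) : Prop :=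
  (0 < D)%nat /\ forall n, f (n + Z.of_nat D)%Z = f n.

Definition zsum (a : Z) (n : nat) (f : Z -> C) : C :=
  csum (seq 0 n) (fun i => f (a + Z.of_nat i)%Z).

Definition mean_zero (D : nat) (f : Z -> C) : Prop := zsum 0 D f = RtoC 0.

Lemma zsum_S a n f : zsum a (S n) f = (zsum a n f + f (a + Z.of_nat n)%Z)%C.
Proof. unfold zsum; now rewrite csum_seq_S. Qed.

Lemma zsum_add a n m f : zsum a (n + m) f = (zsum a n f + zsum (a + Z.of_nat n) m f)%C.
Proof.
  induction m as [|m IH].
  - rewrite Nat.add_0_r; unfold zsum at 3, csum; simpl; ring.
  - rewrite Nat.add_succ_r, !zsum_S, IH.
    replace (a + Z.of_nat (n + m))%Z with (a + Z.of_nat n + Z.of_nat m)%Z by lia; ring.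
Qed.

Lemma zsum_step a n f : (zsum (a + 1) n f = zsum a n f - f a + f (a + Z.of_nat n)%Z)%C.
Proof.
  induction n as [|n IH].
  - unfold zsum, csum; simpl; rewrite Z.add_0_r; ring.
  - rewrite !zsum_S, IH.
    replace (a + 1 + Z.of_nat n)%Z with (a + Z.of_nat (S n))%Z by lia; ring.
Qed.

Lemma zsum_period D f : periodic D f -> forall a, zsum a D f = zsum 0 D f.
Proof.
  intros [_ HD].
  assert (Hs : forall a, zsum (a + 1) D f = zsum a D f) by (intros; rewrite zsum_step, HD; ring).
  assert (Hp : forall n : nat, zsum (Z.of_nat n) D f = zsum 0 D f).
  { induction n as [|n IH]; [reflexivity|].
    replace (Z.of_nat (S n)) with (Z.of_nat n + 1)%Z by lia; now rewrite Hs. }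
  assert (Hm : forall n : nat, zsum (- Z.of_nat n) D f = zsum 0 D f).
  { induction n as [|n IH]; [reflexivity|].
    rewrite <- IH, <- Hs; f_equal; lia. }
  intros a. destruct (Z_le_gt_dec 0 a).
  - rewrite <- (Hp (Z.to_nat a)); f_equal; lia.
  - rewrite <- (Hm (Z.to_nat (- a))); f_equal; lia.
Qed.

Lemma Cmod_zsum_le a n f B : (forall i, Cmod (f i) <= B) -> Cmod (zsum a n f) <= INR n * B.
Proof.
  intros H. eapply Rle_trans; [apply Cmod_csum|].
  rewrite <- (length_seq n 0) at 2; rewrite <- rsum_const; apply rsum_le; intros; apply H.
Qed.

(* Complete periods drop out, so an interval of any length contributes fewer
   than [D] terms. *)
Lemma Cmod_zsum_period D f B :
  periodic D f -> mean_zero D f -> (forall i, Cmod (f i) <= B) ->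
  forall n a, Cmod (zsum a n f) <= INR D * B.
Proof.
  intros HP HM HB n. assert (0 <= B) by (eapply Rle_trans; [apply Cmod_ge_0|apply (HB 0%Z)]).
  induction n as [n IH] using lt_wf_ind; intros a.
  destruct (le_lt_dec D n) as [L|L].
  - replace n with (D + (n - D))%nat by lia.
    rewrite zsum_add, (zsum_period _ _ HP), HM, Cplus_0_l.
    apply IH; destruct HP; lia.
  - eapply Rle_trans; [apply Cmod_zsum_le, HB|].
    apply Rmult_le_compat_r; [assumption|]; apply le_INR; lia.
Qed.

Lemma periodic_mul D f k : periodic D f -> forall n, f (n + Z.of_nat D * k)%Z = f n.
Proof.
  intros [_ HD].
  assert (Hp : forall (j : nat) n, f (n + Z.of_nat D * Z.of_nat j)%Z = f n).
  { induction j as [|j IH]; intros n; [f_equal; lia|].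
    transitivity (f (n + Z.of_nat D * Z.of_nat j + Z.of_nat D)%Z); [f_equal; lia|].
    rewrite HD; apply IH. }
  intros n. destruct (Z_le_gt_dec 0 k).
  - rewrite <- (Hp (Z.to_nat k) n), Z2Nat.id by lia; reflexivity.
  - rewrite <- (Hp (Z.to_nat (- k)) (n + Z.of_nat D * k)%Z), Z2Nat.id by lia; f_equal; ring.
Qed.

Lemma periodic_mod D f n : periodic D f -> f (n mod Z.of_nat D)%Z = f n.
Proof.
  intros HP. rewrite <- (periodic_mul _ _ (n / Z.of_nat D) HP (n mod Z.of_nat D)).
  f_equal. destruct HP. pose proof (Z.div_mod n (Z.of_nat D)). lia.
Qed.

(** Convolution with an interval of length H. After j applications a bounded mean zero function of
    period D has size D^j only, while the mass of a nonnegative function grows like H^j. The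
    quotient (D/H)^j is the saving that smooth weights would give. *)
Definition shift_sum (H : nat) (f : Z -> C) : Z -> C := fun n => zsum n H f.

Lemma shift_sum_periodic H D f : periodic D f -> periodic D (shift_sum H f).
Proof.
  intros [H0 HD]; split; [assumption|]; intros n; unfold shift_sum, zsum.
  apply csum_ext; intros i _.
  transitivity (f (n + Z.of_nat i + Z.of_nat D)%Z); [f_equal; lia|apply HD].
Qed.

Lemma shift_sum_mean_zero H D f : periodic D f -> mean_zero D f -> mean_zero D (shift_sum H f).
Proof.
  intros HP HM; unfold mean_zero, shift_sum, zsum. rewrite csum_swap.
  rewrite <- (csum_0 (seq 0 H)); apply csum_ext; intros i _.
  transitivity (zsum (Z.of_nat i) D f); [|now rewrite (zsum_period _ _ HP)].
  unfold zsum; apply csum_ext; intros; f_equal; lia.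
Qed.

Fixpoint shift_iter (j H : nat) (f : Z -> C) : Z -> C :=
  match j with O => f | S j => shift_sum H (shift_iter j H f) end.

Lemma shift_iter_bound j H D f :
  periodic D f -> mean_zero D f -> (forall i, Cmod (f i) <= 1) ->
  periodic D (shift_iter j H f) /\ mean_zero D (shift_iter j H f) /\
  forall i, Cmod (shift_iter j H f i) <= INR D ^ j.
Proof.
  intros HP HM HB. induction j as [|j [IP [IM IB]]]; simpl; [auto|].
  split; [now apply shift_sum_periodic|]; split; [now apply shift_sum_mean_zero|].
  intros i; now apply Cmod_zsum_period.
Qed.

Lemma shift_iter_csum {A} (l : list A) (f : A -> Z -> C) j H n :
  shift_iter j H (fun m => csum l (fun a => f a m)) n = csum l (fun a => shift_iter j H (f a) n).
Proof.
  revert n; induction j as [|j IH]; intros n; simpl; [reflexivity|].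
  unfold shift_sum, zsum. rewrite csum_swap. apply csum_ext; intros; apply IH.
Qed.

Lemma shift_iter_scal c (f : Z -> C) j H n :
  shift_iter j H (fun m => c * f m)%C n = (c * shift_iter j H f n)%C.
Proof.
  revert n; induction j as [|j IH]; intros n; simpl; [reflexivity|].
  unfold shift_sum, zsum. rewrite <- csum_scal. apply csum_ext; intros; apply IH.
Qed.

Lemma shift_iter_ext f g j H n : (forall m, f m = g m) -> shift_iter j H f n = shift_iter j H g n.
Proof.
  intros E; revert n; induction j as [|j IH]; intros n; simpl; [apply E|].
  unfold shift_sum, zsum; apply csum_ext; intros; apply IH.
Qed.

(** * Dirichlet characters and their orthogonality *)

Lemma rel_prime_period a d k : rel_prime a d -> rel_prime (a + d * k) d.
Proof.
  intros H. apply Zgcd_1_rel_prime. apply Zgcd_1_rel_prime in H.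
  rewrite Z.gcd_comm, (Z.mul_comm d k), Z.gcd_add_mult_diag_r, Z.gcd_comm; assumption.
Qed.

Lemma dc_periodic q chi : dirichlet_character q chi -> periodic q chi.
Proof. intros [H0 _ HP _]; now split. Qed.

Lemma dc_1 q chi : dirichlet_character q chi -> chi 1%Z = RtoC 1.
Proof.
  intros [_ HM _ HS].
  assert (H : chi 1%Z <> RtoC 0) by (apply HS, rel_prime_sym, rel_prime_1 || (apply HS; apply rel_prime_1)).
  pose proof (HM 1%Z 1%Z) as E; rewrite Z.mul_1_l in E.
  replace (chi 1%Z) with (chi 1%Z * chi 1%Z * / chi 1%Z)%C by (field; assumption).
  rewrite <- E; now apply Cinv_r.
Qed.

Lemma dc_pow q chi n k : dirichlet_character q chi -> chi (n ^ Z.of_nat k)%Z = (chi n ^ k)%C.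
Proof.
  intros HC. induction k as [|k IH]; [apply (dc_1 _ _ HC)|].
  rewrite Nat2Z.inj_succ, Z.pow_succ_r, (chi_mult _ _ HC), IH by lia; reflexivity.
Qed.

Lemma dc_bounded q chi : dirichlet_character q chi -> exists B, forall n, Cmod (chi n) <= B.
Proof.
  intros HC. pose proof (dc_periodic _ _ HC) as HP.
  exists (rsum (seq 0 q) (fun i => Cmod (chi (Z.of_nat i)))). intros n.
  rewrite <- (periodic_mod _ _ n HP).
  assert (0 <= n mod Z.of_nat q < Z.of_nat q)%Z by (apply Z.mod_pos_bound; destruct HP; lia).
  replace (n mod Z.of_nat q)%Z with (Z.of_nat (Z.to_nat (n mod Z.of_nat q))) by lia.
  set (i := Z.to_nat (n mod Z.of_nat q)). assert (i < q)%nat by lia.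
  eapply Rle_trans with (rsum [i] (fun i => Cmod (chi (Z.of_nat i)))).
  - unfold rsum; simpl; lra.
  - apply rsum_incl; [repeat constructor; intros []| |intros; apply Cmod_ge_0].
    intros x [<-|[]]; apply in_seq; lia.
Qed.

(** The powers of [chi n] are themselves values of chi, hence bounded by a common constant, which
    excludes a modulus above 1. *)
Lemma dc_Cmod_le q chi n : dirichlet_character q chi -> Cmod (chi n) <= 1.
Proof.
  intros HC. destruct (dc_bounded _ _ HC) as [B HB].
  apply Rnot_lt_le; intros L.
  destruct (Pow_x_infinity (Cmod (chi n))) with (b := B + 1) as [N HN].
  { rewrite Rabs_pos_eq by apply Cmod_ge_0; lra. }
  specialize (HN N (Nat.le_refl N)).
  rewrite <- Cmod_pow, <- (dc_pow q chi n N HC), Rabs_pos_eq in HN by apply Cmod_ge_0.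
  pose proof (HB (n ^ Z.of_nat N)%Z). lra.
Qed.

Lemma rel_prime_inverse n q : rel_prime n q -> exists m, exists k, (n * m = 1 + q * k)%Z.
Proof.
  intros H. destruct (rel_prime_bezout _ _ H) as [u v E]. exists u, (- v)%Z. lia.
Qed.

Lemma dc_Cmod_1 q chi n : dirichlet_character q chi -> chi n <> RtoC 0 -> Cmod (chi n) = 1.
Proof.
  intros HC Hn. pose proof (dc_Cmod_le _ _ n HC).
  apply (chi_support _ _ HC) in Hn. destruct (rel_prime_inverse _ _ Hn) as [m [k E]].
  assert (E1 : (chi n * chi m = RtoC 1)%C).
  { rewrite <- (chi_mult _ _ HC), E, (periodic_mul _ _ k (dc_periodic _ _ HC)); apply (dc_1 _ _ HC). }
  apply (f_equal Cmod) in E1. rewrite Cmod_mult, Cmod_1 in E1.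
  pose proof (dc_Cmod_le _ _ m HC). pose proof (Cmod_ge_0 (chi m)). pose proof (Cmod_ge_0 (chi n)). nra.
Qed.

(* Multiplication by a unit permutes the residues. *)
Lemma zsum_mul_unit D f m :
  periodic D f -> rel_prime m (Z.of_nat D) -> zsum 0 D (fun n => f (m * n)%Z) = zsum 0 D f.
Proof.
  intros HP Hm. assert (HD : (0 < Z.of_nat D)%Z) by (destruct HP; lia).
  set (g := fun i => Z.to_nat ((m * Z.of_nat i) mod Z.of_nat D)).
  assert (Hg : forall i, Z.of_nat (g i) = ((m * Z.of_nat i) mod Z.of_nat D)%Z).
  { intros i; unfold g; rewrite Z2Nat.id; [reflexivity|]. apply Z.mod_pos_bound; assumption. }
  assert (P : Permutation (map g (seq 0 D)) (seq 0 D)).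
  { apply NoDup_Permutation_bis.
    - apply NoDup_map_NoDup_ForallPairs; [|apply seq_NoDup].
      intros i j Hi Hj E. apply in_seq in Hi, Hj.
      apply (f_equal Z.of_nat) in E; rewrite !Hg in E.
      assert (Hdv : (Z.of_nat D | m * (Z.of_nat i - Z.of_nat j))%Z).
      { apply Z.mod_divide; [lia|]. rewrite Z.mul_sub_distr_l, Zminus_mod, E, Z.sub_diag; apply Zmod_0_l. }
      apply Gauss in Hdv; [|now apply rel_prime_sym].
      destruct Hdv as [k Hk]. destruct (Z.eq_dec k 0); nia.
    - now rewrite length_map.
    - intros x Hx. apply in_map_iff in Hx; destruct Hx as [i [<- Hi]].
      apply in_seq. pose proof (Z.mod_pos_bound (m * Z.of_nat i) _ HD). specialize (Hg i). lia. }
  unfold zsum. rewrite <- (csum_perm _ _ (fun i => f (0 + Z.of_nat i)%Z) P), csum_map. apply csum_ext; intros i _.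
  rewrite !Z.add_0_l, Hg. symmetry; now apply periodic_mod.
Qed.

(** Replacing n by m n permutes the residues modulo D and multiplies the sum over a period by [f m],
    which is not 1. *)
Lemma mult_mean_zero D f :
  periodic D f -> (forall m n, f (m * n)%Z = (f m * f n)%C) ->
  (exists m, rel_prime m (Z.of_nat D) /\ f m <> RtoC 1) -> mean_zero D f.
Proof.
  intros HP HM [m [Hm Hf]]. unfold mean_zero.
  pose proof (zsum_mul_unit D f m HP Hm) as E.
  replace (zsum 0 D (fun n => f (m * n)%Z)) with (f m * zsum 0 D f)%C in E.
  2:{ unfold zsum. rewrite <- csum_scal. apply csum_ext; intros; now rewrite HM. }
  apply NNPP; intros N. apply Hf.
  replace (f m) with (f m * zsum 0 D f * / zsum 0 D f)%C by (field; assumption).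
  rewrite E; now apply Cinv_r.
Qed.

Lemma dc_mean_zero q chi : dirichlet_character q chi -> ~ principal chi -> mean_zero q chi.
Proof.
  intros HC HN. apply mult_mean_zero; [now apply dc_periodic|apply (chi_mult _ _ HC)|].
  apply NNPP; intros H. apply HN. intros n Hn. apply NNPP; intros H1. apply H.
  exists n; split; [now apply (chi_support _ _ HC)|assumption].
Qed.

Lemma crt_gcd m n q r :
  (Z.gcd q r | m - n)%Z -> exists x k l, x = (m + q * k)%Z /\ x = (n + r * l)%Z.
Proof.
  intros [t Ht]. destruct (Z.gcd_bezout q r (Z.gcd q r) eq_refl) as [u [v E]].
  exists (m - q * (u * t))%Z, (- (u * t))%Z, (v * t)%Z. nia.
Qed.

Lemma prime_divisor_exists g : (1 < g)%Z -> exists p, prime p /\ (p | g)%Z.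
Proof.
  intros Hg. revert Hg. pattern g. apply (well_founded_ind (Zwf.Zwf_well_founded 0)).
  clear g; intros g IH Hg. destruct (prime_dec g) as [Hp|Hp]; [exists g; split; [assumption|apply Z.divide_refl]|].
  destruct (not_prime_divide _ Hg Hp) as [n [Hn Hd]].
  destruct (IH n) as [p [Hp1 Hp2]]; [unfold Zwf.Zwf; lia|lia|].
  exists p; split; [assumption|now apply Z.divide_trans with n].
Qed.

(* A class prime to [d] contains elements prime to any given nonzero [D]: multiply
   out the primes dividing [D] but not the class. *)
Lemma coprime_lift (d D : Z) n :
  (0 < D)%Z -> (d | D)%Z -> rel_prime n d -> exists k, rel_prime (n + d * k) D.
Proof.
  intros HD Hd Hn.
  assert (Hrec : forall (N : nat) (E : Z), (0 < E)%Z -> (Z.to_nat E <= N)%nat ->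
            exists k, forall p, prime p -> (p | E)%Z -> ~ (p | d)%Z -> ~ (p | n + d * k)%Z).
  { induction N as [|N IH]; intros E HE HN; [lia|].
    destruct (classic (exists p, prime p /\ (p | E)%Z /\ ~ (p | d)%Z)) as [[p [Hp [[E' HE'] Hpd]]]|H].
    - pose proof (prime_ge_2 _ Hp). destruct (IH E') as [k Hk]; [nia|nia|].
      destruct (classic (p | n + d * k)%Z) as [Hdiv|Hdiv].
      + destruct (classic (p | E')%Z) as [HpE'|HpE'].
        * exists k; intros r Hr HrE Hrd. apply Hk; try assumption.
          rewrite HE' in HrE. apply prime_mult in HrE; [|assumption].
          destruct HrE as [|Hrp]; [assumption|].
          apply prime_div_prime in Hrp; try assumption; now subst.
        (* Here p divides n + d k but neither d nor E'. Adding d E' destroys the divisibility by p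
           and changes nothing modulo the primes dividing E'. *)
        * exists (k + E')%Z; intros r Hr HrE Hrd Hdv.
          rewrite HE' in HrE. apply prime_mult in HrE; [|assumption].
          destruct HrE as [HrE|Hrp].
          -- apply (Hk r Hr HrE Hrd).
             replace (n + d * k)%Z with (n + d * (k + E') - d * E')%Z by ring.
             apply Z.divide_sub_r; [assumption|]. now apply Z.divide_mul_r.
          -- apply prime_div_prime in Hrp; try assumption; subst r.
             assert (Hx : (p | d * E')%Z).
             { replace (d * E')%Z with (n + d * (k + E') - (n + d * k))%Z by ring.
               now apply Z.divide_sub_r. }
             apply prime_mult in Hx; tauto.
      + exists k; intros r Hr HrE Hrd Hdv. rewrite HE' in HrE.
        apply prime_mult in HrE; [|assumption].
        destruct HrE as [HrE|Hrp]; [now apply (Hk r)|].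
        apply prime_div_prime in Hrp; try assumption; now subst r.
    - exists 0%Z; intros p Hp HpE Hpd; exfalso; apply H; eauto. }
  destruct (Hrec (Z.to_nat D) D HD (Nat.le_refl _)) as [k Hk].
  exists k. apply NNPP; intros Hnr.
  rewrite <- Zgcd_1_rel_prime in Hnr.
  set (g := Z.gcd (n + d * k) D) in *.
  assert (Hg : (0 < g)%Z).
  { pose proof (Z.gcd_nonneg (n + d * k) D). assert (g <> 0)%Z; [|unfold g in *; lia].
    intros E; apply Z.gcd_eq_0 in E; lia. }
  destruct (prime_divisor_exists g) as [p [Hp Hpg]]; [unfold g in *; lia|].
  assert (H1 : (p | n + d * k)%Z) by (eapply Z.divide_trans; [exact Hpg|apply Z.gcd_divide_l]).
  assert (H2 : (p | D)%Z) by (eapply Z.divide_trans; [exact Hpg|apply Z.gcd_divide_r]).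
  destruct (classic (p | d)%Z) as [Hpd|Hpd]; [|now apply (Hk p Hp H2 Hpd)].
  assert (H3 : (p | n)%Z).
  { replace n with (n + d * k - d * k)%Z by ring.
    apply Z.divide_sub_r; [assumption|]. now apply Z.divide_mul_l. }
  destruct Hn as [_ _ Hn]. pose proof (Hn p H3 Hpd) as H4.
  pose proof (prime_ge_2 _ Hp). apply Z.divide_1_r_nonneg in H4; lia.
Qed.

(** On integers prime to both moduli [chi n] depends only on n modulo the gcd. If m and n agree
    there, the Chinese remainder theorem gives x congruent to m modulo q and to n modulo q', and chi
    m = chi x = psi x = psi n = chi n. So chi descends to the gcd, the value at a class being read
    off at a representative prime to both moduli. *)
Lemma induced_gcd q chi q' psi :
  dirichlet_character q chi -> dirichlet_character q' psi ->
  (forall n, rel_prime n (Z.of_nat q * Z.of_nat q') -> chi n = psi n) ->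
  exists phi, induced_by q chi (Z.to_nat (Z.gcd (Z.of_nat q) (Z.of_nat q'))) phi.
Proof.
  intros HC HC' HE. set (d := Z.to_nat (Z.gcd (Z.of_nat q) (Z.of_nat q'))).
  assert (Hq : (0 < q)%nat) by apply (modulus_pos _ _ HC).
  assert (Hq' : (0 < q')%nat) by apply (modulus_pos _ _ HC').
  assert (Hdg : Z.of_nat d = Z.gcd (Z.of_nat q) (Z.of_nat q'))
    by (unfold d; rewrite Z2Nat.id; [reflexivity|apply Z.gcd_nonneg]).
  assert (Hdq : (Z.of_nat d | Z.of_nat q)%Z).
  { rewrite Hdg; apply Z.gcd_divide_l. }
  assert (Hdq' : (Z.of_nat d | Z.of_nat q')%Z).
  { rewrite Hdg; apply Z.gcd_divide_r. }
  assert (Hd0 : (0 < d)%nat)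
    by (destruct Hdq as [k Hk]; apply Nat.neq_0_lt_0; intros E; rewrite E in Hk; lia).
  set (D := (Z.of_nat q * Z.of_nat q')%Z) in *.
  assert (HD : (0 < D)%Z) by (unfold D; nia).
  assert (HdD : (Z.of_nat d | D)%Z) by (unfold D; now apply Z.divide_mul_l).
  assert (Hrp : forall n e, (e | D)%Z -> rel_prime n D -> rel_prime n e).
  { intros n e He Hn. apply rel_prime_sym, rel_prime_div with D; [now apply rel_prime_sym|assumption]. }
  assert (HqD : (Z.of_nat q | D)%Z) by (unfold D; apply Z.divide_factor_l).
  assert (HqD' : (Z.of_nat q' | D)%Z) by (unfold D; apply Z.divide_factor_r).
  assert (Hwd : forall m n, rel_prime m D -> rel_prime n D ->
            (Z.of_nat d | m - n)%Z -> chi m = chi n).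
  { intros m n Hm Hn Hmn. rewrite Hdg in Hmn.
    destruct (crt_gcd _ _ _ _ Hmn) as [x [k [l [E1 E2]]]].
    assert (Hx : rel_prime x D).
    { unfold D; apply rel_prime_mult.
      - rewrite E1; apply rel_prime_period. now apply Hrp.
      - rewrite E2; apply rel_prime_period. now apply Hrp. }
    transitivity (chi x).
    - rewrite E1; symmetry; apply periodic_mul; now apply dc_periodic.
    - rewrite (HE x Hx), (HE n Hn), E2. apply periodic_mul; now apply dc_periodic. }
  set (lift := fun n => epsilon (inhabits 0%Z) (fun m => rel_prime m D /\ (Z.of_nat d | m - n)%Z)).
  assert (Hlift : forall n, rel_prime n (Z.of_nat d) ->
            rel_prime (lift n) D /\ (Z.of_nat d | lift n - n)%Z).
  { intros n Hn; unfold lift; apply epsilon_spec.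
    destruct (coprime_lift _ D n HD HdD Hn) as [k Hk].
    exists (n + Z.of_nat d * k)%Z; split; [assumption|]. exists k; ring. }
  exists (fun n => if rel_prime_dec n (Z.of_nat d) then chi (lift n) else RtoC 0).
  split; [assumption|]; split.
  - split.
    + assumption.
    + intros m n.
      destruct (rel_prime_dec m (Z.of_nat d)) as [Hm|Hm];
      destruct (rel_prime_dec n (Z.of_nat d)) as [Hn|Hn];
      destruct (rel_prime_dec (m * n) (Z.of_nat d)) as [Hmn|Hmn]; try ring.
      * rewrite <- (chi_mult _ _ HC).
        destruct (Hlift _ Hm) as [A1 [a A2]], (Hlift _ Hn) as [B1 [b B2]], (Hlift _ Hmn) as [C1 [c C2]].
        apply Hwd; [assumption| |].
        -- apply rel_prime_sym, rel_prime_mult; now apply rel_prime_sym.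
        -- replace (lift (m * n) - lift m * lift n)%Z
             with ((lift (m * n) - m * n) - (lift m - m) * lift n - m * (lift n - n))%Z by ring.
           rewrite A2, B2, C2. exists (c - a * lift n - m * b)%Z; ring.
      * exfalso; apply Hmn. apply rel_prime_sym, rel_prime_mult; now apply rel_prime_sym.
      * exfalso; apply Hn. apply rel_prime_div with (m * n)%Z; [assumption|apply Z.divide_factor_r].
      * exfalso; apply Hm. apply rel_prime_div with (m * n)%Z; [assumption|apply Z.divide_factor_l].
      * exfalso; apply Hm. apply rel_prime_div with (m * n)%Z; [assumption|apply Z.divide_factor_l].
    + intros n.
      assert (Hiff : rel_prime (n + Z.of_nat d) (Z.of_nat d) <-> rel_prime n (Z.of_nat d)).
      { split; intros H.
        - replace n with (n + Z.of_nat d + Z.of_nat d * (-1))%Z by ring; now apply rel_prime_period.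
        - replace (n + Z.of_nat d)%Z with (n + Z.of_nat d * 1)%Z by ring; now apply rel_prime_period. }
      destruct (rel_prime_dec (n + Z.of_nat d) (Z.of_nat d)) as [H1|H1];
      destruct (rel_prime_dec n (Z.of_nat d)) as [H2|H2]; try tauto.
      destruct (Hlift _ H1) as [A1 [a A2]], (Hlift _ H2) as [B1 [b B2]].
      apply Hwd; try assumption. exists (a + 1 - b)%Z. lia.
    + intros n. destruct (rel_prime_dec n (Z.of_nat d)) as [H2|H2].
      * split; [tauto|intros _]. apply (chi_support _ _ HC).
        apply Hrp; [assumption|]. now apply Hlift.
      * split; [intros H; now exfalso; apply H|tauto].
  - intros n Hn.
    assert (Hnd : rel_prime n (Z.of_nat d)).
    { apply rel_prime_sym, rel_prime_div with (Z.of_nat q); [now apply rel_prime_sym|assumption]. }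
    destruct (rel_prime_dec n (Z.of_nat d)) as [_|H]; [|tauto].
    destruct (coprime_lift _ D n HD HqD Hn) as [k Hk].
    rewrite <- (periodic_mul _ _ k (dc_periodic _ _ HC) n).
    destruct (Hlift _ Hnd) as [A1 [a A2]].
    apply Hwd; try assumption.
    destruct Hdq as [e He]. exists (e * k - a)%Z. rewrite He. lia.
Qed.

(** Each of the two characters is induced from the gcd of the moduli, so primitivity forces both
    moduli to equal that gcd. *)
Lemma primitive_agree q chi q' psi :
  primitive_character q chi -> primitive_character q' psi ->
  (forall n, rel_prime n (Z.of_nat q * Z.of_nat q') -> chi n = psi n) -> chi = psi.
Proof.
  intros [HC HP] [HC' HP'] HE.
  destruct (induced_gcd _ _ _ _ HC HC' HE) as [phi Hphi].
  destruct (induced_gcd _ _ _ _ HC' HC) as [phi' Hphi'].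
  { intros n Hn; symmetry; apply HE; now rewrite Z.mul_comm. }
  assert (Hq : (0 < q)%nat) by apply (modulus_pos _ _ HC).
  assert (Hq' : (0 < q')%nat) by apply (modulus_pos _ _ HC').
  assert (E1 : (Z.gcd (Z.of_nat q) (Z.of_nat q')) = Z.of_nat q).
  { assert (HL : ((Z.gcd (Z.of_nat q) (Z.of_nat q')) <= Z.of_nat q)%Z) by (apply Z.divide_pos_le; [lia|apply Z.gcd_divide_l]).
    destruct (Z.eq_dec (Z.gcd (Z.of_nat q) (Z.of_nat q')) (Z.of_nat q)); [assumption|]. exfalso; apply HP.
    exists (Z.to_nat (Z.gcd (Z.of_nat q) (Z.of_nat q'))), phi; split; [lia|assumption]. }
  assert (E2 : (Z.gcd (Z.of_nat q') (Z.of_nat q)) = Z.of_nat q').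
  { assert (HL : ((Z.gcd (Z.of_nat q') (Z.of_nat q)) <= Z.of_nat q')%Z) by (apply Z.divide_pos_le; [lia|apply Z.gcd_divide_l]).
    destruct (Z.eq_dec (Z.gcd (Z.of_nat q') (Z.of_nat q)) (Z.of_nat q')); [assumption|]. exfalso; apply HP'.
    exists (Z.to_nat (Z.gcd (Z.of_nat q') (Z.of_nat q))), phi'; split; [lia|assumption]. }
  assert (q = q') by (apply Nat2Z.inj; rewrite <- E1, Z.gcd_comm; assumption). subst q'.
  apply functional_extensionality; intros n.
  destruct (rel_prime_dec n (Z.of_nat q)) as [H|H].
  - apply HE. now apply rel_prime_mult.
  - transitivity (RtoC 0).
    + apply NNPP; intros N; now apply (chi_support _ _ HC) in N.
    + symmetry; apply NNPP; intros N; now apply (chi_support _ _ HC') in N.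
Qed.

(** If chi conj(psi) were 1 at all integers prime to both moduli, then chi and psi would agree
    there, because |psi n| = 1, and the two primitive characters would coincide. *)
Lemma primitive_product q chi q' psi :
  primitive_character q chi -> primitive_character q' psi -> chi <> psi ->
  periodic (q * q') (fun n => chi n * Cconj (psi n))%C /\
  mean_zero (q * q') (fun n => chi n * Cconj (psi n))%C.
Proof.
  intros HC HC' HN.
  assert (HP : periodic (q * q') (fun n => chi n * Cconj (psi n))%C).
  { split; [pose proof (modulus_pos _ _ (proj1 HC)); pose proof (modulus_pos _ _ (proj1 HC')); nia|].
    intros n. f_equal; [|f_equal].
    - rewrite Nat2Z.inj_mul; apply periodic_mul, dc_periodic, HC.
    - rewrite Nat2Z.inj_mul, Z.mul_comm; apply periodic_mul, dc_periodic, HC'. }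
  split; [assumption|]. apply mult_mean_zero; [assumption| |].
  - intros m n. rewrite (chi_mult _ _ (proj1 HC)), (chi_mult _ _ (proj1 HC')), Cmult_conj; ring.
  - apply NNPP; intros H. apply HN.
    apply (primitive_agree _ _ _ _ HC HC'). intros n Hn.
    apply NNPP; intros Hne. apply H. exists n; split; [now rewrite Nat2Z.inj_mul|].
    intros E. apply Hne.
    assert (H1 : chi n <> RtoC 0) by (intros Z; apply C1_nz; rewrite <- E, Z; ring).
    assert (H2 : psi n <> RtoC 0).
    { apply (chi_support _ _ (proj1 HC')).
      apply rel_prime_sym, rel_prime_div with (Z.of_nat q * Z.of_nat q')%Z;
        [now apply rel_prime_sym|apply Z.divide_factor_r]. }
    pose proof (dc_Cmod_1 _ _ n (proj1 HC') H2) as E2.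
    pose proof (Cmod2_conj (psi n)) as E3. rewrite E2 in E3.
    replace (chi n) with (chi n * RtoC 1)%C by ring.
    replace (RtoC 1) with (psi n * Cconj (psi n))%C by (rewrite <- E3; f_equal; ring).
    transitivity ((chi n * Cconj (psi n)) * psi n)%C; [ring|rewrite E; ring].
Qed.

(** * Complex exponential and differentiation *)

Lemma C_ext (a b : C) : Re a = Re b -> Im a = Im b -> a = b.
Proof. destruct a, b; simpl; intros; now subst. Qed.

Lemma exp_le x y : x <= y -> exp x <= exp y.
Proof. intros [H|H]; [left; now apply exp_increasing|right; now rewrite H]. Qed.

Lemma Cexp_plus z w : Cexp (z + w) = (Cexp z * Cexp w)%C.
Proof.
  apply C_ext; unfold Cexp; simpl; rewrite exp_plus; unfold Re, Im;
    [rewrite cos_plus|rewrite sin_plus]; ring.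
Qed.

Lemma Cexp_0 : Cexp (RtoC 0) = RtoC 1.
Proof. apply C_ext; unfold Cexp; simpl; rewrite exp_0, ?cos_0, ?sin_0; ring. Qed.

Lemma Cmod_sqr (z : C) : Cmod z ^ 2 = Re z ^ 2 + Im z ^ 2.
Proof. apply Cmod2_alt. Qed.

Lemma Cmod_Cexp z : Cmod (Cexp z) = exp (Re z).
Proof.
  apply Rsqr_inj; [apply Cmod_ge_0|left; apply exp_pos|].
  rewrite !Rsqr_pow2, Cmod_sqr; unfold Cexp; simpl.
  pose proof (sin2_cos2 (Im z)) as H; unfold Rsqr in H.
  transitivity (exp (Re z) * exp (Re z) * (sin (Im z) * sin (Im z) + cos (Im z) * cos (Im z)));
    [ring|rewrite H; ring].
Qed.

Lemma Cexp_nz z : Cexp z <> RtoC 0.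
Proof. apply Cmod_gt_0; rewrite Cmod_Cexp; apply exp_pos. Qed.

Lemma Cexp_opp z : Cexp (- z) = (/ Cexp z)%C.
Proof.
  assert (E : (Cexp (- z) * Cexp z)%C = RtoC 1).
  { rewrite <- Cexp_plus. replace (- z + z)%C with (RtoC 0) by ring. apply Cexp_0. }
  replace (Cexp (- z)) with (Cexp (- z) * Cexp z * / Cexp z)%C by (field; apply Cexp_nz).
  rewrite E; ring.
Qed.

Lemma Cexp_minus z w : Cexp (z - w) = (Cexp z / Cexp w)%C.
Proof. unfold Cminus; now rewrite Cexp_plus, Cexp_opp. Qed.

Lemma Cexp_R x : Cexp (RtoC x) = RtoC (exp x).
Proof. apply C_ext; unfold Cexp; simpl; rewrite ?cos_0, ?sin_0; ring. Qed.

Lemma Cexp_csum {A} (l : list A) f : Cexp (csum l f) = cprod l (fun a => Cexp (f a)).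
Proof.
  induction l as [|a l IH]; [apply Cexp_0|].
  rewrite csum_cons, Cexp_plus, IH; reflexivity.
Qed.

Lemma Cmod_RtoC_nonneg x : 0 <= x -> Cmod (RtoC x) = x.
Proof. intros; rewrite Cmod_R; now apply Rabs_pos_eq. Qed.

Lemma Cmod_minus_sym z w : Cmod (z - w) = Cmod (w - z).
Proof. rewrite <- Cmod_opp; f_equal; ring. Qed.

Lemma Cmod_triangle_inv z w : Cmod z - Cmod w <= Cmod (z - w).
Proof.
  pose proof (Cmod_triangle (z - w) w) as H. replace (z - w + w)%C with z in H by ring. lra.
Qed.

Lemma Im_le_Cmod z : Rabs (Im z) <= Cmod z.
Proof.
  eapply Rle_trans; [|apply Rmax_Cmod]. apply Rmax_r.
Qed.

Lemma Cmod_le_sum z : Cmod z <= Rabs (Re z) + Rabs (Im z).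
Proof.
  apply Rsqr_incr_0_var; [|pose proof (Rabs_pos (Re z)); pose proof (Rabs_pos (Im z)); lra].
  rewrite !Rsqr_pow2, Cmod_sqr, <- (pow2_abs (Re z)), <- (pow2_abs (Im z)).
  pose proof (Rabs_pos (Re z)); pose proof (Rabs_pos (Im z)); nra.
Qed.

(** * Derivatives along a real variable, and the exponential series *)

Definition cderiv (f : R -> C) (t : R) (l : C) : Prop :=
  is_derive (fun x => Re (f x)) t (Re l) /\ is_derive (fun x => Im (f x)) t (Im l).

Lemma cderiv_const c t : cderiv (fun _ => c) t (RtoC 0).
Proof. split; simpl; apply (is_derive_const (K := R_AbsRing) (V := R_NormedModule)). Qed.

Lemma is_derive_Rmult (f g : R -> R) x df dg :
  is_derive f x df -> is_derive g x dg -> is_derive (fun x => f x * g x) x (df * g x + f x * dg).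
Proof. rewrite !is_derive_Reals; apply derivable_pt_lim_mult. Qed.

Lemma is_derive_Rplus (f g : R -> R) x df dg :
  is_derive f x df -> is_derive g x dg -> is_derive (fun x => f x + g x) x (df + dg).
Proof. rewrite !is_derive_Reals; apply derivable_pt_lim_plus. Qed.

Lemma is_derive_Rminus (f g : R -> R) x df dg :
  is_derive f x df -> is_derive g x dg -> is_derive (fun x => f x - g x) x (df - dg).
Proof. rewrite !is_derive_Reals; apply derivable_pt_lim_minus. Qed.

Lemma is_derive_Rcomp (f g : R -> R) x df dg :
  is_derive f x df -> is_derive g (f x) dg -> is_derive (fun x => g (f x)) x (dg * df).
Proof. rewrite !is_derive_Reals; apply derivable_pt_lim_comp. Qed.

Lemma is_derive_Rid x : is_derive (fun x : R => x) x 1.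
Proof. apply is_derive_Reals, derivable_pt_lim_id. Qed.

Lemma is_derive_eq (f : R -> R) x l m : is_derive f x l -> l = m -> is_derive f x m.
Proof. now intros H <-. Qed.

Lemma cderiv_plus f g t l m : cderiv f t l -> cderiv g t m -> cderiv (fun x => f x + g x)%C t (l + m)%C.
Proof. intros [F1 F2] [G1 G2]; split; simpl; now apply is_derive_Rplus. Qed.

Lemma cderiv_mult f g t l m :
  cderiv f t l -> cderiv g t m -> cderiv (fun x => f x * g x)%C t (l * g t + f t * m)%C.
Proof.
  intros [F1 F2] [G1 G2]; split.
  - eapply is_derive_eq.
    + exact (is_derive_Rminus _ _ _ _ _ (is_derive_Rmult _ _ _ _ _ F1 G1) (is_derive_Rmult _ _ _ _ _ F2 G2)).
    + unfold Re, Im; simpl; ring.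
  - eapply is_derive_eq.
    + exact (is_derive_Rplus _ _ _ _ _ (is_derive_Rmult _ _ _ _ _ F1 G2) (is_derive_Rmult _ _ _ _ _ F2 G1)).
    + unfold Re, Im; simpl; ring.
Qed.

Lemma cderiv_ext f g t l m : (forall x, f x = g x) -> l = m -> cderiv f t l -> cderiv g t m.
Proof.
  intros E <- [F1 F2]; split; eapply is_derive_ext; try eassumption; intros; simpl; now rewrite E.
Qed.

Lemma cderiv_scal c f t l : cderiv f t l -> cderiv (fun x => c * f x)%C t (c * l)%C.
Proof.
  intros H. eapply cderiv_ext; [| |apply (cderiv_mult (fun _ => c) f t _ _ (cderiv_const c t) H)].
  - reflexivity.
  - ring.
Qed.

Lemma cderiv_opp f t l : cderiv f t l -> cderiv (fun x => - f x)%C t (- l)%C.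
Proof.
  intros H. eapply cderiv_ext; [| |apply (cderiv_scal (- RtoC 1)%C _ _ _ H)]; intros; simpl; ring.
Qed.

Lemma cderiv_minus f g t l m : cderiv f t l -> cderiv g t m -> cderiv (fun x => f x - g x)%C t (l - m)%C.
Proof. intros F G; unfold Cminus; apply cderiv_plus; [assumption|now apply cderiv_opp]. Qed.

Lemma cderiv_RtoC f t l : is_derive f t l -> cderiv (fun x => RtoC (f x)) t (RtoC l).
Proof.
  intros H; split; simpl; [assumption|]. apply (is_derive_const (K := R_AbsRing) (V := R_NormedModule)).
Qed.

Lemma cderiv_Cexp f t l : cderiv f t l -> cderiv (fun x => Cexp (f x)) t (l * Cexp (f t))%C.
Proof.
  intros [F1 F2].
  assert (E : is_derive (fun x => exp (Re (f x))) t (exp (Re (f t)) * Re l))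
    by (apply (is_derive_Rcomp _ exp _ _ _ F1), is_derive_Reals, derivable_pt_lim_exp).
  assert (Co : is_derive (fun x => cos (Im (f x))) t (- sin (Im (f t)) * Im l))
    by (apply (is_derive_Rcomp _ cos _ _ _ F2), is_derive_Reals, derivable_pt_lim_cos).
  assert (Si : is_derive (fun x => sin (Im (f x))) t (cos (Im (f t)) * Im l))
    by (apply (is_derive_Rcomp _ sin _ _ _ F2), is_derive_Reals, derivable_pt_lim_sin).
  split.
  - eapply is_derive_eq; [exact (is_derive_Rmult _ _ _ _ _ E Co)|].
    unfold Cexp, Re, Im; simpl; ring.
  - eapply is_derive_eq; [exact (is_derive_Rmult _ _ _ _ _ E Si)|].
    unfold Cexp, Re, Im; simpl; ring.
Qed.

(* The real mean value theorem applied to the projection of [f] on the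
   direction of [f b - f a]. *)
Lemma cderiv_mvt f df a b B :
  a <= b -> (forall t, a <= t <= b -> cderiv f t (df t)) ->
  (forall t, a <= t <= b -> Cmod (df t) <= B) -> Cmod (f b - f a) <= B * (b - a).
Proof.
  intros Hab Hd HB. set (w := (f b - f a)%C).
  destruct (Req_dec (Cmod w) 0) as [E|E].
  { rewrite E. apply Rmult_le_pos; [|lra].
    eapply Rle_trans; [apply Cmod_ge_0|apply (HB a)]; lra. }
  assert (Hg : forall t, a <= t <= b -> cderiv (fun t => Cconj w * f t)%C t (Cconj w * df t)%C)
    by (intros; apply cderiv_scal; auto).
  destruct (MVT_gen (fun t => Re (Cconj w * f t)) a b (fun t => Re (Cconj w * df t))) as [c [Hc Ec]].
  - rewrite Rmin_left, Rmax_right by assumption. intros t Ht; apply Hg; lra.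
  - rewrite Rmin_left, Rmax_right by assumption. intros t Ht.
    apply continuity_pt_filterlim, (ex_derive_continuous (K := R_AbsRing) (V := R_NormedModule)).
    eexists; apply Hg; assumption.
  - rewrite Rmin_left, Rmax_right in Hc by assumption.
    assert (E1 : Re (Cconj w * f b) - Re (Cconj w * f a) = Cmod w ^ 2).
    { rewrite Cmod_sqr; unfold w, Cconj; simpl; unfold Re, Im; ring. }
    rewrite E1 in Ec.
    assert (H2 : Cmod w ^ 2 <= Cmod w * B * (b - a)).
    { rewrite Ec. apply Rmult_le_compat_r; [lra|].
      eapply Rle_trans; [apply Rle_abs|]. eapply Rle_trans; [apply re_le_Cmod|].
      rewrite Cmod_mult, Cmod_conj. apply Rmult_le_compat_l; [apply Cmod_ge_0|auto]. }
    pose proof (Cmod_ge_0 w). nra.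
Qed.

Fixpoint Cexp_part (J : nat) (z : C) : C :=
  match J with
  | O => RtoC 0
  | S J => (Cexp_part J z + z ^ J / RtoC (INR (fact J)))%C
  end.

Lemma cderiv_pow (z : C) n t :
  cderiv (fun t => (RtoC t * z) ^ S n)%C t (z * (RtoC (INR (S n)) * (RtoC t * z) ^ n))%C.
Proof.
  induction n as [|n IH].
  - eapply cderiv_ext; [| |apply (cderiv_scal z (fun t => RtoC t) t (RtoC 1))].
    + intros x; simpl; ring.
    + simpl; ring.
    + apply cderiv_RtoC, is_derive_Rid.
  - eapply cderiv_ext; [| |apply (cderiv_mult (fun t => (RtoC t * z)%C) (fun t => (RtoC t * z) ^ S n)%C t z (z * (RtoC (INR (S n)) * (RtoC t * z) ^ n))%C)].
    + intros x. symmetry; simpl. reflexivity.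
    + rewrite (S_INR (S n)), RtoC_plus. simpl Cpow; ring.
    + eapply cderiv_ext; [| |apply (cderiv_scal z (fun t => RtoC t) t (RtoC 1))].
      * intros x; simpl; ring.
      * ring.
      * apply cderiv_RtoC, is_derive_Rid.
    + apply IH.
Qed.

Lemma Cexp_part_deriv J z t :
  cderiv (fun t => Cexp_part (S J) (RtoC t * z)) t (z * Cexp_part J (RtoC t * z))%C.
Proof.
  induction J as [|J IH].
  - eapply cderiv_ext; [| |apply (cderiv_const (RtoC 1))]; intros; simpl; [field|ring].
  - eapply cderiv_ext; [| |apply cderiv_plus; [apply IH|]].
    + intros x; symmetry; change (Cexp_part (S (S J)) (RtoC x * z))
        with (Cexp_part (S J) (RtoC x * z) + (RtoC x * z) ^ S J / RtoC (INR (fact (S J))))%C.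
      reflexivity.
    + rewrite <- Cmult_plus_distr_l. f_equal. simpl (Cexp_part (S J) _). reflexivity.
    + eapply cderiv_ext; [| |apply (cderiv_scal (/ RtoC (INR (fact (S J))))%C), (cderiv_pow z J)].
      * intros; simpl; unfold Cdiv; ring.
      * change (fact (S J)) with (S J * fact J)%nat. rewrite mult_INR, RtoC_mult.
        field; split; intros E; apply RtoC_inj in E; revert E; [apply INR_fact_neq_0|apply not_0_INR; lia].
Qed.

(** Induction on J by the mean value inequality: along t z the derivative of one remainder is z
    times the preceding one. The missing 1/J! is immaterial, since the bound serves for |z| <= 1/4
    and for J = 2. *)
Lemma Cexp_part_error J z :
  Cmod (Cexp z - Cexp_part J z) <= Cmod z ^ J * exp (Cmod z).
Proof.
  revert z; induction J as [|J IH]; intros z.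
  - simpl. replace (Cexp z - RtoC 0)%C with (Cexp z) by ring. rewrite Cmod_Cexp, Rmult_1_l.
    apply exp_le. pose proof (re_le_Cmod z). pose proof (Rle_abs (Re z)). lra.
  - pose (f := fun t => (Cexp (RtoC t * z) - Cexp_part (S J) (RtoC t * z))%C).
    assert (H : Cmod (f 1 - f 0) <= Cmod z * (Cmod z ^ J * exp (Cmod z)) * (1 - 0)).
    { apply cderiv_mvt with (df := fun t => (z * (Cexp (RtoC t * z) - Cexp_part J (RtoC t * z)))%C).
      - lra.
      - intros t _. unfold f. eapply cderiv_ext; [reflexivity| |apply cderiv_minus].
        2:{ apply (cderiv_Cexp (fun t => RtoC t * z)%C t z).
            eapply cderiv_ext; [| |apply (cderiv_scal z (fun t => RtoC t) t (RtoC 1))].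
            - intros x; simpl; ring.
            - ring.
            - apply cderiv_RtoC, is_derive_Rid. }
        2: apply Cexp_part_deriv. ring.
      - intros t Ht. rewrite Cmod_mult. apply Rmult_le_compat_l; [apply Cmod_ge_0|].
        eapply Rle_trans; [apply IH|].
        assert (Cmod (RtoC t * z) <= Cmod z).
        { rewrite Cmod_mult, Cmod_RtoC_nonneg by lra. pose proof (Cmod_ge_0 z). nra. }
        apply Rmult_le_compat; [apply pow_le, Cmod_ge_0|left; apply exp_pos| |now apply exp_le].
        apply pow_incr; split; [apply Cmod_ge_0|assumption]. }
    assert (E0 : f 0 = RtoC 0).
    { unfold f. replace (RtoC 0 * z)%C with (RtoC 0) by ring. rewrite Cexp_0.
      assert (E : Cexp_part (S J) (RtoC 0) = RtoC 1); [|rewrite E; ring].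
      clear. induction J as [|J IH]; [simpl; field; apply C1_nz|].
      change (Cexp_part (S (S J)) (RtoC 0)) with
        (Cexp_part (S J) (RtoC 0) + RtoC 0 ^ S J / RtoC (INR (fact (S J))))%C.
      rewrite IH. simpl Cpow. unfold Cdiv. ring. }
    rewrite E0 in H. unfold f in H.
    replace (RtoC 1 * z)%C with z in H by ring.
    replace (Cexp z - Cexp_part (S J) z - RtoC 0)%C with (Cexp z - Cexp_part (S J) z)%C in H by ring.
    simpl pow. lra.
Qed.

Lemma Cexp_2_bound z : Cmod (Cexp z - RtoC 1 - z) <= Cmod z ^ 2 * exp (Cmod z).
Proof.
  pose proof (Cexp_part_error 2 z) as H. simpl in H.
  replace (Cexp z - (RtoC 0 + RtoC 1 / RtoC 1 + z * RtoC 1 / RtoC 1))%C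
    with (Cexp z - RtoC 1 - z)%C in H by (field; apply C1_nz).
  simpl; lra.
Qed.

(** * Complex differentiability and continuity *)

Definition is_cd (f : C -> C) (s l : C) : Prop :=
  forall eps, 0 < eps -> exists d, 0 < d /\
    forall z, Cmod (z - s) < d -> Cmod (f z - f s - l * (z - s)) <= eps * Cmod (z - s).

Lemma holomorphic_iff f s : holomorphic_at f s <-> exists l, is_cd f s l.
Proof.
  split.
  - intros [l [_ Hl]]. exists l. intros eps He.
    specialize (Hl s (fun P HP => HP) (mkposreal eps He)).
    destruct Hl as [d Hd]. exists d; split; [apply cond_pos|]. intros z Hz.
    specialize (Hd z Hz). simpl in Hd.
    replace (f z - f s - l * (z - s))%C with (minus (minus (f z) (f s)) (scal (minus z s) l)).
    + exact Hd.
    + unfold minus, plus, opp, scal; simpl; unfold mult; simpl; ring.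
  - intros [l Hl]. exists l. split; [apply is_linear_scal_l|].
    intros x Hx.
    assert (E : x = s) by (symmetry; now apply (is_filter_lim_locally_unique (V := AbsRing_NormedModule C_AbsRing))).
    subst x. intros eps. destruct (Hl eps (cond_pos eps)) as [d [Hd H]].
    exists (mkposreal d Hd). intros z Hz. specialize (H z Hz).
    assert (E : minus (minus (f z) (f s)) (scal (minus z s) l) = (f z - f s - l * (z - s))%C)
      by (unfold minus, plus, opp, scal; simpl; unfold mult; simpl; ring).
    change (norm (V := C_NormedModule) (minus (minus (f z) (f s)) (scal (minus z s) l)) <= eps * Cmod (z - s)).
    refine (eq_ind_r (fun w => norm (V := C_NormedModule) w <= eps * Cmod (z - s)) H E).
Qed.

Definition ccont (f : C -> C) (s : C) : Prop :=
  forall eps, 0 < eps -> exists d, 0 < d /\ forall z, Cmod (z - s) < d -> Cmod (f z - f s) < eps.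

Lemma is_cd_lip f s l : is_cd f s l ->
  exists d, 0 < d /\ forall z, Cmod (z - s) < d -> Cmod (f z - f s) <= (Cmod l + 1) * Cmod (z - s).
Proof.
  intros H. destruct (H 1) as [d [Hd H1]]; [lra|]. exists d; split; [assumption|]. intros z Hz.
  specialize (H1 z Hz).
  replace (f z - f s)%C with ((f z - f s - l * (z - s)) + l * (z - s))%C by ring.
  eapply Rle_trans; [apply Cmod_triangle|]. rewrite Cmod_mult. lra.
Qed.

Lemma is_cd_cont f s l : is_cd f s l -> ccont f s.
Proof.
  intros H. destruct (is_cd_lip _ _ _ H) as [d [Hd H1]].
  intros eps He. pose proof (Cmod_ge_0 l).
  exists (Rmin d (eps / (2 * (Cmod l + 1)))). split.
  - apply Rmin_glb_lt; [assumption|]. apply Rdiv_lt_0_compat; lra.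
  - intros z Hz.
    assert (Cmod (z - s) < d) by (eapply Rlt_le_trans; [exact Hz|apply Rmin_l]).
    assert (H3 : Cmod (z - s) < eps / (2 * (Cmod l + 1))) by (eapply Rlt_le_trans; [exact Hz|apply Rmin_r]).
    eapply Rle_lt_trans; [now apply H1|].
    apply Rmult_lt_compat_l with (r := Cmod l + 1) in H3; [|lra].
    replace ((Cmod l + 1) * (eps / (2 * (Cmod l + 1)))) with (eps / 2) in H3 by (field; lra). lra.
Qed.

Lemma holomorphic_cont f s : holomorphic_at f s -> ccont f s.
Proof. intros H; apply holomorphic_iff in H; destruct H as [l H]; now apply is_cd_cont in H. Qed.

Lemma ccont_const c s : ccont (fun _ => c) s.
Proof. intros eps He; exists 1; split; [lra|]; intros; replace (c - c)%C with (RtoC 0) by ring; now rewrite Cmod_0. Qed.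

Lemma ccont_id s : ccont (fun z => z) s.
Proof. intros eps He; exists eps; auto. Qed.

Lemma ccont_plus f g s : ccont f s -> ccont g s -> ccont (fun z => f z + g z)%C s.
Proof.
  intros F G eps He. destruct (F (eps / 2)) as [d1 [H1 F1]]; [lra|]. destruct (G (eps / 2)) as [d2 [H2 G1]]; [lra|].
  exists (Rmin d1 d2); split; [now apply Rmin_glb_lt|]. intros z Hz.
  pose proof (Rmin_l d1 d2). pose proof (Rmin_r d1 d2).
  specialize (F1 z ltac:(lra)). specialize (G1 z ltac:(lra)).
  replace (f z + g z - (f s + g s))%C with ((f z - f s) + (g z - g s))%C by ring.
  eapply Rle_lt_trans; [apply Cmod_triangle|]. lra.
Qed.

Lemma ccont_mult f g s : ccont f s -> ccont g s -> ccont (fun z => f z * g z)%C s.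
Proof.
  intros F G eps He.
  pose proof (Cmod_ge_0 (f s)) as Pf. pose proof (Cmod_ge_0 (g s)) as Pg.
  set (K := Cmod (f s) + Cmod (g s) + 1).
  assert (HK : 0 < eps / (2 * K)) by (apply Rdiv_lt_0_compat; unfold K; lra).
  set (e := Rmin 1 (eps / (2 * K))).
  assert (He' : 0 < e) by (apply Rmin_glb_lt; lra).
  destruct (F e He') as [d1 [H1 F1]]. destruct (G e He') as [d2 [H2 G1]].
  exists (Rmin d1 d2); split; [now apply Rmin_glb_lt|]. intros z Hz.
  pose proof (Rmin_l d1 d2). pose proof (Rmin_r d1 d2).
  specialize (F1 z ltac:(lra)). specialize (G1 z ltac:(lra)).
  pose proof (Rmin_l 1 (eps / (2 * K))) as R1. pose proof (Rmin_r 1 (eps / (2 * K))) as R2. fold e in R1, R2.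
  replace (f z * g z - f s * g s)%C with ((f z - f s) * (g z - g s) + f s * (g z - g s) + (f z - f s) * g s)%C by ring.
  eapply Rle_lt_trans; [eapply Rle_trans; [apply Cmod_triangle|apply Rplus_le_compat_r, Cmod_triangle]|].
  rewrite !Cmod_mult. pose proof (Cmod_ge_0 (f z - f s)). pose proof (Cmod_ge_0 (g z - g s)).
  apply Rle_lt_trans with (e * K).
  - unfold K. assert (Cmod (f z - f s) * Cmod (g z - g s) <= e * 1) by (apply Rmult_le_compat; lra).
    assert (Cmod (f s) * Cmod (g z - g s) <= Cmod (f s) * e) by (apply Rmult_le_compat_l; lra).
    assert (Cmod (f z - f s) * Cmod (g s) <= e * Cmod (g s)) by (apply Rmult_le_compat_r; lra). lra.
  - apply Rle_lt_trans with (eps / (2 * K) * K); [apply Rmult_le_compat_r; [unfold K; lra|exact R2]|].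
    replace (eps / (2 * K) * K) with (eps / 2) by (field; unfold K; lra). lra.
Qed.

Lemma ccont_ext f g s : (forall z, f z = g z) -> ccont f s -> ccont g s.
Proof.
  intros E H eps He; destruct (H eps He) as [d [Hd H1]]; exists d; split; [assumption|].
  intros z Hz; rewrite <- (E z), <- (E s); auto.
Qed.

Lemma ccont_ext_loc f g s r : 0 < r -> (forall z, Cmod (z - s) < r -> f z = g z) -> ccont f s -> ccont g s.
Proof.
  intros Hr E H eps He; destruct (H eps He) as [d [Hd H1]]; exists (Rmin d r); split; [now apply Rmin_glb_lt|].
  intros z Hz. pose proof (Rmin_l d r). pose proof (Rmin_r d r).
  rewrite <- (E z) by lra. rewrite <- (E s); [apply H1; lra|].
  replace (s - s)%C with (RtoC 0) by ring. now rewrite Cmod_0.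
Qed.

Lemma ccont_comp f g s : ccont f s -> ccont g (f s) -> ccont (fun z => g (f z)) s.
Proof.
  intros F G eps He. destruct (G eps He) as [d [Hd G1]]. destruct (F d Hd) as [e [He' F1]].
  exists e; split; auto.
Qed.

Lemma is_cd_Cexp s : is_cd Cexp s (Cexp s).
Proof.
  intros eps He.
  exists (Rmin 1 (eps / (exp (Re s) * 3))). pose proof (exp_pos (Re s)).
  assert (0 < eps / (exp (Re s) * 3)) by (apply Rdiv_lt_0_compat; lra).
  split; [apply Rmin_glb_lt; lra|]. intros z Hz.
  pose proof (Rmin_l 1 (eps / (exp (Re s) * 3))). pose proof (Rmin_r 1 (eps / (exp (Re s) * 3))).
  replace (Cexp z) with (Cexp s * Cexp (z - s))%C by (rewrite <- Cexp_plus; f_equal; ring).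
  replace (Cexp s * Cexp (z - s) - Cexp s - Cexp s * (z - s))%C
    with (Cexp s * (Cexp (z - s) - RtoC 1 - (z - s)))%C by ring.
  rewrite Cmod_mult, Cmod_Cexp.
  pose proof (Cexp_2_bound (z - s)). pose proof (Cmod_ge_0 (z - s)).
  assert (exp (Cmod (z - s)) <= 3) by (apply Rle_trans with (exp 1); [apply exp_le; lra|apply exp_le_3]).
  apply Rle_trans with (exp (Re s) * (Cmod (z - s) ^ 2 * 3)).
  { apply Rmult_le_compat_l; [lra|]. eapply Rle_trans; [eassumption|].
    apply Rmult_le_compat_l; [apply pow2_ge_0|assumption]. }
  replace (exp (Re s) * (Cmod (z - s) ^ 2 * 3)) with (Cmod (z - s) * (exp (Re s) * 3) * Cmod (z - s)) by ring.
  apply Rmult_le_compat_r; [assumption|].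
  apply Rle_trans with (eps / (exp (Re s) * 3) * (exp (Re s) * 3)).
  - apply Rmult_le_compat_r; lra.
  - apply Req_le; field; lra.
Qed.

Lemma ccont_Cexp s : ccont Cexp s.
Proof. apply is_cd_cont with (Cexp s), is_cd_Cexp. Qed.

Lemma ccont_csum {A} (l : list A) (f : A -> C -> C) s :
  (forall a, In a l -> ccont (f a) s) -> ccont (fun z => csum l (fun a => f a z)) s.
Proof.
  induction l as [|a l IH]; intros H.
  - apply ccont_ext with (fun _ => RtoC 0); [reflexivity|apply ccont_const].
  - apply ccont_ext with (fun z => f a z + csum l (fun a => f a z))%C; [reflexivity|].
    apply ccont_plus; [apply H; now left|apply IH; intros; apply H; now right].
Qed.

Lemma ccont_cprod {A} (l : list A) (f : A -> C -> C) s :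
  (forall a, In a l -> ccont (f a) s) -> ccont (fun z => cprod l (fun a => f a z)) s.
Proof.
  induction l as [|a l IH]; intros H.
  - apply ccont_ext with (fun _ => RtoC 1); [reflexivity|apply ccont_const].
  - apply ccont_ext with (fun z => f a z * cprod l (fun a => f a z))%C; [reflexivity|].
    apply ccont_mult; [apply H; now left|apply IH; intros; apply H; now right].
Qed.

(** With w = g z - g s one has f z = f s e^w and e^w = 1 + w + O(w^2). Continuity makes w small,
    then differentiability of f gives w = O(z - s), and the quadratic term becomes negligible. *)
Lemma log_holomorphic f g s r :
  0 < r -> (forall z, Cmod (z - s) < r -> Cexp (g z) = f z) -> ccont g s -> holomorphic_at f s ->
  holomorphic_at g s.
Proof.
  intros Hr HE HG HF. apply holomorphic_iff in HF; destruct HF as [l HF]. apply holomorphic_iff.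
  assert (HE0 : Cexp (g s) = f s).
  { apply HE. replace (s - s)%C with (RtoC 0) by ring; now rewrite Cmod_0. }
  set (m := (l / f s)%C). exists m. intros eps He.
  assert (Hfs : f s <> RtoC 0) by (rewrite <- HE0; apply Cexp_nz).
  destruct (is_cd_lip _ _ _ HF) as [d0 [Hd0 HL]].
  set (A := Cmod (f s)). assert (HA : 0 < A) by (now apply Cmod_gt_0).
  set (K := 2 * (Cmod l + 1) / A).
  assert (HK : 0 < K) by (unfold K; apply Rdiv_lt_0_compat; [pose proof (Cmod_ge_0 l); lra|assumption]).
  (* Below 1/6 the error 3 |w|^2 is at most |w|/2, which yields |w| <= K |z - s|. The second entry
     then makes 3 |w|^2 at most eps/2 times |z - s|. *)
  set (e1 := Rmin (1/6) (eps / (6 * K))).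
  assert (He1 : 0 < e1).
  { apply Rmin_glb_lt; [lra|]. apply Rdiv_lt_0_compat; lra. }
  destruct (HG e1 He1) as [d1 [Hd1 HG1]].
  destruct (HF (A * eps / 2)) as [d2 [Hd2 HF2]]; [apply Rdiv_lt_0_compat; [apply Rmult_lt_0_compat|]; lra|].
  exists (Rmin (Rmin r d0) (Rmin d1 d2)). split; [repeat apply Rmin_glb_lt; assumption|].
  intros z Hz.
  pose proof (Rmin_l (Rmin r d0) (Rmin d1 d2)). pose proof (Rmin_r (Rmin r d0) (Rmin d1 d2)).
  pose proof (Rmin_l r d0). pose proof (Rmin_r r d0). pose proof (Rmin_l d1 d2). pose proof (Rmin_r d1 d2).
  pose proof (Rmin_l (1/6) (eps / (6 * K))) as Q1. pose proof (Rmin_r (1/6) (eps / (6 * K))) as Q2. fold e1 in Q1, Q2.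
  specialize (HE z ltac:(lra)). specialize (HL z ltac:(lra)). specialize (HG1 z ltac:(lra)). specialize (HF2 z ltac:(lra)).
  set (w := (g z - g s)%C) in *. set (h := (z - s)%C) in *.
  assert (Efz : f z = (f s * Cexp w)%C).
  { rewrite <- HE, <- HE0, <- Cexp_plus. f_equal. unfold w; ring. }
  pose proof (Cexp_2_bound w) as B. pose proof (Cmod_ge_0 w) as Pw. pose proof (Cmod_ge_0 h) as Ph.
  assert (B3 : exp (Cmod w) <= 3) by (apply Rle_trans with (exp 1); [apply exp_le; lra|apply exp_le_3]).
  assert (B' : Cmod (Cexp w - RtoC 1 - w) <= 3 * Cmod w ^ 2).
  { eapply Rle_trans; [exact B|]. rewrite Rmult_comm. apply Rmult_le_compat_r; [apply pow2_ge_0|assumption]. }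
  assert (Hw : Cmod w <= K * Cmod h).
  { assert (T : Cmod w <= Cmod (Cexp w - RtoC 1) + Cmod (Cexp w - RtoC 1 - w)).
    { replace w with ((Cexp w - RtoC 1) - (Cexp w - RtoC 1 - w))%C at 1 by ring.
      unfold Cminus at 1. eapply Rle_trans; [apply Cmod_triangle|]. rewrite Cmod_opp; lra. }
    assert (Cmod w <= 2 * Cmod (Cexp w - RtoC 1)) by nra.
    assert (A * Cmod (Cexp w - RtoC 1) <= (Cmod l + 1) * Cmod h).
    { unfold A; rewrite <- Cmod_mult. eapply Rle_trans; [|exact HL]. apply Req_le; f_equal. rewrite Efz; ring. }
    apply Rmult_le_reg_l with A; [assumption|]. unfold K.
    replace (A * (2 * (Cmod l + 1) / A * Cmod h)) with (2 * ((Cmod l + 1) * Cmod h)) by (field; lra). nra. }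
  replace (w - m * h)%C with
    (/ f s * (f z - f s - l * h) - (Cexp w - RtoC 1 - w))%C.
  2:{ rewrite Efz. unfold m. field; assumption. }
  unfold Cminus at 1. eapply Rle_trans; [apply Cmod_triangle|]. rewrite Cmod_opp, Cmod_mult, Cmod_inv by assumption.
  fold A.
  assert (T1 : / A * Cmod (f z - f s - l * h) <= eps / 2 * Cmod h).
  { apply Rle_trans with (/ A * (A * eps / 2 * Cmod h)).
    - apply Rmult_le_compat_l; [left; now apply Rinv_0_lt_compat|assumption].
    - apply Req_le; field; lra. }
  assert (T2 : 3 * Cmod w ^ 2 <= eps / 2 * Cmod h).
  { apply Rle_trans with (3 * (eps / (6 * K) * (K * Cmod h))).
    - simpl; rewrite Rmult_1_r. apply Rmult_le_compat_l; [lra|]. apply Rmult_le_compat; lra.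
    - apply Req_le; field; lra. }
  lra.
Qed.

(** * Powers of integers *)

Definition cpow (x : R) (s : C) : C := Cexp (s * RtoC (ln x)).

Lemma npow_cpow n s : npow n s = cpow (INR n) s.
Proof. reflexivity. Qed.

Lemma Cmod_cpow x s : Cmod (cpow x s) = Rpower x (Re s).
Proof. unfold cpow, Rpower; rewrite Cmod_Cexp; f_equal; simpl; unfold Re; simpl; ring. Qed.

Lemma npow_nz n s : npow n s <> RtoC 0.
Proof. apply Cexp_nz. Qed.

Lemma cpow_plus x s w : cpow x (s + w) = (cpow x s * cpow x w)%C.
Proof. unfold cpow; rewrite <- Cexp_plus; f_equal; ring. Qed.

Lemma cpow_opp x s : cpow x (- s) = (/ cpow x s)%C.
Proof. unfold cpow; rewrite <- Cexp_opp; f_equal; ring. Qed.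

Lemma cpow_mult x y s : 0 < x -> 0 < y -> cpow (x * y) s = (cpow x s * cpow y s)%C.
Proof. intros; unfold cpow; rewrite <- Cexp_plus, ln_mult, RtoC_plus by assumption; f_equal; ring. Qed.

Lemma cpow_1 s : cpow 1 s = RtoC 1.
Proof. unfold cpow. rewrite ln_1, <- Cexp_0; f_equal; ring. Qed.

Lemma npow_mult m n s : (0 < m)%nat -> (0 < n)%nat -> npow (m * n) s = (npow m s * npow n s)%C.
Proof. intros; rewrite !npow_cpow, mult_INR; apply cpow_mult; now apply lt_0_INR. Qed.

Lemma npow_1 s : npow 1 s = RtoC 1.
Proof. apply (cpow_1 s). Qed.

Lemma Cmod_npow n s : Cmod (npow n s) = Rpower (INR n) (Re s).
Proof. apply Cmod_cpow. Qed.

Lemma npow_INR_mult n (l : nat) s : npow n (RtoC (INR l) * s) = (npow n s ^ l)%C.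
Proof.
  induction l as [|l IH].
  - simpl. unfold npow. replace (RtoC 0 * s * RtoC (ln (INR n)))%C with (RtoC 0) by ring. apply Cexp_0.
  - rewrite S_INR, RtoC_plus, Cmult_plus_distr_r, Cmult_1_l, npow_cpow, cpow_plus, <- npow_cpow, IH.
    simpl; rewrite <- npow_cpow; ring.
Qed.

Lemma ccont_cpow x s : ccont (fun z => cpow x z) s.
Proof.
  unfold cpow. apply (ccont_comp (fun z => z * RtoC (ln x))%C Cexp); [|apply ccont_Cexp].
  apply ccont_mult; [apply ccont_id|apply ccont_const].
Qed.

Lemma ccont_div_npow c n s : ccont (fun z => c / npow n z)%C s.
Proof.
  apply ccont_ext with (fun z => c * cpow (INR n) (- z))%C.
  { intros z; now rewrite cpow_opp, <- npow_cpow. }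
  apply ccont_mult; [apply ccont_const|].
  apply (ccont_comp (fun z => - z)%C (cpow (INR n))); [|apply ccont_cpow].
  apply ccont_ext with (fun z => - RtoC 1 * z)%C; [intros; ring|].
  apply ccont_mult; [apply ccont_const|apply ccont_id].
Qed.

Lemma cderiv_cpow s x : 0 < x -> cderiv (fun x => cpow x (- s)) x (- s * cpow x (- s - RtoC 1))%C.
Proof.
  intros Hx. eapply cderiv_ext; [reflexivity| |apply cderiv_Cexp].
  2:{ apply cderiv_scal, cderiv_RtoC. apply is_derive_Reals, derivable_pt_lim_ln, Hx. }
  unfold Cminus. rewrite cpow_plus. fold (cpow x (- s)).
  replace (cpow x (- RtoC 1)) with (RtoC (/ x)); [ring|].
  rewrite cpow_opp. unfold cpow. rewrite Cmult_1_l, Cexp_R, exp_ln by assumption.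
  apply RtoC_inv; lra.
Qed.

(** * An elementary large sieve *)

Lemma Re_csum {A} (l : list A) f : Re (csum l f) = rsum l (fun a => Re (f a)).
Proof. induction l as [|a l IH]; [reflexivity|]; rewrite csum_cons, rsum_cons, <- IH; reflexivity. Qed.

Lemma Re_plus a b : Re (a + b)%C = Re a + Re b.
Proof. reflexivity. Qed.

Lemma Re_zsum_nonneg a n h : (forall i, 0 <= Re (h i)) -> 0 <= Re (zsum a n h).
Proof. intros H; unfold zsum; rewrite Re_csum; apply rsum_ge0; auto. Qed.

(** Each of the H translates of the widened interval contains the original one, and the additional
    terms are nonnegative. A sum over a sharp interval is thus majorized by a smoothed one. *)
Lemma shift_sum_lower H h a M :
  (forall i, 0 <= Re (h i)) ->
  INR H * Re (zsum a M h) <= Re (zsum (a - Z.of_nat H) (M + H) (shift_sum H h)).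
Proof.
  intros Hh. unfold shift_sum, zsum at 2. unfold zsum at 2. rewrite csum_swap, Re_csum.
  rewrite <- (length_seq H 0) at 1. rewrite <- rsum_const. apply rsum_le. intros i Hi. apply in_seq in Hi.
  replace (csum (seq 0 (M + H)) _) with (zsum (a - Z.of_nat H + Z.of_nat i) ((H - i) + (M + i)) h).
  - rewrite zsum_add, zsum_add.
    replace (a - Z.of_nat H + Z.of_nat i + Z.of_nat (H - i))%Z with a by lia.
    rewrite !Re_plus.
    pose proof (Re_zsum_nonneg (a - Z.of_nat H + Z.of_nat i) (H - i) h Hh).
    pose proof (Re_zsum_nonneg (a + Z.of_nat M) i h Hh). lra.
  - unfold zsum. replace (H - i + (M + i))%nat with (M + H)%nat by lia.
    apply csum_ext; intros; f_equal; lia.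
Qed.

Lemma shift_iter_nonneg j H g : (forall i, 0 <= Re (g i)) -> forall i, 0 <= Re (shift_iter j H g i).
Proof.
  intros Hg; induction j as [|j IH]; simpl; [assumption|]. intros i; now apply Re_zsum_nonneg.
Qed.

Lemma shift_iter_lower j H g a M :
  (forall i, 0 <= Re (g i)) ->
  INR H ^ j * Re (zsum a M g) <= Re (zsum (a - Z.of_nat (j * H)) (M + j * H) (shift_iter j H g)).
Proof.
  intros Hg; induction j as [|j IH].
  - simpl. rewrite Z.sub_0_r, Nat.add_0_r; lra.
  - simpl shift_iter.
    replace (a - Z.of_nat (S j * H))%Z with (a - Z.of_nat (j * H) - Z.of_nat H)%Z by lia.
    replace (M + S j * H)%nat with (M + j * H + H)%nat by lia.
    eapply Rle_trans; [|apply shift_sum_lower, shift_iter_nonneg, Hg].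
    simpl pow; rewrite Rmult_assoc. apply Rmult_le_compat_l; [apply pos_INR|exact IH].
Qed.

Lemma shift_iter_le j H f : (forall i, Cmod (f i) <= 1) -> forall i, Cmod (shift_iter j H f i) <= INR H ^ j.
Proof.
  intros Hf; induction j as [|j IH]; intros i; simpl; [apply Hf|]. now apply Cmod_zsum_le.
Qed.

Definition characters_upto (Q : nat) (E : list (Z -> C)) : Prop :=
  NoDup E /\ forall chi, In chi E -> exists q, (q <= Q)%nat /\ primitive_character q chi.

Lemma rsum_delta {A} (l : list A) (x : A) f :
  NoDup l -> In x l -> rsum l (fun y => if excluded_middle_informative (x = y) then f y else 0) = f x.
Proof.
  induction l as [|a l IH]; intros Hn Hx; [destruct Hx|].
  inversion Hn; subst. rewrite rsum_cons.
  destruct (excluded_middle_informative (x = a)) as [->|N].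
  - rewrite (rsum_ext l _ (fun _ => 0)), rsum_0; [ring|].
    intros y Hy. destruct (excluded_middle_informative (a = y)); [subst; contradiction|reflexivity].
  - destruct Hx as [->|Hx]; [tauto|]. rewrite IH by assumption; ring.
Qed.

(** The squares on the left are nonnegative, so the sum over m may be smoothed j times. After the
    squares are opened, equal characters are bounded trivially. For distinct ones the product has
    mean zero and period at most Q^2, which leaves Q^(2(j+1)). Cauchy-Schwarz over the pairs brings
    in the length of E. *)
Lemma dual_large_sieve Q E (j H M : nat) (b : (Z -> C) -> C) :
  characters_upto Q E ->
  rsum (seq 1 M) (fun m => Cmod (csum E (fun chi => b chi * chi (Z.of_nat m)))%C ^ 2) * INR H ^ j
  <= (INR (M + j * H) * INR H ^ j + INR (length E) * INR Q ^ (2 * (j + 1)))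
     * rsum E (fun chi => Cmod (b chi) ^ 2).
Proof.
  intros [Hnd HE].
  set (B := fun m => csum E (fun chi => b chi * chi m)%C).
  set (g := fun m => RtoC (Cmod (B m) ^ 2)).
  assert (Hg : forall i, 0 <= Re (g i)) by (intros; unfold g; simpl; apply pow2_ge_0).
  set (a := (1 - Z.of_nat (j * H))%Z). set (n := (M + j * H)%nat).
  assert (L := shift_iter_lower j H g 1 M Hg). fold a n in L.
  assert (EL : Re (zsum 1 M g) = rsum (seq 1 M) (fun m => Cmod (B (Z.of_nat m)) ^ 2)).
  { unfold zsum, g. rewrite csum_RtoC. simpl Re.
    rewrite (rsum_seq_shift _ 0 M 1). apply rsum_ext; intros i _.
    replace (Z.of_nat (i + 1)) with (1 + Z.of_nat i)%Z by lia; reflexivity. }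
  rewrite EL in L. unfold B in L at 1.
  rewrite Rmult_comm. eapply Rle_trans; [exact L|]. clear L EL.
  set (T := fun chi psi : Z -> C => zsum a n (shift_iter j H (fun m => chi m * Cconj (psi m))%C)).
  assert (EX : zsum a n (shift_iter j H g)
     = csum E (fun chi => csum E (fun psi => (b chi * Cconj (b psi) * T chi psi)%C))).
  { transitivity (zsum a n (fun i => csum E (fun chi => csum E (fun psi =>
        (b chi * Cconj (b psi) * shift_iter j H (fun m => chi m * Cconj (psi m))%C i)%C)))).
    - unfold zsum; apply csum_ext; intros i _.
      rewrite (shift_iter_ext g (fun m => csum E (fun chi => csum E (fun psi =>
        (b chi * Cconj (b psi) * (chi m * Cconj (psi m)))%C)))).
      + rewrite shift_iter_csum. apply csum_ext; intros chi _.
        rewrite shift_iter_csum. apply csum_ext; intros psi _. apply shift_iter_scal.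
      + intros m; unfold g, B. rewrite csum_sqr. apply csum_ext; intros chi _.
        apply csum_ext; intros psi _. rewrite Cmult_conj; ring.
    - unfold zsum. rewrite csum_swap. apply csum_ext; intros chi _.
      rewrite csum_swap. apply csum_ext; intros psi _. rewrite csum_scal. reflexivity. }
  rewrite EX. eapply Rle_trans; [apply Rle_abs|]. eapply Rle_trans; [apply re_le_Cmod|].
  eapply Rle_trans; [apply Cmod_csum|].
  assert (HT : forall chi psi, In chi E -> In psi E ->
     Cmod (T chi psi) <= (if excluded_middle_informative (chi = psi) then INR n * INR H ^ j else 0)
                         + INR Q ^ (2 * (j + 1))).
  { intros chi psi Hchi Hpsi.
    destruct (HE chi Hchi) as [q [Hq HC]], (HE psi Hpsi) as [q' [Hq' HC']].
    assert (H1 : forall m, Cmod (chi m * Cconj (psi m)) <= 1).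
    { intros m. rewrite Cmod_mult, Cmod_conj.
      pose proof (dc_Cmod_le _ _ m (proj1 HC)). pose proof (dc_Cmod_le _ _ m (proj1 HC')).
      pose proof (Cmod_ge_0 (chi m)). pose proof (Cmod_ge_0 (psi m)). nra. }
    assert (0 <= INR Q ^ (2 * (j + 1))) by (apply pow_le, pos_INR).
    destruct (excluded_middle_informative (chi = psi)) as [->|N].
    - apply Rle_trans with (INR n * INR H ^ j); [|lra].
      apply Cmod_zsum_le. now apply shift_iter_le.
    - destruct (primitive_product _ _ _ _ HC HC' N) as [HP HM].
      destruct (shift_iter_bound j H _ _ HP HM H1) as [IP [IM IB]].
      eapply Rle_trans; [apply (Cmod_zsum_period _ _ _ IP IM IB)|].
      rewrite Rplus_0_l, pow_mult, mult_INR.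
      replace ((INR q * INR q') * (INR q * INR q') ^ j) with ((INR q * INR q') ^ (j + 1)) by (rewrite pow_add; simpl; ring).
      apply pow_incr. split; [apply Rmult_le_pos; apply pos_INR|].
      simpl; rewrite Rmult_1_r. apply Rmult_le_compat; try apply pos_INR; now apply le_INR. }
  apply Rle_trans with (rsum E (fun chi => INR n * INR H ^ j * Cmod (b chi) ^ 2
      + INR Q ^ (2 * (j + 1)) * Cmod (b chi) * rsum E (fun psi => Cmod (b psi)))).
  { apply rsum_le; intros chi Hchi. eapply Rle_trans; [apply Cmod_csum|].
    apply Rle_trans with (rsum E (fun psi =>
       Cmod (b chi) * ((if excluded_middle_informative (chi = psi) then Cmod (b psi) * (INR n * INR H ^ j) else 0)
         + INR Q ^ (2 * (j + 1)) * Cmod (b psi)))).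
    - apply rsum_le; intros psi Hpsi. rewrite !Cmod_mult, Cmod_conj, Rmult_assoc.
      apply Rmult_le_compat_l; [apply Cmod_ge_0|].
      specialize (HT chi psi Hchi Hpsi). pose proof (Cmod_ge_0 (b psi)).
      eapply Rle_trans; [apply Rmult_le_compat_l; [assumption|exact HT]|].
      destruct (excluded_middle_informative (chi = psi)); lra.
    - rewrite rsum_scal, rsum_plus, rsum_delta, rsum_scal by assumption. simpl; lra. }
  rewrite rsum_plus, rsum_scal, Rmult_plus_distr_r. apply Rplus_le_compat_l.
  rewrite (rsum_ext E _ (fun chi => (INR Q ^ (2 * (j + 1)) * rsum E (fun psi => Cmod (b psi))) * Cmod (b chi)))
    by (intros; ring).
  rewrite rsum_scal.
  assert (CS := rsum_CS E (fun _ => 1) (fun chi => Cmod (b chi))).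
  cbv beta in CS.
  rewrite (rsum_ext E (fun a0 => 1 * Cmod (b a0)) (fun a => Cmod (b a))) in CS by (intros; ring).
  rewrite (rsum_ext E (fun _ => 1 ^ 2) (fun _ => 1)), rsum_const in CS by (intros; ring).
  replace (INR Q ^ (2 * (j + 1)) * rsum E (fun psi => Cmod (b psi)) * rsum E (fun chi => Cmod (b chi)))
    with (INR Q ^ (2 * (j + 1)) * rsum E (fun psi => Cmod (b psi)) ^ 2) by ring.
  rewrite (Rmult_comm (INR (length E))), Rmult_assoc.
  apply Rmult_le_compat_l; [apply pow_le, pos_INR|]. lra.
Qed.

(** Let S be the left side of the conclusion. With [b x] the conjugate of the inner sum at x,
    Cauchy-Schwarz gives S^2 <= |a|^2 Delta S. *)
Lemma duality {A B} (E : list A) (L : list B) (k : A -> B -> C) (Delta : R) :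
  0 <= Delta ->
  (forall b : A -> C, rsum L (fun m => Cmod (csum E (fun x => b x * k x m))%C ^ 2)
                      <= Delta * rsum E (fun x => Cmod (b x) ^ 2)) ->
  forall a : B -> C, rsum E (fun x => Cmod (csum L (fun m => a m * k x m))%C ^ 2)
                     <= Delta * rsum L (fun m => Cmod (a m) ^ 2).
Proof.
  intros HD H a. set (T := fun x => csum L (fun m => a m * k x m)%C).
  change (rsum E (fun x => Cmod (T x) ^ 2) <= Delta * rsum L (fun m => Cmod (a m) ^ 2)).
  set (S := rsum E (fun x => Cmod (T x) ^ 2)).
  assert (HS : 0 <= S) by (apply rsum_ge0; intros; apply pow2_ge_0).
  assert (HA : 0 <= rsum L (fun m => Cmod (a m) ^ 2)) by (apply rsum_ge0; intros; apply pow2_ge_0).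
  assert (ES : RtoC S = csum L (fun m => a m * csum E (fun x => Cconj (T x) * k x m))%C).
  { unfold S. rewrite <- csum_RtoC.
    transitivity (csum E (fun x => csum L (fun m => a m * (Cconj (T x) * k x m))%C)).
    - apply csum_ext; intros x _. rewrite Cmod2_conj. unfold T at 1.
      rewrite Cmult_comm, <- csum_scal. apply csum_ext; intros; ring.
    - rewrite csum_swap. apply csum_ext; intros m _. apply csum_scal. }
  pose proof (csum_CS L a (fun m => csum E (fun x => Cconj (T x) * k x m)%C)) as CS.
  cbv beta in CS. rewrite <- ES, Cmod_RtoC_nonneg in CS by assumption.
  specialize (H (fun x => Cconj (T x))). cbv beta in H.
  rewrite (rsum_ext E (fun x => Cmod (Cconj (T x)) ^ 2) (fun x => Cmod (T x) ^ 2)) in H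
    by (intros; now rewrite Cmod_conj). fold S in H.
  assert (S ^ 2 <= rsum L (fun m => Cmod (a m) ^ 2) * (Delta * S)).
  { eapply Rle_trans; [exact CS|]. now apply Rmult_le_compat_l. }
  destruct (Req_dec S 0) as [E0|E0]; [rewrite E0; now apply Rmult_le_pos|].
  apply Rmult_le_reg_r with S; [lra|]. lra.
Qed.

(** The sieve with M = 1 and j = 1, where every character contributes [chi 1] = 1. The choice H = 2
    Q^4 makes the off-diagonal term half the number of characters, which is absorbed on the left. *)
Lemma number_of_characters Q E :
  (0 < Q)%nat -> characters_upto Q E -> INR (length E) <= 6 * INR Q ^ 4.
Proof.
  intros HQ HE. set (H := (2 * Q ^ 4)%nat).
  assert (Q1 : 1 <= INR Q) by (apply (le_INR 1); lia).
  assert (HH : INR H = 2 * INR Q ^ 4) by (unfold H; now rewrite mult_INR, pow_INR).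
  assert (Q4 : 1 <= INR Q ^ 4) by (apply pow_R1_Rle; lra).
  assert (HR : 0 <= INR (length E)) by apply pos_INR.
  pose proof (duality E (seq 1 1) (fun chi m => chi (Z.of_nat m)) (1 + INR H + INR (length E) * INR Q ^ 4 / INR H)) as D.
  assert (P : 0 <= INR (length E) * INR Q ^ 4 / INR H).
  { apply Rmult_le_pos; [apply Rmult_le_pos; lra|]. left; apply Rinv_0_lt_compat; lra. }
  specialize (D ltac:(lra)).
  assert (D2 : forall b : (Z -> C) -> C,
     rsum (seq 1 1) (fun m => Cmod (csum E (fun x => b x * x (Z.of_nat m)))%C ^ 2)
     <= (1 + INR H + INR (length E) * INR Q ^ 4 / INR H) * rsum E (fun x => Cmod (b x) ^ 2)).
  { intros b. pose proof (dual_large_sieve Q E 1 H 1 b HE) as L.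
    rewrite pow_1 in L. apply Rmult_le_reg_r with (INR H); [lra|].
    eapply Rle_trans; [exact L|]. apply Req_le.
    rewrite plus_INR, Nat.mul_1_l. change (2 * (1 + 1))%nat with 4%nat. simpl (INR 1). field; lra. }
  specialize (D D2 (fun _ => RtoC 1)).
  rewrite (rsum_ext E _ (fun _ => 1)), rsum_const in D.
  2:{ intros chi Hchi. destruct (proj2 HE chi Hchi) as [q [_ [HC _]]].
      unfold csum; simpl. rewrite (dc_1 _ _ HC).
      replace (RtoC 1 * RtoC 1 + RtoC 0)%C with (RtoC 1) by ring. rewrite Cmod_1; ring. }
  unfold rsum in D; simpl in D. rewrite Cmod_1 in D.
  assert (E1 : INR (length E) * INR Q ^ 4 / INR H = INR (length E) / 2) by (rewrite HH; field; lra).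
  assert (D' : INR (length E) <= 1 + INR H + INR (length E) / 2).
  { rewrite <- E1. simpl pow. lra. }
  rewrite HH in D'. lra.
Qed.

Lemma large_sieve eps : 0 < eps -> exists K, 0 < K /\ forall Q E M (a : nat -> C),
  (0 < Q)%nat -> characters_upto Q E ->
  rsum E (fun chi => Cmod (csum (seq 1 M) (fun m => a m * chi (Z.of_nat m)))%C ^ 2)
  <= (INR M + K * Rpower (INR Q) (2 + eps)) * rsum (seq 1 M) (fun m => Cmod (a m) ^ 2).
Proof.
  intros He.
  (* With H at least Q^(2+eps), more than 6/eps smoothings give H^j >= Q^(2j+6). This dominates
     Q^(2(j+1)) times the crude count 6 Q^4 of the characters, up to the constant 6. *)
  destruct (nfloor_ex (6 / eps)) as [j0 [_ Hj0]]; [apply Rmult_le_pos; [lra|left; now apply Rinv_0_lt_compat]|].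
  set (j := S j0). assert (Hj : 6 / eps < INR j) by (unfold j; rewrite S_INR; exact Hj0).
  exists (2 * INR j + 6). split; [pose proof (pos_INR j); lra|].
  intros Q E M a HQ HE.
  assert (Q1 : 1 <= INR Q) by (apply (le_INR 1); lia).
  set (P := Rpower (INR Q) (2 + eps)).
  assert (P1 : 1 <= P).
  { unfold P. rewrite <- (Rpower_O (INR Q)) by lra. apply Rle_Rpower; lra. }
  destruct (nfloor_ex P) as [h [Hh1 Hh2]]; [lra|].
  set (H := S h). assert (HH1 : P <= INR H) by (unfold H; rewrite S_INR; lra).
  assert (HH2 : INR H <= 2 * P) by (unfold H; rewrite S_INR; lra).
  assert (HR : 0 <= INR (length E)) by apply pos_INR.
  apply duality.
  { apply Rplus_le_le_0_compat; [apply pos_INR|]. apply Rmult_le_pos; [pose proof (pos_INR j); lra|lra]. }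
  intros b. pose proof (dual_large_sieve Q E j H M b HE) as L.
  assert (PH : 0 < INR H ^ j) by (apply pow_lt; lra).
  apply Rmult_le_reg_r with (INR H ^ j); [assumption|].
  eapply Rle_trans; [exact L|].
  rewrite (Rmult_comm (_ * _) (INR H ^ j)), <- Rmult_assoc.
  apply Rmult_le_compat_r; [apply rsum_ge0; intros; apply pow2_ge_0|].
  assert (K1 : INR (length E) * INR Q ^ (2 * (j + 1)) <= 6 * INR H ^ j).
  { apply Rle_trans with (6 * INR Q ^ 4 * INR Q ^ (2 * (j + 1))).
    - apply Rmult_le_compat_r; [apply pow_le; lra|]. now apply number_of_characters.
    - rewrite Rmult_assoc. apply Rmult_le_compat_l; [lra|].
      apply Rle_trans with (P ^ j); [|apply pow_incr; lra].
      rewrite <- pow_add, <- !Rpower_pow by (try apply exp_pos; lra).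
      unfold P; rewrite Rpower_mult. apply Rle_Rpower; [assumption|].
      rewrite plus_INR, mult_INR, plus_INR. simpl (INR 4). simpl (INR 2). simpl (INR 1).
      apply Rmult_lt_compat_l with (r := eps) in Hj; [|assumption].
      replace (eps * (6 / eps)) with 6 in Hj by (field; lra). lra. }
  rewrite plus_INR, mult_INR.
  assert (INR j * INR H <= 2 * INR j * P) by (pose proof (pos_INR j); nra).
  apply Rle_trans with (INR H ^ j * (INR M + INR j * INR H + 6)); [lra|].
  apply Rmult_le_compat_l; [lra|]. lra.
Qed.

(* Taylor expansion of [m^{-h}] in [h] reduces varying points near [s0] to [s0]. *)
Lemma large_sieve_points eps : 0 < eps -> exists K, 0 < K /\
  forall Q E M (a : nat -> C) (s0 : C) (s : (Z -> C) -> C) (Lm : R),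
  (0 < Q)%nat -> characters_upto Q E ->
  (forall m, (1 <= m <= M)%nat -> ln (INR m) <= Lm) ->
  (forall chi, In chi E -> Cmod (s chi - s0) * Lm <= / 4) ->
  rsum E (fun chi => Cmod (csum (seq 1 M) (fun m => a m * chi (Z.of_nat m) / npow m (s chi)))%C ^ 2)
  <= K * (INR M + Rpower (INR Q) (2 + eps))
     * rsum (seq 1 M) (fun m => Cmod (a m) ^ 2 * Rpower (INR m) (- 2 * Re s0)).
Proof.
  intros He. destruct (large_sieve eps He) as [K0 [HK0 LS]].
  exists (16 * (1 + K0)). split; [lra|].
  intros Q E M a s0 s Lm HQ HE HL Hs.
  set (W := (INR M + Rpower (INR Q) (2 + eps)) * rsum (seq 1 M) (fun m => Cmod (a m) ^ 2 * Rpower (INR m) (- 2 * Re s0))).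
  destruct (Nat.eq_dec M 0) as [->|HM].
  { simpl. unfold W, csum, rsum at 2; simpl.
    rewrite (rsum_ext E _ (fun _ => 0)), rsum_0 by (intros; rewrite Cmod_0; simpl; ring). lra. }
  assert (L0 : 0 <= Lm) by (rewrite <- ln_1; apply (HL 1%nat); lia).
  assert (HW : 0 <= W).
  { apply Rmult_le_pos; [pose proof (pos_INR M); assert (0 < Rpower (INR Q) (2 + eps)) by apply exp_pos; lra|].
    apply rsum_ge0; intros; apply Rmult_le_pos; [apply pow2_ge_0|left; apply exp_pos]. }
  (* The normalized logarithm of m. If [Lm] = 0, all logarithms in the range vanish and the value 0
     is the right one. *)
  set (x := fun m => if Req_dec_T Lm 0 then 0 else ln (INR m) / Lm).
  assert (Hx : forall m, (1 <= m <= M)%nat -> 0 <= x m <= 1 /\ ln (INR m) = x m * Lm).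
  { intros m Hm. pose proof (HL m Hm) as H1.
    assert (0 <= ln (INR m)) by (rewrite <- ln_1; apply ln_le; [lra|apply (le_INR 1); lia]).
    unfold x; destruct (Req_dec_T Lm 0) as [E0|E0]; [split; lra|].
    split; [|field; assumption]. split; [apply Rmult_le_pos; [assumption|left; apply Rinv_0_lt_compat; lra]|].
    apply Rmult_le_reg_r with Lm; [lra|]. unfold Rdiv; rewrite Rmult_assoc, Rinv_l by assumption; lra. }
  set (c := fun j m => (a m * RtoC (x m ^ j) / npow m s0)%C).
  assert (Hj : forall j, rsum E (fun chi => Cmod (csum (seq 1 M) (fun m => c j m * chi (Z.of_nat m)))%C ^ 2) <= (1 + K0) * W).
  { intros j. eapply Rle_trans; [apply (LS Q E M (c j) HQ HE)|].
    unfold W; rewrite <- Rmult_assoc. apply Rmult_le_compat.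
    - apply Rplus_le_le_0_compat; [apply pos_INR|apply Rmult_le_pos; [lra|left; apply exp_pos]].
    - apply rsum_ge0; intros; apply pow2_ge_0.
    - assert (0 < Rpower (INR Q) (2 + eps)) by apply exp_pos. pose proof (pos_INR M). nra.
    - apply rsum_le. intros m Hm; apply in_seq in Hm. destruct (Hx m) as [[X1 X2] _]; [lia|].
      unfold c. rewrite Cmod_div, Cmod_mult, Cmod_npow by apply npow_nz.
      rewrite Cmod_RtoC_nonneg by (apply pow_le; lra).
      assert (Hp : x m ^ j <= 1) by (rewrite <- (pow1 j); apply pow_incr; lra).
      assert (0 <= x m ^ j) by (apply pow_le; lra).
      replace (Rpower (INR m) (- 2 * Re s0)) with (/ Rpower (INR m) (Re s0) ^ 2).
      2:{ rewrite <- Rpower_pow by apply exp_pos. rewrite Rpower_mult, <- Rpower_Ropp. f_equal. simpl; ring. }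
      unfold Rdiv; rewrite !Rpow_mult_distr, pow_inv.
      apply Rmult_le_compat_r; [left; apply Rinv_0_lt_compat, pow_lt, exp_pos|].
      assert ((x m ^ j) ^ 2 <= 1) by (simpl; nra). pose proof (pow2_ge_0 (Cmod (a m))). nra. }
  set (h := fun chi => ((s0 - s chi) * RtoC Lm)%C).
  assert (Hh : forall chi, In chi E -> Cmod (h chi) <= / 4).
  { intros chi Hchi. unfold h. rewrite Cmod_mult, Cmod_RtoC_nonneg, Cmod_minus_sym by assumption. now apply Hs. }
  set (F := fun j chi => csum (seq 1 M) (fun m => c j m * chi (Z.of_nat m))%C).
  set (FJ := fun J chi => csum (seq 0 J) (fun j => h chi ^ j / RtoC (INR (fact j)) * F j chi)%C).
  set (G := fun chi => csum (seq 1 M) (fun m => a m * chi (Z.of_nat m) / npow m (s chi))%C).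
  set (A := rsum (seq 1 M) (fun m => Cmod (a m) * Rpower (INR m) (- Re s0))).
  assert (Hfact : forall j, RtoC (INR (fact j)) <> RtoC 0) by (intros j E1; apply RtoC_inj in E1; now apply INR_fact_neq_0 in E1).
  assert (HFJ : forall J chi, FJ J chi = csum (seq 1 M) (fun m => a m * chi (Z.of_nat m) / npow m s0 * Cexp_part J (h chi * RtoC (x m)))%C).
  { induction J as [|J IH]; intros chi.
    - transitivity (RtoC 0); [reflexivity|]. simpl Cexp_part.
      transitivity (csum (seq 1 M) (fun _ => RtoC 0)); [now rewrite csum_0|].
      apply csum_ext; intros; ring.
    - unfold FJ. rewrite csum_seq_S. fold (FJ J chi). rewrite IH. unfold F. rewrite <- csum_scal, <- csum_plus.
      apply csum_ext; intros m _. simpl. unfold c. rewrite RtoC_pow, Cpow_mult_l. field.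
      split; [apply Hfact|apply npow_nz]. }
  assert (Herr : forall J chi, In chi E -> Cmod (G chi - FJ J chi) <= (/ 4) ^ J * (3 * A)).
  { intros J chi Hchi. rewrite HFJ. unfold G. rewrite <- csum_minus.
    eapply Rle_trans; [apply Cmod_csum|]. unfold A. rewrite <- !rsum_scal.
    apply rsum_le; intros m Hm; apply in_seq in Hm. destruct (Hx m) as [[X1 X2] X3]; [lia|].
    replace (a m * chi (Z.of_nat m) / npow m (s chi) - a m * chi (Z.of_nat m) / npow m s0 * Cexp_part J (h chi * RtoC (x m)))%C
      with (a m * chi (Z.of_nat m) * / npow m s0 * (Cexp (h chi * RtoC (x m)) - Cexp_part J (h chi * RtoC (x m))))%C.
    2:{ replace (Cexp (h chi * RtoC (x m))) with (npow m s0 / npow m (s chi))%C; [field; split; apply npow_nz|].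
        unfold npow. rewrite <- Cexp_minus. f_equal. rewrite X3, RtoC_mult. unfold h; ring. }
    rewrite !Cmod_mult, Cmod_inv, Cmod_npow, <- Rpower_Ropp by apply npow_nz.
    destruct (proj2 HE chi Hchi) as [q [_ [HC _]]].
    pose proof (dc_Cmod_le _ _ (Z.of_nat m) HC). pose proof (Cmod_ge_0 (chi (Z.of_nat m))). pose proof (Cmod_ge_0 (a m)).
    assert (0 < Rpower (INR m) (- Re s0)) by apply exp_pos.
    set (z := (h chi * RtoC (x m))%C).
    assert (Hz : Cmod z <= / 4).
    { unfold z; rewrite Cmod_mult, Cmod_RtoC_nonneg by assumption. specialize (Hh chi Hchi). pose proof (Cmod_ge_0 (h chi)). nra. }
    assert (T : Cmod (Cexp z - Cexp_part J z) <= (/ 4) ^ J * 3).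
    { eapply Rle_trans; [apply Cexp_part_error|]. apply Rmult_le_compat.
      - apply pow_le, Cmod_ge_0.
      - left; apply exp_pos.
      - apply pow_incr; split; [apply Cmod_ge_0|assumption].
      - apply Rle_trans with (exp 1); [apply exp_le; lra|apply exp_le_3]. }
    replace ((/ 4) ^ J * (3 * (Cmod (a m) * Rpower (INR m) (- Re s0))))
      with (Cmod (a m) * Rpower (INR m) (- Re s0) * ((/ 4) ^ J * 3)) by ring.
    apply Rmult_le_compat; [|apply Cmod_ge_0| |exact T].
    - apply Rmult_le_pos; [apply Rmult_le_pos; assumption|lra].
    - apply Rmult_le_compat_r; [lra|]. nra. }
  (* The Taylor weights are at most 4^-j = 2^-j 2^-j. Cauchy-Schwarz with weights 2^-j leaves a
     convergent combination of the bounds [Hj], which do not depend on j. *)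
  assert (HFJ2 : forall J, rsum E (fun chi => Cmod (FJ J chi) ^ 2) <= 4 * ((1 + K0) * W)).
  { intros J.
    assert (Hgeo : forall J, rsum (seq 0 J) (fun j => (/ 2) ^ j) <= 2).
    { intros J'. assert (rsum (seq 0 J') (fun j => (/ 2) ^ j) = 2 - 2 * (/ 2) ^ J').
      { induction J' as [|J' IH']; [unfold rsum; simpl; ring|]. rewrite rsum_seq_S, IH'. simpl. field. }
      assert (0 < (/ 2) ^ J') by (apply pow_lt; lra). lra. }
    apply Rle_trans with (rsum E (fun chi => 2 * rsum (seq 0 J) (fun j => (/ 2) ^ j * Cmod (F j chi) ^ 2))).
    - apply rsum_le; intros chi Hchi. unfold FJ.
      assert (B : Cmod (csum (seq 0 J) (fun j => h chi ^ j / RtoC (INR (fact j)) * F j chi)%C)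
        <= rsum (seq 0 J) (fun j => (/ 2) ^ j * ((/ 2) ^ j * Cmod (F j chi)))).
      { eapply Rle_trans; [apply Cmod_csum|]. apply rsum_le; intros j _.
        rewrite Cmod_mult, <- Rmult_assoc. apply Rmult_le_compat_r; [apply Cmod_ge_0|].
        rewrite Cmod_div, Cmod_pow, Cmod_RtoC_nonneg by (try apply pos_INR; apply Hfact).
        rewrite <- Rpow_mult_distr. apply Rle_trans with (Cmod (h chi) ^ j).
        - assert (1 <= INR (fact j)) by (apply (le_INR 1); pose proof (lt_O_fact j); lia).
          rewrite <- (Rmult_1_r (Cmod (h chi) ^ j)) at 2. apply Rmult_le_compat_l; [apply pow_le, Cmod_ge_0|].
          apply Rle_trans with (/ 1); [apply Rinv_le_contravar; lra|rewrite Rinv_1; lra].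
        - apply pow_incr; split; [apply Cmod_ge_0|]. specialize (Hh chi Hchi). lra. }
      eapply Rle_trans; [apply pow_incr; split; [apply Cmod_ge_0|exact B]|].
      assert (CS := rsum_CS (seq 0 J) (fun j => sqrt ((/ 2) ^ j)) (fun j => sqrt ((/ 2) ^ j) * (Cmod (F j chi)))).
      cbv beta in CS.
      assert (Hs2 : forall j, sqrt ((/ 2) ^ j) * sqrt ((/ 2) ^ j) = (/ 2) ^ j) by (intros; apply sqrt_sqrt, pow_le; lra).
      eapply Rle_trans with (rsum (seq 0 J) (fun j => (/ 2) ^ j * Cmod (F j chi)) ^ 2).
      { apply pow_incr; split.
        - apply rsum_ge0; intros. apply Rmult_le_pos; [apply pow_le; lra|]. apply Rmult_le_pos; [apply pow_le; lra|apply Cmod_ge_0].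
        - apply rsum_le; intros. apply Rmult_le_compat_l; [apply pow_le; lra|].
          assert ((/ 2) ^ a0 <= 1) by (rewrite <- (pow1 a0); apply pow_incr; lra).
          pose proof (Cmod_ge_0 (F a0 chi)). assert (0 <= (/ 2) ^ a0) by (apply pow_le; lra). nra. }
      rewrite (rsum_ext _ (fun j => sqrt ((/ 2) ^ j) * (sqrt ((/ 2) ^ j) * Cmod (F j chi))) (fun j => (/ 2) ^ j * Cmod (F j chi))) in CS
        by (intros; rewrite <- Rmult_assoc, Hs2; reflexivity).
      eapply Rle_trans; [exact CS|]. apply Rmult_le_compat.
      + apply rsum_ge0; intros; apply pow2_ge_0.
      + apply rsum_ge0; intros; apply pow2_ge_0.
      + eapply Rle_trans; [|apply (Hgeo J)]. apply Req_le, rsum_ext. intros j _.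
        pose proof (Hs2 j) as E2; set (u := sqrt ((/ 2) ^ j)) in *; rewrite <- E2; ring.
      + apply Req_le, rsum_ext. intros j _.
        pose proof (Hs2 j) as E2; set (u := sqrt ((/ 2) ^ j)) in *; rewrite <- E2; ring.
    - rewrite rsum_scal, rsum_swap.
      apply Rle_trans with (2 * rsum (seq 0 J) (fun j => (/ 2) ^ j * ((1 + K0) * W))).
      + apply Rmult_le_compat_l; [lra|]. apply rsum_le; intros j _. rewrite rsum_scal.
        apply Rmult_le_compat_l; [apply pow_le; lra|]. apply Hj.
      + rewrite (rsum_ext _ _ (fun j => ((1 + K0) * W) * (/ 2) ^ j)), rsum_scal by (intros; ring).
        specialize (Hgeo J). assert (X0 : 0 <= (1 + K0) * W) by (apply Rmult_le_pos; [lra|exact HW]).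
        apply Rle_trans with (2 * ((1 + K0) * W * 2)); [|lra].
        apply Rmult_le_compat_l; [lra|]. apply Rmult_le_compat_l; assumption. }
  assert (HG : forall J, rsum E (fun chi => Cmod (G chi) ^ 2) <= 8 * ((1 + K0) * W) + INR (length E) * (2 * (3 * A) ^ 2) * (/ 4) ^ J).
  { intros J. apply Rle_trans with (rsum E (fun chi => 2 * Cmod (FJ J chi) ^ 2 + 2 * (3 * A) ^ 2 * (/ 4) ^ J)).
    - apply rsum_le; intros chi Hchi. specialize (Herr J chi Hchi).
      assert (T : Cmod (G chi) <= Cmod (FJ J chi) + (/ 4) ^ J * (3 * A)).
      { pose proof (Cmod_triangle_inv (G chi) (FJ J chi)). lra. }
      pose proof (Cmod_ge_0 (G chi)). pose proof (Cmod_ge_0 (FJ J chi)).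
      set (e := (/ 4) ^ J * (3 * A)) in *.
      assert (He0 : 0 <= e) by (pose proof (Cmod_ge_0 (G chi - FJ J chi)); lra).
      apply Rle_trans with (2 * Cmod (FJ J chi) ^ 2 + 2 * e ^ 2).
      { apply Rle_trans with ((Cmod (FJ J chi) + e) ^ 2); [apply pow_incr; lra|].
        pose proof (pow2_ge_0 (Cmod (FJ J chi) - e)). lra. }
      apply Rplus_le_compat_l. unfold e.
      assert (Hp : 0 <= (/ 4) ^ J <= 1) by (split; [apply pow_le; lra|rewrite <- (pow1 J); apply pow_incr; lra]).
      rewrite Rpow_mult_distr.
      revert Hp; generalize ((/ 4) ^ J); intros p Hp. pose proof (pow2_ge_0 (3 * A)) as HA.
      revert HA; generalize ((3 * A) ^ 2); intros Z HZ.
      assert (p ^ 2 <= p) by (replace (p ^ 2) with (p * p) by ring; rewrite <- (Rmult_1_r p) at 3; apply Rmult_le_compat_l; lra).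
      rewrite (Rmult_comm (2 * Z)). replace (2 * (p ^ 2 * Z)) with (p ^ 2 * (2 * Z)) by ring.
      apply Rmult_le_compat_r; lra.
    - rewrite rsum_plus, rsum_scal, rsum_const. specialize (HFJ2 J). lra. }
  set (Y := INR (length E) * (2 * (3 * A) ^ 2)) in *.
  assert (HY : 0 <= Y) by (apply Rmult_le_pos; [apply pos_INR|]; pose proof (pow2_ge_0 (3 * A)); lra).
  (* The Taylor error carries the uncontrolled factor [Y] but decays like 4^-J. Since [HG] holds for
     every J, it disappears for J large. *)
  apply Rnot_lt_le; intros Hlt.
  assert (Hlt' : 8 * ((1 + K0) * W) < rsum E (fun chi => Cmod (G chi) ^ 2)).
  { eapply Rle_lt_trans; [|exact Hlt]. fold W.
    replace (16 * (1 + K0) * (INR M + Rpower (INR Q) (2 + eps)) * rsum (seq 1 M) (fun m => Cmod (a m) ^ 2 * Rpower (INR m) (-2 * Re s0)))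
      with (16 * (1 + K0) * W) by (unfold W; ring).
    assert (0 <= (1 + K0) * W) by (apply Rmult_le_pos; [lra|exact HW]). lra. }
  set (gap := rsum E (fun chi => Cmod (G chi) ^ 2) - 8 * ((1 + K0) * W)) in *.
  assert (Hgap : 0 < gap / (Y + 1)) by (apply Rdiv_lt_0_compat; unfold gap; lra).
  destruct (pow_lt_1_zero (/ 4)) with (y := gap / (Y + 1)) as [N HN]; [rewrite Rabs_pos_eq; lra|assumption|].
  specialize (HN N (Nat.le_refl N)). rewrite Rabs_pos_eq in HN by (apply pow_le; lra).
  specialize (HG N).
  apply Rmult_lt_compat_l with (r := Y + 1) in HN; [|lra].
  replace ((Y + 1) * (gap / (Y + 1))) with gap in HN by (field; lra).
  assert (0 < (/ 4) ^ N) by (apply pow_lt; lra). unfold gap in HN. lra.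
Qed.

(** * Goursat's theorem and the identity theorem for entire functions *)

Lemma is_cd_const c s : is_cd (fun _ => c) s (RtoC 0).
Proof.
  intros eps He; exists 1; split; [lra|]; intros z _.
  replace (c - c - RtoC 0 * (z - s))%C with (RtoC 0) by ring. rewrite Cmod_0.
  apply Rmult_le_pos; [lra|apply Cmod_ge_0].
Qed.

Lemma is_cd_id s : is_cd (fun z => z) s (RtoC 1).
Proof.
  intros eps He; exists 1; split; [lra|]; intros z _.
  replace (z - s - RtoC 1 * (z - s))%C with (RtoC 0) by ring. rewrite Cmod_0.
  apply Rmult_le_pos; [lra|apply Cmod_ge_0].
Qed.

Lemma is_cd_plus f g s l m : is_cd f s l -> is_cd g s m -> is_cd (fun z => f z + g z)%C s (l + m)%C.
Proof.
  intros F G eps He. destruct (F (eps / 2)) as [d1 [H1 F1]]; [lra|]. destruct (G (eps / 2)) as [d2 [H2 G1]]; [lra|].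
  exists (Rmin d1 d2); split; [now apply Rmin_glb_lt|]. intros z Hz.
  pose proof (Rmin_l d1 d2). pose proof (Rmin_r d1 d2).
  specialize (F1 z ltac:(lra)). specialize (G1 z ltac:(lra)).
  replace (f z + g z - (f s + g s) - (l + m) * (z - s))%C
    with ((f z - f s - l * (z - s)) + (g z - g s - m * (z - s)))%C by ring.
  eapply Rle_trans; [apply Cmod_triangle|]. lra.
Qed.

Lemma is_cd_ext f g s l m : (forall z, f z = g z) -> l = m -> is_cd f s l -> is_cd g s m.
Proof.
  intros E <- H eps He; destruct (H eps He) as [d [Hd H1]]; exists d; split; [assumption|].
  intros z Hz; rewrite <- (E z), <- (E s); auto.
Qed.

Lemma is_cd_comp f g s l m : is_cd f s l -> is_cd g (f s) m -> is_cd (fun z => g (f z)) s (m * l)%C.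
Proof.
  intros F G eps He. pose proof (Cmod_ge_0 l). pose proof (Cmod_ge_0 m).
  destruct (is_cd_lip _ _ _ F) as [d0 [Hd0 L0]].
  destruct (G (eps / (2 * (Cmod l + 1)))) as [d1 [Hd1 G1]]; [apply Rdiv_lt_0_compat; lra|].
  destruct (F (eps / (2 * (Cmod m + 1)))) as [d2 [Hd2 F2]]; [apply Rdiv_lt_0_compat; lra|].
  destruct (is_cd_cont _ _ _ F d1 Hd1) as [d3 [Hd3 F3]].
  exists (Rmin (Rmin d0 d2) d3). split; [repeat apply Rmin_glb_lt; assumption|]. intros z Hz.
  pose proof (Rmin_l (Rmin d0 d2) d3). pose proof (Rmin_r (Rmin d0 d2) d3).
  pose proof (Rmin_l d0 d2). pose proof (Rmin_r d0 d2).
  specialize (L0 z ltac:(lra)). specialize (F2 z ltac:(lra)). specialize (F3 z ltac:(lra)).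
  specialize (G1 (f z) F3). pose proof (Cmod_ge_0 (z - s)) as Pz.
  replace (g (f z) - g (f s) - m * l * (z - s))%C
    with ((g (f z) - g (f s) - m * (f z - f s)) + m * (f z - f s - l * (z - s)))%C by ring.
  eapply Rle_trans; [apply Cmod_triangle|]. rewrite Cmod_mult.
  assert (A1 : eps / (2 * (Cmod l + 1)) * Cmod (f z - f s) <= eps / 2 * Cmod (z - s)).
  { apply Rle_trans with (eps / (2 * (Cmod l + 1)) * ((Cmod l + 1) * Cmod (z - s))).
    - apply Rmult_le_compat_l; [left; apply Rdiv_lt_0_compat; lra|assumption].
    - apply Req_le; field; lra. }
  assert (A2 : Cmod m * Cmod (f z - f s - l * (z - s)) <= eps / 2 * Cmod (z - s)).
  { apply Rle_trans with ((Cmod m + 1) * (eps / (2 * (Cmod m + 1)) * Cmod (z - s))).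
    - apply Rmult_le_compat; [assumption|apply Cmod_ge_0|lra|assumption].
    - apply Req_le; field; lra. }
  lra.
Qed.

(** Polarization: f g is a quarter of (f + g)^2 - (f - g)^2, so that only squares, multiples, sums
    and compositions need an estimate. *)
Lemma is_cd_mult f g s l m :
  is_cd f s l -> is_cd g s m -> is_cd (fun z => f z * g z)%C s (l * g s + f s * m)%C.
Proof.
  intros F G.
  assert (Sq : forall w, is_cd (fun z => z * z)%C w (RtoC 2 * w)%C).
  { intros w eps He; exists eps; split; [assumption|]; intros z Hz.
    replace (z * z - w * w - RtoC 2 * w * (z - w))%C with ((z - w) * (z - w))%C by ring.
    rewrite Cmod_mult. apply Rmult_le_compat_r; [apply Cmod_ge_0|lra]. }
  assert (Sc : forall c f l, is_cd f s l -> is_cd (fun z => c * f z)%C s (c * l)%C).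
  { intros c f0 l0 H. apply (is_cd_comp f0 (fun w => c * w)%C _ _ _ H).
    intros eps He; exists 1; split; [lra|]; intros z _.
    replace (c * z - c * f0 s - c * (z - f0 s))%C with (RtoC 0) by ring. rewrite Cmod_0.
    apply Rmult_le_pos; [lra|apply Cmod_ge_0]. }
  assert (P := is_cd_comp _ _ _ _ _ (is_cd_plus _ _ _ _ _ F G) (Sq _)).
  assert (M := is_cd_comp _ _ _ _ _ (is_cd_plus _ _ _ _ _ F (Sc (- RtoC 1)%C _ _ G)) (Sq _)).
  eapply is_cd_ext; [| |exact (is_cd_plus _ _ _ _ _ (Sc (/ RtoC 4)%C _ _ P) (Sc (- / RtoC 4)%C _ _ M))].
  - intros z; cbv beta; field.
  - cbv beta; field.
Qed.

(** * Integrals along segments and rectangles *)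

Definition CI (f : R -> C) (a b : R) : C :=
  (RInt (fun x => Re (f x)) a b, RInt (fun x => Im (f x)) a b).

Definition rcont (f : R -> C) : Prop :=
  forall x, continuous (fun x => Re (f x)) x /\ continuous (fun x => Im (f x)) x.

Lemma CI_antideriv f F a b :
  rcont f -> (forall x, cderiv F x (f x)) -> CI f a b = (F b - F a)%C.
Proof.
  intros Hc HF. apply C_ext; simpl.
  - apply is_RInt_unique.
    apply (is_RInt_derive (V := R_CompleteNormedModule) (fun x => Re (F x)) (fun x => Re (f x)) a b);
      intros; [apply HF|apply Hc].
  - apply is_RInt_unique.
    apply (is_RInt_derive (V := R_CompleteNormedModule) (fun x => Im (F x)) (fun x => Im (f x)) a b);
      intros; [apply HF|apply Hc].
Qed.

Lemma CI_deriv f a x : rcont f -> cderiv (fun t => CI f a t) x (f x).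
Proof.
  intros Hc; split; simpl.
  - apply (is_derive_RInt (V := R_CompleteNormedModule) (fun x => Re (f x)) _ a); [|apply Hc].
    apply filter_forall; intros t. apply RInt_correct, (ex_RInt_continuous (V := R_CompleteNormedModule)).
    intros; apply Hc.
  - apply (is_derive_RInt (V := R_CompleteNormedModule) (fun x => Im (f x)) _ a); [|apply Hc].
    apply filter_forall; intros t. apply RInt_correct, (ex_RInt_continuous (V := R_CompleteNormedModule)).
    intros; apply Hc.
Qed.

Lemma CI_point f a : CI f a a = RtoC 0.
Proof. apply C_ext; simpl; apply (RInt_point (V := R_CompleteNormedModule)). Qed.

Lemma CI_bound f a b B :
  rcont f -> a <= b -> (forall x, a <= x <= b -> Cmod (f x) <= B) -> Cmod (CI f a b) <= B * (b - a).
Proof.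
  intros Hc Hab HB. replace (CI f a b) with (CI f a b - CI f a a)%C by (rewrite CI_point; ring).
  apply (cderiv_mvt (fun t => CI f a t) f); auto. intros; now apply CI_deriv.
Qed.

Lemma CI_Chasles f a b c : rcont f -> (CI f a b + CI f b c)%C = CI f a c.
Proof.
  intros Hc. assert (E := CI_antideriv f (fun t => CI f a t) b c Hc (fun x => CI_deriv f a x Hc)).
  rewrite E; ring.
Qed.

Lemma CI_plus f g a b : rcont f -> rcont g -> CI (fun x => f x + g x)%C a b = (CI f a b + CI g a b)%C.
Proof.
  intros Hf Hg. rewrite (CI_antideriv _ (fun t => CI f a t + CI g a t)%C).
  - rewrite !CI_point; ring.
  - intros x; split; simpl; apply (continuous_plus (V := R_NormedModule)); (apply Hf || apply Hg).
  - intros x; apply cderiv_plus; now apply CI_deriv.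
Qed.

Lemma rcont_line g (u v : C) : (forall z, ccont g z) -> rcont (fun t => g (u + RtoC t * v)%C).
Proof.
  intros Hg x.
  assert (H : forall eps, 0 < eps -> exists d, 0 < d /\ forall t, Rabs (t - x) < d ->
     Cmod (g (u + RtoC t * v) - g (u + RtoC x * v))%C < eps).
  { intros eps He. destruct (Hg (u + RtoC x * v)%C eps He) as [d [Hd H]].
    pose proof (Cmod_ge_0 v). exists (d / (Cmod v + 1)); split; [apply Rdiv_lt_0_compat; lra|].
    intros t Ht. apply H.
    replace (u + RtoC t * v - (u + RtoC x * v))%C with (RtoC (t - x) * v)%C by (rewrite RtoC_minus; ring).
    rewrite Cmod_mult, Cmod_R. apply Rmult_lt_compat_r with (r := Cmod v + 1) in Ht; [|lra].
    replace (d / (Cmod v + 1) * (Cmod v + 1)) with d in Ht by (field; lra).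
    pose proof (Rabs_pos (t - x)). nra. }
  split; apply continuity_pt_filterlim; intros eps He; destruct (H eps He) as [d [Hd H1]];
    exists d; (split; [assumption|]); intros t [_ Ht]; simpl; unfold R_dist in *;
    specialize (H1 t Ht); (eapply Rle_lt_trans; [|exact H1]).
  - replace (Re (g (u + RtoC t * v)%C) - Re (g (u + RtoC x * v)%C))
      with (Re (g (u + RtoC t * v) - g (u + RtoC x * v))%C) by reflexivity. apply re_le_Cmod.
  - replace (Im (g (u + RtoC t * v)%C) - Im (g (u + RtoC x * v)%C))
      with (Im (g (u + RtoC t * v) - g (u + RtoC x * v))%C) by reflexivity. apply Im_le_Cmod.
Qed.

(** Both kinds of segment are written as u + t v, including the factor 1, so that [rcont_line] and
    [CI_affine] apply as they stand. *)
Definition hline (g : C -> C) (a b y : R) : C := CI (fun x => g (Ci * RtoC y + RtoC x * RtoC 1)%C) a b.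
Definition vline (g : C -> C) (x c d : R) : C := CI (fun y => g (RtoC x + RtoC y * Ci)%C) c d.
(** The counterclockwise boundary integral of the rectangle with lower left corner (a, c), width w
    and height h. The factor [Ci] is dz/dy on the vertical sides. *)
Definition rectI (g : C -> C) (a c w h : R) : C :=
  (hline g a (a + w) c - hline g a (a + w) (c + h)
   + Ci * (vline g (a + w) c (c + h) - vline g a c (c + h)))%C.

Lemma rectI_split g a c w h : (forall z, ccont g z) ->
  rectI g a c w h =
  (rectI g a c (w / 2) (h / 2) + rectI g (a + w / 2) c (w / 2) (h / 2)
   + rectI g a (c + h / 2) (w / 2) (h / 2) + rectI g (a + w / 2) (c + h / 2) (w / 2) (h / 2))%C.
Proof.
  intros Hg. unfold rectI.
  replace (a + w / 2 + w / 2) with (a + w) by field. replace (c + h / 2 + h / 2) with (c + h) by field.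
  assert (Hh : forall y, (hline g a (a + w) y = hline g a (a + w / 2) y + hline g (a + w / 2) (a + w) y)%C)
    by (intros; unfold hline; rewrite CI_Chasles; [reflexivity|now apply rcont_line]).
  assert (Hv : forall x, (vline g x c (c + h) = vline g x c (c + h / 2) + vline g x (c + h / 2) (c + h))%C)
    by (intros; unfold vline; rewrite CI_Chasles; [reflexivity|now apply rcont_line]).
  rewrite !Hh, !Hv. ring.
Qed.

Lemma rectI_plus f g a c w h : (forall z, ccont f z) -> (forall z, ccont g z) ->
  rectI (fun z => f z + g z)%C a c w h = (rectI f a c w h + rectI g a c w h)%C.
Proof.
  intros Hf Hg; unfold rectI, hline, vline.
  rewrite !CI_plus; try (now apply rcont_line). ring.
Qed.

Lemma ccont_affine al be z : ccont (fun z => al + be * z)%C z.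
Proof. apply ccont_plus; [apply ccont_const|apply ccont_mult; [apply ccont_const|apply ccont_id]]. Qed.

Lemma CI_affine al be (u v : C) a b :
  (v * CI (fun t => al + be * (u + RtoC t * v)) a b
   = (al * (u + RtoC b * v) + be / RtoC 2 * ((u + RtoC b * v) * (u + RtoC b * v)))
     - (al * (u + RtoC a * v) + be / RtoC 2 * ((u + RtoC a * v) * (u + RtoC a * v))))%C.
Proof.
  set (p := fun t => (u + RtoC t * v)%C).
  rewrite (CI_antideriv _ (fun t => al * RtoC t + be * (u * RtoC t + v / RtoC 2 * (RtoC t * RtoC t)))%C).
  - unfold p. field.
  - apply (rcont_line (fun z => al + be * z)%C). intros; apply ccont_affine.
  - intros x. eapply cderiv_ext; [reflexivity| |].
    2:{ apply cderiv_plus; apply cderiv_scal; [apply cderiv_RtoC, is_derive_Rid|].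
        apply cderiv_plus; apply cderiv_scal; [apply cderiv_RtoC, is_derive_Rid|].
        apply cderiv_mult; apply cderiv_RtoC, is_derive_Rid. }
    cbv beta; field.
Qed.

Lemma rectI_affine al be a c w h : rectI (fun z => al + be * z)%C a c w h = RtoC 0.
Proof.
  unfold rectI, hline, vline.
  pose proof (CI_affine al be (Ci * RtoC c) (RtoC 1) a (a + w)) as E1.
  pose proof (CI_affine al be (Ci * RtoC (c + h)) (RtoC 1) a (a + w)) as E2.
  pose proof (CI_affine al be (RtoC (a + w)) Ci c (c + h)) as E3.
  pose proof (CI_affine al be (RtoC a) Ci c (c + h)) as E4.
  rewrite Cmult_1_l in E1, E2. rewrite E1, E2.
  assert (HC : forall X Y : C, (Ci * (X - Y) = Ci * X - Ci * Y)%C) by (intros; ring).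
  rewrite HC, E3, E4. rewrite !RtoC_plus. field.
Qed.

Lemma rectI_bound g a c w h B :
  (forall z, ccont g z) -> 0 <= w -> 0 <= h ->
  (forall x y, a <= x <= a + w -> c <= y <= c + h -> Cmod (g (x, y)) <= B) ->
  Cmod (rectI g a c w h) <= 2 * B * (w + h).
Proof.
  intros Hg Hw Hh HB. unfold rectI, hline, vline.
  assert (Hx : forall y, c <= y <= c + h ->
     Cmod (CI (fun x => g (Ci * RtoC y + RtoC x * RtoC 1)%C) a (a + w)) <= B * w).
  { intros y Hy. replace w with (a + w - a) at 2 by ring. apply CI_bound; [now apply rcont_line|lra|].
    intros x Hx. replace (Ci * RtoC y + RtoC x * RtoC 1)%C with ((x, y) : C); [auto|].
    apply C_ext; simpl; ring. }
  assert (Hy : forall x, a <= x <= a + w ->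
     Cmod (CI (fun y => g (RtoC x + RtoC y * Ci)%C) c (c + h)) <= B * h).
  { intros x Hx'. replace h with (c + h - c) at 2 by ring. apply CI_bound; [now apply rcont_line|lra|].
    intros y Hy. replace (RtoC x + RtoC y * Ci)%C with ((x, y) : C); [auto|].
    apply C_ext; simpl; ring. }
  pose proof (Hx c ltac:(lra)). pose proof (Hx (c + h) ltac:(lra)).
  pose proof (Hy a ltac:(lra)). pose proof (Hy (a + w) ltac:(lra)).
  eapply Rle_trans; [apply Cmod_triangle|]. rewrite Cmod_mult, Cmod_Ci, Rmult_1_l.
  unfold Cminus. eapply Rle_trans; [apply Rplus_le_compat; apply Cmod_triangle|].
  rewrite !Cmod_opp. lra.
Qed.

Lemma nested_point (a : nat -> R) w :
  0 <= w -> (forall n, a n <= a (S n) <= a n + w * (/ 2) ^ S n) ->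
  exists p, forall n, a n <= p <= a n + w * (/ 2) ^ n.
Proof.
  intros Hw Ha.
  assert (Hhalf : forall n, w * (/ 2) ^ n = w * (/ 2) ^ S n + w * (/ 2) ^ S n) by (intros; simpl; field).
  assert (Hp : forall n, 0 <= w * (/ 2) ^ n) by (intros; apply Rmult_le_pos; [assumption|apply pow_le; lra]).
  assert (Hup : forall n k, a n <= a (n + k)%nat <= a n + w * (/ 2) ^ n - w * (/ 2) ^ (n + k)).
  { intros n; induction k as [|k IH]; [rewrite Nat.add_0_r; lra|].
    rewrite Nat.add_succ_r. specialize (Ha (n + k)%nat). specialize (Hhalf (n + k)%nat). lra. }
  destruct (completeness (fun x => exists n, x = a n)) as [p [Hp1 Hp2]].
  - exists (a 0%nat + w). intros x [n ->]. specialize (Hup 0%nat n). specialize (Hp n). simpl in Hup. lra.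
  - exists (a 0%nat), 0%nat; reflexivity.
  - exists p. intros n; split; [apply Hp1; now exists n|].
    apply Hp2. intros x [m ->]. destruct (le_lt_dec n m).
    + specialize (Hup n (m - n)%nat). replace (n + (m - n))%nat with m in Hup by lia. specialize (Hp m). lra.
    + specialize (Hup m (n - m)%nat). replace (m + (n - m))%nat with n in Hup by lia. specialize (Hp n). lra.
Qed.

(** Quadrisection. At the limit point the affine part of g integrates to zero over every rectangle,
    and the rest is at most eps times the diameter, so the integral over the n-th rectangle is
    o(4^-n). *)
Theorem goursat g a c w h :
  (forall z, exists l, is_cd g z l) -> 0 < w -> 0 < h -> rectI g a c w h = RtoC 0.
Proof.
  intros Hd Hw Hh.
  assert (Hg : forall z, ccont g z) by (intros z; destruct (Hd z) as [l Hl]; now apply is_cd_cont in Hl).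
  set (e0 := Cmod (rectI g a c w h)).
  set (big := fun n (p : R * R) => e0 * (/ 4) ^ n <= Cmod (rectI g (fst p) (snd p) (w * (/ 2) ^ n) (h * (/ 2) ^ n))).
  set (sub := fun n (p r : R * R) =>
     (fst r = fst p \/ fst r = fst p + w * (/ 2) ^ S n) /\ (snd r = snd p \/ snd r = snd p + h * (/ 2) ^ S n)).
  assert (Hstep : forall n p, big n p -> exists r, big (S n) r /\ sub n p r).
  { intros n [x y] Hb. apply NNPP; intros N.
    assert (Hq : forall r, sub n (x, y) r ->
       Cmod (rectI g (fst r) (snd r) (w * (/ 2) ^ S n) (h * (/ 2) ^ S n)) < e0 * (/ 4) ^ S n).
    { intros r Hr. apply Rnot_le_lt; intros Hle. apply N. exists r; split; assumption. }
    unfold big in Hb; simpl fst in Hb; simpl snd in Hb.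
    rewrite rectI_split in Hb by assumption.
    replace (w * (/ 2) ^ n / 2) with (w * (/ 2) ^ S n) in Hb by (simpl; field).
    replace (h * (/ 2) ^ n / 2) with (h * (/ 2) ^ S n) in Hb by (simpl; field).
    pose proof (Hq (x, y) ltac:(unfold sub; simpl; auto)) as H1.
    pose proof (Hq (x + w * (/ 2) ^ S n, y) ltac:(unfold sub; simpl; auto)) as H2.
    pose proof (Hq (x, y + h * (/ 2) ^ S n) ltac:(unfold sub; simpl; auto)) as H3.
    pose proof (Hq (x + w * (/ 2) ^ S n, y + h * (/ 2) ^ S n) ltac:(unfold sub; simpl; auto)) as H4.
    cbn [fst snd] in H1, H2, H3, H4.
    assert (E : e0 * (/ 4) ^ n = 4 * (e0 * (/ 4) ^ S n)) by (simpl; field).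
    rewrite E in Hb.
    match goal with Hb : _ <= Cmod (?A + ?B + ?D + ?F)%C |- _ =>
      pose proof (Cmod_triangle (A + B + D)%C F); pose proof (Cmod_triangle (A + B)%C D);
      pose proof (Cmod_triangle A B) end. lra. }
  set (next := fun n p => epsilon (inhabits (0, 0)) (fun r : R * R => big (S n) r /\ sub n p r)).
  set (seqp := fix sp n := match n with O => (a, c) | S n => next n (sp n) end).
  assert (Hbig : forall n, big n (seqp n)).
  { induction n as [|n IH]; [unfold big; simpl; rewrite !Rmult_1_r; unfold e0; lra|].
    simpl. exact (proj1 (epsilon_spec (inhabits (0, 0)) _ (Hstep n _ IH))). }
  assert (Hsub : forall n, sub n (seqp n) (seqp (S n))).
  { intros n. exact (proj2 (epsilon_spec (inhabits (0, 0)) _ (Hstep n _ (Hbig n)))). }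
  assert (Hpos : forall x n, 0 < x -> 0 < x * (/ 2) ^ n) by (intros; apply Rmult_lt_0_compat; [assumption|apply pow_lt; lra]).
  destruct (nested_point (fun n => fst (seqp n)) w) as [px Hpx]; [lra| |].
  { intros n. specialize (Hpos w (S n) Hw). destruct (Hsub n) as [[E|E] _]; rewrite E; lra. }
  destruct (nested_point (fun n => snd (seqp n)) h) as [py Hpy]; [lra| |].
  { intros n. specialize (Hpos h (S n) Hh). destruct (Hsub n) as [_ [E|E]]; rewrite E; lra. }
  set (z0 := (px, py) : C). destruct (Hd z0) as [l Hl].
  apply Cmod_eq_0. fold e0. apply Rle_antisym; [|apply Cmod_ge_0].
  apply Rnot_lt_le; intros Hpe.
  (* The bound obtained on the N-th rectangle is then e0/2 times 4^-N, half of what the selection of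
     the rectangles guarantees. *)
  set (eps := e0 / (4 * (w + h) * (w + h))).
  assert (Heps : 0 < eps) by (apply Rdiv_lt_0_compat; [assumption|apply Rmult_lt_0_compat; lra]).
  destruct (Hl eps Heps) as [d [Hd0 Hd1]].
  destruct (pow_lt_1_zero (/ 2)) with (y := d / (w + h)) as [N HN];
    [rewrite Rabs_pos_eq; lra|apply Rdiv_lt_0_compat; lra|].
  specialize (HN N (Nat.le_refl N)). rewrite Rabs_pos_eq in HN by (apply pow_le; lra).
  set (t := (/ 2) ^ N) in *. assert (Ht : 0 < t) by (apply pow_lt; lra).
  assert (Hsm : (w + h) * t < d).
  { apply Rmult_lt_compat_l with (r := w + h) in HN; [|lra].
    replace ((w + h) * (d / (w + h))) with d in HN by (field; lra). lra. }
  specialize (Hpx N). specialize (Hpy N). specialize (Hbig N). unfold big in Hbig. cbv beta in Hpx, Hpy. fold t in Hpx, Hpy, Hbig.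
  set (x0 := fst (seqp N)) in *. set (y0 := snd (seqp N)) in *.
  assert (Erec : rectI g x0 y0 (w * t) (h * t)
     = rectI (fun z => g z + ((- g z0 + l * z0) + (- l) * z))%C x0 y0 (w * t) (h * t)).
  { rewrite rectI_plus, rectI_affine by (auto; intros; apply ccont_affine). ring. }
  assert (Hb2 : Cmod (rectI g x0 y0 (w * t) (h * t)) <= 2 * (eps * ((w + h) * t)) * (w * t + h * t)).
  { rewrite Erec. apply rectI_bound.
    - intros z; apply ccont_plus; [apply Hg|apply ccont_affine].
    - left; now apply Rmult_lt_0_compat.
    - left; now apply Rmult_lt_0_compat.
    - intros x y Hx Hy. set (z := (x, y) : C).
      assert (Hz : Cmod (z - z0) <= (w + h) * t).
      { eapply Rle_trans; [apply Cmod_le_sum|].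
        change (Re (z - z0)) with (x - px). change (Im (z - z0)) with (y - py).
        assert (Rabs (x - px) <= w * t) by (apply Rabs_le; lra).
        assert (Rabs (y - py) <= h * t) by (apply Rabs_le; lra). lra. }
      replace (g z + (- g z0 + l * z0 + - l * z))%C with (g z - g z0 - l * (z - z0))%C by ring.
      eapply Rle_trans; [apply Hd1; lra|]. apply Rmult_le_compat_l; lra. }
  assert (E4 : (/ 4) ^ N = t * t).
  { unfold t. rewrite <- Rpow_mult_distr. f_equal; field. }
  rewrite E4 in Hbig.
  assert (Efin : 2 * (eps * ((w + h) * t)) * (w * t + h * t) = e0 / 2 * (t * t)) by (unfold eps; field; lra).
  rewrite Efin in Hb2. assert (0 < t * t) by (now apply Rmult_lt_0_compat). nra.
Qed.

(* Circles around 0 become vertical segments in the coordinate [exp w]. *)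
Lemma compact_support_0 f r :
  (forall z, exists l, is_cd f z l) -> 0 < r -> (forall z, r <= Cmod z -> f z = RtoC 0) -> f (RtoC 0) = RtoC 0.
Proof.
  intros Hd Hr Hf.
  set (g := fun z => f (Cexp z)).
  assert (Hgd : forall z, exists l, is_cd g z l).
  { intros z. destruct (Hd (Cexp z)) as [l Hl]. exists (l * Cexp z)%C. exact (is_cd_comp Cexp f z _ _ (is_cd_Cexp z) Hl). }
  assert (Hg : forall z, ccont g z) by (intros z; destruct (Hgd z) as [l Hl]; now apply is_cd_cont in Hl).
  apply Cmod_eq_0, Rle_antisym; [|apply Cmod_ge_0]. apply Rnot_lt_le; intros Hpos.
  set (e := Cmod (f (RtoC 0))) in *.
  destruct (Hd (RtoC 0)) as [l0 Hl0]. destruct (is_cd_cont _ _ _ Hl0 (e / 2)) as [d [Hd0 Hd1]]; [lra|].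
  (* The vertical segment over r2 maps to the circle of radius r, where f vanishes. The one over r1
     maps to a circle on which f is within e/2 of its value at 0. *)
  set (r2 := ln r). set (r1 := Rmin (r2 - 1) (ln (d / 2))).
  assert (H12 : r1 < r2) by (unfold r1; pose proof (Rmin_l (r2 - 1) (ln (d / 2))); lra).
  assert (Hr1 : exp r1 < d).
  { apply Rle_lt_trans with (exp (ln (d / 2))); [apply exp_le, Rmin_r|]. rewrite exp_ln; lra. }
  assert (HPI := PI_RGT_0).
  pose proof (goursat g r1 0 (r2 - r1) (2 * PI) Hgd ltac:(lra) ltac:(lra)) as G.
  unfold rectI in G. replace (r1 + (r2 - r1)) with r2 in G by ring.
  (* The horizontal sides cancel by the period of the exponential. So the integral along the left
     side equals the one along the right side, which is 0, although it must be close to 2 pi times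
     the value of f at 0. *)
  assert (Eh : hline g r1 r2 0 = hline g r1 r2 (0 + 2 * PI)).
  { unfold hline. f_equal. apply functional_extensionality; intros x. unfold g. f_equal.
    replace (Ci * RtoC (0 + 2 * PI) + RtoC x * RtoC 1)%C
      with ((Ci * RtoC 0 + RtoC x * RtoC 1) + Ci * RtoC (2 * PI))%C by (rewrite (RtoC_plus 0 (2 * PI)); generalize (RtoC (2 * PI)); intros; ring).
    rewrite (Cexp_plus (Ci * RtoC 0 + RtoC x * RtoC 1)). replace (Cexp (Ci * RtoC (2 * PI))) with (RtoC 1); [ring|].
    apply C_ext; unfold Cexp; simpl.
    - replace (0 * (2 * PI) - 1 * 0) with 0 by ring. replace (0 * 0 + 1 * (2 * PI)) with (2 * PI) by ring.
      rewrite exp_0, cos_2PI; ring.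
    - replace (0 * (2 * PI) - 1 * 0) with 0 by ring. replace (0 * 0 + 1 * (2 * PI)) with (2 * PI) by ring.
      rewrite exp_0, sin_2PI; ring. }
  rewrite Eh in G.
  assert (E2 : vline g r2 0 (0 + 2 * PI) = RtoC 0).
  { apply Cmod_eq_0, Rle_antisym; [|apply Cmod_ge_0].
    apply Rle_trans with (0 * (0 + 2 * PI - 0)); [|lra].
    apply CI_bound; [now apply rcont_line|lra|]. intros y _. unfold g. rewrite Hf, Cmod_0; [lra|].
    rewrite Cmod_Cexp. simpl. replace (r2 + (y * 0 - 0 * 1)) with r2 by ring. unfold r2; rewrite exp_ln; lra. }
  rewrite E2 in G.
  assert (E1 : vline g r1 0 (0 + 2 * PI) = RtoC 0).
  { replace (vline g r1 0 (0 + 2 * PI)) with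
      (Ci * (hline g r1 r2 (0 + 2 * PI) - hline g r1 r2 (0 + 2 * PI) + Ci * (RtoC 0 - vline g r1 0 (0 + 2 * PI))))%C.
    - rewrite G; ring.
    - apply C_ext; simpl; ring. }
  assert (B : Cmod (vline (fun z => g z + (- f (RtoC 0)))%C r1 0 (0 + 2 * PI)) <= e / 2 * (0 + 2 * PI - 0)).
  { apply CI_bound; [|lra|].
    - apply (rcont_line (fun z => g z + (- f (RtoC 0)))%C). intros; apply ccont_plus; [apply Hg|apply ccont_const].
    - intros y _. left. unfold g. apply Hd1.
      replace (Cexp (RtoC r1 + RtoC y * Ci) - RtoC 0)%C with (Cexp (RtoC r1 + RtoC y * Ci)) by ring.
      rewrite Cmod_Cexp. simpl. replace (r1 + (y * 0 - 0 * 1)) with r1 by ring. assumption. }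
  unfold vline in B, E1. rewrite CI_plus, E1 in B.
  - rewrite (CI_antideriv (fun _ => - f (RtoC 0))%C (fun t => - f (RtoC 0) * RtoC t)%C) in B.
    + replace (RtoC 0 + (- f (RtoC 0) * RtoC (0 + 2 * PI) - - f (RtoC 0) * RtoC 0))%C
        with (- (f (RtoC 0) * RtoC (2 * PI)))%C in B by (rewrite RtoC_plus; ring).
      rewrite Cmod_opp, Cmod_mult, Cmod_RtoC_nonneg in B by lra. fold e in B. nra.
    + intros x; split; apply continuous_const.
    + intros x. eapply cderiv_ext; [reflexivity| |apply cderiv_scal, cderiv_RtoC, is_derive_Rid]. ring.
  - now apply rcont_line.
  - intros x; split; apply continuous_const.
Qed.

(* The product of [F] over the four rotations of [w] about [c] vanishes for large
   [w], because one of the four points lies in the half plane. *)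
Theorem entire_identity F G :
  (forall z, holomorphic_at F z) -> (forall z, holomorphic_at G z) ->
  (forall s, 1 < Re s -> F s = G s) -> forall s, F s = G s.
Proof.
  intros HF HG HE c.
  set (D := fun z => (F z + - RtoC 1 * G z)%C).
  assert (HD : forall z, exists l, is_cd D z l).
  { intros z. destruct (proj1 (holomorphic_iff _ _) (HF z)) as [l Hl], (proj1 (holomorphic_iff _ _) (HG z)) as [m Hm].
    eexists. apply is_cd_plus; [exact Hl|]. apply is_cd_mult; [apply is_cd_const|exact Hm]. }
  assert (H0 : forall s, 1 < Re s -> D s = RtoC 0) by (intros s Hs; unfold D; rewrite HE by assumption; ring).
  set (P := fun w => ((D (c + RtoC 1 * w) * D (c + Ci * w)) * (D (c + - RtoC 1 * w) * D (c + - Ci * w)))%C).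
  assert (Hrot : forall u z, exists l, is_cd (fun w => D (c + u * w)%C) z l).
  { intros u z. destruct (HD (c + u * z)%C) as [l Hl]. eexists.
    apply (is_cd_comp (fun w => c + u * w)%C D); [|exact Hl].
    apply is_cd_plus; [apply is_cd_const|]. apply is_cd_mult; [apply is_cd_const|apply is_cd_id]. }
  assert (HP : P (RtoC 0) = RtoC 0).
  (* From this radius on, the larger of |Re z| and |Im z| is at least |Re c| + 2, so one of the four
     rotated points has real part at least 2. *)
  { apply compact_support_0 with (r := 2 * (Rabs (Re c) + 2)).
    - intros z. destruct (Hrot (RtoC 1) z) as [l1 H1], (Hrot Ci z) as [l2 H2],
        (Hrot (- RtoC 1)%C z) as [l3 H3], (Hrot (- Ci)%C z) as [l4 H4].
      eexists. apply is_cd_mult; apply is_cd_mult; eassumption.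
    - pose proof (Rabs_pos (Re c)); lra.
    - intros z Hz. pose proof (Cmod_le_sum z) as Hs. pose proof (Rle_abs (- Re c)) as Ha. rewrite Rabs_Ropp in Ha.
      unfold P.
      destruct (Rle_dec (Rabs (Im z)) (Rabs (Re z))).
      + unfold Rabs in *. destruct (Rcase_abs (Re z)).
        * rewrite (H0 (c + - RtoC 1 * z)%C); [ring|].
          simpl; unfold Re, Im in *; lra.
        * rewrite (H0 (c + RtoC 1 * z)%C); [ring|].
          simpl; unfold Re, Im in *; lra.
      + unfold Rabs in *. destruct (Rcase_abs (Im z)).
        * rewrite (H0 (c + Ci * z)%C); [ring|].
          simpl; unfold Re, Im in *; lra.
        * rewrite (H0 (c + - Ci * z)%C); [ring|].
          simpl; unfold Re, Im in *; lra. }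
  unfold P in HP. rewrite !Cmult_0_r, !Cplus_0_r in HP.
  assert (HDc : D c = RtoC 0).
  { apply NNPP; intros N. revert HP. repeat apply Cmult_neq_0; assumption. }
  unfold D in HDc. replace (F c) with (F c + - RtoC 1 * G c + G c)%C by ring. rewrite HDc; ring.
Qed.

(** * Series of complex numbers and power sums *)

(** Genuine convergence, of the sums of the first N terms. [CSeries] assigns a value to every
    sequence, and [cser_CSeries] says when it is the limit. *)
Definition cser (a : nat -> C) (l : C) : Prop :=
  forall eps, 0 < eps -> exists N0, forall N, (N0 <= N)%nat -> Cmod (csum (seq 0 N) a - l) < eps.

Lemma sum_n_rsum a N : sum_n a N = rsum (seq 0 (S N)) a.
Proof.
  induction N as [|N IH]; [rewrite sum_O; symmetry; apply Rplus_0_r|].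
  rewrite sum_Sn, IH, (rsum_seq_S a 0 (S N)). reflexivity.
Qed.

Lemma Im_csum {A} (l : list A) f : Im (csum l f) = rsum l (fun a => Im (f a)).
Proof. induction l as [|a l IH]; [reflexivity|]; rewrite csum_cons, rsum_cons, <- IH; reflexivity. Qed.

Lemma is_series_rsum a l :
  (forall eps, 0 < eps -> exists N0, forall N, (N0 <= N)%nat -> Rabs (rsum (seq 0 N) a - l) < eps) ->
  is_series a l.
Proof.
  intros H. apply (is_lim_seq_spec _ l). intros eps.
  destruct (H eps (cond_pos eps)) as [N0 HN]. exists N0; intros n Hn.
  rewrite sum_n_rsum. apply HN; lia.
Qed.

Lemma cser_CSeries a l : cser a l -> CSeries a = l.
Proof.
  intros H; apply C_ext; simpl.
  - apply is_series_unique, is_series_rsum. intros eps He. destruct (H eps He) as [N0 HN]; exists N0; intros N HN'.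
    eapply Rle_lt_trans; [|apply (HN N HN')].
    rewrite <- Re_csum. apply (re_le_Cmod (csum (seq 0 N) a - l)).
  - apply is_series_unique, is_series_rsum. intros eps He. destruct (H eps He) as [N0 HN]; exists N0; intros N HN'.
    eapply Rle_lt_trans; [|apply (HN N HN')].
    rewrite <- Im_csum. apply (Im_le_Cmod (csum (seq 0 N) a - l)).
Qed.

Lemma is_series_rsum_inv a l : is_series a l ->
  forall eps, 0 < eps -> exists N0, forall N, (N0 <= N)%nat -> Rabs (rsum (seq 0 N) a - l) < eps.
Proof.
  intros H eps He. destruct (proj2 (is_lim_seq_spec _ l) H (mkposreal eps He)) as [N0 HN].
  exists (S N0); intros N HN'. destruct N as [|N]; [lia|].
  rewrite <- sum_n_rsum. apply HN; lia.
Qed.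

Lemma ex_series_bounded b B :
  (forall n, 0 <= b n) -> (forall N, rsum (seq 0 N) b <= B) -> ex_series b.
Proof.
  intros Hb HB.
  destruct (ex_finite_lim_seq_incr (sum_n b) B) as [l Hl].
  - intros n. rewrite sum_Sn. specialize (Hb (S n)). unfold plus; simpl. lra.
  - intros n. rewrite sum_n_rsum. apply HB.
  - exists l. exact Hl.
Qed.

Lemma cser_ex a (b : nat -> R) B :
  (forall n, Cmod (a n) <= b n) -> (forall N, rsum (seq 0 N) b <= B) -> exists l, cser a l.
Proof.
  intros Ha HB.
  assert (Hb : ex_series b) by (apply (ex_series_bounded b B); [intros n; pose proof (Cmod_ge_0 (a n)); specialize (Ha n); lra|assumption]).
  assert (HR : ex_series (fun n => Re (a n))).
  { apply (ex_series_le (V := R_CompleteNormedModule) _ b); [|assumption]. intros n.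
    eapply Rle_trans; [apply re_le_Cmod|apply Ha]. }
  assert (HI : ex_series (fun n => Im (a n))).
  { apply (ex_series_le (V := R_CompleteNormedModule) _ b); [|assumption]. intros n.
    eapply Rle_trans; [apply Im_le_Cmod|apply Ha]. }
  destruct HR as [x Hx], HI as [y Hy]. exists (x, y).
  intros eps He.
  destruct (is_series_rsum_inv _ _ Hx (eps / 2)) as [N1 H1]; [lra|].
  destruct (is_series_rsum_inv _ _ Hy (eps / 2)) as [N2 H2]; [lra|].
  exists (N1 + N2)%nat; intros N HN.
  specialize (H1 N ltac:(lia)). specialize (H2 N ltac:(lia)). rewrite <- Re_csum in H1. rewrite <- Im_csum in H2.
  eapply Rle_lt_trans; [apply Cmod_le_sum|].
  change (Re (csum (seq 0 N) a - (x, y))) with (Re (csum (seq 0 N) a) - x).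
  change (Im (csum (seq 0 N) a - (x, y))) with (Im (csum (seq 0 N) a) - y). lra.
Qed.

Lemma cser_tail a l N T :
  cser a l -> (forall M, Cmod (csum (seq N M) a) <= T) -> Cmod (l - csum (seq 0 N) a) <= T.
Proof.
  intros H HT. apply Rnot_lt_le; intros Hlt.
  destruct (H (Cmod (l - csum (seq 0 N) a) - T)) as [N0 HN]; [lra|].
  specialize (HN (N + N0)%nat ltac:(lia)). rewrite csum_seq_add in HN.
  specialize (HT N0). simpl in HN.
  replace (csum (seq 0 N) a + csum (seq N N0) a - l)%C with (- ((l - csum (seq 0 N) a) - csum (seq N N0) a))%C in HN by ring.
  rewrite Cmod_opp in HN.
  pose proof (Cmod_triangle_inv (l - csum (seq 0 N) a) (csum (seq N N0) a)). lra.
Qed.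

Lemma cser_bound a l T : cser a l -> (forall M, Cmod (csum (seq 0 M) a) <= T) -> Cmod l <= T.
Proof.
  intros H HT. pose proof (cser_tail a l 0 T H HT) as B. unfold csum at 1 in B; simpl in B.
  now replace (l - RtoC 0)%C with l in B by ring.
Qed.

Lemma cser_plus a b l m : cser a l -> cser b m -> cser (fun n => a n + b n)%C (l + m)%C.
Proof.
  intros H1 H2 eps He. destruct (H1 (eps / 2)) as [N1 K1]; [lra|]. destruct (H2 (eps / 2)) as [N2 K2]; [lra|].
  exists (N1 + N2)%nat; intros N HN. specialize (K1 N ltac:(lia)). specialize (K2 N ltac:(lia)).
  rewrite csum_plus.
  replace (csum (seq 0 N) a + csum (seq 0 N) b - (l + m))%C
    with ((csum (seq 0 N) a - l) + (csum (seq 0 N) b - m))%C by ring.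
  eapply Rle_lt_trans; [apply Cmod_triangle|]. lra.
Qed.

Lemma cser_scal c a l : cser a l -> cser (fun n => c * a n)%C (c * l)%C.
Proof.
  intros H eps He. pose proof (Cmod_ge_0 c).
  destruct (H (eps / (Cmod c + 1))) as [N0 K]; [apply Rdiv_lt_0_compat; lra|].
  exists N0; intros N HN. specialize (K N HN). rewrite csum_scal.
  replace (c * csum (seq 0 N) a - c * l)%C with (c * (csum (seq 0 N) a - l))%C by ring.
  rewrite Cmod_mult. apply Rmult_lt_compat_l with (r := Cmod c + 1) in K; [|lra].
  replace ((Cmod c + 1) * (eps / (Cmod c + 1))) with eps in K by (field; lra).
  pose proof (Cmod_ge_0 (csum (seq 0 N) a - l)). nra.
Qed.

Lemma cser_ext a b l : (forall n, a n = b n) -> cser a l -> cser b l.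
Proof.
  intros E H eps He. destruct (H eps He) as [N0 K]; exists N0; intros N HN.
  rewrite <- (csum_ext _ a b) by auto. now apply K.
Qed.

(* Mean value theorem for [x^{1-p}]. *)
Lemma power_term_le p n : 1 < p -> (1 <= n)%nat ->
  Rpower (INR (S n)) (- p) <= (Rpower (INR n) (1 - p) - Rpower (INR (S n)) (1 - p)) / (p - 1).
Proof.
  intros Hp Hn. assert (H1 : 1 <= INR n) by (apply (le_INR 1); lia).
  rewrite S_INR.
  destruct (MVT_cor2 (fun x => Rpower x (1 - p)) (fun x => (1 - p) * Rpower x (1 - p - 1)) (INR n) (INR n + 1))
    as [c [Hc1 Hc2]]; [lra| |].
  - intros c Hc. apply derivable_pt_lim_power; lra.
  - replace (INR n + 1 - INR n) with 1 in Hc1 by ring.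
    replace (1 - p - 1) with (- p) in Hc1 by ring.
    replace (Rpower (INR n) (1 - p) - Rpower (INR n + 1) (1 - p)) with ((p - 1) * Rpower c (- p)) by lra.
    replace ((p - 1) * Rpower c (- p) / (p - 1)) with (Rpower c (- p)) by (field; lra).
    rewrite !Rpower_Ropp. apply Rinv_le_contravar; [apply exp_pos|].
    unfold Rpower. apply exp_le. apply Rmult_le_compat_l; [lra|]. apply ln_le; lra.
Qed.

Lemma power_sum_tail p N M : 1 < p -> (1 <= N)%nat ->
  rsum (seq (S N) M) (fun n => Rpower (INR n) (- p)) <= Rpower (INR N) (1 - p) / (p - 1).
Proof.
  intros Hp HN.
  assert (H : rsum (seq (S N) M) (fun n => Rpower (INR n) (- p))
              <= (Rpower (INR N) (1 - p) - Rpower (INR (N + M)) (1 - p)) / (p - 1)).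
  { induction M as [|M IH].
    - rewrite Nat.add_0_r. unfold rsum; simpl. apply Req_le; field; lra.
    - rewrite rsum_seq_S. eapply Rle_trans; [apply Rplus_le_compat; [exact IH|apply (power_term_le p (N + M) Hp); lia]|].
      rewrite Nat.add_succ_r. apply Req_le; field; lra. }
  eapply Rle_trans; [exact H|]. apply Rmult_le_compat_r; [left; apply Rinv_0_lt_compat; lra|].
  assert (0 < Rpower (INR (N + M)) (1 - p)) by apply exp_pos. lra.
Qed.

Lemma power_sum_le p M : 1 < p -> rsum (seq 1 M) (fun n => Rpower (INR n) (- p)) <= p / (p - 1).
Proof.
  intros Hp. destruct M as [|M].
  - unfold rsum; simpl. apply Rmult_le_pos; [lra|left; apply Rinv_0_lt_compat; lra].
  - change (seq 1 (S M)) with (1%nat :: seq 2 M). rewrite rsum_cons.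
    pose proof (power_sum_tail p 1 M Hp (Nat.le_refl _)) as H.
    change (INR 1) with 1 in *.
    assert (E1 : forall x, Rpower 1 x = 1) by (intros; unfold Rpower; rewrite ln_1, Rmult_0_r; apply exp_0).
    rewrite !E1 in *. eapply Rle_trans; [apply Rplus_le_compat_l, H|]. apply Req_le; field; lra.
Qed.

(** * Continuation of the Dirichlet series of a nonprincipal character *)

Definition nper (D : nat) (a : nat -> C) : Prop :=
  (0 < D)%nat /\ (forall n, a (n + D)%nat = a n) /\ csum (seq 0 D) a = RtoC 0.

(** The summatory function minus its mean over a period. With the mean removed it is again periodic
    of mean zero, so that summation by parts can be repeated. *)
Definition anti (D : nat) (a : nat -> C) (n : nat) : C :=
  (csum (seq 0 n) a - csum (seq 0 D) (fun m => csum (seq 0 m) a) / RtoC (INR D))%C.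

Lemma anti_S D a n : (anti D a (S n) - anti D a n)%C = a n.
Proof. unfold anti; rewrite csum_seq_S; simpl; ring. Qed.

Lemma nper_window D a n : nper D a -> csum (seq n D) a = RtoC 0.
Proof.
  intros [H0 [HD HM]]. induction n as [|n IH]; [assumption|].
  assert (E : (csum (seq n 1) a + csum (seq (n + 1) D) a)%C = (csum (seq n D) a + csum (seq (n + D) 1) a)%C).
  { rewrite <- !csum_seq_add, (Nat.add_comm 1 D). reflexivity. }
  unfold csum at 1 4 in E; simpl in E. rewrite HD, IH in E.
  replace (S n) with (n + 1)%nat by lia.
  replace (csum (seq (n + 1) D) a) with (a n + RtoC 0 + csum (seq (n + 1) D) a - a n)%C by ring.
  rewrite E; ring.
Qed.

Lemma anti_nper D a : nper D a -> nper D (fun n => anti D a (S n)).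
Proof.
  intros H. destruct H as [H0 [HD HM]] eqn:E; clear E.
  assert (HP : forall n, anti D a (n + D)%nat = anti D a n).
  { intros n; unfold anti. rewrite csum_seq_add, (nper_window D a (0 + n) H). ring. }
  assert (HZ : csum (seq 0 D) (anti D a) = RtoC 0).
  { unfold anti. rewrite csum_minus, csum_const, length_seq. field.
    intros E; apply RtoC_inj in E. apply (not_0_INR D); [lia|exact E]. }
  split; [assumption|]; split; [intros n; apply (HP (S n))|].
  rewrite (csum_ext _ _ (fun n => anti D a (n + 1)%nat)) by (intros; f_equal; lia).
  rewrite <- csum_seq_shift.
  assert (E : (csum (seq 0 1) (anti D a) + csum (seq (0 + 1) D) (anti D a))%C
            = (csum (seq 0 D) (anti D a) + csum (seq (0 + D) 1) (anti D a))%C).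
  { rewrite <- !csum_seq_add, (Nat.add_comm 1 D). reflexivity. }
  rewrite HZ in E. unfold csum at 1 3 in E; cbn [seq map fold_right] in E.
  rewrite (HP 0%nat) in E.
  replace (csum (seq (0 + 1) D) (anti D a))
    with (anti D a 0 + RtoC 0 + csum (seq (0 + 1) D) (anti D a) - anti D a 0)%C by ring.
  rewrite E; ring.
Qed.

Lemma nper_bounded D a : nper D a -> exists B, 0 <= B /\ forall n, Cmod (a n) <= B.
Proof.
  intros [H0 [HD _]]. exists (rsum (seq 0 D) (fun n => Cmod (a n))).
  split; [apply rsum_ge0; intros; apply Cmod_ge_0|].
  intros n. induction n as [n IH] using lt_wf_ind.
  destruct (le_lt_dec D n) as [L|L].
  - replace n with (n - D + D)%nat by lia. rewrite HD. apply IH; lia.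
  - eapply Rle_trans with (rsum [n] (fun n => Cmod (a n))); [unfold rsum; simpl; lra|].
    apply rsum_incl; [repeat constructor; intros []| |intros; apply Cmod_ge_0].
    intros x [<-|[]]; apply in_seq; lia.
Qed.

Lemma abel (a phi A : nat -> C) Y N :
  (forall n, A (S n) - A n = a n)%C ->
  csum (seq Y N) (fun n => a n * phi n)%C
  = (A (Y + N)%nat * phi (Y + N)%nat - A Y * phi Y
     + csum (seq Y N) (fun n => A (S n) * (phi n - phi (S n))))%C.
Proof.
  intros HA. induction N as [|N IH].
  - rewrite Nat.add_0_r; unfold csum; simpl; ring.
  - rewrite !csum_seq_S, IH, <- HA, Nat.add_succ_r; ring.
Qed.

(** The shift to [S n] matches the factor [A (S n)] that summation by parts produces in [abel]. *)
Fixpoint aseq (D k : nat) (a : nat -> C) : nat -> C :=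
  match k with O => a | S k => fun n => anti D (aseq D k a) (S n) end.

Lemma aseq_nper D k a : nper D a -> nper D (aseq D k a).
Proof. intros H; induction k as [|k IH]; [assumption|]. simpl. now apply anti_nper. Qed.

Fixpoint nab (k : nat) (phi : R -> C) (x : R) : C :=
  match k with O => phi x | S k => (nab k phi x - nab k phi (x + 1))%C end.

Lemma nab_deriv k phi psi x :
  (forall x, 0 < x -> cderiv phi x (psi x)) -> 0 < x -> cderiv (nab k phi) x (nab k psi x).
Proof.
  intros H; revert x; induction k as [|k IH]; intros x Hx; [now apply H|]. simpl.
  apply cderiv_minus; [now apply IH|].
  assert (Hc : cderiv (nab k phi) (x + 1) (nab k psi (x + 1))) by (apply IH; lra).
  destruct Hc as [C1 C2].
  assert (Hi : is_derive (fun x : R => x + 1) x 1).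
  { apply (is_derive_eq _ _ (1 + 0)); [|apply Rplus_0_r].
    apply (is_derive_Rplus (fun x => x) (fun _ => 1) x 1 0); [apply is_derive_Rid|].
    apply is_derive_Reals, derivable_pt_lim_const. }
  split.
  - eapply is_derive_eq; [apply (is_derive_Rcomp (fun x => x + 1) (fun t => Re (nab k phi t)) _ _ _ Hi C1)|apply Rmult_1_r].
  - eapply is_derive_eq; [apply (is_derive_Rcomp (fun x => x + 1) (fun t => Im (nab k phi t)) _ _ _ Hi C2)|apply Rmult_1_r].
Qed.

(** [phi] lists a function and its successive derivatives. By the mean value inequality each
    difference over a unit step is paid by one derivative. *)
Lemma nab_bound k : forall (phi : nat -> R -> C) x0 B,
  (forall i x, 0 < x -> cderiv (phi i) x (phi (S i) x)) -> 0 < x0 ->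
  (forall x, x0 <= x -> Cmod (phi k x) <= B) -> Cmod (nab k (phi 0%nat) x0) <= B.
Proof.
  induction k as [|k IH]; intros phi x0 B Hd H0 HB; [apply HB; lra|].
  simpl. rewrite Cmod_minus_sym.
  replace B with (B * (x0 + 1 - x0)) by ring.
  apply cderiv_mvt with (df := nab k (phi 1%nat)); [lra| |].
  - intros t Ht. apply nab_deriv; [|lra]. intros; now apply Hd.
  - intros t Ht. apply (IH (fun i => phi (S i))); [intros; now apply Hd|lra|].
    intros x Hx. apply HB; lra.
Qed.

Lemma nab_lin k (f g : R -> C) c x :
  nab k (fun x => f x + c * g x)%C x = (nab k f x + c * nab k g x)%C.
Proof. revert x; induction k as [|k IH]; intros x; simpl; [reflexivity|]; rewrite !IH; ring. Qed.

Lemma nab_ext k (f g : R -> C) x : (forall x, f x = g x) -> nab k f x = nab k g x.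
Proof. intros E; revert x; induction k as [|k IH]; intros x; simpl; [apply E|]; now rewrite !IH. Qed.

(* [pcoef k s * x^{-s-k}] is the k-th derivative of [x^{-s}]; [pcoef'] is the
   derivative of [pcoef] in [s]. *)
Fixpoint pcoef (k : nat) (s : C) : C :=
  match k with O => RtoC 1 | S k => (- (s + RtoC (INR k)) * pcoef k s)%C end.

Fixpoint pcoef' (k : nat) (s : C) : C :=
  match k with
  | O => RtoC 0
  | S k => (- pcoef k s - (s + RtoC (INR k)) * pcoef' k s)%C
  end.

Definition ppow (k : nat) (s : C) (x : R) : C := (pcoef k s * cpow x (- (s + RtoC (INR k))))%C.

Definition ppow' (k : nat) (s : C) (x : R) : C :=
  ((pcoef' k s - pcoef k s * RtoC (ln x)) * cpow x (- (s + RtoC (INR k))))%C.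

Lemma ppow_deriv k s x : 0 < x -> cderiv (ppow k s) x (ppow (S k) s x).
Proof.
  intros Hx. unfold ppow. eapply cderiv_ext; [reflexivity| |apply cderiv_scal, cderiv_cpow, Hx].
  cbn [pcoef]. rewrite S_INR, RtoC_plus.
  replace (- (s + RtoC (INR k)) - RtoC 1)%C with (- (s + (RtoC (INR k) + RtoC 1)))%C by ring. ring.
Qed.

Lemma ppow'_deriv k s x : 0 < x -> cderiv (ppow' k s) x (ppow' (S k) s x).
Proof.
  intros Hx. unfold ppow'.
  eapply cderiv_ext; [reflexivity| |apply cderiv_mult; [|apply cderiv_cpow, Hx]].
  2:{ apply cderiv_minus; [apply cderiv_const|]. apply cderiv_scal, cderiv_RtoC, is_derive_Reals, derivable_pt_lim_ln, Hx. }
  cbn [pcoef pcoef']. rewrite S_INR, RtoC_plus.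
  replace (- (s + RtoC (INR k)) - RtoC 1)%C with (- (s + (RtoC (INR k) + RtoC 1)))%C by ring.
  set (w := (s + RtoC (INR k))%C).
  replace (s + (RtoC (INR k) + RtoC 1))%C with (w + RtoC 1)%C by (unfold w; ring).
  assert (E : cpow x (- w) = (RtoC x * cpow x (- (w + RtoC 1)))%C).
  { replace (- w)%C with (- (w + RtoC 1) + RtoC 1)%C by ring. rewrite cpow_plus.
    replace (cpow x (RtoC 1)) with (RtoC x); [ring|].
    unfold cpow. rewrite Cmult_1_l, Cexp_R, exp_ln by assumption. reflexivity. }
  rewrite E, RtoC_inv by lra. field. intros E0; apply RtoC_inj in E0; lra.
Qed.

Lemma pcoef_taylor k s : exists B, 0 <= B /\ forall h, Cmod h <= 1 ->
  Cmod (pcoef k (s + h) - pcoef k s - h * pcoef' k s) <= B * Cmod h ^ 2.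
Proof.
  induction k as [|k [B [HB IH]]].
  - exists 0; split; [lra|]. intros h _. simpl.
    replace (RtoC 1 - RtoC 1 - h * RtoC 0)%C with (RtoC 0) by ring. rewrite Cmod_0; lra.
  - set (w := (s + RtoC (INR k))%C). pose proof (Cmod_ge_0 w) as Pw. pose proof (Cmod_ge_0 (pcoef' k s)) as Pc.
    exists (Cmod w * B + B + Cmod (pcoef' k s)). split; [nra|]. intros h Hh. specialize (IH h Hh).
    pose proof (Cmod_ge_0 h) as Ph. cbn [pcoef pcoef'].
    set (r := (pcoef k (s + h) - pcoef k s - h * pcoef' k s)%C) in *.
    replace (- (s + h + RtoC (INR k)) * pcoef k (s + h) - - (s + RtoC (INR k)) * pcoef k s
             - h * (- pcoef k s - (s + RtoC (INR k)) * pcoef' k s))%C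
      with (- (w * r + h * r + h * h * pcoef' k s))%C by (unfold r, w; ring).
    rewrite Cmod_opp. eapply Rle_trans; [apply Cmod_triangle|].
    eapply Rle_trans; [apply Rplus_le_compat_r, Cmod_triangle|]. rewrite !Cmod_mult.
    pose proof (Cmod_ge_0 r).
    assert (Cmod w * Cmod r <= Cmod w * (B * Cmod h ^ 2)) by (apply Rmult_le_compat_l; assumption).
    assert (Cmod h * Cmod r <= 1 * (B * Cmod h ^ 2)) by (apply Rmult_le_compat; assumption).
    simpl in *. lra.
Qed.

Lemma ln_le_pow x e : 0 < e -> 1 <= x -> ln x <= / e * Rpower x e.
Proof.
  intros He Hx.
  assert (H : 1 + e * ln x <= Rpower x e) by (unfold Rpower; apply exp_ineq1_le).
  apply Rmult_le_reg_l with e; [assumption|]. rewrite <- Rmult_assoc, Rinv_r by lra. lra.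
Qed.

Lemma ppow_remainder k s : exists B, 0 <= B /\ forall h x, Cmod h <= / 4 -> 1 <= x ->
  Cmod (ppow k (s + h) x - ppow k s x - h * ppow' k s x)
  <= B * Cmod h ^ 2 * Rpower x (- (Re s + INR k) + / 2).
Proof.
  destruct (pcoef_taylor k s) as [B0 [HB0 HT]].
  set (c := pcoef k s). set (c' := pcoef' k s).
  pose proof (Cmod_ge_0 c) as Pc. pose proof (Cmod_ge_0 c') as Pc'.
  exists ((B0 + Cmod c + 2 * Cmod c') * 81). split; [apply Rmult_le_pos; lra|].
  intros h x Hh Hx. specialize (HT h ltac:(lra)). fold c c' in HT.
  set (L := ln x). assert (HL : 0 <= L) by (unfold L; rewrite <- ln_1; apply ln_le; lra).
  pose proof (Cmod_ge_0 h) as Ph.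
  set (e := Cexp (- h * RtoC L)).
  assert (Eq : (ppow k (s + h) x - ppow k s x - h * ppow' k s x)%C =
    (cpow x (- (s + RtoC (INR k))) * ((pcoef k (s + h) - c - h * c') * e + (c + h * c') * (e - RtoC 1 - (- h * RtoC L))
      - h * h * c' * RtoC L))%C).
  { unfold ppow, ppow'. replace (- (s + h + RtoC (INR k)))%C with (- (s + RtoC (INR k)) + - h)%C by ring.
    rewrite cpow_plus. replace (cpow x (- h)) with e by reflexivity. fold c c' L. ring. }
  rewrite Eq, Cmod_mult, Cmod_cpow.
  assert (He : Cmod (- h * RtoC L) <= / 4 * L).
  { rewrite Cmod_mult, Cmod_opp, Cmod_RtoC_nonneg by assumption. apply Rmult_le_compat_r; assumption. }
  assert (He' : Cmod (- h * RtoC L) = Cmod h * L) by (now rewrite Cmod_mult, Cmod_opp, Cmod_RtoC_nonneg).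
  set (X := Rpower x (/ 4)). assert (HX : 1 <= X).
  { unfold X; rewrite <- (Rpower_O x) by lra. apply Rle_Rpower; lra. }
  assert (Xe : exp (/ 4 * L) = X) by reflexivity.
  assert (Ee : Cmod e <= X).
  { unfold e. rewrite Cmod_Cexp, <- Xe. apply exp_le. eapply Rle_trans; [apply Rle_abs|].
    eapply Rle_trans; [apply re_le_Cmod|assumption]. }
  assert (E2 : Cmod (e - RtoC 1 - (- h * RtoC L)) <= Cmod h ^ 2 * L ^ 2 * X).
  { eapply Rle_trans; [apply Cexp_2_bound|]. rewrite He', Rpow_mult_distr.
    apply Rmult_le_compat_l; [apply Rmult_le_pos; apply pow2_ge_0|]. rewrite <- Xe, <- He'. now apply exp_le. }
  set (Y := Rpower x (/ 8)). assert (HY : 1 <= Y).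
  { unfold Y; rewrite <- (Rpower_O x) by lra. apply Rle_Rpower; lra. }
  assert (LY : L <= 8 * Y).
  { unfold L, Y. pose proof (ln_le_pow x (/ 8) ltac:(lra) Hx). lra. }
  assert (YX : Y * Y = X).
  { unfold X, Y; rewrite <- Rpower_plus; f_equal; field. }
  assert (L2 : L ^ 2 <= 64 * X) by (simpl; nra).
  assert (L1 : L <= 64 * X) by nra.
  assert (Xh : X * X = Rpower x (/ 2)) by (unfold X; rewrite <- Rpower_plus; f_equal; field).
  replace (Rpower x (- (Re s + INR k) + / 2)) with (Rpower x (- (Re s + INR k)) * (X * X))
    by (rewrite Xh, <- Rpower_plus; reflexivity).
  replace (Re (- (s + RtoC (INR k)))) with (- (Re s + INR k)) by (simpl; unfold Re; simpl; ring).
  replace ((B0 + Cmod c + 2 * Cmod c') * 81 * Cmod h ^ 2 * (Rpower x (- (Re s + INR k)) * (X * X)))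
    with (Rpower x (- (Re s + INR k)) * ((B0 + Cmod c + 2 * Cmod c') * 81 * Cmod h ^ 2 * (X * X))) by ring.
  apply Rmult_le_compat_l; [left; apply exp_pos|].
  unfold Cminus at 1. eapply Rle_trans; [apply Cmod_triangle|].
  eapply Rle_trans; [apply Rplus_le_compat_r, Cmod_triangle|]. rewrite Cmod_opp, !Cmod_mult, (Cmod_RtoC_nonneg L HL).
  set (H2 := Cmod h ^ 2) in *. assert (PH2 : 0 <= H2) by apply pow2_ge_0.
  assert (XX : X <= X * X) by nra.
  assert (T1 : Cmod (pcoef k (s + h) - c - h * c') * Cmod e <= B0 * H2 * (X * X)).
  { apply Rle_trans with (B0 * H2 * X); [apply Rmult_le_compat; try apply Cmod_ge_0; assumption|].
    apply Rmult_le_compat_l; [apply Rmult_le_pos|]; assumption. }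
  assert (T2 : Cmod (c + h * c') * Cmod (e - RtoC 1 - (- h * RtoC L)) <= (Cmod c + Cmod c') * (H2 * 64 * (X * X))).
  { apply Rmult_le_compat; try apply Cmod_ge_0.
    - eapply Rle_trans; [apply Cmod_triangle|]. rewrite Cmod_mult. nra.
    - eapply Rle_trans; [exact E2|]. replace (H2 * 64 * (X * X)) with (H2 * (64 * X) * X) by ring.
      apply Rmult_le_compat_r; [lra|]. apply Rmult_le_compat_l; lra. }
  assert (T3 : Cmod h * Cmod h * Cmod c' * L <= H2 * Cmod c' * (64 * (X * X))).
  { replace (Cmod h * Cmod h) with H2 by (unfold H2; ring). apply Rmult_le_compat_l; [now apply Rmult_le_pos|]. lra. }
  assert (0 <= H2 * (X * X)) by (apply Rmult_le_pos; nra).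
  set (Z := H2 * (X * X)) in *.
  replace (B0 * H2 * (X * X)) with (B0 * Z) in T1 by (unfold Z; ring).
  replace ((Cmod c + Cmod c') * (H2 * 64 * (X * X))) with ((Cmod c + Cmod c') * (64 * Z)) in T2 by (unfold Z; ring).
  replace (H2 * Cmod c' * (64 * (X * X))) with (Cmod c' * (64 * Z)) in T3 by (unfold Z; ring).
  replace ((B0 + Cmod c + 2 * Cmod c') * 81 * H2 * (X * X)) with ((B0 + Cmod c + 2 * Cmod c') * 81 * Z) by (unfold Z; ring).
  assert (0 <= B0 * Z) by (now apply Rmult_le_pos). assert (0 <= Cmod c * Z) by (now apply Rmult_le_pos).
  assert (0 <= Cmod c' * Z) by (now apply Rmult_le_pos). lra.
Qed.

(** * Continuation by repeated summation by parts *)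

Definition dpow (s : C) (x : R) : C := cpow x (- s).

Lemma ppow_0 s x : ppow 0 s x = dpow s x.
Proof. unfold ppow, dpow; simpl. rewrite Cmult_1_l. f_equal. simpl; ring. Qed.

Lemma nab_dpow_bound k s x : 1 <= x -> 0 <= Re s + INR k ->
  Cmod (nab k (dpow s) x) <= Cmod (pcoef k s) * Rpower x (- (Re s + INR k)).
Proof.
  intros Hx Hs. rewrite <- (nab_ext k (ppow 0 s)) by apply ppow_0.
  apply (nab_bound k (fun i => ppow i s)); [intros; now apply ppow_deriv|lra|].
  intros t Ht. unfold ppow. rewrite Cmod_mult, Cmod_cpow.
  apply Rmult_le_compat_l; [apply Cmod_ge_0|].
  replace (Re (- (s + RtoC (INR k)))) with (- (Re s + INR k)) by (simpl; unfold Re; simpl; ring).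
  rewrite !Rpower_Ropp. apply Rinv_le_contravar; [apply exp_pos|].
  unfold Rpower. apply exp_le, Rmult_le_compat_l; [assumption|]. apply ln_le; lra.
Qed.

(** The n-th term of the Dirichlet series after k summations by parts. It is O(n^(-Re s - k)), hence
    summable as soon as Re s + k >= 2. [Lbdry] collects the boundary terms at n = 0. *)
Definition Lterm (D k : nat) (a : nat -> C) (s : C) (n : nat) : C :=
  (aseq D k a n * nab k (dpow s) (INR n + 1))%C.

Definition Lbdry (D k : nat) (a : nat -> C) (s : C) : C :=
  csum (seq 0 k) (fun j => anti D (aseq D j a) 0 * nab j (dpow s) 1)%C.

Definition Lcont (D k : nat) (a : nat -> C) (s : C) : C :=
  (CSeries (Lterm D k a s) - Lbdry D k a s)%C.

Lemma nab_dpow_vanish s k : 0 < Re s + INR k ->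
  forall eps, 0 < eps -> exists N0, forall N, (N0 <= N)%nat -> Cmod (nab k (dpow s) (INR N + 1)) < eps.
Proof.
  intros Hs eps He. set (p := Re s + INR k) in *. set (c := Cmod (pcoef k s) + 1).
  assert (Hc : 0 < c) by (unfold c; pose proof (Cmod_ge_0 (pcoef k s)); lra).
  destruct (nfloor_ex (Rpower (c / eps) (/ p))) as [N0 [_ HN0]]; [left; apply exp_pos|].
  exists N0; intros N HN. apply le_INR in HN.
  eapply Rle_lt_trans; [apply nab_dpow_bound; [pose proof (pos_INR N); lra|fold p; lra]|]. fold p.
  rewrite Rpower_Ropp.
  assert (H : c / eps < Rpower (INR N + 1) p).
  { replace (c / eps) with (Rpower (Rpower (c / eps) (/ p)) p).
    - unfold Rpower at 1 3. apply exp_increasing, Rmult_lt_compat_l; [assumption|].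
      apply ln_increasing; [apply exp_pos|lra].
    - rewrite Rpower_mult, Rinv_l, Rpower_1; [reflexivity| |lra]. apply Rdiv_lt_0_compat; assumption. }
  apply Rmult_lt_reg_r with (Rpower (INR N + 1) p); [apply exp_pos|].
  rewrite Rmult_assoc, Rinv_l by (apply Rgt_not_eq, exp_pos).
  apply Rmult_lt_compat_l with (r := eps) in H; [|assumption].
  replace (eps * (c / eps)) with c in H by (field; lra). unfold c in H. lra.
Qed.

Lemma rsum_Rpower_bound p : 1 < p -> forall N, rsum (seq 0 N) (fun n => Rpower (INR n + 1) (- p)) <= p / (p - 1).
Proof.
  intros Hp N. eapply Rle_trans; [|apply (power_sum_le p N Hp)].
  rewrite (rsum_seq_shift _ 0 N 1). apply Req_le, rsum_ext; intros. now rewrite plus_INR.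
Qed.

Lemma Lterm_conv D k a s : nper D a -> 2 <= Re s + INR k -> exists l, cser (Lterm D k a s) l.
Proof.
  intros Ha Hs. destruct (nper_bounded _ _ (aseq_nper D k a Ha)) as [B [HB0 HB]].
  apply (cser_ex _ (fun n => B * Cmod (pcoef k s) * Rpower (INR n + 1) (- (Re s + INR k)))
           (B * Cmod (pcoef k s) * ((Re s + INR k) / (Re s + INR k - 1)))).
  - intros n. unfold Lterm. rewrite Cmod_mult, Rmult_assoc.
    apply Rmult_le_compat; try apply Cmod_ge_0; [apply HB|]. apply nab_dpow_bound; [pose proof (pos_INR n)|]; lra.
  - intros N. rewrite rsum_scal. apply Rmult_le_compat_l; [apply Rmult_le_pos; [assumption|apply Cmod_ge_0]|].
    apply rsum_Rpower_bound; lra.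
Qed.

Lemma cser_CSeries_ex a : (exists l, cser a l) -> cser a (CSeries a).
Proof. intros [l Hl]; now rewrite (cser_CSeries _ _ Hl). Qed.

(* One summation by parts: the boundary term at infinity vanishes. *)
Lemma Lterm_step D k a s l : nper D a -> 0 < Re s + INR k ->
  cser (Lterm D (S k) a s) l ->
  cser (Lterm D k a s) (l - anti D (aseq D k a) 0 * nab k (dpow s) 1)%C.
Proof.
  intros Ha Hs Hl eps He.
  destruct (nper_bounded _ _ (aseq_nper D (S k) a Ha)) as [B [HB0 HB]].
  destruct (Hl (eps / 2)) as [N1 H1]; [lra|].
  destruct (nab_dpow_vanish s k Hs (eps / (2 * (B + 1)))) as [N2 H2]; [apply Rdiv_lt_0_compat; lra|].
  exists (S (N1 + N2)); intros N HN. specialize (H1 N ltac:(lia)). specialize (H2 N ltac:(lia)).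
  unfold Lterm at 1.
  rewrite (abel (aseq D k a) (fun n => nab k (dpow s) (INR n + 1)) (anti D (aseq D k a)) 0 N) by apply anti_S.
  rewrite (csum_ext (seq 0 N) _ (Lterm D (S k) a s)).
  2:{ intros n _. unfold Lterm. cbn [aseq nab]. rewrite S_INR. reflexivity. }
  simpl (0 + N)%nat. simpl (INR 0). rewrite Rplus_0_l.
  set (U := csum (seq 0 N) (Lterm D (S k) a s)) in *. set (V := nab k (dpow s) (INR N + 1)) in *.
  replace (anti D (aseq D k a) N * V - anti D (aseq D k a) 0 * nab k (dpow s) 1 + U
           - (l - anti D (aseq D k a) 0 * nab k (dpow s) 1))%C
    with ((U - l) + anti D (aseq D k a) N * V)%C by ring.
  eapply Rle_lt_trans; [apply Cmod_triangle|]. rewrite Cmod_mult.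
  assert (HA : Cmod (anti D (aseq D k a) N) <= B).
  { destruct N as [|N]; [lia|]. apply (HB N). }
  pose proof (Cmod_ge_0 V). pose proof (Cmod_ge_0 (anti D (aseq D k a) N)).
  apply Rmult_lt_compat_l with (r := B + 1) in H2; [|lra].
  replace ((B + 1) * (eps / (2 * (B + 1)))) with (eps / 2) in H2 by (field; lra). nra.
Qed.

Lemma Lterm_steps D k j a s l : nper D a -> 0 < Re s + INR k ->
  cser (Lterm D (k + j) a s) l ->
  cser (Lterm D k a s) (l - csum (seq k j) (fun j => anti D (aseq D j a) 0 * nab j (dpow s) 1))%C.
Proof.
  intros Ha Hs. revert l; induction j as [|j IH]; intros l Hl.
  - rewrite Nat.add_0_r in Hl. unfold csum; simpl. now replace (l - RtoC 0)%C with l by ring.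
  - rewrite Nat.add_succ_r in Hl. apply Lterm_step in Hl; [|assumption|rewrite plus_INR; pose proof (pos_INR j); lra].
    apply IH in Hl. rewrite csum_seq_S.
    match goal with H : cser _ ?x |- cser _ ?y => replace y with x by ring end. exact Hl.
Qed.

Lemma Lcont_indep D k j a s : nper D a -> 2 <= Re s + INR k -> Lcont D (k + j) a s = Lcont D k a s.
Proof.
  intros Ha Hs. unfold Lcont, Lbdry.
  assert (H : exists l, cser (Lterm D (k + j) a s) l)
    by (apply Lterm_conv; [assumption|rewrite plus_INR; pose proof (pos_INR j); lra]).
  apply cser_CSeries_ex in H. apply Lterm_steps in H; [|assumption|lra].
  rewrite (cser_CSeries _ _ H), csum_seq_add. simpl (0 + k)%nat. ring.
Qed.

Lemma Lcont_series D k a s : nper D a -> 0 < Re s -> 2 <= Re s + INR k ->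
  cser (fun n => a n * dpow s (INR n + 1))%C (Lcont D k a s).
Proof.
  intros Ha Hs Hk. pose proof (cser_CSeries_ex _ (Lterm_conv D k a s Ha Hk)) as H.
  apply (Lterm_steps D 0 k a s) in H; [|assumption|simpl; lra]. exact H.
Qed.

Lemma is_cd_quadratic f s l B r : 0 < r -> 0 <= B ->
  (forall h, Cmod h <= r -> Cmod (f (s + h) - f s - l * h)%C <= B * Cmod h ^ 2) -> is_cd f s l.
Proof.
  intros Hr HB H eps He. exists (Rmin r (eps / (B + 1))).
  split; [apply Rmin_glb_lt; [assumption|apply Rdiv_lt_0_compat; lra]|].
  intros z Hz. pose proof (Rmin_l r (eps / (B + 1))). pose proof (Rmin_r r (eps / (B + 1))).
  specialize (H (z - s)%C ltac:(lra)). replace (s + (z - s))%C with z in H by ring.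
  eapply Rle_trans; [exact H|]. simpl. rewrite Rmult_1_r, <- Rmult_assoc.
  apply Rmult_le_compat_r; [apply Cmod_ge_0|].
  assert (Hz' : Cmod (z - s) < eps / (B + 1)) by lra.
  apply Rmult_lt_compat_l with (r := B + 1) in Hz'; [|lra].
  replace ((B + 1) * (eps / (B + 1))) with eps in Hz' by (field; lra).
  pose proof (Cmod_ge_0 (z - s)). nra.
Qed.

(** The remainder in h of a k-th difference is the k-th difference of the remainder, so [nab_bound]
    applies to it as a whole and reduces it to [ppow_remainder]. *)
Lemma nab_remainder k s : exists B, 0 <= B /\ forall h x, Cmod h <= / 4 -> 1 <= x -> 2 <= Re s + INR k ->
  Cmod (nab k (dpow (s + h)) x - nab k (dpow s) x - h * nab k (ppow' 0 s) x)
  <= B * Cmod h ^ 2 * Rpower x (- (3 / 2)).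
Proof.
  destruct (ppow_remainder k s) as [B [HB HR]]. exists B; split; [assumption|].
  intros h x Hh Hx Hs.
  set (phi := fun i y => ((ppow i (s + h) y + (- RtoC 1) * ppow i s y) + (- h) * ppow' i s y)%C).
  replace (nab k (dpow (s + h)) x - nab k (dpow s) x - h * nab k (ppow' 0 s) x)%C with (nab k (phi 0%nat) x).
  - apply nab_bound; [|lra|].
    + intros i y Hy. apply cderiv_plus; [apply cderiv_plus; [now apply ppow_deriv|]|].
      * apply cderiv_scal; now apply ppow_deriv.
      * apply cderiv_scal; now apply ppow'_deriv.
    + intros y Hy. unfold phi.
      replace (ppow k (s + h) y + - RtoC 1 * ppow k s y + - h * ppow' k s y)%C
        with (ppow k (s + h) y - ppow k s y - h * ppow' k s y)%C by ring.
      eapply Rle_trans; [apply HR; [assumption|lra]|].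
      apply Rmult_le_compat_l; [apply Rmult_le_pos; [assumption|apply pow2_ge_0]|].
      apply Rle_trans with (Rpower y (- (3 / 2))); [apply Rle_Rpower; lra|].
      rewrite !Rpower_Ropp. apply Rinv_le_contravar; [apply exp_pos|].
      unfold Rpower. apply exp_le, Rmult_le_compat_l; [lra|]. apply ln_le; lra.
  - unfold phi. rewrite (nab_lin k (fun y => ppow 0 (s + h) y + - RtoC 1 * ppow 0 s y)%C (ppow' 0 s)).
    rewrite (nab_lin k (ppow 0 (s + h)) (ppow 0 s)).
    rewrite (nab_ext k (ppow 0 (s + h)) (dpow (s + h))), (nab_ext k (ppow 0 s) (dpow s)) by apply ppow_0. ring.
Qed.

Lemma ccont_like_nab j s x : exists l, is_cd (fun s => nab j (dpow s) x) s l.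
Proof.
  revert x; induction j as [|j IH]; intros x.
  - simpl. unfold dpow, cpow. eexists.
    apply (is_cd_comp (fun s => - s * RtoC (ln x))%C Cexp); [|apply is_cd_Cexp].
    apply is_cd_mult; [|apply is_cd_const].
    eapply is_cd_ext; [| |apply (is_cd_mult (fun _ => - RtoC 1)%C (fun z => z)); [apply is_cd_const|apply is_cd_id]];
      [intros; simpl; ring|reflexivity].
  - destruct (IH x) as [l1 H1], (IH (x + 1)) as [l2 H2]. eexists.
    eapply is_cd_ext; [| |apply is_cd_plus; [exact H1|apply is_cd_mult; [apply (is_cd_const (- RtoC 1)%C)|exact H2]]];
      [intros z; simpl; ring|reflexivity].
Qed.

Lemma is_cd_csum {A} (l : list A) (f : A -> C -> C) s :
  (forall a, exists m, is_cd (f a) s m) -> exists m, is_cd (fun z => csum l (fun a => f a z)) s m.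
Proof.
  intros H; induction l as [|a l [m IH]].
  - exists (RtoC 0). exact (is_cd_const (RtoC 0) s).
  - destruct (H a) as [m' H']. exists (m' + m)%C. exact (is_cd_plus _ _ _ _ _ H' IH).
Qed.

(** Each term has a quadratic Taylor remainder in h that is summable in n. The hypothesis with 3 in
    place of 2 leaves room to move s by h. *)
Lemma Lcont_holomorphic D k a s : nper D a -> 3 <= Re s + INR k -> exists l, is_cd (Lcont D k a) s l.
Proof.
  intros Ha Hs.
  assert (H1 : exists l, is_cd (fun s => CSeries (Lterm D k a s)) s l).
  { destruct (nper_bounded _ _ (aseq_nper D k a Ha)) as [B [HB0 HB]].
    destruct (nab_remainder k s) as [B1 [HB1 HR]].
    set (dt := fun n => (aseq D k a n * nab k (ppow' 0 s) (INR n + 1))%C).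
    assert (Hconv : forall h, Cmod h <= / 4 -> exists l, cser (Lterm D k a (s + h)) l).
    { intros h Hh. apply Lterm_conv; [assumption|].
      pose proof (re_le_Cmod h). simpl. pose proof (Rabs_maj2 (Re h)). unfold Re in *; lra. }
    assert (Hrem : forall h, Cmod h <= / 4 -> forall n,
       Cmod (Lterm D k a (s + h) n + (- RtoC 1 * Lterm D k a s n + - h * dt n))%C
       <= B * B1 * Cmod h ^ 2 * Rpower (INR n + 1) (- (3 / 2))).
    { intros h Hh n. unfold Lterm, dt.
      replace (aseq D k a n * nab k (dpow (s + h)) (INR n + 1) +
        (- RtoC 1 * (aseq D k a n * nab k (dpow s) (INR n + 1)) + - h * (aseq D k a n * nab k (ppow' 0 s) (INR n + 1))))%C
        with (aseq D k a n * (nab k (dpow (s + h)) (INR n + 1) - nab k (dpow s) (INR n + 1) - h * nab k (ppow' 0 s) (INR n + 1)))%C by ring.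
      rewrite Cmod_mult. replace (B * B1 * Cmod h ^ 2 * Rpower (INR n + 1) (- (3 / 2)))
        with (B * (B1 * Cmod h ^ 2 * Rpower (INR n + 1) (- (3 / 2)))) by ring.
      apply Rmult_le_compat; try apply Cmod_ge_0; [apply HB|]. apply HR; [assumption|pose proof (pos_INR n); lra|lra]. }
    assert (Hsum : forall h, Cmod h <= / 4 -> forall N,
       rsum (seq 0 N) (fun n => B * B1 * Cmod h ^ 2 * Rpower (INR n + 1) (- (3 / 2))) <= B * B1 * Cmod h ^ 2 * 3).
    { intros h Hh N. rewrite rsum_scal. apply Rmult_le_compat_l; [apply Rmult_le_pos; [nra|apply pow2_ge_0]|].
      eapply Rle_trans; [apply rsum_Rpower_bound; lra|]. apply Req_le; field. }
    assert (H0' : cser (Lterm D k a s) (CSeries (Lterm D k a s))) by (apply cser_CSeries_ex, Lterm_conv; [assumption|lra]).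
    (* Convergence of the differentiated series needs no estimate of its own: at h = 1/4 each [dt n]
       is a combination of the terms at s + h and at s and of the remainder, and all three are
       summable. *)
    assert (Hdt : exists l, cser dt l).
    { set (h0 := RtoC (/ 4)). assert (Hh0 : Cmod h0 <= / 4) by (unfold h0; rewrite Cmod_RtoC_nonneg; lra).
      destruct (cser_ex _ _ _ (Hrem h0 Hh0) (Hsum h0 Hh0)) as [l1 Hl1].
      destruct (Hconv h0 Hh0) as [l2 Hl2].
      pose proof (cser_scal (RtoC 4) _ _ (cser_plus _ _ _ _ Hl2 (cser_plus _ _ _ _
        (cser_scal (- RtoC 1)%C _ _ H0') (cser_scal (- RtoC 1)%C _ _ Hl1)))) as T.
      eexists. eapply cser_ext; [|exact T].
      intros n. cbv beta. unfold h0. rewrite RtoC_inv by lra. field. }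
    destruct Hdt as [l Hl]. exists l.
    apply (is_cd_quadratic _ _ _ (B * B1 * 3) (/ 4)); [lra|nra|].
    intros h Hh.
    assert (Hser : cser (fun n => Lterm D k a (s + h) n + (- RtoC 1 * Lterm D k a s n + - h * dt n))%C
       (CSeries (Lterm D k a (s + h)) + (- RtoC 1 * CSeries (Lterm D k a s) + - h * l))%C).
    { apply cser_plus; [apply cser_CSeries_ex; auto|]. apply cser_plus; now apply cser_scal. }
    replace (CSeries (Lterm D k a (s + h)) - CSeries (Lterm D k a s) - l * h)%C
      with (CSeries (Lterm D k a (s + h)) + (- RtoC 1 * CSeries (Lterm D k a s) + - h * l))%C by ring.
    apply (cser_bound _ _ _ Hser). intros M. eapply Rle_trans; [apply Cmod_csum|].
    eapply Rle_trans; [apply rsum_le; intros n _; apply (Hrem h Hh n)|].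
    eapply Rle_trans; [apply Hsum; assumption|]. lra. }
  assert (H2 : exists l, is_cd (Lbdry D k a) s l).
  { apply (is_cd_csum (seq 0 k) (fun j z => anti D (aseq D j a) 0 * nab j (dpow z) 1)%C). intros j.
    destruct (ccont_like_nab j s 1) as [m Hm]. eexists. apply is_cd_mult; [apply is_cd_const|exact Hm]. }
  destruct H1 as [l1 H1], H2 as [l2 H2]. eexists.
  eapply is_cd_ext; [| |apply is_cd_plus; [exact H1|apply is_cd_mult; [apply (is_cd_const (- RtoC 1)%C)|exact H2]]];
    [intros z; unfold Lcont; ring|reflexivity].
Qed.

Definition Lorder (s : C) : nat := Z.to_nat (up (4 - Re s)).

Lemma Lorder_spec s : 4 <= Re s + INR (Lorder s).
Proof.
  unfold Lorder. destruct (archimed (4 - Re s)) as [H _].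
  destruct (Z_le_gt_dec 0 (up (4 - Re s))) as [L|L].
  - rewrite INR_IZR_INZ, Z2Nat.id by assumption. lra.
  - assert (IZR (up (4 - Re s)) <= 0) by (apply IZR_le; lia). pose proof (pos_INR (Z.to_nat (up (4 - Re s)))). lra.
Qed.

(** The number of summations by parts depends on s. By [Lentire_eq] it may be frozen near a given
    point, which is how holomorphy is obtained. *)
Definition Lentire (D : nat) (a : nat -> C) (s : C) : C := Lcont D (Lorder s) a s.

Lemma Lentire_eq D k a s : nper D a -> 2 <= Re s + INR k -> Lentire D a s = Lcont D k a s.
Proof.
  intros Ha Hk. unfold Lentire. pose proof (Lorder_spec s).
  rewrite <- (Lcont_indep D (Lorder s) k a s), <- (Lcont_indep D k (Lorder s) a s) by (assumption || lra).
  f_equal; lia.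
Qed.

Lemma Lentire_holomorphic D a s : nper D a -> holomorphic_at (Lentire D a) s.
Proof.
  intros Ha. apply holomorphic_iff. pose proof (Lorder_spec s) as Hk.
  destruct (Lcont_holomorphic D (Lorder s) a s Ha) as [l Hl]; [lra|]. exists l.
  intros eps He. destruct (Hl eps He) as [d [Hd H]]. exists (Rmin d 1); split; [apply Rmin_glb_lt; lra|].
  intros z Hz. pose proof (Rmin_l d 1). pose proof (Rmin_r d 1).
  rewrite !(Lentire_eq D (Lorder s)); try assumption; [apply H; lra|lra|].
  pose proof (re_le_Cmod (z - s)) as Hr. change (Re (z - s)) with (Re z - Re s) in Hr.
  pose proof (Rabs_maj2 (Re z - Re s)). lra.
Qed.

Lemma Lentire_series D a s : nper D a -> 0 < Re s ->
  cser (fun n => a n * dpow s (INR n + 1))%C (Lentire D a s).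
Proof. intros Ha Hs. apply Lcont_series; [assumption|assumption|]. pose proof (Lorder_spec s); lra. Qed.

Definition cseq (chi : Z -> C) (n : nat) : C := chi (Z.of_nat (S n)).

Lemma cseq_nper q chi : dirichlet_character q chi -> ~ principal chi -> nper q (cseq chi).
Proof.
  intros HC HN. pose proof (dc_periodic _ _ HC) as HP.
  split; [apply HP|]; split.
  - intros n. unfold cseq. rewrite <- (proj2 HP (Z.of_nat (S n))). f_equal; lia.
  - rewrite <- (dc_mean_zero _ _ HC HN), <- (zsum_period _ _ HP 1). unfold zsum, cseq.
    apply csum_ext; intros; f_equal; lia.
Qed.

Lemma cseq_term chi s n : (chi (Z.of_nat (S n)) / npow (S n) s = cseq chi n * dpow s (INR n + 1))%C.
Proof. unfold dpow, cseq. rewrite cpow_opp, npow_cpow, S_INR. reflexivity. Qed.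

(** [Lentire] is a witness for the specification behind [epsilon], so [dirichlet_L chi] satisfies it
    as well. The identity theorem then identifies the two functions and transfers the convergence
    for Re s > 0. *)
Theorem dirichlet_L_entire q chi : dirichlet_character q chi -> ~ principal chi ->
  (forall s, holomorphic_at (dirichlet_L chi) s) /\
  (forall s, 0 < Re s -> cser (fun n => chi (Z.of_nat (S n)) / npow (S n) s)%C (dirichlet_L chi s)).
Proof.
  intros HC HN. pose proof (cseq_nper _ _ HC HN) as Ha.
  assert (HL : is_dirichlet_L chi (Lentire q (cseq chi))).
  { split.
    - intros s Hs. symmetry. apply cser_CSeries.
      eapply cser_ext; [|apply (Lentire_series q (cseq chi) s Ha); lra].
      intros n. symmetry; apply cseq_term.
    - intros s _. now apply Lentire_holomorphic. }
  assert (HD : is_dirichlet_L chi (dirichlet_L chi))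
    by (unfold dirichlet_L; apply epsilon_spec; now exists (Lentire q (cseq chi))).
  assert (HE : forall s, holomorphic_at (dirichlet_L chi) s) by (intros s; apply HD; now right).
  split; [assumption|].
  intros s Hs. rewrite (entire_identity (dirichlet_L chi) (Lentire q (cseq chi))).
  - eapply cser_ext; [|apply (Lentire_series q (cseq chi) s Ha Hs)]. intros n. symmetry; apply cseq_term.
  - assumption.
  - intros; now apply Lentire_holomorphic.
  - intros z Hz. destruct HD as [HD _], HL as [HL _]. now rewrite HD, HL.
Qed.

(** * Truncation of the Dirichlet series *)

Lemma Rpower_le_base_neg x y p : 0 < x -> x <= y -> 0 <= p -> Rpower y (- p) <= Rpower x (- p).
Proof.
  intros Hx Hxy Hp. rewrite !Rpower_Ropp. apply Rinv_le_contravar; [apply exp_pos|].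
  unfold Rpower. apply exp_le, Rmult_le_compat_l; [assumption|]. now apply ln_le.
Qed.

Lemma dpow_diff s x : 1 <= x -> 0 < Re s -> Cmod (dpow s x - dpow s (x + 1)) <= Cmod s * Rpower x (- (Re s + 1)).
Proof.
  intros Hx Hs. pose proof (nab_dpow_bound 1 s x Hx) as H. simpl in H.
  replace (- (s + RtoC 0) * RtoC 1)%C with (- s)%C in H by ring. rewrite Cmod_opp in H. apply H; lra.
Qed.

(** Summation by parts beyond Y. Sums of chi over intervals are bounded by the modulus only, since
    complete periods drop out, and nothing sharper is needed later. *)
Theorem dirichlet_L_approx q chi s Y : dirichlet_character q chi -> ~ principal chi ->
  0 < Re s -> (1 <= Y)%nat ->
  Cmod (dirichlet_L chi s - csum (seq 1 Y) (fun n => chi (Z.of_nat n) / npow n s))%C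
  <= INR q * (1 + Cmod s * (1 + / Re s)) * Rpower (INR Y) (- Re s).
Proof.
  intros HC HN Hs HY. destruct (dirichlet_L_entire _ _ HC HN) as [_ HL]. specialize (HL s Hs).
  rewrite (csum_seq_shift _ 0 Y 1).
  rewrite (csum_ext (seq 0 Y) _ (fun n => chi (Z.of_nat (S n)) / npow (S n) s)%C)
    by (intros; do 2 f_equal; try f_equal; lia).
  apply (cser_tail _ _ _ _ HL). intros M.
  assert (Y1 : 1 <= INR Y) by (apply (le_INR 1); lia).
  pose proof (dc_periodic _ _ HC) as HP. pose proof (dc_mean_zero _ _ HC HN) as HM.
  set (A := fun n => zsum (Z.of_nat (S Y)) (n - Y) chi).
  assert (HA : forall n, Cmod (A n) <= INR q).
  { intros n. rewrite <- (Rmult_1_r (INR q)). apply (Cmod_zsum_period _ _ _ HP HM). intros; now apply (dc_Cmod_le q). }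
  assert (Hstep : forall n, (Y <= n)%nat -> (A (S n) - A n)%C = cseq chi n).
  { intros n Hn. unfold A. replace (S n - Y)%nat with (S (n - Y)) by lia. rewrite zsum_S.
    replace (Z.of_nat (S Y) + Z.of_nat (n - Y))%Z with (Z.of_nat (S n)) by lia. unfold cseq; ring. }
  (* [abel] asks for a primitive at every n, whereas [A] is a primitive of [cseq chi] only from Y
     on, because of the truncated subtraction. Below Y the sequence [a] is irrelevant. *)
  set (a := fun n => (A (S n) - A n)%C).
  rewrite (csum_ext (seq Y M) _ (fun n => a n * dpow s (INR n + 1))%C).
  2:{ intros n Hn; apply in_seq in Hn. unfold a. rewrite Hstep by lia. apply cseq_term. }
  rewrite (abel a (fun n => dpow s (INR n + 1)) A Y M) by reflexivity.
  assert (A0 : A Y = RtoC 0) by (unfold A; rewrite Nat.sub_diag; reflexivity). rewrite A0.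
  replace (A (Y + M)%nat * dpow s (INR (Y + M) + 1) - RtoC 0 * dpow s (INR Y + 1) +
     csum (seq Y M) (fun n => A (S n) * (dpow s (INR n + 1) - dpow s (INR (S n) + 1))))%C
    with (A (Y + M)%nat * dpow s (INR (Y + M) + 1) +
     csum (seq Y M) (fun n => A (S n) * (dpow s (INR n + 1) - dpow s (INR (S n) + 1))))%C by ring.
  eapply Rle_trans; [apply Cmod_triangle|].
  set (P := Rpower (INR Y) (- Re s)). assert (HPp : 0 < P) by apply exp_pos.
  assert (T1 : Cmod (A (Y + M)%nat * dpow s (INR (Y + M) + 1)) <= INR q * P).
  { rewrite Cmod_mult. apply Rmult_le_compat; try apply Cmod_ge_0; [apply HA|].
    unfold dpow. rewrite Cmod_cpow. change (Re (- s)) with (- Re s).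
    apply Rpower_le_base_neg; [lra|rewrite plus_INR; pose proof (pos_INR M); lra|lra]. }
  assert (T2 : Cmod (csum (seq Y M) (fun n => A (S n) * (dpow s (INR n + 1) - dpow s (INR (S n) + 1)))%C)
     <= INR q * (Cmod s * (P / Re s))).
  { eapply Rle_trans; [apply Cmod_csum|].
    apply Rle_trans with (rsum (seq Y M) (fun n => INR q * Cmod s * Rpower (INR n + 1) (- (Re s + 1)))).
    - apply rsum_le; intros n Hn. rewrite Cmod_mult, Rmult_assoc.
      apply Rmult_le_compat; try apply Cmod_ge_0; [apply HA|].
      rewrite S_INR. apply dpow_diff; [pose proof (pos_INR n)|]; lra.
    - rewrite rsum_scal, Rmult_assoc. apply Rmult_le_compat_l; [apply pos_INR|].
      apply Rmult_le_compat_l; [apply Cmod_ge_0|].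
      rewrite (rsum_ext _ _ (fun n => Rpower (INR (n + 1)) (- (Re s + 1)))) by (intros; now rewrite plus_INR).
      rewrite <- (rsum_seq_shift (fun n => Rpower (INR n) (- (Re s + 1)))).
      replace (Y + 1)%nat with (S Y) by lia.
      eapply Rle_trans; [apply power_sum_tail; [lra|assumption]|].
      replace (1 - (Re s + 1)) with (- Re s) by ring. replace (Re s + 1 - 1) with (Re s) by ring. fold P. lra. }
  assert (0 <= INR q * (Cmod s * P)) by (apply Rmult_le_pos; [apply pos_INR|apply Rmult_le_pos; [apply Cmod_ge_0|lra]]).
  apply Rle_trans with (INR q * P + INR q * (Cmod s * (P / Re s))); [lra|].
  unfold Rdiv in *. lra.
Qed.

(** * Mollifier coefficients and divisor sums *)

Definition dvb (d n : nat) : bool := Nat.eqb (n mod d) 0.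

Lemma dvb_iff d n : (0 < d)%nat -> dvb d n = true <-> Nat.divide d n.
Proof.
  intros Hd; unfold dvb. rewrite Nat.eqb_eq. apply Nat.Lcm0.mod_divide.
Qed.

Definition nprime (p : nat) : Prop := prime (Z.of_nat p).

Lemma nprime_ge2 p : nprime p -> (2 <= p)%nat.
Proof. intros H; apply prime_ge_2 in H; lia. Qed.

Lemma nat_Z_divide a b : Nat.divide a b <-> (Z.of_nat a | Z.of_nat b)%Z.
Proof.
  split.
  - intros [k ->]; exists (Z.of_nat k); lia.
  - intros H. destruct (Nat.eq_dec a 0) as [->|Ha].
    + destruct H as [k Hk]. exists 0%nat. lia.
    + apply Nat.Lcm0.mod_divide. apply Z.mod_divide in H; [|lia].
      rewrite <- Nat2Z.inj_mod in H. lia.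
Qed.

Lemma nprime_mult p a b : nprime p -> Nat.divide p (a * b) -> Nat.divide p a \/ Nat.divide p b.
Proof. rewrite !nat_Z_divide, Nat2Z.inj_mul; intros; now apply prime_mult. Qed.

Lemma nprime_div p q : nprime p -> nprime q -> Nat.divide p q -> p = q.
Proof. rewrite nat_Z_divide; intros Hp Hq H. apply Nat2Z.inj. now apply prime_div_prime. Qed.

Lemma nprime_divisor n : (1 < n)%nat -> exists p, nprime p /\ Nat.divide p n.
Proof.
  intros Hn. destruct (prime_divisor_exists (Z.of_nat n)) as [p [Hp Hd]]; [lia|].
  pose proof (prime_ge_2 _ Hp). exists (Z.to_nat p). unfold nprime.
  rewrite nat_Z_divide, Z2Nat.id by lia. now split.
Qed.

(** The pairs (d, mu(d)) for the products d of distinct entries of l, when l consists of distinct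
    primes: the expansion of the product of 1 - g(p). *)
Fixpoint mob (l : list nat) : list (nat * R) :=
  match l with
  | [] => [(1%nat, 1)]
  | p :: l => mob l ++ map (fun de => ((p * fst de)%nat, - snd de)) (mob l)
  end.

Definition rough (l : list nat) (n : nat) : bool := forallb (fun p => negb (dvb p n)) l.

Lemma mob_pos l : (forall p, In p l -> (0 < p)%nat) -> forall de, In de (mob l) -> (0 < fst de)%nat.
Proof.
  induction l as [|p l IH]; intros Hl de Hde; simpl in Hde.
  - destruct Hde as [<-|[]]; simpl; lia.
  - apply in_app_or in Hde. destruct Hde as [Hde|Hde].
    + apply IH; auto. intros; apply Hl; now right.
    + apply in_map_iff in Hde. destruct Hde as [[d e] [<- H]]; simpl.
      specialize (IH ltac:(intros; apply Hl; now right) _ H). specialize (Hl p ltac:(now left)). simpl in IH. nia.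
Qed.

Lemma mob_sign l de : In de (mob l) -> Rabs (snd de) = 1.
Proof.
  revert de; induction l as [|p l IH]; intros de Hde; simpl in Hde.
  - destruct Hde as [<-|[]]; simpl; apply Rabs_R1.
  - apply in_app_or in Hde. destruct Hde as [Hde|Hde]; [auto|].
    apply in_map_iff in Hde. destruct Hde as [[d e] [<- H]]; simpl. rewrite Rabs_Ropp. apply (IH _ H).
Qed.

Lemma mob_prime_divisor l : (forall p, In p l -> nprime p) ->
  forall de r, In de (mob l) -> nprime r -> Nat.divide r (fst de) -> In r l.
Proof.
  induction l as [|p l IH]; intros Hl de r Hde Hr Hd; simpl in Hde.
  - destruct Hde as [<-|[]]; simpl in Hd. apply Nat.divide_1_r in Hd. apply nprime_ge2 in Hr. lia.
  - apply in_app_or in Hde. destruct Hde as [Hde|Hde].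
    + right; apply (IH ltac:(intros; apply Hl; now right) de); assumption.
    + apply in_map_iff in Hde. destruct Hde as [[d e] [<- H]]; simpl in Hd.
      apply nprime_mult in Hd; [|assumption]. destruct Hd as [Hd|Hd].
      * left. symmetry. apply nprime_div; [assumption|apply Hl; now left|assumption].
      * right. apply (IH ltac:(intros; apply Hl; now right) (d, e)); assumption.
Qed.

Lemma mob_NoDup l : NoDup l -> (forall p, In p l -> nprime p) -> NoDup (map fst (mob l)).
Proof.
  induction l as [|p l IH]; intros Hn Hl; simpl.
  - repeat constructor. intros [].
  - inversion Hn; subst. assert (Hl' : forall p, In p l -> nprime p) by (intros; apply Hl; now right).
    pose proof (nprime_ge2 p (Hl p ltac:(now left))) as Hp2.
    rewrite map_app, map_map; simpl. apply NoDup_app.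
    + now apply IH.
    + replace (map (fun x => (p * fst x)%nat) (mob l)) with (map (Nat.mul p) (map fst (mob l)))
        by (rewrite map_map; reflexivity).
      apply NoDup_map_NoDup_ForallPairs; [|now apply IH]. intros a b _ _ E. nia.
    + intros d Hd Hd'. apply in_map_iff in Hd'. destruct Hd' as [[d' e'] [E H']]. simpl in E.
      apply in_map_iff in Hd. destruct Hd as [[d0 e0] [E0 H0]]. simpl in E0. subst d0.
      assert (In p l); [|contradiction].
      apply (mob_prime_divisor l Hl' (d, e0) p H0); [apply Hl; now left|]. simpl. exists d'. lia.
Qed.

Definition cmult (g : nat -> C) : Prop :=
  g 1%nat = RtoC 1 /\ forall m n, (0 < m)%nat -> (0 < n)%nat -> g (m * n)%nat = (g m * g n)%C.

Lemma mob_prod g l : cmult g -> (forall p, In p l -> (0 < p)%nat) ->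
  cprod l (fun p => RtoC 1 - g p)%C = csum (mob l) (fun de => RtoC (snd de) * g (fst de))%C.
Proof.
  intros [G1 GM]. induction l as [|p l IH]; intros Hl.
  - unfold cprod, csum; simpl. rewrite G1; ring.
  - assert (Hl' : forall p, In p l -> (0 < p)%nat) by (intros; apply Hl; now right).
    transitivity ((RtoC 1 - g p) * cprod l (fun p => RtoC 1 - g p))%C; [reflexivity|].
    rewrite IH by assumption. cbn [mob]. rewrite csum_app, csum_map.
    rewrite (csum_ext (mob l) (fun a => _ * g (fst (_, _)))%C (fun de => (- g p) * (RtoC (snd de) * g (fst de)))%C).
    + rewrite csum_scal; ring.
    + intros de Hde; simpl. rewrite GM; [rewrite RtoC_opp; ring|apply Hl; now left|].
      now apply (mob_pos l).
Qed.

(** Inclusion and exclusion, by induction on l. If n = p n', the new pairs contribute minus the sum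
    for n', and n and n' have the same divisors in the rest of the list, so everything cancels. *)
Lemma mob_detect l n : NoDup l -> (forall p, In p l -> nprime p) -> (0 < n)%nat ->
  rsum (mob l) (fun de => if dvb (fst de) n then snd de else 0) = if rough l n then 1 else 0.
Proof.
  revert n; induction l as [|p l IH]; intros n Hn Hl Hn0.
  - unfold rsum; simpl. unfold dvb; simpl. ring.
  - inversion Hn; subst. assert (Hl' : forall p, In p l -> nprime p) by (intros; apply Hl; now right).
    assert (Hp : nprime p) by (apply Hl; now left). pose proof (nprime_ge2 p Hp) as Hp2.
    assert (Hpos : forall de, In de (mob l) -> (0 < fst de)%nat)
      by (apply mob_pos; intros q Hq; apply Hl', nprime_ge2 in Hq; lia).
    cbn [mob]. rewrite rsum_app, rsum_map, IH by assumption. cbn [fst snd rough forallb].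
    fold (rough l n). destruct (dvb p n) eqn:Ed; simpl.
    + apply dvb_iff in Ed; [|lia]. destruct Ed as [n' En].
      assert (Hn' : (0 < n')%nat) by nia.
      rewrite (rsum_ext (mob l) _ (fun de => (- 1) * (if dvb (fst de) n' then snd de else 0))).
      * rewrite rsum_scal, IH by assumption.
        replace (rough l n') with (rough l n); [destruct (rough l n); ring|].
        unfold rough. assert (E : forall q, In q l -> dvb q n = dvb q n').
        { intros q Hq. pose proof (nprime_ge2 q (Hl' q Hq)).
          apply Bool.eq_iff_eq_true. rewrite !dvb_iff by lia. split; intros Hd.
          - rewrite En in Hd. apply nprime_mult in Hd; [|auto]. destruct Hd as [|Hd]; [assumption|].
            apply nprime_div in Hd; auto. subst; contradiction.
          - rewrite En. now apply Nat.divide_mul_l. }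
        clear - E. induction l as [|q l IH]; [reflexivity|]. simpl.
        rewrite E by now left. f_equal. apply IH. intros; apply E; now right.
      * intros de Hde. specialize (Hpos de Hde).
        replace (dvb (p * fst de) n) with (dvb (fst de) n'); [destruct (dvb (fst de) n'); ring|].
        apply Bool.eq_iff_eq_true. rewrite !dvb_iff by nia. split; intros [k Hk].
        -- exists k. rewrite En, Hk. ring.
        -- exists k. nia.
    + rewrite (rsum_ext (mob l) _ (fun _ => 0)), rsum_0; [ring|].
      intros de Hde. specialize (Hpos de Hde).
      destruct (dvb (p * fst de) n) eqn:E2; [|reflexivity].
      apply dvb_iff in E2; [|nia]. exfalso.
      assert (Nat.divide p n) by (eapply Nat.divide_trans; [|exact E2]; exists (fst de); lia).
      apply dvb_iff in H; [congruence|lia].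
Qed.

Definition divs (n : nat) : list nat := filter (fun d => dvb d n) (seq 1 n).

Lemma in_divs d n : (0 < n)%nat -> In d (divs n) <-> (0 < d)%nat /\ Nat.divide d n.
Proof.
  intros Hn. unfold divs. rewrite filter_In, in_seq. split.
  - intros [H1 H2]. split; [lia|]. apply dvb_iff; [lia|assumption].
  - intros [H1 H2]. pose proof (Nat.divide_pos_le _ _ Hn H2). split; [lia|]. now apply dvb_iff.
Qed.

Lemma divs_NoDup n : NoDup (divs n).
Proof. apply NoDup_filter, seq_NoDup. Qed.

Definition dcount (n : nat) : R := rsum (divs n) (fun _ => 1).

Definition mtrunc (l : list nat) (X : nat) : list (nat * R) :=
  filter (fun de => Nat.leb (fst de) X) (mob l).

(** Up to the factor chi(n), the coefficient of n^-s in the product of L with the mollifier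
    truncated at X. *)
Definition mcoef (l : list nat) (X n : nat) : R :=
  rsum (mtrunc l X) (fun de => if dvb (fst de) n then snd de else 0).

Lemma rsum_filter_le {A} (l : list A) (b : A -> bool) f :
  (forall a, In a l -> 0 <= f a) -> rsum (filter b l) f <= rsum l f.
Proof. intros H. rewrite rsum_filter. apply rsum_le. intros a Ha. specialize (H a Ha). destruct (b a); lra. Qed.

Lemma Rabs_rsum {A} (l : list A) f : Rabs (rsum l f) <= rsum l (fun a => Rabs (f a)).
Proof.
  induction l as [|a l IH]; [unfold rsum; simpl; rewrite Rabs_R0; lra|].
  rewrite !rsum_cons. eapply Rle_trans; [apply Rabs_triang|]. lra.
Qed.

Lemma mcoef_le l X n : NoDup l -> (forall p, In p l -> nprime p) -> (0 < n)%nat ->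
  Rabs (mcoef l X n) <= dcount n.
Proof.
  intros Hn Hl Hn0. unfold mcoef, mtrunc. eapply Rle_trans; [apply Rabs_rsum|].
  eapply Rle_trans; [apply rsum_filter_le; intros; apply Rabs_pos|].
  rewrite (rsum_ext _ _ (fun de => if dvb (fst de) n then 1 else 0)).
  2:{ intros de Hde. destruct (dvb (fst de) n); [now apply (mob_sign l)|apply Rabs_R0]. }
  rewrite <- (rsum_map fst (mob l) (fun d => if dvb d n then 1 else 0)), <- rsum_filter.
  unfold dcount. apply rsum_incl; [now apply NoDup_filter, mob_NoDup| |intros; lra].
  intros d Hd. apply filter_In in Hd. destruct Hd as [H1 H2].
  assert (Hd0 : (0 < d)%nat).
  { apply in_map_iff in H1. destruct H1 as [de [<- H1]]. apply (mob_pos l); [|assumption].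
    intros q Hq; apply Hl, nprime_ge2 in Hq; lia. }
  apply in_divs; [assumption|]. split; [assumption|]. now apply dvb_iff.
Qed.

(** Divisors of n do not exceed X, so the truncation is not felt and [mob_detect] applies. *)
Lemma mcoef_rough l X n : NoDup l -> (forall p, In p l -> nprime p) -> (0 < n <= X)%nat ->
  mcoef l X n = if rough l n then 1 else 0.
Proof.
  intros Hn Hl Hn0. rewrite <- mob_detect by (assumption || lia). unfold mcoef, mtrunc.
  rewrite rsum_filter. apply rsum_ext. intros de Hde.
  destruct (Nat.leb (fst de) X) eqn:E; [reflexivity|]. apply Nat.leb_gt in E.
  destruct (dvb (fst de) n) eqn:E2; [|reflexivity]. exfalso.
  apply dvb_iff in E2; [|lia]. apply Nat.divide_pos_le in E2; lia.
Qed.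

Lemma div_succ d Z : (0 < d)%nat -> (S Z / d = Z / d + if dvb d (S Z) then 1 else 0)%nat.
Proof.
  intros Hd. unfold dvb. pose proof (Nat.div_mod (S Z) d ltac:(lia)) as E1.
  pose proof (Nat.div_mod Z d ltac:(lia)) as E2.
  pose proof (Nat.mod_upper_bound (S Z) d ltac:(lia)). pose proof (Nat.mod_upper_bound Z d ltac:(lia)).
  destruct (Nat.eqb_spec (S Z mod d) 0) as [E|E]; nia.
Qed.

Lemma multiples_csum g d Z : (0 < d)%nat ->
  csum (seq 1 (Z / d)) (fun m => g (d * m)%nat) = csum (seq 1 Z) (fun n => if dvb d n then g n else RtoC 0).
Proof.
  intros Hd; induction Z as [|Z IH].
  - rewrite Nat.Div0.div_0_l; reflexivity.
  - rewrite csum_seq_S, <- IH, div_succ by assumption. simpl (1 + Z)%nat.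
    destruct (dvb d (S Z)) eqn:E.
    + rewrite Nat.add_1_r, csum_seq_S. f_equal. f_equal.
      apply dvb_iff in E; [|assumption]. destruct E as [k Hk].
      assert (Z / d = k - 1)%nat.
      { assert (1 <= k)%nat by nia. symmetry. apply Nat.div_unique with (r := (d - 1)%nat); nia. }
      assert (1 <= k)%nat by nia. rewrite H. nia.
    + rewrite Nat.add_0_r; ring.
Qed.

Lemma multiples_rsum g d Z : (0 < d)%nat ->
  rsum (seq 1 (Z / d)) (fun m => g (d * m)%nat) = rsum (seq 1 Z) (fun n => if dvb d n then g n else 0).
Proof.
  intros Hd. apply RtoC_inj. rewrite <- !csum_RtoC.
  rewrite (multiples_csum (fun n => RtoC (g n)) d Z Hd). apply csum_ext; intros n _. now destruct (dvb d n).
Qed.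

(** Regrouping by n = d m. The inner sums stop at the integer part of Z/d, so that every multiple of
    d up to Z occurs exactly once. *)
Lemma mollified_sum g l X Z : cmult g -> (forall p, In p l -> (0 < p)%nat) ->
  csum (mtrunc l X) (fun de => RtoC (snd de) * g (fst de) * csum (seq 1 (Z / fst de)) g)%C
  = csum (seq 1 Z) (fun n => RtoC (mcoef l X n) * g n)%C.
Proof.
  intros [G1 GM] Hl.
  transitivity (csum (mtrunc l X) (fun de => csum (seq 1 Z) (fun n =>
     RtoC (if dvb (fst de) n then snd de else 0) * g n))%C).
  - apply csum_ext. intros de Hde. unfold mtrunc in Hde. apply filter_In in Hde. destruct Hde as [Hde _].
    pose proof (mob_pos l Hl de Hde) as Hpos.
    transitivity (RtoC (snd de) * csum (seq 1 (Z / fst de)) (fun m => g (fst de * m)%nat))%C.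
    + rewrite <- Cmult_assoc. f_equal. rewrite <- csum_scal. apply csum_ext. intros m Hm. apply in_seq in Hm.
      rewrite GM by lia. reflexivity.
    + rewrite multiples_csum, <- csum_scal by assumption. apply csum_ext. intros n _.
      destruct (dvb (fst de) n); ring.
  - rewrite csum_swap. apply csum_ext. intros n _. unfold mcoef. rewrite <- csum_RtoC.
    rewrite Cmult_comm, <- csum_scal. apply csum_ext. intros; ring.
Qed.

Lemma harmonic_le N : rsum (seq 1 N) (fun n => / INR n) <= 1 + ln (INR (S N)).
Proof.
  assert (H : forall N, rsum (seq 1 N) (fun n => / INR n) <= match N with O => 0 | S _ => 1 + ln (INR N) end).
  { clear N. induction N as [|N IH]; [unfold rsum; simpl; lra|].
    rewrite rsum_seq_S. simpl (1 + N)%nat. destruct N as [|N].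
    - unfold rsum; cbn [seq map fold_right]. change (INR 1) with 1. rewrite ln_1. lra.
    - assert (P : 0 < INR (S N)) by (apply lt_0_INR; lia). rewrite (S_INR (S N)).
      assert (H : / (INR (S N) + 1) <= ln (INR (S N) + 1) - ln (INR (S N))).
      { pose proof (exp_ineq1_le (- / (INR (S N) + 1))) as E.
        assert (E2 : 1 + - / (INR (S N) + 1) = INR (S N) / (INR (S N) + 1)) by (field; lra).
        rewrite E2 in E. apply ln_le in E; [|apply Rdiv_lt_0_compat; lra].
        rewrite ln_exp, ln_div in E by lra. lra. }
      lra. }
  eapply Rle_trans; [apply H|]. destruct N as [|N]; [change (INR 1) with 1; rewrite ln_1; lra|].
  apply Rplus_le_compat_l. apply ln_le; [apply lt_0_INR; lia|]. apply le_INR; lia.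
Qed.

Lemma count_multiples m N : (0 < m)%nat -> rsum (seq 1 N) (fun n => if dvb m n then 1 else 0) <= INR N / INR m.
Proof.
  intros Hm. rewrite <- (multiples_rsum (fun _ => 1) m N Hm), rsum_const, length_seq.
  assert (P : 0 < INR m) by (apply lt_0_INR; lia).
  apply Rmult_le_reg_r with (INR m); [assumption|].
  unfold Rdiv. rewrite !Rmult_1_r, Rmult_assoc, Rinv_l, Rmult_1_r, <- mult_INR by lra.
  apply le_INR. rewrite Nat.mul_comm. apply Nat.Div0.mul_div_le.
Qed.

Lemma dcount_eq N n : (0 < n <= N)%nat -> dcount n = rsum (seq 1 N) (fun d => if dvb d n then 1 else 0).
Proof.
  intros Hn. unfold dcount. rewrite <- rsum_filter.
  apply Rle_antisym.
  - apply rsum_incl; [apply divs_NoDup| |intros; lra]. intros d Hd. apply in_divs in Hd; [|lia].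
    apply filter_In. destruct Hd as [H1 H2]. pose proof (Nat.divide_pos_le d n ltac:(lia) H2).
    split; [apply in_seq; lia|now apply dvb_iff].
  - apply rsum_incl; [apply NoDup_filter, seq_NoDup| |intros; lra]. intros d Hd. apply filter_In in Hd.
    destruct Hd as [H1 H2]. apply in_seq in H1. apply in_divs; [lia|]. split; [lia|]. apply dvb_iff; [lia|assumption].
Qed.

(** The sum is at most that of N / lcm(d, e) over d, e <= N. Here 1 / lcm(d, e) = gcd(d, e) / (d e)
    is one term of the sum of g / (d e) over all common divisors g, and for fixed g the sums over d
    and e separate. Three harmonic sums result. *)
Lemma dcount_sqr_sum N : rsum (seq 1 N) (fun n => dcount n ^ 2) <= INR N * (1 + ln (INR (S N))) ^ 3.
Proof.
  set (H := 1 + ln (INR (S N))). set (h := rsum (seq 1 N) (fun n => / INR n)).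
  assert (Hh : h <= H) by apply harmonic_le.
  assert (Hh0 : 0 <= h).
  { apply rsum_ge0. intros n Hn. apply in_seq in Hn. left; apply Rinv_0_lt_compat, lt_0_INR; lia. }
  set (I := fun d n => if dvb d n then 1 else 0).
  assert (HI : forall d n, 0 <= I d n) by (intros d n; unfold I; destruct (dvb d n); lra).
  rewrite (rsum_ext _ _ (fun n => rsum (seq 1 N) (fun d => rsum (seq 1 N) (fun e => I d n * I e n)))).
  2:{ intros n Hn. apply in_seq in Hn. rewrite (dcount_eq N) by lia. simpl; rewrite Rmult_1_r. apply rsum_mult. }
  rewrite rsum_swap.
  apply Rle_trans with (rsum (seq 1 N) (fun d => rsum (seq 1 N) (fun e =>
     INR N * rsum (seq 1 N) (fun g => INR g * (I g d * / INR d) * (I g e * / INR e))))).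
  - apply rsum_le; intros d Hd. apply in_seq in Hd. rewrite rsum_swap. apply rsum_le; intros e He. apply in_seq in He.
    set (g0 := Nat.gcd d e). set (m := Nat.lcm d e).
    assert (Hg0 : (0 < g0)%nat).
    { unfold g0. destruct (Nat.gcd d e) eqn:E; [|lia]. apply Nat.gcd_eq_0 in E. lia. }
    assert (Hm : (m * g0 = d * e)%nat).
    { unfold m, g0, Nat.lcm. destruct (Nat.gcd_divide_r d e) as [k Hk]. rewrite Hk at 1.
      rewrite Nat.div_mul by (fold g0; lia). rewrite Hk at 2. ring. }
    assert (Hm0 : (0 < m)%nat) by nia.
    apply Rle_trans with (INR N / INR m).
    + eapply Rle_trans; [|apply (count_multiples m N Hm0)]. apply rsum_le; intros n Hn. apply in_seq in Hn.
      unfold I. destruct (dvb d n) eqn:E1; [|destruct (dvb m n); lra].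
      destruct (dvb e n) eqn:E2; [|destruct (dvb m n); lra].
      apply dvb_iff in E1; [|lia]. apply dvb_iff in E2; [|lia].
      replace (dvb m n) with true; [lra|]. symmetry. apply dvb_iff; [assumption|]. now apply Nat.lcm_least.
    + unfold Rdiv. apply Rmult_le_compat_l; [apply pos_INR|].
      assert (Pd : 0 < INR d) by (apply lt_0_INR; lia). assert (Pe : 0 < INR e) by (apply lt_0_INR; lia).
      assert (Pm : 0 < INR m) by (apply lt_0_INR; lia). assert (Pg : 0 < INR g0) by (apply lt_0_INR; lia).
      apply Rle_trans with (rsum [g0] (fun g => INR g * (I g d * / INR d) * (I g e * / INR e))).
      * unfold rsum; simpl. unfold I.
        replace (dvb g0 d) with true by (symmetry; apply dvb_iff; [assumption|apply Nat.gcd_divide_l]).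
        replace (dvb g0 e) with true by (symmetry; apply dvb_iff; [assumption|apply Nat.gcd_divide_r]).
        apply (f_equal INR) in Hm. rewrite !mult_INR in Hm.
        apply Req_le. replace (INR m) with (INR d * INR e / INR g0) by (rewrite <- Hm; field; lra). field; lra.
      * apply rsum_incl; [repeat constructor; intros []| |].
        -- intros x [<-|[]]. apply in_seq. pose proof (Nat.divide_pos_le g0 d ltac:(lia) (Nat.gcd_divide_l d e)). lia.
        -- intros g Hg. apply Rmult_le_pos; [apply Rmult_le_pos; [apply pos_INR|]|];
           (apply Rmult_le_pos; [apply HI|left; apply Rinv_0_lt_compat; assumption]).
  - apply Rle_trans with (INR N * rsum (seq 1 N) (fun g => INR g * (h * / INR g) * (h * / INR g))).
    + rewrite (rsum_ext _ _ (fun d => INR N * rsum (seq 1 N) (fun g => rsum (seq 1 N) (fun e =>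
        INR g * (I g d * / INR d) * (I g e * / INR e))))).
      2:{ intros d _. rewrite rsum_scal. f_equal. apply rsum_swap. }
      rewrite rsum_scal. apply Rmult_le_compat_l; [apply pos_INR|].
      rewrite rsum_swap. apply rsum_le; intros g Hg. apply in_seq in Hg.
      assert (Pg : 0 < INR g) by (apply lt_0_INR; lia).
      rewrite (rsum_ext _ _ (fun d => (INR g * rsum (seq 1 N) (fun e => I g e * / INR e)) * (I g d * / INR d))).
      2:{ intros d _. rewrite rsum_scal. ring. }
      rewrite rsum_scal.
      assert (Hs : rsum (seq 1 N) (fun e => I g e * / INR e) <= h * / INR g).
      { rewrite (rsum_ext _ _ (fun e => if dvb g e then / INR e else 0)) by (intros e _; unfold I; destruct (dvb g e); ring).
        rewrite <- (multiples_rsum (fun e => / INR e)) by lia.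
        rewrite (rsum_ext _ _ (fun m => / INR g * / INR m)).
        2:{ intros m Hm. apply in_seq in Hm. rewrite mult_INR, Rinv_mult. reflexivity. }
        rewrite rsum_scal, Rmult_comm. apply Rmult_le_compat_r; [left; apply Rinv_0_lt_compat; assumption|].
        apply rsum_incl; [apply seq_NoDup| |].
        - intros x Hx. apply in_seq in Hx. apply in_seq. pose proof (Nat.Div0.div_le_upper_bound N g N).
          assert (N / g <= N)%nat by (apply Nat.Div0.div_le_upper_bound; nia). lia.
        - intros x Hx. apply in_seq in Hx. left; apply Rinv_0_lt_compat, lt_0_INR; lia. }
      assert (Hs0 : 0 <= rsum (seq 1 N) (fun e => I g e * / INR e)).
      { apply rsum_ge0. intros e He. apply in_seq in He. apply Rmult_le_pos; [apply HI|left; apply Rinv_0_lt_compat, lt_0_INR; lia]. }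
      apply Rmult_le_compat; [apply Rmult_le_pos; [lra|assumption]|assumption| |assumption].
      apply Rmult_le_compat_l; lra.
    + rewrite (rsum_ext _ _ (fun g => h ^ 2 * / INR g)).
      2:{ intros g Hg. apply in_seq in Hg. field. apply not_0_INR; lia. }
      rewrite rsum_scal. fold h. apply Rmult_le_compat_l; [apply pos_INR|].
      replace (h ^ 2 * h) with (h ^ 3) by ring. apply pow_incr; lra.
Qed.

(** * The k-fold divisor function [tau], and powers of Dirichlet polynomials *)

Fixpoint tau (k n : nat) : R :=
  match k with
  | O => if Nat.eqb n 1 then 1 else 0
  | S k => rsum (divs n) (fun d => tau k (n / d))
  end.

Lemma tau_nonneg k n : 0 <= tau k n.
Proof.
  revert n; induction k as [|k IH]; intros n; simpl; [destruct (Nat.eqb n 1); lra|].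
  apply rsum_ge0; intros; apply IH.
Qed.

Lemma tau_1 k : tau k 1 = 1.
Proof.
  induction k as [|k IH]; [reflexivity|]. simpl tau.
  replace (divs 1) with [1%nat] by reflexivity. unfold rsum; simpl. rewrite IH. ring.
Qed.

(** A divisor of p m either divides m or is p times a divisor of m. The second kind contributes one
    more copy of [tau] at m in each step of the recursion. *)
Lemma tau_prime k p m : nprime p -> (0 < m)%nat -> tau k (p * m) <= INR k * tau k m.
Proof.
  intros Hp. pose proof (nprime_ge2 p Hp) as Hp2.
  revert m; induction k as [|k IH]; intros m Hm.
  - simpl. destruct (Nat.eqb_spec (p * m) 1); [nia|]. lra.
  - cbn [tau].
    apply Rle_trans with (rsum (divs m ++ map (Nat.mul p) (divs m)) (fun d => tau k (p * m / d))).
    + apply rsum_incl; [apply divs_NoDup| |intros; apply tau_nonneg].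
      intros d Hd. apply in_divs in Hd; [|nia]. destruct Hd as [Hd0 [c Hc]].
      apply in_or_app. destruct (classic (Nat.divide p d)) as [[d' Hd']|N].
      * right. apply in_map_iff. exists d'. split; [lia|]. apply in_divs; [assumption|].
        split; [nia|]. exists c. nia.
      * left. apply in_divs; [assumption|]. split; [assumption|].
        destruct (nprime_mult p c d Hp) as [[c' Hc']|]; [exists m; lia| |contradiction].
        exists c'. nia.
    + rewrite rsum_app, rsum_map, S_INR.
      assert (H1 : rsum (divs m) (fun d => tau k (p * m / d)) <= INR k * rsum (divs m) (fun d => tau k (m / d))).
      { rewrite <- rsum_scal. apply rsum_le. intros d Hd. apply in_divs in Hd; [|assumption]. destruct Hd as [Hd0 [c Hc]].
        replace (p * m / d)%nat with (p * (m / d))%nat.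
        - apply IH. rewrite Hc, Nat.div_mul by lia. nia.
        - rewrite Hc, Nat.mul_assoc, !Nat.div_mul by lia. reflexivity. }
      assert (H2 : rsum (divs m) (fun d => tau k (p * m / (p * d))) = rsum (divs m) (fun d => tau k (m / d))).
      { apply rsum_ext. intros d Hd. apply in_divs in Hd; [|assumption]. destruct Hd as [Hd0 _].
        now rewrite Nat.Div0.div_mul_cancel_l by lia. }
      rewrite H2. lra.
Qed.

(** All prime factors of m exceed y and m < y^(w+1), so there are at most w of them, and removing
    one costs a factor k by [tau_prime]. *)
Lemma tau_rough_le k y w m : (1 <= k)%nat -> 0 < y -> (0 < m)%nat ->
  (forall p, nprime p -> Nat.divide p m -> y < INR p) -> INR m < y ^ S w -> tau k m <= INR k ^ w.
Proof.
  intros Hk Hy. assert (K1 : 1 <= INR k) by (apply (le_INR 1); lia).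
  revert m; induction w as [|w IH]; intros m Hm HR Hlt.
  - destruct (Nat.eq_dec m 1) as [->|N1]; [rewrite tau_1; simpl; lra|].
    destruct (nprime_divisor m) as [p [Hp Hd]]; [lia|]. specialize (HR p Hp Hd).
    apply Nat.divide_pos_le in Hd; [|assumption]. apply le_INR in Hd. simpl in Hlt. lra.
  - destruct (Nat.eq_dec m 1) as [->|N1]; [rewrite tau_1; apply pow_R1_Rle; lra|].
    destruct (nprime_divisor m) as [p [Hp Hd]]; [lia|]. pose proof (HR p Hp Hd) as Hpy.
    destruct Hd as [m' Em]. rewrite Nat.mul_comm in Em. subst m.
    assert (Hm' : (0 < m')%nat) by nia.
    eapply Rle_trans; [now apply tau_prime|]. simpl pow. apply Rmult_le_compat_l; [lra|].
    apply IH; [assumption| |].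
    + intros r Hr Hd. apply HR; [assumption|]. now apply Nat.divide_mul_r.
    + rewrite mult_INR in Hlt. change (y ^ S (S w)) with (y * y ^ S w) in Hlt.
      assert (0 < INR m') by (apply lt_0_INR; lia). nra.
Qed.

(** All k-fold products with multiplicity: their counts are the coefficients of the k-th power of a
    Dirichlet polynomial supported on B, as [plist_csum] shows. *)
Fixpoint plist (B : list nat) (k : nat) : list nat :=
  match k with
  | O => [1%nat]
  | S k => flat_map (fun n => map (Nat.mul n) (plist B k)) B
  end.

Lemma plist_range B k N : (1 <= N)%nat -> (forall n, In n B -> (N < n <= 2 * N)%nat) ->
  forall m, In m (plist B k) -> (N ^ k <= m <= (2 * N) ^ k)%nat /\ (0 < m)%nat.
Proof.
  intros HN HB; induction k as [|k IH]; intros m Hm; simpl in Hm.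
  - destruct Hm as [<-|[]]. simpl; lia.
  - apply in_flat_map in Hm. destruct Hm as [n [Hn Hm]]. apply in_map_iff in Hm. destruct Hm as [m' [<- Hm']].
    specialize (IH m' Hm'). specialize (HB n Hn). rewrite !Nat.pow_succ_r'.
    split; [split; apply Nat.mul_le_mono; lia|nia].
Qed.

Lemma plist_csum g B k : cmult g -> (forall n, In n B -> (0 < n)%nat) ->
  csum (plist B k) g = (csum B g ^ k)%C.
Proof.
  intros [G1 GM] HB.
  assert (Hpos : forall k m, In m (plist B k) -> (0 < m)%nat).
  { clear k; induction k as [|k IH]; intros m Hm; simpl in Hm; [destruct Hm as [<-|[]]; lia|].
    apply in_flat_map in Hm. destruct Hm as [n [Hn Hm]]. apply in_map_iff in Hm. destruct Hm as [m' [<- Hm']].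
    specialize (IH m' Hm'). specialize (HB n Hn). nia. }
  induction k as [|k IH]; [unfold csum; simpl; rewrite G1; ring|].
  cbn [plist Cpow]. rewrite csum_flat_map, <- IH, csum_mult. apply csum_ext. intros n Hn.
  rewrite csum_map. apply csum_ext. intros m Hm. apply GM; [auto|now apply (Hpos k)].
Qed.

Lemma csum_count g (T : list nat) M : (forall m, In m T -> (1 <= m <= M)%nat) ->
  csum T g = csum (seq 1 M) (fun m => RtoC (INR (count_occ Nat.eq_dec T m)) * g m)%C.
Proof.
  induction T as [|t T IH]; intros HT.
  - transitivity (RtoC 0); [reflexivity|].
    transitivity (csum (seq 1 M) (fun _ => RtoC 0)); [now rewrite csum_0|].
    apply csum_ext; intros; simpl; ring.
  - rewrite csum_cons, IH by (intros; apply HT; now right).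
    rewrite (csum_ext _ (fun m => RtoC (INR (count_occ Nat.eq_dec (t :: T) m)) * g m)%C
      (fun m => (if Nat.eq_dec t m then g m else RtoC 0) + RtoC (INR (count_occ Nat.eq_dec T m)) * g m)%C).
    + rewrite csum_plus. f_equal. specialize (HT t ltac:(now left)).
      replace M with ((t - 1) + (1 + (M - t)))%nat by lia.
      rewrite csum_seq_add, csum_seq_add.
      rewrite (csum_ext (seq 1 (t - 1)) _ (fun _ => RtoC 0)), csum_0.
      2:{ intros x Hx. apply in_seq in Hx. destruct (Nat.eq_dec t x); [lia|reflexivity]. }
      rewrite (csum_ext (seq (1 + (t - 1) + 1) _) _ (fun _ => RtoC 0)), csum_0.
      2:{ intros x Hx. apply in_seq in Hx. destruct (Nat.eq_dec t x); [lia|reflexivity]. }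
      replace (1 + (t - 1))%nat with t by lia. unfold csum; simpl.
      destruct (Nat.eq_dec t t); [ring|congruence].
    + intros m _. simpl. destruct (Nat.eq_dec t m); [rewrite S_INR, RtoC_plus|]; ring.
Qed.

Lemma rsum_count_total (T : list nat) M : (forall m, In m T -> (1 <= m <= M)%nat) ->
  rsum (seq 1 M) (fun m => INR (count_occ Nat.eq_dec T m)) = INR (length T).
Proof.
  intros HT. apply RtoC_inj. rewrite <- csum_RtoC.
  rewrite (csum_ext _ _ (fun m => RtoC (INR (count_occ Nat.eq_dec T m)) * RtoC 1)%C) by (intros; ring).
  rewrite <- (csum_count (fun _ => RtoC 1) T M HT), csum_const. ring.
Qed.

Lemma plist_length B k : length (plist B k) = (length B ^ k)%nat.
Proof.
  induction k as [|k IH]; [reflexivity|]. simpl. rewrite <- IH. clear IH. generalize (plist B k); intros T.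
  induction B as [|b B IH]; [reflexivity|]. simpl. rewrite length_app, length_map. lia.
Qed.

Lemma count_occ_plist B k m : NoDup B -> (forall n, In n B -> (0 < n)%nat) -> (0 < m)%nat ->
  INR (count_occ Nat.eq_dec (plist B k) m) <= tau k m.
Proof.
  intros HN HB. revert m; induction k as [|k IH]; intros m Hm.
  - cbn [plist tau count_occ].
    destruct (Nat.eq_dec 1 m) as [E|E]; destruct (Nat.eqb_spec m 1); try lia; simpl; lra.
  - cbn [plist tau].
    assert (E : forall L, (forall n, In n L -> (0 < n)%nat) -> INR (count_occ Nat.eq_dec (flat_map (fun n => map (Nat.mul n) (plist B k)) L) m)
       = rsum (filter (fun n => dvb n m) L) (fun n => INR (count_occ Nat.eq_dec (plist B k) (m / n)%nat))).
    { induction L as [|n L IHL]; intros HL; [reflexivity|]. simpl flat_map. rewrite count_occ_app, plus_INR, IHL by (intros; apply HL; now right).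
      simpl filter. specialize (HL n ltac:(now left)). destruct (dvb n m) eqn:Ed.
      - rewrite rsum_cons. apply Rplus_eq_compat_r, f_equal. apply dvb_iff in Ed; [|assumption]. destruct Ed as [c Hc].
        rewrite Hc, Nat.div_mul by lia. generalize (plist B k); intros T.
        induction T as [|t T IHT]; [reflexivity|]. simpl.
        destruct (Nat.eq_dec (n * t) (c * n)), (Nat.eq_dec t c); try (now rewrite IHT); exfalso; nia.
      - assert (E0 : count_occ Nat.eq_dec (map (Nat.mul n) (plist B k)) m = 0%nat); [|rewrite E0; simpl; ring].
        apply count_occ_not_In. intros Hi. apply in_map_iff in Hi. destruct Hi as [t [Et _]].
        assert (dvb n m = true) by (apply dvb_iff; [assumption|exists t; lia]). congruence. }
    rewrite E by assumption.
    apply Rle_trans with (rsum (filter (fun n => dvb n m) B) (fun n => tau k (m / n))).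
    + apply rsum_le. intros n Hn. apply filter_In in Hn. destruct Hn as [H1 H2].
      apply IH. specialize (HB n H1). apply dvb_iff in H2; [|assumption]. destruct H2 as [c Hc].
      rewrite Hc, Nat.div_mul by lia. nia.
    + apply rsum_incl; [now apply NoDup_filter| |intros; apply tau_nonneg].
      intros n Hn. apply filter_In in Hn. destruct Hn as [H1 H2]. specialize (HB n H1).
      apply in_divs; [assumption|]. split; [assumption|now apply dvb_iff].
Qed.

(** * The logarithm series and the Euler product *)

Definition lterm (z : C) (k : nat) : C := (z ^ S k / RtoC (INR (S k)))%C.

(** The power series of -log(1 - z); the index in [lterm] starts at the power 1. *)
Definition lam (z : C) : C := CSeries (lterm z).

Lemma RtoC_nz x : x <> 0 -> RtoC x <> RtoC 0.
Proof. intros H E; now apply RtoC_inj in E. Qed.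

Lemma INR_S_nz k : RtoC (INR (S k)) <> RtoC 0.
Proof. apply RtoC_nz, not_0_INR; lia. Qed.

Lemma lterm_le z k : Cmod (lterm z k) <= Cmod z ^ S k.
Proof.
  unfold lterm. rewrite Cmod_div, Cmod_pow, Cmod_RtoC_nonneg by (try apply pos_INR; apply INR_S_nz).
  assert (1 <= INR (S k)) by (apply (le_INR 1); lia). assert (0 <= Cmod z ^ S k) by (apply pow_le, Cmod_ge_0).
  apply Rmult_le_reg_r with (INR (S k)); [lra|]. unfold Rdiv. rewrite Rmult_assoc, Rinv_l by lra. nra.
Qed.

Lemma geom_sum_le r m N : 0 <= r < 1 -> rsum (seq m N) (fun k => r ^ k) <= r ^ m / (1 - r).
Proof.
  intros Hr. assert (E : rsum (seq m N) (fun k => r ^ k) = (r ^ m - r ^ (m + N)) / (1 - r)).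
  { induction N as [|N IH]; [rewrite Nat.add_0_r; unfold rsum; simpl; field; lra|].
    rewrite rsum_seq_S, IH, Nat.add_succ_r. simpl. field; lra. }
  rewrite E. apply Rmult_le_compat_r; [left; apply Rinv_0_lt_compat; lra|].
  assert (0 <= r ^ (m + N)) by (apply pow_le; lra). lra.
Qed.

Lemma lterm_sum_le z m N : Cmod z < 1 ->
  rsum (seq m N) (fun k => Cmod (lterm z k)) <= Cmod z ^ S m / (1 - Cmod z).
Proof.
  intros Hz. pose proof (Cmod_ge_0 z). apply Rle_trans with (rsum (seq (m + 1) N) (fun k => Cmod z ^ k)).
  - rewrite rsum_seq_shift. apply rsum_le; intros k _. rewrite Nat.add_1_r. apply lterm_le.
  - replace (m + 1)%nat with (S m) by lia. apply geom_sum_le; lra.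
Qed.

Lemma lam_cser z : Cmod z < 1 -> cser (lterm z) (lam z).
Proof.
  intros Hz. apply cser_CSeries_ex.
  apply (cser_ex _ (fun k => Cmod (lterm z k)) (Cmod z ^ 1 / (1 - Cmod z))); [intros; lra|].
  intros N; now apply lterm_sum_le.
Qed.

Lemma lam_tail z N : Cmod z < 1 -> Cmod (lam z - csum (seq 0 N) (lterm z)) <= Cmod z ^ S N / (1 - Cmod z).
Proof.
  intros Hz. apply cser_tail; [now apply lam_cser|]. intros M.
  eapply Rle_trans; [apply Cmod_csum|]. now apply lterm_sum_le.
Qed.

Lemma lam_bound z : Cmod z < 1 -> Cmod (lam z) <= Cmod z / (1 - Cmod z).
Proof.
  intros Hz. pose proof (lam_tail z 0 Hz) as H. unfold csum in H; simpl in H.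
  replace (lam z - RtoC 0)%C with (lam z) in H by ring. now rewrite Rmult_1_r in H.
Qed.

Lemma cser_shift a l : cser a l -> cser (fun n => a (S n)) (l - a 0%nat)%C.
Proof.
  intros H eps He. destruct (H eps He) as [N0 HN]. exists N0; intros N HN'.
  specialize (HN (S N) ltac:(lia)).
  rewrite (csum_ext _ _ (fun n => a (n + 1)%nat)) by (intros; f_equal; lia).
  rewrite <- csum_seq_shift.
  assert (E : csum (seq 0 (S N)) a = (a 0%nat + csum (seq (0 + 1) N) a)%C) by reflexivity.
  rewrite E in HN.
  now replace (csum (seq (0 + 1) N) a - (l - a 0%nat))%C with (a 0%nat + csum (seq (0 + 1) N) a - l)%C by ring.
Qed.

Lemma lam_shift z : Cmod z < 1 -> CSeries (fun k => lterm z (S k)) = (lam z - z)%C.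
Proof.
  intros Hz. apply cser_CSeries. pose proof (cser_shift _ _ (lam_cser z Hz)) as H.
  replace (lterm z 0) with z in H by (unfold lterm; simpl; field). exact H.
Qed.

(* Along [t |-> t z] the derivative of [exp (partial sum) * (1 - t z)] is
   [- z (t z)^N exp (partial sum)]. *)
Lemma lam_exp z : Cmod z < 1 -> (Cexp (lam z) * (RtoC 1 - z))%C = RtoC 1.
Proof.
  intros Hz. pose proof (Cmod_ge_0 z) as Pz.
  set (LN := fun N t => csum (seq 0 N) (lterm (RtoC t * z)%C)).
  set (b := Cmod z / (1 - Cmod z)).
  assert (HLb : forall N t, 0 <= t <= 1 -> Cmod (LN N t) <= b).
  { intros N t Ht. eapply Rle_trans; [apply Cmod_csum|].
    assert (Hm : Cmod (RtoC t * z) <= Cmod z) by (rewrite Cmod_mult, Cmod_RtoC_nonneg by lra; nra).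
    eapply Rle_trans; [apply lterm_sum_le; lra|]. unfold b. rewrite pow_1.
    apply Rmult_le_compat; [apply Cmod_ge_0|left; apply Rinv_0_lt_compat; lra|assumption|].
    apply Rinv_le_contravar; lra. }
  assert (HLd : forall N t, cderiv (LN N) t (z * csum (seq 0 N) (fun k => (RtoC t * z) ^ k))%C).
  { intros N t; induction N as [|N IH].
    - eapply cderiv_ext; [| |apply (cderiv_const (RtoC 0))]; intros; unfold LN, csum; simpl; ring.
    - assert (T : cderiv (fun x => lterm (RtoC x * z)%C N) t (z * (RtoC t * z) ^ N)%C).
      { eapply cderiv_ext; [| |apply (cderiv_scal (/ RtoC (INR (S N)))%C), (cderiv_pow z N)].
        - intros x. unfold lterm, Cdiv; ring.
        - field. apply INR_S_nz. }
      eapply cderiv_ext; [| |apply (cderiv_plus _ _ _ _ _ IH T)].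
      + intros x; unfold LN. rewrite csum_seq_S. reflexivity.
      + rewrite csum_seq_S, Cmult_plus_distr_l. reflexivity. }
  assert (Hgeo : forall N w, ((RtoC 1 - w) * csum (seq 0 N) (fun k => w ^ k) = RtoC 1 - w ^ N)%C).
  { intros N w; induction N as [|N IH]; [unfold csum; simpl; ring|].
    rewrite csum_seq_S, Cmult_plus_distr_l, IH. simpl. ring. }
  assert (HN : forall N, Cmod (Cexp (LN N 1) * (RtoC 1 - z) - RtoC 1) <= exp b * Cmod z ^ S N).
  { intros N. set (f := fun t => (Cexp (LN N t) * (RtoC 1 - RtoC t * z))%C).
    assert (H : Cmod (f 1 - f 0) <= exp b * Cmod z ^ S N * (1 - 0)).
    { apply cderiv_mvt with (df := fun t => (- Cexp (LN N t) * z * (RtoC t * z) ^ N)%C); [lra| |].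
      - intros t Ht. eapply cderiv_ext; [reflexivity| |apply cderiv_mult].
        2:{ apply cderiv_Cexp, HLd. }
        2:{ apply cderiv_minus; [apply cderiv_const|].
            eapply cderiv_ext; [| |apply (cderiv_mult (fun t => RtoC t) (fun _ => z) t (RtoC 1) (RtoC 0))].
            - reflexivity.
            - reflexivity.
            - apply cderiv_RtoC, is_derive_Rid.
            - apply cderiv_const. }
        cbv beta. pose proof (Hgeo N (RtoC t * z)%C) as G.
        transitivity (Cexp (LN N t) * z * ((RtoC 1 - RtoC t * z) * csum (seq 0 N) (fun k => (RtoC t * z) ^ k) - RtoC 1))%C; [ring|].
        rewrite G. ring.
      - intros t Ht. rewrite !Cmod_mult, Cmod_opp, Cmod_Cexp.
        assert (Hm : Cmod (RtoC t * z) <= Cmod z) by (rewrite Cmod_mult, Cmod_RtoC_nonneg by lra; nra).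
        rewrite Rmult_assoc. apply Rmult_le_compat; [left; apply exp_pos|apply Rmult_le_pos; apply Cmod_ge_0| |].
        + apply exp_le. eapply Rle_trans; [apply Rle_abs|]. eapply Rle_trans; [apply re_le_Cmod|]. now apply HLb.
        + rewrite Cmod_pow. simpl. apply Rmult_le_compat_l; [apply Cmod_ge_0|].
          apply pow_incr; split; [apply Cmod_ge_0|assumption]. }
    unfold f in H.
    assert (E0 : LN N 0 = RtoC 0).
    { unfold LN. rewrite (csum_ext _ _ (fun _ => RtoC 0)), csum_0; [reflexivity|].
      intros k _. unfold lterm. simpl Cpow. unfold Cdiv. ring. }
    rewrite E0, Cexp_0 in H.
    replace (Cexp (LN N 1) * (RtoC 1 - RtoC 1 * z) - RtoC 1 * (RtoC 1 - RtoC 0 * z))%C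
      with (Cexp (LN N 1) * (RtoC 1 - z) - RtoC 1)%C in H by ring. lra. }
  assert (EL : forall N, LN N 1 = csum (seq 0 N) (lterm z)).
  { intros N. unfold LN. now replace (RtoC 1 * z)%C with z by ring. }
  apply NNPP; intros Hne.
  set (d := Cmod (Cexp (lam z) * (RtoC 1 - z) - RtoC 1)).
  assert (Hd : 0 < d).
  { apply Cmod_gt_0. intros E. apply Hne. replace (Cexp (lam z) * (RtoC 1 - z))%C
      with (Cexp (lam z) * (RtoC 1 - z) - RtoC 1 + RtoC 1)%C by ring. rewrite E; ring. }
  set (F := fun w => (Cexp w * (RtoC 1 - z))%C).
  assert (HF : ccont F (lam z)) by (apply ccont_mult; [apply ccont_Cexp|apply ccont_const]).
  destruct (HF (d / 2)) as [e [He HFe]]; [lra|].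
  destruct (lam_cser z Hz e He) as [N1 H1].
  pose proof (exp_pos b) as Peb.
  destruct (pow_lt_1_zero (Cmod z)) with (y := d / (2 * exp b)) as [N2 H2];
    [rewrite Rabs_pos_eq; lra|apply Rdiv_lt_0_compat; lra|].
  specialize (H1 (N1 + N2)%nat ltac:(lia)). specialize (H2 (S (N1 + N2)) ltac:(lia)). specialize (HN (N1 + N2)%nat).
  rewrite Rabs_pos_eq in H2 by (now apply pow_le).
  apply HFe in H1. rewrite EL in HN. unfold F in H1.
  set (U := Cexp (csum (seq 0 (N1 + N2)) (lterm z))) in *.
  apply Rmult_lt_compat_l with (r := exp b) in H2; [|assumption].
  replace (exp b * (d / (2 * exp b))) with (d / 2) in H2 by (field; lra).
  assert (d <= Cmod (U * (RtoC 1 - z) - RtoC 1) + Cmod (U * (RtoC 1 - z) - Cexp (lam z) * (RtoC 1 - z))).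
  { unfold d. replace (Cexp (lam z) * (RtoC 1 - z) - RtoC 1)%C
      with ((U * (RtoC 1 - z) - RtoC 1) - (U * (RtoC 1 - z) - Cexp (lam z) * (RtoC 1 - z)))%C by ring.
    unfold Cminus at 1. eapply Rle_trans; [apply Cmod_triangle|]. rewrite Cmod_opp. lra. }
  lra.
Qed.

Lemma Cpow_diff z w r k : Cmod z <= r -> Cmod w <= r ->
  Cmod (z ^ S k - w ^ S k) <= INR (S k) * r ^ k * Cmod (z - w).
Proof.
  intros Hz Hw. assert (Hr : 0 <= r) by (pose proof (Cmod_ge_0 z); lra).
  induction k as [|k IH].
  - simpl. replace (z * RtoC 1 - w * RtoC 1)%C with (z - w)%C by ring. lra.
  - replace (z ^ S (S k) - w ^ S (S k))%C with (z * (z ^ S k - w ^ S k) + (z - w) * w ^ S k)%C by (simpl; ring).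
    eapply Rle_trans; [apply Cmod_triangle|]. rewrite !Cmod_mult, Cmod_pow.
    assert (A : Cmod z * Cmod (z ^ S k - w ^ S k) <= r * (INR (S k) * r ^ k * Cmod (z - w)))
      by (apply Rmult_le_compat; try apply Cmod_ge_0; assumption).
    assert (B : Cmod (z - w) * Cmod w ^ S k <= Cmod (z - w) * r ^ S k).
    { apply Rmult_le_compat_l; [apply Cmod_ge_0|]. apply pow_incr; split; [apply Cmod_ge_0|assumption]. }
    rewrite (S_INR (S k)). simpl pow in *. lra.
Qed.

Lemma lam_lip z w r : Cmod z <= r -> Cmod w <= r -> r < 1 -> Cmod (lam z - lam w) <= Cmod (z - w) / (1 - r).
Proof.
  intros Hz Hw Hr. assert (Hr0 : 0 <= r) by (pose proof (Cmod_ge_0 z); lra).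
  assert (H : cser (fun k => lterm z k + - RtoC 1 * lterm w k)%C (lam z + - RtoC 1 * lam w)%C).
  { apply cser_plus; [apply lam_cser; lra|apply cser_scal, lam_cser; lra]. }
  replace (lam z - lam w)%C with (lam z + - RtoC 1 * lam w)%C by ring.
  apply (cser_bound _ _ _ H). intros M. eapply Rle_trans; [apply Cmod_csum|].
  apply Rle_trans with (rsum (seq 0 M) (fun k => Cmod (z - w) * r ^ k)).
  - apply rsum_le; intros k _.
    replace (lterm z k + - RtoC 1 * lterm w k)%C with ((z ^ S k - w ^ S k) / RtoC (INR (S k)))%C
      by (unfold lterm, Cdiv; ring).
    rewrite Cmod_div, Cmod_RtoC_nonneg by (try apply pos_INR; apply INR_S_nz).
    assert (P : 0 < INR (S k)) by (apply lt_0_INR; lia).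
    apply Rmult_le_reg_r with (INR (S k)); [assumption|]. unfold Rdiv. rewrite Rmult_assoc, Rinv_l by lra.
    rewrite Rmult_1_r. eapply Rle_trans; [apply (Cpow_diff z w r); assumption|]. lra.
  - rewrite rsum_scal. apply Rmult_le_compat_l; [apply Cmod_ge_0|].
    eapply Rle_trans; [apply geom_sum_le; lra|]. simpl. unfold Rdiv. lra.
Qed.

Lemma ccont_lam z : Cmod z < 1 -> ccont lam z.
Proof.
  intros Hz eps He. set (r := (1 + Cmod z) / 2). assert (Hr : Cmod z < r < 1) by (unfold r; lra).
  exists (Rmin (r - Cmod z) (eps * (1 - r))). split; [apply Rmin_glb_lt; [lra|apply Rmult_lt_0_compat; lra]|].
  intros w Hw. pose proof (Rmin_l (r - Cmod z) (eps * (1 - r))). pose proof (Rmin_r (r - Cmod z) (eps * (1 - r))).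
  pose proof (Cmod_triangle_inv w z).
  eapply Rle_lt_trans; [apply (lam_lip w z r); lra|].
  apply Rmult_lt_reg_r with (1 - r); [lra|]. unfold Rdiv. rewrite Rmult_assoc, Rinv_l by lra. lra.
Qed.

(** Written so that [primes_le y] is convertible with [primesN] at the integer part of y. *)
Definition primesN (N : nat) : list nat :=
  filter (fun n => if prime_dec (Z.of_nat n) then true else false) (seq 0 (S N)).

Lemma in_primesN p N : In p (primesN N) <-> nprime p /\ (p <= N)%nat.
Proof.
  unfold primesN. rewrite filter_In, in_seq. unfold nprime.
  destruct (prime_dec (Z.of_nat p)) as [H|H]; intuition (try discriminate; try lia).
Qed.

Lemma primesN_NoDup N : NoDup (primesN N).
Proof. apply NoDup_filter, seq_NoDup. Qed.

Lemma primesN_pos N p : In p (primesN N) -> (0 < p)%nat.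
Proof. intros H; apply in_primesN in H; destruct H as [H _]; apply nprime_ge2 in H; lia. Qed.

Lemma primesN_prime N p : In p (primesN N) -> nprime p.
Proof. intros H; now apply in_primesN in H. Qed.

Lemma primesN_csum N f :
  csum (primesN N) f = csum (seq 0 (S N)) (fun n => if prime_dec (Z.of_nat n) then f n else RtoC 0).
Proof.
  unfold primesN. rewrite csum_filter. apply csum_ext; intros n _. now destruct (prime_dec (Z.of_nat n)).
Qed.

Lemma rough_primesN N n : (0 < n)%nat -> rough (primesN N) n = true -> n = 1%nat \/ (N < n)%nat.
Proof.
  intros Hn HR. destruct (Nat.eq_dec n 1) as [|N1]; [now left|right].
  destruct (nprime_divisor n) as [p [Hp Hd]]; [lia|].
  apply Nat.nle_gt; intros Hle. unfold rough in HR. rewrite forallb_forall in HR.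
  assert (Hin : In p (primesN N)).
  { apply in_primesN. split; [assumption|]. apply Nat.divide_pos_le in Hd; lia. }
  specialize (HR p Hin). apply nprime_ge2 in Hp. apply dvb_iff in Hd; [|lia]. rewrite Hd in HR. discriminate.
Qed.

(** The abstraction of chi(n) n^-s. It also covers |chi(n)| n^-sigma and chi(n)^2 n^-s, which the
    3-4-1 argument needs beside it. *)
Definition gdom (sigma : R) (g : nat -> C) : Prop :=
  cmult g /\ forall n, (1 <= n)%nat -> Cmod (g n) <= Rpower (INR n) (- sigma).

Lemma gdom_le1 sigma g n : gdom sigma g -> 0 <= sigma -> (1 <= n)%nat -> Cmod (g n) <= 1.
Proof.
  intros [_ H] Hs Hn. eapply Rle_trans; [now apply H|].
  assert (1 <= INR n) by (apply (le_INR 1); lia).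
  rewrite <- (Rpower_O (INR n)) by lra. apply Rle_Rpower; lra.
Qed.

Lemma list_bound {A} (l : list A) (f : A -> nat) : exists D, (1 <= D)%nat /\ forall a, In a l -> (f a <= D)%nat.
Proof.
  induction l as [|a l [D [H1 H2]]]; [exists 1%nat; split; [lia|intros _ []]|].
  exists (D + f a)%nat; split; [lia|]. intros b [<-|Hb]; [lia|]. specialize (H2 b Hb); lia.
Qed.

Lemma gdom_tail sigma g N M : gdom sigma g -> 1 < sigma -> (1 <= N)%nat ->
  rsum (seq (S N) M) (fun n => Cmod (g n)) <= Rpower (INR N) (1 - sigma) / (sigma - 1).
Proof.
  intros [_ Hg] Hs HN. eapply Rle_trans; [|apply (power_sum_tail sigma N M Hs HN)].
  apply rsum_le; intros n Hn. apply in_seq in Hn. apply Hg; lia.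
Qed.

Lemma rough_sum_mob g l Z : cmult g -> NoDup l -> (forall p, In p l -> nprime p) ->
  csum (mob l) (fun de => RtoC (snd de) * g (fst de) * csum (seq 1 (Z / fst de)) g)%C
  = csum (seq 1 Z) (fun n => if rough l n then g n else RtoC 0).
Proof.
  intros Hg Hn Hl. destruct (list_bound (mob l) fst) as [D [_ HD]].
  assert (E : mtrunc l (Z + D) = mob l).
  { unfold mtrunc. apply forallb_filter_id, forallb_forall.
    intros de Hde. apply Nat.leb_le. specialize (HD de Hde). lia. }
  assert (M := mollified_sum g l (Z + D) Z Hg). rewrite E in M. rewrite M.
  - apply csum_ext. intros n Hn'. apply in_seq in Hn'. rewrite mcoef_rough by (assumption || lia).
    destruct (rough l n); ring.
  - intros p Hp. apply Hl, nprime_ge2 in Hp; lia.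
Qed.

(** Multiplying the series by the expanded product leaves 1 and the terms free of primes up to N,
    all of which have n > N. *)
Theorem euler_product_error sigma g G N : gdom sigma g -> 1 < sigma -> (1 <= N)%nat ->
  cser (fun n => g (S n)) G ->
  Cmod (cprod (primesN N) (fun p => RtoC 1 - g p) * G - RtoC 1)%C <= Rpower (INR N) (1 - sigma) / (sigma - 1).
Proof.
  intros Hg Hs HN HG. set (l := primesN N). set (T := Rpower (INR N) (1 - sigma) / (sigma - 1)).
  set (U := fun Z => csum (mob l) (fun de => RtoC (snd de) * g (fst de) * csum (seq 1 (Z / fst de)) g)%C).
  assert (HU : forall Z, (N <= Z)%nat -> Cmod (U Z - RtoC 1) <= T).
  { intros Z HZ. unfold U. rewrite rough_sum_mob; [|apply Hg|apply primesN_NoDup|apply primesN_prime].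
    replace Z with (1 + (Z - 1))%nat by lia. rewrite csum_seq_add.
    assert (E1 : csum (seq 1 1) (fun n => if rough l n then g n else RtoC 0) = RtoC 1).
    { unfold csum; cbn [seq map fold_right].
      assert (Hr : rough l 1 = true).
      { unfold rough. apply forallb_forall. intros p Hp. apply in_primesN in Hp. destruct Hp as [Hp _].
        apply nprime_ge2 in Hp. destruct (dvb p 1) eqn:E; [|reflexivity].
        apply dvb_iff in E; [|lia]. apply Nat.divide_1_r in E. lia. }
      rewrite Hr. destruct Hg as [[G1 _] _]. rewrite G1. ring. }
    rewrite E1. match goal with |- Cmod (RtoC 1 + ?X - RtoC 1)%C <= _ => replace (RtoC 1 + X - RtoC 1)%C with X by ring end.
    eapply Rle_trans; [apply Cmod_csum|].
    apply Rle_trans with (rsum (seq (S N) (Z - N)) (fun n => Cmod (g n))); [|now apply gdom_tail].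
    replace (Z - 1)%nat with ((N - 1) + (Z - N))%nat by lia. rewrite seq_app, rsum_app.
    rewrite (rsum_ext (seq (1 + 1) (N - 1)) _ (fun _ => 0)), rsum_0, Rplus_0_l.
    - replace (1 + 1 + (N - 1))%nat with (S N) by lia. apply rsum_le. intros n _.
      destruct (rough l n); [lra|]. rewrite Cmod_0. apply Cmod_ge_0.
    - intros n Hn. apply in_seq in Hn. destruct (rough l n) eqn:E; [|apply Cmod_0].
      apply rough_primesN in E; lia. }
  assert (EP : cprod l (fun p => RtoC 1 - g p)%C = csum (mob l) (fun de => RtoC (snd de) * g (fst de))%C)
    by (apply mob_prod; [apply Hg|apply primesN_pos]).
  apply le_epsilon. intros eps He.
  destruct (list_bound (mob l) fst) as [D [HD1 HD]].
  set (K := INR (length (mob l)) + 1). assert (HK : 0 < K) by (unfold K; pose proof (pos_INR (length (mob l))); lra).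
  destruct (HG (eps / K)) as [N0 HN0]; [apply Rdiv_lt_0_compat; assumption|].
  (* Long enough for each of the finitely many inner sums, of length Z/d with d <= D, to be within
     eps/K of G. *)
  set (Z := (N + D * (N0 + 1))%nat). specialize (HU Z ltac:(unfold Z; lia)).
  assert (HD2 : Cmod (U Z - cprod l (fun p => RtoC 1 - g p) * G)%C <= eps).
  { rewrite EP, Cmult_comm, <- csum_scal. unfold U. rewrite <- csum_minus.
    eapply Rle_trans; [apply Cmod_csum|].
    apply Rle_trans with (rsum (mob l) (fun _ => eps / K)).
    - apply rsum_le. intros de Hde.
      assert (Hpos : (0 < fst de)%nat) by (apply (mob_pos l); [apply primesN_pos|assumption]).
      replace (RtoC (snd de) * g (fst de) * csum (seq 1 (Z / fst de)) g - G * (RtoC (snd de) * g (fst de)))%C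
        with (RtoC (snd de) * g (fst de) * (csum (seq 1 (Z / fst de)) g - G))%C by ring.
      rewrite !Cmod_mult, Cmod_R, (mob_sign l) by assumption.
      pose proof (gdom_le1 sigma g (fst de) Hg ltac:(lra) Hpos). pose proof (Cmod_ge_0 (g (fst de))).
      assert (HZd : (N0 <= Z / fst de)%nat).
      { apply Nat.div_le_lower_bound; [lia|]. specialize (HD de Hde). unfold Z. nia. }
      specialize (HN0 _ HZd).
      rewrite (csum_ext _ _ (fun n => g (n + 1)%nat)), <- csum_seq_shift in HN0 by (intros; f_equal; lia).
      simpl (0 + 1)%nat in HN0. pose proof (Cmod_ge_0 (csum (seq 1 (Z / fst de)) g - G)). nra.
    - rewrite rsum_const. unfold Rdiv. rewrite <- Rmult_assoc.
      apply Rmult_le_reg_r with K; [assumption|]. rewrite Rmult_assoc, Rinv_l by lra. unfold K. nra. }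
  replace (cprod l (fun p => RtoC 1 - g p) * G - RtoC 1)%C
    with ((U Z - RtoC 1) - (U Z - cprod l (fun p => RtoC 1 - g p) * G))%C by ring.
  unfold Cminus at 1. eapply Rle_trans; [apply Cmod_triangle|]. rewrite Cmod_opp. lra.
Qed.

Lemma gdom_prime_le sigma g p : gdom sigma g -> 1 <= sigma -> nprime p -> Cmod (g p) <= / 2.
Proof.
  intros [_ H] Hs Hp. apply nprime_ge2 in Hp. eapply Rle_trans; [apply H; lia|].
  assert (2 <= INR p) by (apply (le_INR 2); lia).
  apply Rle_trans with (Rpower (INR p) (Ropp 1)); [apply Rle_Rpower; lra|].
  rewrite Rpower_Ropp, Rpower_1 by lra. apply Rinv_le_contravar; lra.
Qed.

Definition lseries (g : nat -> C) : C := prime_series (fun p => lam (g p)).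

Lemma lseries_cser sigma g : gdom sigma g -> 1 < sigma ->
  cser (fun n => if prime_dec (Z.of_nat n) then lam (g n) else RtoC 0) (lseries g) /\
  forall N, (1 <= N)%nat ->
    Cmod (lseries g - csum (primesN N) (fun p => lam (g p))) <= 2 * (Rpower (INR N) (1 - sigma) / (sigma - 1)).
Proof.
  intros Hg Hs. set (h := fun n => if prime_dec (Z.of_nat n) then lam (g n) else RtoC 0).
  assert (Hh : forall n, (1 <= n)%nat -> Cmod (h n) <= 2 * Cmod (g n)).
  { intros n Hn. unfold h. pose proof (Cmod_ge_0 (g n)). destruct (prime_dec (Z.of_nat n)) as [Hp|Hp]; [|rewrite Cmod_0; lra].
    pose proof (gdom_prime_le sigma g n Hg ltac:(lra) Hp). eapply Rle_trans; [apply lam_bound; lra|].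
    apply Rmult_le_reg_r with (1 - Cmod (g n)); [lra|]. unfold Rdiv. rewrite Rmult_assoc, Rinv_l by lra. nra. }
  assert (Hser : cser h (lseries g)).
  { apply cser_CSeries_ex. apply (cser_ex _ (fun n => Cmod (h n)) (2 * (sigma / (sigma - 1)))); [intros; lra|].
    intros M. destruct M as [|M].
    { unfold rsum; simpl. apply Rmult_le_pos; [lra|]. apply Rmult_le_pos; [lra|left; apply Rinv_0_lt_compat; lra]. }
    change (seq 0 (S M)) with (0%nat :: seq 1 M). rewrite rsum_cons.
    assert (E0 : h 0%nat = RtoC 0).
    { unfold h. destruct (prime_dec (Z.of_nat 0)) as [Hp|]; [apply prime_ge_2 in Hp; simpl in Hp; lia|reflexivity]. }
    rewrite E0, Cmod_0, Rplus_0_l. eapply Rle_trans with (rsum (seq 1 M) (fun n => 2 * Rpower (INR n) (- sigma))).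
    - apply rsum_le; intros n Hn. apply in_seq in Hn. destruct Hg as [_ Hg].
      specialize (Hh n ltac:(lia)). specialize (Hg n ltac:(lia)). lra.
    - rewrite rsum_scal. apply Rmult_le_compat_l; [lra|]. now apply power_sum_le. }
  split; [assumption|]. intros N HN. rewrite primesN_csum.
  apply (cser_tail h _ _ _ Hser). intros M. eapply Rle_trans; [apply Cmod_csum|].
  eapply Rle_trans; [|apply Rmult_le_compat_l; [lra|apply (gdom_tail sigma g N M Hg Hs HN)]].
  rewrite <- rsum_scal. apply rsum_le. intros n Hn. apply in_seq in Hn. apply Hh; lia.
Qed.

Lemma Rpower_small p eps : 0 < p -> 0 < eps -> exists N0, (1 <= N0)%nat /\ forall N, (N0 <= N)%nat -> Rpower (INR N) (- p) < eps.
Proof.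
  intros Hp He. destruct (nfloor_ex (Rpower (/ eps) (/ p))) as [N0 [_ H0]]; [left; apply exp_pos|].
  exists (S N0); split; [lia|]. intros N HN. apply le_INR in HN. rewrite S_INR in HN.
  rewrite Rpower_Ropp. rewrite <- (Rinv_inv eps). apply Rinv_lt_contravar.
  - apply Rmult_lt_0_compat; [apply Rinv_0_lt_compat; assumption|apply exp_pos].
  - replace (/ eps) with (Rpower (Rpower (/ eps) (/ p)) p).
    + unfold Rpower at 1 3. apply exp_increasing, Rmult_lt_compat_l; [assumption|].
      apply ln_increasing; [apply exp_pos|lra].
    + rewrite Rpower_mult, Rinv_l, Rpower_1; [reflexivity| |lra]. now apply Rinv_0_lt_compat.
Qed.

Lemma cprod_inv {A} (l : list A) f h : (forall a, In a l -> (h a * f a)%C = RtoC 1) -> (cprod l h * cprod l f)%C = RtoC 1.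
Proof.
  induction l as [|a l IH]; intros H; [unfold cprod; simpl; ring|].
  change (cprod (a :: l) h) with (h a * cprod l h)%C. change (cprod (a :: l) f) with (f a * cprod l f)%C.
  replace (h a * cprod l h * (f a * cprod l f))%C with ((h a * f a) * (cprod l h * cprod l f))%C by ring.
  rewrite IH, H by (intros; try apply H; simpl; auto). ring.
Qed.

(** For the primes up to N the exponential of the logarithms is exactly the inverse of the finite
    product P, and P G is close to 1 by [euler_product_error]. The rest is the passage to the
    limit. *)
Theorem lseries_exp sigma g G : gdom sigma g -> 1 < sigma -> cser (fun n => g (S n)) G -> Cexp (lseries g) = G.
Proof.
  intros Hg Hs HG. destruct (lseries_cser sigma g Hg Hs) as [_ HT].
  set (p := fun N => csum (primesN N) (fun p => lam (g p))).
  set (t := fun N => Rpower (INR N) (1 - sigma) / (sigma - 1)).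
  assert (Ht : forall eps, 0 < eps -> exists N, (1 <= N)%nat /\ t N < eps).
  { intros eps He. destruct (Rpower_small (sigma - 1) (eps * (sigma - 1))) as [N0 [H1 H2]]; [lra|apply Rmult_lt_0_compat; lra|].
    exists N0; split; [assumption|]. specialize (H2 N0 (Nat.le_refl _)). unfold t.
    replace (1 - sigma) with (- (sigma - 1)) by ring.
    apply Rmult_lt_reg_r with (sigma - 1); [lra|]. unfold Rdiv; rewrite Rmult_assoc, Rinv_l; lra. }
  apply NNPP; intros Hne. set (d := Cmod (Cexp (lseries g) - G)).
  assert (Hd : 0 < d).
  { apply Cmod_gt_0. intros E. apply Hne. replace (Cexp (lseries g)) with (Cexp (lseries g) - G + G)%C by ring.
    rewrite E; ring. }
  set (B := exp (Cmod (lseries g) + 1)). assert (HB : 0 < B) by apply exp_pos.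
  destruct (ccont_Cexp (lseries g) (d / 2)) as [e [He HC]]; [lra|].
  set (eps := Rmin (Rmin (e / 2) (1 / 2)) (d / (2 * B))).
  assert (Hd2 : 0 < d / (2 * B)) by (apply Rdiv_lt_0_compat; lra).
  assert (Heps : 0 < eps) by (repeat apply Rmin_glb_lt; lra).
  destruct (Ht eps Heps) as [N [HN1 HN2]].
  pose proof (Rmin_l (Rmin (e / 2) (1 / 2)) (d / (2 * B))). pose proof (Rmin_r (Rmin (e / 2) (1 / 2)) (d / (2 * B))).
  pose proof (Rmin_l (e / 2) (1 / 2)). pose proof (Rmin_r (e / 2) (1 / 2)). fold eps in H, H0.
  specialize (HT N HN1). fold (t N) in HT. fold (p N) in HT. rewrite Cmod_minus_sym in HT.
  specialize (HC (p N) ltac:(lra)).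
  pose proof (euler_product_error sigma g G N Hg Hs HN1 HG) as HE. fold (t N) in HE.
  set (P := cprod (primesN N) (fun p => RtoC 1 - g p)%C) in *.
  assert (EP : (Cexp (p N) * P)%C = RtoC 1).
  { unfold p, P. rewrite Cexp_csum. apply cprod_inv. intros r Hr. apply lam_exp.
    pose proof (gdom_prime_le sigma g r Hg ltac:(lra) (primesN_prime N r Hr)). lra. }
  assert (HG2 : Cmod (Cexp (p N) - G) <= B * t N).
  { replace (Cexp (p N) - G)%C with (- (Cexp (p N) * (P * G - RtoC 1)))%C.
    - rewrite Cmod_opp, Cmod_mult, Cmod_Cexp. apply Rmult_le_compat; [left; apply exp_pos|apply Cmod_ge_0| |assumption].
      unfold B. apply exp_le. pose proof (re_le_Cmod (p N)). pose proof (Rle_abs (Re (p N))).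
      pose proof (Cmod_triangle_inv (p N) (lseries g)). lra.
    - transitivity (Cexp (p N) - (Cexp (p N) * P) * G)%C; [ring|]. rewrite EP; ring. }
  assert (d <= Cmod (Cexp (p N) - G) + Cmod (Cexp (p N) - Cexp (lseries g))).
  { unfold d. replace (Cexp (lseries g) - G)%C with ((Cexp (p N) - G) - (Cexp (p N) - Cexp (lseries g)))%C by ring.
    unfold Cminus at 1. eapply Rle_trans; [apply Cmod_triangle|]. rewrite Cmod_opp. lra. }
  assert (B * t N < d / 2).
  { apply Rlt_le_trans with (B * (d / (2 * B))); [apply Rmult_lt_compat_l; lra|]. apply Req_le; field; lra. }
  lra.
Qed.

Definition gchar (chi : Z -> C) (s : C) (n : nat) : C := (chi (Z.of_nat n) / npow n s)%C.

Lemma gchar_gdom q chi s : dirichlet_character q chi -> gdom (Re s) (gchar chi s).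
Proof.
  intros HC. split; [split|].
  - unfold gchar. rewrite npow_1. change (Z.of_nat 1) with 1%Z. rewrite (dc_1 _ _ HC). field.
  - intros m n Hm Hn. unfold gchar. rewrite Nat2Z.inj_mul, (chi_mult _ _ HC), npow_mult by assumption.
    field; split; apply npow_nz.
  - intros n Hn. unfold gchar. rewrite Cmod_div, Cmod_npow by apply npow_nz. rewrite Rpower_Ropp.
    pose proof (dc_Cmod_le _ _ (Z.of_nat n) HC). pose proof (Cmod_ge_0 (chi (Z.of_nat n))).
    assert (0 < / Rpower (INR n) (Re s)) by (apply Rinv_0_lt_compat, exp_pos). unfold Rdiv. nra.
Qed.

Lemma log_term_lterm chi s p k : log_term chi s p (k + 1) = lterm (gchar chi s p) k.
Proof.
  unfold log_term, lterm, gchar. rewrite Nat.add_1_r, npow_INR_mult.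
  unfold Cdiv. rewrite Cpow_mult_l, Cpow_inv by apply npow_nz. field.
  split; [apply INR_S_nz|]. apply Cpow_nz, npow_nz.
Qed.

Lemma log_series_lseries chi s : log_series chi s = lseries (gchar chi s).
Proof.
  unfold log_series, lseries, lam. f_equal. apply functional_extensionality; intros p.
  f_equal. apply functional_extensionality; intros k. apply log_term_lterm.
Qed.

Theorem log_series_exp q chi s : dirichlet_character q chi -> ~ principal chi -> 1 < Re s ->
  Cexp (log_series chi s) = dirichlet_L chi s.
Proof.
  intros HC HN Hs. rewrite log_series_lseries.
  apply (lseries_exp (Re s)); [now apply (gchar_gdom q)|assumption|].
  apply (dirichlet_L_entire _ _ HC HN); lra.
Qed.

Lemma ccont_gchar chi n s : ccont (fun s => gchar chi s n) s.
Proof. apply ccont_div_npow. Qed.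

(** On Re z > s0 the finite sums over primes up to N approximate with one tail bound for all z, and
    each finite sum is continuous. *)
Lemma ccont_log_series q chi s : dirichlet_character q chi -> 1 < Re s -> ccont (log_series chi) s.
Proof.
  intros HC Hs eps He. set (s0 := (1 + Re s) / 2). assert (H0 : 1 < s0 < Re s) by (unfold s0; lra).
  destruct (Rpower_small (s0 - 1) (eps / 8 * (s0 - 1))) as [N [HN1 HN]]; [lra|apply Rmult_lt_0_compat; lra|].
  specialize (HN N (Nat.le_refl N)).
  assert (HT : forall z, s0 < Re z -> Cmod (log_series chi z - csum (primesN N) (fun p => lam (gchar chi z p))) < eps / 4).
  { intros z Hz. rewrite log_series_lseries.
    assert (Hg : gdom s0 (gchar chi z)).
    { destruct (gchar_gdom q chi z HC) as [G1 G2]. split; [assumption|]. intros n Hn. eapply Rle_trans; [now apply G2|].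
      apply Rle_Rpower; [apply (le_INR 1); lia|lra]. }
    destruct (lseries_cser s0 _ Hg) as [_ HL]; [lra|]. specialize (HL N HN1).
    replace (1 - s0) with (- (s0 - 1)) in HL by ring.
    apply Rle_lt_trans with (1 := HL).
    apply Rmult_lt_reg_r with (s0 - 1); [lra|]. unfold Rdiv. rewrite !Rmult_assoc, Rinv_l by lra. lra. }
  assert (HP : ccont (fun z => csum (primesN N) (fun p => lam (gchar chi z p))) s).
  { apply ccont_csum. intros p Hp. apply (ccont_comp (fun z => gchar chi z p) lam); [apply ccont_gchar|].
    apply ccont_lam. pose proof (gdom_prime_le (Re s) _ p (gchar_gdom q chi s HC) ltac:(lra) (primesN_prime N p Hp)). lra. }
  destruct (HP (eps / 4)) as [d [Hd HPd]]; [lra|].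
  exists (Rmin d (Re s - s0)). split; [apply Rmin_glb_lt; lra|]. intros z Hz.
  pose proof (Rmin_l d (Re s - s0)). pose proof (Rmin_r d (Re s - s0)).
  assert (Hrz : s0 < Re z).
  { pose proof (re_le_Cmod (z - s)) as Hr. change (Re (z - s)) with (Re z - Re s) in Hr.
    pose proof (Rabs_maj2 (Re z - Re s)). lra. }
  pose proof (HT z Hrz) as T1. pose proof (HT s ltac:(lra)) as T2. specialize (HPd z ltac:(lra)).
  set (pz := csum (primesN N) (fun p => lam (gchar chi z p))) in *.
  set (ps := csum (primesN N) (fun p => lam (gchar chi s p))) in *.
  replace (log_series chi z - log_series chi s)%C
    with ((log_series chi z - pz) + ((pz - ps) + - (log_series chi s - ps)))%C by ring.
  eapply Rle_lt_trans; [apply Cmod_triangle|]. pose proof (Cmod_triangle (pz - ps) (- (log_series chi s - ps))) as T3.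
  rewrite Cmod_opp in T3. lra.
Qed.

Lemma gchar_prime_le_half q chi s p : dirichlet_character q chi -> / 2 < Re s -> nprime p -> Cmod (gchar chi s p) <= 3 / 4.
Proof.
  intros HC Hs Hp. destruct (gchar_gdom q chi s HC) as [_ Hg]. apply nprime_ge2 in Hp.
  assert (H2 : 2 <= INR p) by (apply (le_INR 2); lia).
  eapply Rle_trans; [apply Hg; lia|]. eapply Rle_trans; [apply (Rpower_le_base_neg 2); lra|].
  apply Rle_trans with (Rpower 2 (- / 2)); [apply Rle_Rpower; lra|].
  rewrite Rpower_Ropp, Rpower_sqrt by lra. apply Rmult_le_reg_r with (sqrt 2); [apply sqrt_lt_R0; lra|].
  rewrite Rinv_l by (apply Rgt_not_eq, sqrt_lt_R0; lra).
  assert (4 / 3 <= sqrt 2); [|lra]. apply Rsqr_incr_0_var; [|apply sqrt_pos]. rewrite Rsqr_sqrt by lra. unfold Rsqr; lra.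
Qed.

(** With z = chi(p) p^-alpha the terms l >= 2 at p add up to [lam z - z], which is O(p^(-2 alpha));
    here |z| <= 3/4 keeps the constant uniform. *)
Lemma C_sum_approx q chi alpha N : dirichlet_character q chi -> / 2 < alpha -> (1 <= N)%nat ->
  Cmod (C_sum alpha chi - csum (primesN N) (fun p => lam (gchar chi (RtoC alpha) p) - gchar chi (RtoC alpha) p))%C
  <= 4 * (Rpower (INR N) (1 - 2 * alpha) / (2 * alpha - 1)).
Proof.
  intros HC Ha HN. set (g := gchar chi (RtoC alpha)).
  set (h := fun n => if prime_dec (Z.of_nat n) then (lam (g n) - g n)%C else RtoC 0).
  assert (Hh : forall n, (1 <= n)%nat -> Cmod (h n) <= 4 * Rpower (INR n) (- (2 * alpha))).
  { intros n Hn. assert (0 < Rpower (INR n) (- (2 * alpha))) by apply exp_pos.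
    unfold h. destruct (prime_dec (Z.of_nat n)) as [Hp|Hp]; [|rewrite Cmod_0; lra].
    pose proof (gchar_prime_le_half q chi (RtoC alpha) n HC Ha Hp) as H34. fold g in H34.
    destruct (gchar_gdom q chi (RtoC alpha) HC) as [_ Hg]. specialize (Hg n Hn). fold g in Hg. simpl in Hg.
    pose proof (lam_tail (g n) 1 ltac:(lra)) as HT.
    replace (csum (seq 0 1) (lterm (g n))) with (g n) in HT by (unfold csum, lterm; simpl; field).
    eapply Rle_trans; [exact HT|]. pose proof (Cmod_ge_0 (g n)).
    replace (- (2 * alpha)) with (- alpha + - alpha) by ring. rewrite Rpower_plus.
    apply Rle_trans with (Cmod (g n) ^ 2 * 4).
    - apply Rmult_le_compat_l; [apply pow2_ge_0|]. replace 4 with (/ (1 - 3 / 4)) by field. apply Rinv_le_contravar; lra.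
    - simpl. assert (Cmod (g n) * Cmod (g n) <= Rpower (INR n) (- alpha) * Rpower (INR n) (- alpha)) by (apply Rmult_le_compat; assumption).
      lra. }
  assert (EC : C_sum alpha chi = CSeries h).
  { unfold C_sum, prime_series. f_equal. apply functional_extensionality; intros n. unfold h.
    destruct (prime_dec (Z.of_nat n)) as [Hp|Hp]; [|reflexivity].
    pose proof (gchar_prime_le_half q chi (RtoC alpha) n HC Ha Hp) as H34. fold g in H34.
    rewrite <- lam_shift by lra. f_equal. apply functional_extensionality; intros k.
    replace (k + 2)%nat with (S k + 1)%nat by lia. apply log_term_lterm. }
  assert (Hser : cser h (CSeries h)).
  { apply cser_CSeries_ex. apply (cser_ex _ (fun n => Cmod (h n)) (4 * (2 * alpha / (2 * alpha - 1)))); [intros; lra|].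
    intros M. destruct M as [|M].
    { unfold rsum; simpl. apply Rmult_le_pos; [lra|]. apply Rmult_le_pos; [lra|left; apply Rinv_0_lt_compat; lra]. }
    change (seq 0 (S M)) with (0%nat :: seq 1 M). rewrite rsum_cons.
    assert (E0 : h 0%nat = RtoC 0).
    { unfold h. destruct (prime_dec (Z.of_nat 0)) as [Hp|]; [apply prime_ge_2 in Hp; simpl in Hp; lia|reflexivity]. }
    rewrite E0, Cmod_0, Rplus_0_l. eapply Rle_trans with (rsum (seq 1 M) (fun n => 4 * Rpower (INR n) (- (2 * alpha)))).
    - apply rsum_le; intros n Hn. apply in_seq in Hn. apply Hh; lia.
    - rewrite rsum_scal. apply Rmult_le_compat_l; [lra|]. apply power_sum_le; lra. }
  rewrite EC, primesN_csum. apply (cser_tail h _ _ _ Hser). intros M. eapply Rle_trans; [apply Cmod_csum|].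
  apply Rle_trans with (rsum (seq (S N) M) (fun n => 4 * Rpower (INR n) (- (2 * alpha)))).
  - apply rsum_le. intros n Hn. apply in_seq in Hn. apply Hh; lia.
  - rewrite rsum_scal. apply Rmult_le_compat_l; [lra|]. apply power_sum_tail; [lra|assumption].
Qed.

(** * Nonvanishing on the line [Re s = 1] *)

Lemma cser_Re_nonneg a l : cser a l -> (forall n, 0 <= Re (a n)) -> 0 <= Re l.
Proof.
  intros H Ha. apply Rnot_lt_le; intros Hl. destruct (H (- Re l)) as [N HN]; [lra|].
  specialize (HN N (Nat.le_refl N)). pose proof (re_le_Cmod (csum (seq 0 N) a - l)) as Hr.
  change (Re (csum (seq 0 N) a - l)) with (Re (csum (seq 0 N) a) - Re l) in Hr.
  rewrite Re_csum in Hr. pose proof (rsum_ge0 (seq 0 N) (fun n => Re (a n)) (fun n _ => Ha n)).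
  pose proof (Rle_abs (rsum (seq 0 N) (fun n => Re (a n)) - Re l)). lra.
Qed.

(* [3 + 4 cos x + cos 2x = 2 (1 + cos x)^2]. *)
Lemma trig_341 (r : R) (u : C) : 0 <= r -> Cmod u = 1 ->
  0 <= Re (RtoC 3 * RtoC r + RtoC 4 * (RtoC r * u) + RtoC r * (u * u))%C.
Proof.
  intros Hr Hu. pose proof (Cmod_sqr u) as E. rewrite Hu in E. destruct u as [x y]. simpl in *.
  replace (3 * r - 0 * 0 + (4 * (r * x - 0 * y) - 0 * (r * y + 0 * x)) + (r * (x * x - y * y) - 0 * (x * y + y * x)))
    with (r * (3 + 4 * x + x * x - y * y)) by ring.
  apply Rmult_le_pos; [assumption|].
  replace (3 + 4 * x + x * x - y * y) with (2 * ((1 + x) * (1 + x))) by lra.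
  pose proof (Rle_0_sqr (1 + x)) as Hs; unfold Rsqr in Hs. lra.
Qed.

Lemma lam_341 (r : R) (u : C) : 0 <= r < 1 -> Cmod u = 1 ->
  0 <= Re (RtoC 3 * lam (RtoC r) + RtoC 4 * lam (RtoC r * u) + lam (RtoC r * (u * u)))%C.
Proof.
  intros Hr Hu.
  assert (M0 : Cmod (RtoC r) < 1) by (rewrite Cmod_RtoC_nonneg; lra).
  assert (M1 : Cmod (RtoC r * u) < 1) by (rewrite Cmod_mult, Hu, Cmod_RtoC_nonneg; lra).
  assert (M2 : Cmod (RtoC r * (u * u)) < 1) by (rewrite !Cmod_mult, Hu, Cmod_RtoC_nonneg; lra).
  pose proof (cser_plus _ _ _ _ (cser_plus _ _ _ _ (cser_scal (RtoC 3) _ _ (lam_cser _ M0))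
    (cser_scal (RtoC 4) _ _ (lam_cser _ M1))) (lam_cser _ M2)) as H.
  apply (cser_Re_nonneg _ _ H). intros k. cbv beta. unfold lterm.
  rewrite !Cpow_mult_l, <- RtoC_pow.
  replace (RtoC 3 * (RtoC (r ^ S k) / RtoC (INR (S k))) + RtoC 4 * (RtoC (r ^ S k) * u ^ S k / RtoC (INR (S k)))
     + RtoC (r ^ S k) * (u ^ S k * u ^ S k) / RtoC (INR (S k)))%C
    with (RtoC (/ INR (S k)) * (RtoC 3 * RtoC (r ^ S k) + RtoC 4 * (RtoC (r ^ S k) * u ^ S k) + RtoC (r ^ S k) * (u ^ S k * u ^ S k)))%C.
  - rewrite re_scal_l. apply Rmult_le_pos; [left; apply Rinv_0_lt_compat, lt_0_INR; lia|].
    apply trig_341; [apply pow_le; lra|]. rewrite Cmod_pow, Hu. apply pow1.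
  - rewrite RtoC_inv by (apply not_0_INR; lia). field. apply INR_S_nz.
Qed.

(** The combination 3 log G0 + 4 log G1 + log G2 has nonnegative real part prime by prime, by
    [lam_341]. *)
Lemma euler_341 sigma g0 g1 g2 G0 G1 G2 :
  1 < sigma -> gdom sigma g0 -> gdom sigma g1 -> gdom sigma g2 ->
  (forall p, nprime p -> exists r u, 0 <= r < 1 /\ Cmod u = 1 /\
     g0 p = RtoC r /\ g1 p = (RtoC r * u)%C /\ g2 p = (RtoC r * (u * u))%C) ->
  cser (fun n => g0 (S n)) G0 -> cser (fun n => g1 (S n)) G1 -> cser (fun n => g2 (S n)) G2 ->
  1 <= Cmod G0 ^ 3 * Cmod G1 ^ 4 * Cmod G2.
Proof.
  intros Hs D0 D1 D2 Hp H0 H1 H2.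
  rewrite <- (lseries_exp _ _ _ D0 Hs H0), <- (lseries_exp _ _ _ D1 Hs H1), <- (lseries_exp _ _ _ D2 Hs H2).
  rewrite !Cmod_Cexp. set (a := lseries g0). set (b := lseries g1). set (c := lseries g2).
  replace (exp (Re a) ^ 3 * exp (Re b) ^ 4 * exp (Re c)) with (exp (3 * Re a + 4 * Re b + Re c)).
  2:{ rewrite !exp_plus. replace (3 * Re a) with (Re a + Re a + Re a) by ring.
      replace (4 * Re b) with (Re b + Re b + Re b + Re b) by ring. rewrite !exp_plus. ring. }
  assert (P : 0 <= Re (RtoC 3 * a + RtoC 4 * b + c)%C).
  { pose proof (cser_plus _ _ _ _ (cser_plus _ _ _ _ (cser_scal (RtoC 3) _ _ (proj1 (lseries_cser _ _ D0 Hs)))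
      (cser_scal (RtoC 4) _ _ (proj1 (lseries_cser _ _ D1 Hs)))) (proj1 (lseries_cser _ _ D2 Hs))) as H.
    apply (cser_Re_nonneg _ _ H). intros p. cbv beta.
    destruct (prime_dec (Z.of_nat p)) as [Pp|_].
    - destruct (Hp p Pp) as [r [u [Hr [Hu [E0 [E1 E2]]]]]]. rewrite E0, E1, E2. now apply lam_341.
    - replace (RtoC 3 * RtoC 0 + RtoC 4 * RtoC 0 + RtoC 0)%C with (RtoC 0) by ring. simpl; lra. }
  assert (E : Re (RtoC 3 * a + RtoC 4 * b + c)%C = 3 * Re a + 4 * Re b + Re c).
  { rewrite !Re_plus, !re_scal_l. ring. }
  rewrite E in P. rewrite <- exp_0. now apply exp_le.
Qed.

Lemma cpow_1_minus_deriv s x : 0 < x -> s <> RtoC 1 ->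
  cderiv (fun x => cpow x (- (s - RtoC 1)) / (RtoC 1 - s))%C x (cpow x (- s)).
Proof.
  intros Hx Hs. assert (Hn : (RtoC 1 - s)%C <> RtoC 0).
  { intros E; apply Hs. replace s with (RtoC 1 - (RtoC 1 - s))%C by ring. rewrite E; ring. }
  eapply cderiv_ext; [| |apply (cderiv_scal (/ (RtoC 1 - s))%C), (cderiv_cpow (s - RtoC 1)), Hx].
  - intros; cbv beta. unfold Cdiv; ring.
  - replace (- (s - RtoC 1) - RtoC 1)%C with (- s)%C by ring. field. assumption.
Qed.

(* Euler summation against the primitive [x^{1-s} / (1-s)]. *)
Lemma zeta_partial_bound s N : 1 <= Re s -> s <> RtoC 1 ->
  Cmod (csum (seq 1 N) (fun n => cpow (INR n) (- s))) <= 2 / Cmod (s - RtoC 1) + 2 * Cmod s.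
Proof.
  intros Hs H1. set (phi := fun x => (cpow x (- (s - RtoC 1)) / (RtoC 1 - s))%C).
  assert (Hn : (RtoC 1 - s)%C <> RtoC 0).
  { intros E; apply H1. replace s with (RtoC 1 - (RtoC 1 - s))%C by ring. rewrite E; ring. }
  assert (Hd : 0 < Cmod (s - RtoC 1)) by (rewrite Cmod_minus_sym; now apply Cmod_gt_0).
  assert (Hphi : forall x, 1 <= x -> Cmod (phi x) <= / Cmod (s - RtoC 1)).
  { intros x Hx. unfold phi. rewrite Cmod_div, (Cmod_minus_sym (RtoC 1)), Cmod_cpow by assumption.
    unfold Rdiv. rewrite <- (Rmult_1_l (/ Cmod (s - RtoC 1))) at 2.
    apply Rmult_le_compat_r; [left; now apply Rinv_0_lt_compat|].
    apply Rle_trans with (Rpower x 0); [|rewrite Rpower_O; lra]. apply Rle_Rpower; [lra|].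
    replace (Re (- (s - RtoC 1))) with (1 - Re s) by (unfold Re; simpl; ring). lra. }
  (* Two mean value inequalities: [phi] minus a linear function has derivative x^-s - n^-s, and this
     is bounded by the variation of x^-s over a unit interval. *)
  assert (Hdiff : forall n, (1 <= n)%nat ->
     Cmod (phi (INR n + 1) - phi (INR n) - cpow (INR n) (- s)) <= Cmod s * Rpower (INR n) (- (Re s + 1))).
  { intros n Hn1. assert (N1 : 1 <= INR n) by (apply (le_INR 1); lia).
    set (f := fun x => (phi x - RtoC x * cpow (INR n) (- s))%C).
    assert (H : Cmod (f (INR n + 1) - f (INR n)) <= Cmod s * Rpower (INR n) (- (Re s + 1)) * (INR n + 1 - INR n)).
    { apply cderiv_mvt with (df := fun x => (cpow x (- s) - cpow (INR n) (- s))%C); [lra| |].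
      - intros t Ht. apply cderiv_minus; [apply cpow_1_minus_deriv; [lra|assumption]|].
        eapply cderiv_ext; [| |apply (cderiv_scal (cpow (INR n) (- s))), cderiv_RtoC, is_derive_Rid].
        + intros; cbv beta; ring.
        + ring.
      - intros t Ht. apply Rle_trans with (Cmod s * Rpower (INR n) (- (Re s + 1)) * (t - INR n)).
        + apply (cderiv_mvt (fun x => cpow x (- s)) (fun x => - s * cpow x (- s - RtoC 1))%C); [lra| |].
          * intros x Hx. apply cderiv_cpow; lra.
          * intros x Hx. rewrite Cmod_mult, Cmod_opp, Cmod_cpow. apply Rmult_le_compat_l; [apply Cmod_ge_0|].
            replace (Re (- s - RtoC 1)) with (- (Re s + 1)) by (simpl; unfold Re; simpl; ring).
            apply Rpower_le_base_neg; lra.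
        + assert (0 <= Cmod s * Rpower (INR n) (- (Re s + 1))) by (apply Rmult_le_pos; [apply Cmod_ge_0|left; apply exp_pos]).
          rewrite <- (Rmult_1_r (Cmod s * Rpower (INR n) (- (Re s + 1)))) at 2. apply Rmult_le_compat_l; lra. }
    unfold f in H. replace (INR n + 1 - INR n) with 1 in H by ring.
    rewrite RtoC_plus in H.
    replace (phi (INR n + 1)%R - (RtoC (INR n) + RtoC 1) * cpow (INR n) (- s) - (phi (INR n) - RtoC (INR n) * cpow (INR n) (- s)))%C
      with (phi (INR n + 1)%R - phi (INR n) - cpow (INR n) (- s))%C in H by ring. lra. }
  assert (Hsum : Cmod (phi (INR N + 1) - phi 1 - csum (seq 1 N) (fun n => cpow (INR n) (- s)))
      <= rsum (seq 1 N) (fun n => Cmod s * Rpower (INR n) (- (Re s + 1)))).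
  { induction N as [|N IH].
    - simpl INR. rewrite Rplus_0_l. unfold csum, rsum; simpl.
      replace (phi 1%R - phi 1%R - RtoC 0)%C with (RtoC 0) by ring. rewrite Cmod_0; lra.
    - rewrite csum_seq_S, rsum_seq_S. simpl (1 + N)%nat. specialize (Hdiff (S N) ltac:(lia)).
      rewrite S_INR in *.
      match goal with |- Cmod ?X <= _ => replace X with
        ((phi (INR N + 1)%R - phi 1%R - csum (seq 1 N) (fun n => cpow (INR n) (- s)))
          + (phi (INR N + 1 + 1)%R - phi (INR N + 1)%R - cpow (INR N + 1) (- s)))%C by ring end.
      eapply Rle_trans; [apply Cmod_triangle|]. now apply Rplus_le_compat. }
  rewrite rsum_scal in Hsum.
  assert (HS : rsum (seq 1 N) (fun n => Rpower (INR n) (- (Re s + 1))) <= 2).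
  { eapply Rle_trans; [apply power_sum_le; lra|].
    apply Rmult_le_reg_r with (Re s + 1 - 1); [lra|]. unfold Rdiv. rewrite Rmult_assoc, Rinv_l by lra. lra. }
  pose proof (Hphi (INR N + 1) ltac:(pose proof (pos_INR N); lra)) as B1. pose proof (Hphi 1 ltac:(lra)) as B2.
  set (W := csum (seq 1 N) (fun n => cpow (INR n) (- s))) in *.
  replace W with (phi (INR N + 1)%R + (- phi 1%R + - (phi (INR N + 1)%R - phi 1%R - W)))%C by ring.
  eapply Rle_trans; [apply Cmod_triangle|]. eapply Rle_trans; [apply Rplus_le_compat_l, Cmod_triangle|].
  rewrite !Cmod_opp. pose proof (Cmod_ge_0 s).
  assert (Cmod s * rsum (seq 1 N) (fun n => Rpower (INR n) (- (Re s + 1))) <= Cmod s * 2) by (apply Rmult_le_compat_l; assumption).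
  unfold Rdiv. lra.
Qed.

Lemma nper_partial_bound D a s N B : nper D a -> 1 <= Re s -> (forall n, Cmod (anti D a n) <= B) ->
  Cmod (csum (seq 0 N) (fun n => a n * dpow s (INR n + 1)))%C <= B * (2 + 2 * Cmod s).
Proof.
  intros Ha Hs HB. assert (HB0 : 0 <= B) by (pose proof (Cmod_ge_0 (anti D a 0)); specialize (HB 0%nat); lra).
  rewrite (abel a (fun n => dpow s (INR n + 1)) (anti D a) 0 N) by apply anti_S.
  assert (Hd : forall n : nat, Cmod (dpow s (INR n + 1)) <= 1).
  { intros n. unfold dpow. rewrite Cmod_cpow. pose proof (pos_INR n).
    apply Rle_trans with (Rpower (INR n + 1) 0); [|rewrite Rpower_O; lra]. apply Rle_Rpower; [lra|]. change (Re (- s)) with (- Re s). lra. }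
  unfold Cminus at 1. eapply Rle_trans; [apply Cmod_triangle|]. eapply Rle_trans; [apply Rplus_le_compat_r, Cmod_triangle|].
  rewrite Cmod_opp, !Cmod_mult.
  assert (T1 : forall n, Cmod (anti D a n) * Cmod (dpow s (INR n + 1)) <= B * 1)
    by (intros; apply Rmult_le_compat; try apply Cmod_ge_0; auto).
  assert (T2 : Cmod (csum (seq 0 N) (fun n => anti D a (S n) * (dpow s (INR n + 1) - dpow s (INR (S n) + 1)))%C) <= B * (Cmod s * 2)).
  { eapply Rle_trans; [apply Cmod_csum|].
    apply Rle_trans with (rsum (seq 0 N) (fun n => B * Cmod s * Rpower (INR n + 1) (- (Re s + 1)))).
    - apply rsum_le. intros n _. rewrite Cmod_mult, Rmult_assoc. apply Rmult_le_compat; try apply Cmod_ge_0; [apply HB|].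
      rewrite S_INR. apply dpow_diff; [pose proof (pos_INR n)|]; lra.
    - rewrite rsum_scal, Rmult_assoc. apply Rmult_le_compat_l; [assumption|]. apply Rmult_le_compat_l; [apply Cmod_ge_0|].
      eapply Rle_trans; [apply rsum_Rpower_bound; lra|].
      apply Rmult_le_reg_r with (Re s + 1 - 1); [lra|]. unfold Rdiv. rewrite Rmult_assoc, Rinv_l by lra. lra. }
  pose proof (T1 (0 + N)%nat). pose proof (T1 0%nat). lra.
Qed.

(** Needed for chi^2, which may be principal. After subtraction of the mean c, the mean zero part is
    summed by parts, and c times a partial sum for zeta stays bounded because t is not 0. *)
Lemma periodic_series_bound q (h : Z -> C) t : periodic q h -> t <> 0 ->
  exists K, forall sigma, 1 <= sigma <= 2 -> forall N,
    Cmod (csum (seq 0 N) (fun n => h (Z.of_nat (S n)) * dpow (sigma, t) (INR n + 1)))%C <= K.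
Proof.
  intros HP Ht. set (D := q). assert (HD : RtoC (INR D) <> RtoC 0) by (apply RtoC_nz, not_0_INR; destruct HP; unfold D; lia).
  set (c := (csum (seq 0 D) (fun n => h (Z.of_nat (S n))) / RtoC (INR D))%C).
  set (a := fun n => (h (Z.of_nat (S n)) - c)%C).
  assert (Ha : nper D a).
  { split; [apply HP|]; split.
    - intros n. unfold a. f_equal. rewrite <- (proj2 HP (Z.of_nat (S n))). f_equal. unfold D; lia.
    - unfold a. rewrite csum_minus, csum_const, length_seq. unfold c. field. assumption. }
  assert (HB : exists B, forall n, Cmod (anti D a n) <= B).
  { destruct (nper_bounded _ _ (anti_nper D a Ha)) as [B [HB0 HB]]. exists (Rmax B (Cmod (anti D a 0))).
    intros [|n]; [apply Rmax_r|]. eapply Rle_trans; [apply HB|apply Rmax_l]. }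
  destruct HB as [B HB].
  exists (B * (2 + 2 * (2 + Rabs t)) + Cmod c * (2 / Rabs t + 2 * (2 + Rabs t))).
  intros sigma Hs N. set (s := (sigma, t) : C).
  assert (Hsm : Cmod s <= 2 + Rabs t).
  { eapply Rle_trans; [apply Cmod_le_sum|]. simpl. rewrite (Rabs_pos_eq sigma) by lra. lra. }
  assert (Hs1 : Rabs t <= Cmod (s - RtoC 1)).
  { eapply Rle_trans; [|apply Im_le_Cmod]. simpl. replace (t + - 0) with t by ring. lra. }
  assert (Hs1' : s <> RtoC 1).
  { intros E. apply Ht. apply (f_equal Im) in E. exact E. }
  pose proof (Rabs_pos_lt t Ht) as Pt.
  rewrite (csum_ext _ _ (fun n => a n * dpow s (INR n + 1) + c * dpow s (INR n + 1))%C) by (intros; unfold a; ring).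
  rewrite csum_plus, csum_scal. eapply Rle_trans; [apply Cmod_triangle|]. rewrite Cmod_mult.
  assert (HB0 : 0 <= B) by (pose proof (Cmod_ge_0 (anti D a 0)); specialize (HB 0%nat); lra).
  apply Rplus_le_compat.
  - eapply Rle_trans; [apply (nper_partial_bound D a s N B Ha); [simpl; unfold Re; simpl; lra|assumption]|].
    apply Rmult_le_compat_l; [assumption|lra].
  - apply Rmult_le_compat_l; [apply Cmod_ge_0|].
    rewrite (csum_ext _ _ (fun n => cpow (INR (n + 1)) (- s))) by (intros; rewrite plus_INR; reflexivity).
    rewrite <- (csum_seq_shift (fun n => cpow (INR n) (- s))).
    eapply Rle_trans; [apply zeta_partial_bound; [simpl; unfold Re; simpl; lra|assumption]|].
    apply Rplus_le_compat; [|lra]. unfold Rdiv. apply Rmult_le_compat_l; [lra|]. now apply Rinv_le_contravar.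
Qed.

Lemma gdom_cser sigma g : gdom sigma g -> 1 < sigma -> exists G, cser (fun n => g (S n)) G /\ Cmod G <= sigma / (sigma - 1).
Proof.
  intros [_ Hg] Hs.
  assert (HS : forall N, rsum (seq 0 N) (fun n => Cmod (g (S n))) <= sigma / (sigma - 1)).
  { intros N. eapply Rle_trans; [|apply (rsum_Rpower_bound sigma Hs N)]. apply rsum_le. intros n _.
    rewrite <- S_INR. apply Hg; lia. }
  destruct (cser_ex (fun n => g (S n)) (fun n => Cmod (g (S n))) _ ltac:(intros; lra) HS) as [G HG].
  exists G; split; [assumption|]. apply (cser_bound _ _ _ HG). intros M. eapply Rle_trans; [apply Cmod_csum|apply HS].
Qed.

(** At a zero 1 + i t the value of L at 1 + e + i t is O(e), while the first factor in [euler_341]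
    is O(1/e) and the last one bounded: the product is O(e), yet at least 1. *)
Theorem dirichlet_L_line_nonzero q chi t : dirichlet_character q chi -> ~ principal chi -> t <> 0 ->
  dirichlet_L chi (1, t) <> RtoC 0.
Proof.
  intros HC HN Ht HL0. destruct (dirichlet_L_entire _ _ HC HN) as [HE HS].
  set (F := dirichlet_L chi) in *.
  destruct (proj1 (holomorphic_iff _ _) (HE (1, t))) as [l Hl].
  destruct (is_cd_lip _ _ _ Hl) as [d [Hd HLip]]. set (K := Cmod l + 1) in *.
  assert (HK : 0 < K) by (unfold K; pose proof (Cmod_ge_0 l); lra).
  set (h2 := fun n => (chi n * chi n)%C).
  assert (HP2 : periodic q h2).
  { destruct (dc_periodic _ _ HC) as [A B]. split; [assumption|]. intros n; unfold h2; now rewrite B. }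
  destruct (periodic_series_bound q h2 (2 * t) HP2) as [B HB]; [lra|].
  assert (HB1 : 0 < Rabs B + 1) by (pose proof (Rabs_pos B); lra).
  (* The product in [euler_341] is at most (2/e)^3 (K e)^4 (|B| + 1) = 8 K^4 (|B| + 1) e, and this
     choice makes it at most 1/2. *)
  set (e := Rmin (Rmin (d / 2) 1) (/ (16 * K ^ 4 * (Rabs B + 1)))).
  assert (HK4 : 0 < K ^ 4) by (now apply pow_lt).
  assert (He : 0 < e).
  { repeat apply Rmin_glb_lt; try lra. apply Rinv_0_lt_compat. apply Rmult_lt_0_compat; [lra|assumption]. }
  pose proof (Rmin_l (Rmin (d / 2) 1) (/ (16 * K ^ 4 * (Rabs B + 1)))) as R1.
  pose proof (Rmin_r (Rmin (d / 2) 1) (/ (16 * K ^ 4 * (Rabs B + 1)))) as R2.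
  pose proof (Rmin_l (d / 2) 1). pose proof (Rmin_r (d / 2) 1). fold e in R1, R2.
  set (sigma := 1 + e). assert (Hs : 1 < sigma <= 2) by (unfold sigma; lra).
  set (s := (sigma, t) : C). set (s2 := (sigma, 2 * t) : C).
  (* The series of |chi(n)| n^-sigma takes the place of zeta. At every prime the three terms are
     then r, r u and r u^2, with r = 0 when p divides q. *)
  set (g1 := gchar chi s). set (g0 := fun n => RtoC (Cmod (g1 n))).
  set (g2 := fun n => (chi (Z.of_nat n) * chi (Z.of_nat n) * cpow (INR n) (- s2))%C).
  pose proof (gchar_gdom q chi s HC) as D1. change (Re s) with sigma in D1. fold g1 in D1.
  assert (D0 : gdom sigma g0).
  { destruct D1 as [[G1 GM] GB]. split; [split|].
    - unfold g0. now rewrite G1, Cmod_1.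
    - intros m n Hm Hn. unfold g0. now rewrite GM, Cmod_mult, RtoC_mult.
    - intros n Hn. unfold g0. rewrite Cmod_RtoC_nonneg by apply Cmod_ge_0. now apply GB. }
  assert (D2 : gdom sigma g2).
  { split; [split|].
    - unfold g2. change (Z.of_nat 1) with 1%Z. rewrite (dc_1 _ _ HC). change (INR 1) with 1. rewrite cpow_1. ring.
    - intros m n Hm Hn. unfold g2. rewrite Nat2Z.inj_mul, (chi_mult _ _ HC), mult_INR, cpow_mult by (apply lt_0_INR; assumption). ring.
    - intros n Hn. unfold g2. rewrite !Cmod_mult, Cmod_cpow.
      pose proof (dc_Cmod_le _ _ (Z.of_nat n) HC). pose proof (Cmod_ge_0 (chi (Z.of_nat n))).
      assert (Cmod (chi (Z.of_nat n)) * Cmod (chi (Z.of_nat n)) <= 1) by (rewrite <- (Rmult_1_r 1); apply Rmult_le_compat; assumption).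
      change (Re (- s2)) with (- sigma). assert (0 < Rpower (INR n) (- sigma)) by apply exp_pos. nra. }
  assert (Hp : forall p, nprime p -> exists r u, 0 <= r < 1 /\ Cmod u = 1 /\
     g0 p = RtoC r /\ g1 p = (RtoC r * u)%C /\ g2 p = (RtoC r * (u * u))%C).
  { intros p Pp. pose proof (nprime_ge2 p Pp) as P2.
    assert (Hg : Cmod (g1 p) <= / 2) by (apply (gdom_prime_le sigma); [assumption|lra|assumption]).
    destruct (classic (chi (Z.of_nat p) = RtoC 0)) as [E|E].
    - exists 0, (RtoC 1). unfold g0, g1, g2, gchar. rewrite E.
      assert (E' : (RtoC 0 / npow p s)%C = RtoC 0) by (unfold Cdiv; ring). rewrite E', Cmod_0, Cmod_1.
      repeat split; try lra; ring.
    - set (u := (chi (Z.of_nat p) * cpow (INR p) (- (0, t)%R))%C).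
      exists (Rpower (INR p) (- sigma)), u.
      assert (Hu : Cmod u = 1).
      { unfold u. rewrite Cmod_mult, (dc_Cmod_1 _ _ _ HC E), Cmod_cpow.
        replace (Re (- (0, t)%R)) with 0 by (simpl; unfold Re; simpl; ring).
        rewrite Rpower_O by (apply lt_0_INR; lia). ring. }
      assert (ER : RtoC (Rpower (INR p) (- sigma)) = cpow (INR p) (- RtoC sigma)).
      { unfold cpow, Rpower. rewrite <- Cexp_R. f_equal. rewrite RtoC_mult, RtoC_opp. reflexivity. }
      assert (Eg1 : g1 p = (RtoC (Rpower (INR p) (- sigma)) * u)%C).
      { unfold g1, gchar, u. rewrite ER, npow_cpow. unfold Cdiv. rewrite <- cpow_opp.
        replace (- s)%C with (- RtoC sigma + - (0, t)%R)%C by (unfold s; apply C_ext; simpl; ring).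
        rewrite cpow_plus. ring. }
      assert (Eg2 : g2 p = (RtoC (Rpower (INR p) (- sigma)) * (u * u))%C).
      { unfold g2, u. rewrite ER.
        replace (- s2)%C with (- RtoC sigma + (- (0, t)%R + - (0, t)%R))%C by (unfold s2; apply C_ext; simpl; ring).
        rewrite !cpow_plus. ring. }
      assert (Er : Cmod (g1 p) = Rpower (INR p) (- sigma)).
      { rewrite Eg1, Cmod_mult, Hu, Cmod_RtoC_nonneg by (left; apply exp_pos). ring. }
      split; [split; [left; apply exp_pos|lra]|]. split; [assumption|].
      split; [unfold g0; now rewrite Er|]. split; assumption. }
  destruct (gdom_cser sigma g0 D0) as [G0 [HG0 BG0]]; [lra|].
  destruct (gdom_cser sigma g2 D2) as [G2 [HG2 _]]; [lra|].
  assert (HG1 : cser (fun n => g1 (S n)) (F s)) by (apply (HS s); simpl; unfold Re; simpl; lra).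
  assert (BG2 : Cmod G2 <= Rabs B + 1).
  { apply (cser_bound _ _ _ HG2). intros M. apply Rle_trans with B; [|pose proof (Rle_abs B); lra].
    eapply Rle_trans; [|apply (HB sigma ltac:(lra) M)]. apply Req_le. f_equal. apply csum_ext. intros n _.
    unfold g2, h2, dpow. now rewrite S_INR. }
  assert (BG1 : Cmod (F s) <= K * e).
  { assert (Es : (s - (1, t)%R)%C = RtoC e) by (unfold s, sigma; apply C_ext; simpl; ring).
    specialize (HLip s). rewrite Es, Cmod_RtoC_nonneg in HLip by lra. specialize (HLip ltac:(lra)).
    replace (F s) with (F s - F (1, t)%R)%C by (rewrite HL0; ring). exact HLip. }
  pose proof (euler_341 sigma g0 g1 g2 G0 (F s) G2 ltac:(lra) D0 D1 D2 Hp HG0 HG1 HG2) as H1.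
  assert (BG0' : Cmod G0 <= 2 / e).
  { eapply Rle_trans; [exact BG0|]. unfold sigma. replace (1 + e - 1) with e by ring.
    unfold Rdiv. apply Rmult_le_compat_r; [left; now apply Rinv_0_lt_compat|]. unfold sigma in Hs; lra. }
  assert (HH : Cmod G0 ^ 3 * Cmod (F s) ^ 4 * Cmod G2 <= (2 / e) ^ 3 * (K * e) ^ 4 * (Rabs B + 1)).
  { apply Rmult_le_compat; [apply Rmult_le_pos; apply pow_le, Cmod_ge_0|apply Cmod_ge_0| |assumption].
    apply Rmult_le_compat; try (apply pow_le, Cmod_ge_0); apply pow_incr; split; try apply Cmod_ge_0; assumption. }
  assert (Ef : (2 / e) ^ 3 * (K * e) ^ 4 * (Rabs B + 1) = 8 * K ^ 4 * (Rabs B + 1) * e) by (field; lra).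
  rewrite Ef in HH.
  assert (8 * K ^ 4 * (Rabs B + 1) * e <= / 2).
  { apply Rle_trans with (8 * K ^ 4 * (Rabs B + 1) * / (16 * K ^ 4 * (Rabs B + 1))).
    - apply Rmult_le_compat_l; [|assumption]. apply Rmult_le_pos; lra.
    - apply Req_le; field; split; lra. }
  lra.
Qed.

(** * Logarithms along horizontal segments *)

Definition seg (z0 z1 : C) (t : R) : C := (z0 + RtoC t * (z1 - z0))%C.

Lemma Cexp_1_inv h : Cexp h = RtoC 1 -> Re h = 0 /\ sin (Im h) = 0.
Proof.
  intros E. split.
  - apply (f_equal Cmod) in E. rewrite Cmod_Cexp, Cmod_1 in E. rewrite <- (ln_exp (Re h)), E. apply ln_1.
  - apply (f_equal Im) in E. unfold Cexp in E. simpl in E. pose proof (exp_pos (Re h)).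
    apply Rmult_integral in E. destruct E; [lra|assumption].
Qed.

(* Two continuous logarithms on a segment differ by a continuous function with
   values in [2 i pi Z], hence by a constant. *)
Lemma seg_unique (a b : C -> C) z0 z1 :
  (forall t, 0 <= t <= 1 -> ccont a (seg z0 z1 t) /\ ccont b (seg z0 z1 t) /\
     Cexp (a (seg z0 z1 t)) = Cexp (b (seg z0 z1 t))) ->
  a z0 = b z0 -> a z1 = b z1.
Proof.
  (* Clamping to [0, 1] extends the difference of the logarithms to a continuous function on the
     whole line, as the intermediate value theorem requires. *)
  intros H E0. set (cl := fun t => Rmax 0 (Rmin 1 t)).
  assert (Hcl : forall t, 0 <= cl t <= 1).
  { intros t. unfold cl, Rmin. repeat match goal with |- context [Rle_dec ?u ?v] => destruct (Rle_dec u v) end; unfold Rmax; repeat match goal with |- context [Rle_dec ?u ?v] => destruct (Rle_dec u v) end; lra. }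
  assert (Hlip : forall x y, Rabs (cl x - cl y) <= Rabs (x - y)).
  { intros x y. unfold cl, Rmin.
    repeat match goal with |- context [Rle_dec ?u ?v] => destruct (Rle_dec u v) end; unfold Rmax;
    repeat match goal with |- context [Rle_dec ?u ?v] => destruct (Rle_dec u v) end; unfold Rabs;
      repeat match goal with |- context [Rcase_abs ?u] => destruct (Rcase_abs u) end; lra. }
  set (h := fun z => (a z - b z)%C).
  assert (Hexp : forall t, Re (h (seg z0 z1 (cl t))) = 0 /\ sin (Im (h (seg z0 z1 (cl t)))) = 0).
  { intros t. apply Cexp_1_inv. unfold h. rewrite Cexp_minus.
    destruct (H (cl t) (Hcl t)) as [_ [_ ->]]. field. apply Cexp_nz. }
  set (f := fun t => Im (h (seg z0 z1 (cl t)))).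
  assert (Hf : continuity f).
  { intros x eps He. destruct (H (cl x) (Hcl x)) as [Ca [Cb _]].
    assert (Ch : ccont h (seg z0 z1 (cl x))).
    { apply ccont_ext with (fun z => a z + - RtoC 1 * b z)%C; [intros; unfold h; ring|].
      apply ccont_plus; [assumption|apply ccont_mult; [apply ccont_const|assumption]]. }
    destruct (Ch eps He) as [d [Hd Hc]]. pose proof (Cmod_ge_0 (z1 - z0)) as P.
    exists (d / (Cmod (z1 - z0) + 1)). split; [apply Rdiv_lt_0_compat; lra|].
    intros y [_ Hy]. simpl in *. unfold R_dist in *.
    apply Rle_lt_trans with (Cmod (h (seg z0 z1 (cl y)) - h (seg z0 z1 (cl x)))).
    - unfold f. apply (Im_le_Cmod (h (seg z0 z1 (cl y)) - h (seg z0 z1 (cl x)))).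
    - apply Hc. unfold seg.
      replace (z0 + RtoC (cl y) * (z1 - z0) - (z0 + RtoC (cl x) * (z1 - z0)))%C
        with (RtoC (cl y - cl x) * (z1 - z0))%C by (rewrite RtoC_minus; ring).
      rewrite Cmod_mult, Cmod_R. specialize (Hlip y x).
      apply Rmult_lt_compat_r with (r := Cmod (z1 - z0) + 1) in Hy; [|lra].
      replace (d / (Cmod (z1 - z0) + 1) * (Cmod (z1 - z0) + 1)) with d in Hy by (field; lra).
      pose proof (Rabs_pos (cl y - cl x)). pose proof (Rabs_pos (y - x)). nra. }
  assert (C0 : cl 0 = 0) by (unfold cl, Rmin; repeat match goal with |- context [Rle_dec ?u ?v] => destruct (Rle_dec u v) end; unfold Rmax; repeat match goal with |- context [Rle_dec ?u ?v] => destruct (Rle_dec u v) end; lra).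
  assert (C1 : cl 1 = 1) by (unfold cl, Rmin; repeat match goal with |- context [Rle_dec ?u ?v] => destruct (Rle_dec u v) end; unfold Rmax; repeat match goal with |- context [Rle_dec ?u ?v] => destruct (Rle_dec u v) end; lra).
  assert (S0 : seg z0 z1 0 = z0) by (unfold seg; ring).
  assert (S1 : seg z0 z1 1 = z1) by (unfold seg; ring).
  assert (F0 : f 0 = 0).
  { unfold f, h. rewrite C0, S0, E0. replace (b z0 - b z0)%C with (RtoC 0) by ring. reflexivity. }
  assert (HPI := PI_RGT_0). assert (HPI1 : 1 < PI) by (pose proof PI2_1; lra).
  (* If f moved away from 0, it would take a nonzero value of modulus at most 1 < pi, where the sine
     does not vanish. *)
  assert (F1 : f 1 = 0).
  { destruct (Rtotal_order (f 1) 0) as [L|[E|L]]; [|assumption|]; exfalso.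
    - destruct (IVT_gen f 0 1 (- Rmin (- f 1) 1)) as [x [_ Hx]]; [assumption| |].
      + rewrite F0. pose proof (Rmin_l (- f 1) 1). rewrite Rmin_right, Rmax_left by lra.
        assert (0 < Rmin (- f 1) 1) by (apply Rmin_glb_lt; lra). lra.
      + destruct (Hexp x) as [_ Hs]. fold (f x) in Hs. rewrite Hx, sin_neg in Hs.
        assert (0 < sin (Rmin (- f 1) 1)); [|lra]. apply sin_gt_0; [apply Rmin_glb_lt; lra|].
        pose proof (Rmin_r (- f 1) 1). lra.
    - destruct (IVT_gen f 0 1 (Rmin (f 1) 1)) as [x [_ Hx]]; [assumption| |].
      + rewrite F0. pose proof (Rmin_l (f 1) 1). rewrite Rmin_left, Rmax_right by lra.
        assert (0 < Rmin (f 1) 1) by (apply Rmin_glb_lt; lra). lra.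
      + destruct (Hexp x) as [_ Hs]. fold (f x) in Hs. rewrite Hx in Hs.
        assert (0 < sin (Rmin (f 1) 1)); [|lra]. apply sin_gt_0; [apply Rmin_glb_lt; lra|].
        pose proof (Rmin_r (f 1) 1). lra. }
  assert (Eh : h z1 = RtoC 0).
  { apply C_ext.
    - destruct (Hexp 1) as [Hre _]. rewrite C1, S1 in Hre. exact Hre.
    - unfold f in F1. rewrite C1, S1 in F1. exact F1. }
  unfold h in Eh. replace (a z1) with (a z1 - b z1 + b z1)%C by ring. rewrite Eh; ring.
Qed.

Definition Clog1 (w : C) : C := (- lam (RtoC 1 - w))%C.

Lemma Clog1_exp w : Cmod (RtoC 1 - w) < 1 -> Cexp (Clog1 w) = w.
Proof.
  intros Hw. unfold Clog1. pose proof (lam_exp _ Hw) as E.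
  replace (RtoC 1 - (RtoC 1 - w))%C with w in E by ring. rewrite Cexp_opp.
  replace w with (/ Cexp (lam (RtoC 1 - w)) * (Cexp (lam (RtoC 1 - w)) * w))%C at 2 by (field; apply Cexp_nz).
  rewrite E; ring.
Qed.

Lemma ccont_Clog1 w : Cmod (RtoC 1 - w) < 1 -> ccont Clog1 w.
Proof.
  intros Hw. apply ccont_ext with (fun w => - RtoC 1 * lam (RtoC 1 + - RtoC 1 * w))%C.
  { intros z. unfold Clog1. replace (RtoC 1 + - RtoC 1 * z)%C with (RtoC 1 - z)%C by ring. ring. }
  apply ccont_mult; [apply ccont_const|].
  apply (ccont_comp (fun w => RtoC 1 + - RtoC 1 * w)%C lam); [apply ccont_affine|].
  apply ccont_lam. now replace (RtoC 1 + - RtoC 1 * w)%C with (RtoC 1 - w)%C by ring.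
Qed.

Lemma lam_0 : lam (RtoC 0) = RtoC 0.
Proof.
  apply Cmod_eq_0, Rle_antisym; [|apply Cmod_ge_0].
  eapply Rle_trans; [apply lam_bound; rewrite Cmod_0; lra|]. rewrite Cmod_0. unfold Rdiv. lra.
Qed.

Lemma Clog1_1 : Clog1 (RtoC 1) = RtoC 0.
Proof. unfold Clog1. replace (RtoC 1 - RtoC 1)%C with (RtoC 0) by ring. rewrite lam_0; ring. Qed.

Definition hbase (s : C) : C := (3, Im s).
Definition hpt (J : nat) (s : C) (j : nat) : C := seg (hbase s) s (INR j / INR J).

(** The given logarithm at the base point on Re s = 3, continued to s in J equal horizontal steps by
    adding logarithms near 1 of successive quotients of f. *)
Definition hlift (f G0 : C -> C) (J : nat) (s : C) : C :=
  (G0 (hbase s) + csum (seq 0 J) (fun j => Clog1 (f (hpt J s (S j)) / f (hpt J s j))))%C.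

(** The horizontal ray from s to the right carries no zero. These s form the open set on which the
    logarithm is continued. *)
Definition hfree (f : C -> C) (s : C) : Prop := forall x, Re s <= x -> f (x, Im s) <> RtoC 0.

Lemma Cmod_same_Im x y t : Cmod ((x, t)%R - (y, t)%R)%C = Rabs (x - y).
Proof.
  replace ((x, t)%R - (y, t)%R)%C with (RtoC (x - y)) by (apply C_ext; simpl; ring). apply Cmod_R.
Qed.

(** Compactness of the segment from s to abscissa 3: one radius d serves at all its points, and f
    varies by a factor close to 1 within that distance. *)
Lemma tube f s : (forall z, ccont f z) -> hfree f s -> Re s <= 3 ->
  exists d, 0 < d /\ forall x, Re s <= x <= 3 -> forall w w',
    Cmod (w - (x, Im s)%R) < d -> Cmod (w' - (x, Im s)%R) < d ->
    f w' <> RtoC 0 /\ Cmod (RtoC 1 - f w / f w')%C <= / 2.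
Proof.
  intros Hf Hs H3.
  (* The radius is doubled because a point within d of x is reached from a centre y of the covering
     through x, and both distances are below the radius belonging to y. *)
  assert (Hloc : forall x, exists d : posreal, Re s <= x -> forall w, Cmod (w - (x, Im s)%R) < 2 * d ->
     Cmod (f w - f (x, Im s)) < Cmod (f (x, Im s)) / 8).
  { intros x. destruct (Rle_dec (Re s) x) as [Hx|Hx].
    - pose proof (proj1 (Cmod_gt_0 _) (Hs x Hx)) as P.
      destruct (Hf (x, Im s) (Cmod (f (x, Im s)) / 8)) as [d [Hd H]]; [lra|].
      assert (Hd2 : 0 < d / 2) by lra. exists (mkposreal _ Hd2). intros _ w Hw. apply H. simpl in Hw. lra.
    - exists (mkposreal 1 Rlt_0_1). intros; lra. }
  set (delta := fun x => epsilon (inhabits (mkposreal 1 Rlt_0_1)) (fun d : posreal => Re s <= x -> forall w, Cmod (w - (x, Im s)%R) < 2 * d ->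
     Cmod (f w - f (x, Im s)) < Cmod (f (x, Im s)) / 8)).
  assert (Hdel : forall x, Re s <= x -> forall w, Cmod (w - (x, Im s)%R) < 2 * delta x ->
     Cmod (f w - f (x, Im s)) < Cmod (f (x, Im s)) / 8).
  { intros x. exact (epsilon_spec (inhabits (mkposreal 1 Rlt_0_1)) _ (Hloc x)). }
  destruct (compactness_value_1d (Re s) 3 delta) as [d Hd].
  exists d. split; [apply cond_pos|]. intros x Hx w w' Hw Hw'.
  apply NNPP; intros Hcontra. apply (Hd x Hx). intros [y [Hy [Hxy Hdy]]]. apply Hcontra.
  assert (Hnear : forall v, Cmod (v - (x, Im s)%R) < d -> Cmod (f v - f (y, Im s)) < Cmod (f (y, Im s)) / 8).
  { intros v Hv. apply Hdel; [lra|].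
    replace (v - (y, Im s)%R)%C with ((v - (x, Im s)%R) + ((x, Im s)%R - (y, Im s)%R))%C by ring.
    eapply Rle_lt_trans; [apply Cmod_triangle|]. rewrite Cmod_same_Im. lra. }
  pose proof (proj1 (Cmod_gt_0 _) (Hs y ltac:(lra))) as P. set (m := Cmod (f (y, Im s))) in *.
  pose proof (Hnear w Hw) as N1. pose proof (Hnear w' Hw') as N2.
  assert (L2 : 7 / 8 * m <= Cmod (f w')).
  { pose proof (Cmod_triangle_inv (f (y, Im s)) (f w')) as T. rewrite Cmod_minus_sym in T. fold m in T. lra. }
  assert (Hnz : f w' <> RtoC 0) by (apply Cmod_gt_0; lra).
  split; [assumption|].
  replace (RtoC 1 - f w / f w')%C with ((f w' - f w) / f w')%C by (field; assumption).
  rewrite Cmod_div by assumption.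
  apply Rmult_le_reg_r with (Cmod (f w')); [lra|]. unfold Rdiv. rewrite Rmult_assoc, Rinv_l, Rmult_1_r by lra.
  replace (f w' - f w)%C with ((f w' - f (y, Im s)) + - (f w - f (y, Im s)))%C by ring.
  eapply Rle_trans; [apply Cmod_triangle|]. rewrite Cmod_opp. lra.
Qed.

Lemma hpt_eq J s j : hpt J s j = (3 + INR j / INR J * (Re s - 3), Im s)%R.
Proof. unfold hpt, seg, hbase. apply C_ext; simpl; unfold Re, Im; ring. Qed.

Lemma hpt_0 J s : hpt J s 0 = hbase s.
Proof. rewrite hpt_eq. unfold hbase. simpl (INR 0). apply C_ext; simpl; [unfold Rdiv; ring|reflexivity]. Qed.

Lemma hpt_J J s : (0 < J)%nat -> hpt J s J = s.
Proof.
  intros HJ. rewrite hpt_eq. apply C_ext; simpl; [|reflexivity]. unfold Re. field. apply not_0_INR; lia.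
Qed.

Lemma ccont_hpt J j s : ccont (fun s => hpt J s j) s.
Proof.
  intros eps He. exists (eps / (Rabs (INR j / INR J) + 1)).
  pose proof (Rabs_pos (INR j / INR J)) as P. split; [apply Rdiv_lt_0_compat; lra|]. intros z Hz.
  rewrite !hpt_eq.
  apply Rmult_lt_compat_r with (r := Rabs (INR j / INR J) + 1) in Hz; [|lra].
  replace (eps / (Rabs (INR j / INR J) + 1) * (Rabs (INR j / INR J) + 1)) with eps in Hz by (field; lra).
  set (k := INR j / INR J) in *.
  replace ((3 + k * (Re z - 3), Im z)%R - (3 + k * (Re s - 3), Im s)%R)%C
    with ((k * Re (z - s)%C, Im (z - s)%C) : C) by (apply C_ext; simpl; unfold Re, Im; ring).
  eapply Rle_lt_trans; [|exact Hz].
  apply Rsqr_incr_0_var; [|apply Rmult_le_pos; [apply Cmod_ge_0|lra]].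
  unfold Rsqr. pose proof (Cmod_sqr (k * Re (z - s)%C, Im (z - s)%C)) as E1. pose proof (Cmod_sqr (z - s)) as E2.
  set (c := Cmod (k * Re (z - s)%C, Im (z - s)%C)) in *. set (c2 := Cmod (z - s)) in *.
  cbn [Re Im fst snd] in E1. set (u := Re (z - s)) in *. set (v := Im (z - s)) in *.
  change (fst (k * u, v)) with (k * u) in E1. change (snd (k * u, v)) with v in E1.
  replace (c * c) with (c ^ 2) by ring. rewrite E1.
  replace (c2 * (Rabs k + 1) * (c2 * (Rabs k + 1))) with ((c2 ^ 2) * (Rabs k + 1) ^ 2) by ring. rewrite E2.
  assert (K2 : k ^ 2 = Rabs k ^ 2) by (now rewrite pow2_abs).
  replace ((k * u) ^ 2) with (Rabs k ^ 2 * u ^ 2) by (rewrite <- K2; ring).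
  pose proof (pow2_ge_0 u). pose proof (pow2_ge_0 v). pose proof (pow2_ge_0 (Rabs k)).
  replace ((u ^ 2 + v ^ 2) * (Rabs k + 1) ^ 2) with (Rabs k ^ 2 * u ^ 2 + v ^ 2 + (Rabs k ^ 2 * v ^ 2 + 2 * Rabs k * (u ^ 2 + v ^ 2) + u ^ 2)) by ring.
  assert (0 <= Rabs k ^ 2 * v ^ 2) by (apply Rmult_le_pos; assumption).
  assert (0 <= 2 * Rabs k * (u ^ 2 + v ^ 2)) by (apply Rmult_le_pos; lra). lra.
Qed.

Lemma ccont_div f g s : ccont f s -> ccont g s -> g s <> RtoC 0 -> ccont (fun z => f z / g z)%C s.
Proof.
  intros Hf Hg H0. apply ccont_mult; [assumption|].
  apply (ccont_comp g Cinv); [assumption|].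
  intros eps He. set (w := g s) in *. pose proof (proj1 (Cmod_gt_0 _) H0) as P.
  exists (Rmin (Cmod w / 2) (eps * (Cmod w ^ 2 / 4))).
  assert (P2 : 0 < Cmod w ^ 2) by (apply pow_lt; lra).
  split; [apply Rmin_glb_lt; [lra|apply Rmult_lt_0_compat; lra]|]. intros z Hz.
  pose proof (Rmin_l (Cmod w / 2) (eps * (Cmod w ^ 2 / 4))). pose proof (Rmin_r (Cmod w / 2) (eps * (Cmod w ^ 2 / 4))).
  assert (Lz : Cmod w / 2 <= Cmod z) by (pose proof (Cmod_triangle_inv w z) as T; rewrite Cmod_minus_sym in T; lra).
  assert (Hz0 : z <> RtoC 0) by (apply Cmod_gt_0; lra).
  replace (/ z - / w)%C with (- (z - w) / (z * w))%C by (field; split; assumption).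
  rewrite Cmod_div, Cmod_opp, Cmod_mult by (now apply Cmult_neq_0).
  assert (P3 : 0 < Cmod z * Cmod w) by (apply Rmult_lt_0_compat; lra).
  apply Rmult_lt_reg_r with (Cmod z * Cmod w); [assumption|].
  unfold Rdiv. rewrite Rmult_assoc, Rinv_l, Rmult_1_r by lra.
  apply Rlt_le_trans with (eps * (Cmod w ^ 2 / 4)); [lra|]. apply Rmult_le_compat_l; [lra|]. nra.
Qed.

(* Any step fine enough gives a continuous logarithm near [s]. *)
Lemma hlift_local f G0 s :
  (forall z, ccont f z) -> (forall z, 1 < Re z -> ccont G0 z /\ Cexp (G0 z) = f z) ->
  hfree f s -> Re s <= 2 ->
  exists r J0, 0 < r /\ (0 < J0)%nat /\ forall J z, (J0 <= J)%nat ->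
    Re s - r < Re z <= 3 -> Rabs (Im z - Im s) < r ->
    hfree f z /\ ccont (hlift f G0 J) z /\ Cexp (hlift f G0 J z) = f z.
Proof.
  intros Hf HG Hs H2. destruct (tube f s Hf Hs ltac:(lra)) as [d [Hd HT]].
  (* Since r <= 1 the segment has length below 4 - Re s, so from this J on each step is at most
     d/4. *)
  destruct (nfloor_ex (4 * (4 - Re s) / d)) as [J0 [_ HJ0]].
  { apply Rmult_le_pos; [lra|left; now apply Rinv_0_lt_compat]. }
  exists (Rmin (d / 4) 1), (S J0). split; [apply Rmin_glb_lt; lra|]. split; [lia|].
  intros J z HJ [Hr Hz3] Hi. pose proof (Rmin_l (d / 4) 1). pose proof (Rmin_r (d / 4) 1).
  assert (Hnear : forall x, Re z <= x <= 3 -> exists y, Re s <= y <= 3 /\ Rabs (x - y) <= d / 4).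
  { intros x Hx. exists (Rmax x (Re s)). pose proof (Rmax_l x (Re s)). pose proof (Rmax_r x (Re s)).
    split; [split; [assumption|apply Rmax_lub; lra]|]. apply Rabs_le. split; [|lra].
    assert (Rmax x (Re s) <= x + d / 4) by (apply Rmax_lub; lra). lra. }
  assert (Hdist : forall x y, Rabs (x - y) <= d / 2 -> Cmod ((x, Im z)%R - (y, Im s)%R) < d).
  { intros x y Hxy. eapply Rle_lt_trans; [apply Cmod_le_sum|].
    change (Re ((x, Im z)%R - (y, Im s)%R)) with (x - y). change (Im ((x, Im z)%R - (y, Im s)%R)) with (Im z - Im s). lra. }
  assert (Hfree : hfree f z).
  { intros x Hx. destruct (Rle_dec x 3) as [L|L].
    - destruct (Hnear x ltac:(lra)) as [y [Hy Hxy]].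
      apply (HT y Hy (x, Im z) (x, Im z)); apply Hdist; lra.
    - destruct (HG (x, Im z)) as [_ E]; [simpl; unfold Re; simpl; lra|]. rewrite <- E. apply Cexp_nz. }
  assert (HJpos : 0 < INR J) by (apply lt_0_INR; lia).
  assert (HJbig : 4 * (4 - Re s) / d < INR J) by (apply le_INR in HJ; rewrite S_INR in HJ; lra).
  assert (Hratio : forall j, (j < J)%nat -> f (hpt J z j) <> RtoC 0 /\ Cmod (RtoC 1 - f (hpt J z (S j)) / f (hpt J z j))%C <= / 2).
  { intros j Hj. rewrite !hpt_eq. set (x := 3 + INR j / INR J * (Re z - 3)). set (x' := 3 + INR (S j) / INR J * (Re z - 3)).
    assert (Hfr : 0 <= INR j / INR J <= 1).
    { split; [apply Rmult_le_pos; [apply pos_INR|left; now apply Rinv_0_lt_compat]|].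
      apply Rmult_le_reg_r with (INR J); [assumption|]. unfold Rdiv. rewrite Rmult_assoc, Rinv_l, Rmult_1_r, Rmult_1_l by lra.
      apply le_INR; lia. }
    assert (Hxr : Re z <= x <= 3) by (unfold x; nra).
    assert (Hstep : Rabs (x' - x) <= d / 4).
    { unfold x, x'. rewrite S_INR.
      replace (3 + (INR j + 1) / INR J * (Re z - 3) - (3 + INR j / INR J * (Re z - 3))) with (- ((3 - Re z) / INR J)) by (field; lra).
      rewrite Rabs_Ropp, Rabs_pos_eq by (apply Rmult_le_pos; [lra|left; now apply Rinv_0_lt_compat]).
      apply Rmult_le_reg_r with (INR J); [assumption|]. unfold Rdiv at 1. rewrite Rmult_assoc, Rinv_l, Rmult_1_r by lra.
      apply Rmult_lt_compat_r with (r := d / 4) in HJbig; [|lra].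
      replace (4 * (4 - Re s) / d * (d / 4)) with (4 - Re s) in HJbig by (field; lra). lra. }
    destruct (Hnear x Hxr) as [y [Hy Hxy]].
    apply (HT y Hy); apply Hdist.
    - replace (x' - y) with ((x' - x) + (x - y)) by ring. eapply Rle_trans; [apply Rabs_triang|]. lra.
    - lra. }
  split; [assumption|].
  assert (HB : 1 < Re (hbase z)) by (simpl; unfold Re; simpl; lra).
  split.
  - unfold hlift. apply ccont_plus.
    + apply (ccont_comp hbase G0); [|now apply HG].
      intros eps He. exists eps; split; [assumption|]. intros w Hw. eapply Rle_lt_trans; [|exact Hw].
      replace (hbase w - hbase z)%C with ((0, Im (w - z)%C) : C) by (apply C_ext; simpl; unfold Im; ring).
      eapply Rle_trans; [apply Cmod_le_sum|].
      change (Rabs 0 + Rabs (Im (w - z)) <= Cmod (w - z)). rewrite Rabs_R0, Rplus_0_l. apply Im_le_Cmod.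
    + apply ccont_csum. intros j Hj. apply in_seq in Hj. destruct (Hratio j ltac:(lia)) as [Hnz Hh].
      apply (ccont_comp (fun w => f (hpt J w (S j)) / f (hpt J w j))%C Clog1); [|apply ccont_Clog1; lra].
      apply ccont_div; [| |assumption]; apply (ccont_comp (fun w => hpt J w _) f); try apply ccont_hpt; apply Hf.
  - assert (Htel : forall k, (k <= J)%nat ->
       Cexp (G0 (hbase z) + csum (seq 0 k) (fun j => Clog1 (f (hpt J z (S j)) / f (hpt J z j))))%C = f (hpt J z k)).
    { induction k as [|k IH]; intros Hk.
      - unfold csum; simpl. replace (G0 (hbase z) + RtoC 0)%C with (G0 (hbase z)) by ring.
        rewrite hpt_0. now apply HG.
      - rewrite csum_seq_S, Cplus_assoc, Cexp_plus, IH by lia. simpl (0 + k)%nat.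
        destruct (Hratio k ltac:(lia)) as [Hnz Hh]. rewrite Clog1_exp by lra. field. assumption. }
    unfold hlift. rewrite Htel by lia. rewrite hpt_J by lia. reflexivity.
Qed.

Lemma hlift_base f G0 J s : (0 < J)%nat -> f (hbase s) <> RtoC 0 -> hlift f G0 J (hbase s) = G0 (hbase s).
Proof.
  intros HJ Hnz. unfold hlift.
  rewrite (csum_ext _ _ (fun _ => RtoC 0)), csum_0; [unfold hbase; simpl; apply Cplus_0_r|].
  intros j _. assert (E : forall j, hpt J (hbase s) j = hbase s).
  { intros i. rewrite hpt_eq. unfold hbase. apply C_ext; simpl; [unfold Re; simpl; ring|reflexivity]. }
  rewrite !E. replace (f (hbase s) / f (hbase s))%C with (RtoC 1) by (field; assumption). apply Clog1_1.
Qed.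

Lemma hseg_pt s t : seg (hbase s) s t = (3 + t * (Re s - 3), Im s)%R.
Proof. unfold seg, hbase. apply C_ext; simpl; unfold Re, Im; ring. Qed.

(** Near a point of [hfree], [hlift] is for every fine enough step a continuous logarithm with the
    prescribed value at the base, so by [seg_unique] it is eventually constant in J. The eventual
    value is the logarithm sought. *)
Theorem hlift_exists f G0 :
  (forall z, ccont f z) -> (forall z, 1 < Re z -> ccont G0 z /\ Cexp (G0 z) = f z) ->
  (forall s, hfree f s -> exists r, 0 < r /\ forall z, Cmod (z - s) < r -> hfree f z) /\
  exists G, (forall s, hfree f s -> ccont G s /\ Cexp (G s) = f s) /\ (forall s, 1 < Re s -> G s = G0 s).
Proof.
  intros Hf HG.
  assert (Hright : forall s, 1 < Re s -> hfree f s).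
  { intros s Hs x Hx. destruct (HG (x, Im s)) as [_ E]; [simpl; unfold Re in *; simpl; lra|]. rewrite <- E. apply Cexp_nz. }
  split.
  - intros s Hs. destruct (Rle_dec (Re s) 2) as [L|L].
    + destruct (hlift_local f G0 s Hf HG Hs L) as [r [J0 [Hr [HJ H]]]].
      exists (Rmin r 1). split; [apply Rmin_glb_lt; lra|]. intros z Hz.
      pose proof (Rmin_l r 1). pose proof (Rmin_r r 1).
      pose proof (re_le_Cmod (z - s)) as Hre. change (Re (z - s)) with (Re z - Re s) in Hre.
      pose proof (Rle_abs (Re z - Re s)). pose proof (Rabs_maj2 (Re z - Re s)).
      pose proof (Im_le_Cmod (z - s)) as Hi. change (Im (z - s)) with (Im z - Im s) in Hi.
      apply (H J0); [lia|lra|lra].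
    + exists 1. split; [lra|]. intros z Hz. apply Hright.
      pose proof (re_le_Cmod (z - s)) as Hre. change (Re (z - s)) with (Re z - Re s) in Hre.
      pose proof (Rabs_maj2 (Re z - Re s)). lra.
  - set (limit := fun s z => exists J0, forall J, (J0 <= J)%nat -> hlift f G0 J s = z).
    (* To the right of Re s = 1 the given logarithm is kept, since abscissas beyond 3 are out of
       reach of [hlift]. Across the line Re s = 1 the two agree by [seg_unique]. *)
    set (G := fun s => if Rlt_dec 1 (Re s) then G0 s else epsilon (inhabits (RtoC 0)) (limit s)).
    exists G.
    assert (Hright2 : forall s, 1 < Re s -> G s = G0 s) by (intros s Hs; unfold G; destruct (Rlt_dec 1 (Re s)); [reflexivity|lra]).
    split; [|assumption].
    assert (Hloc : forall s, hfree f s -> Re s <= 1 -> exists r J, 0 < r /\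
       forall z, Cmod (z - s) < r -> G z = hlift f G0 J z /\ ccont (hlift f G0 J) z /\ Cexp (hlift f G0 J z) = f z).
    { intros s Hs H1.
      assert (Hunif : exists r J0, 0 < r /\ (0 < J0)%nat /\ forall J z t, (J0 <= J)%nat -> Cmod (z - s) < r -> Re z <= 3 -> 0 <= t <= 1 ->
         ccont (hlift f G0 J) (seg (hbase z) z t) /\ Cexp (hlift f G0 J (seg (hbase z) z t)) = f (seg (hbase z) z t)).
      { destruct (hlift_local f G0 s Hf HG Hs ltac:(lra)) as [r [J0 [Hr [HJ0 H]]]].
        exists r, J0. split; [assumption|]. split; [assumption|]. intros J z t HJ Hz Hz3 Ht.
        pose proof (re_le_Cmod (z - s)) as Hre. change (Re (z - s)) with (Re z - Re s) in Hre.
        pose proof (Rabs_maj2 (Re z - Re s)).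
        pose proof (Im_le_Cmod (z - s)) as Hi. change (Im (z - s)) with (Im z - Im s) in Hi.
        rewrite hseg_pt. apply H; [assumption| |].
        - change (Re s - r < 3 + t * (Re z - 3) <= 3). nra.
        - change (Rabs (Im z - Im s) < r). lra. }
      destruct Hunif as [r [J0 [Hr [HJ0 HU]]]].
      exists (Rmin r 1), J0. split; [apply Rmin_glb_lt; lra|]. intros z Hz.
      pose proof (Rmin_l r 1). pose proof (Rmin_r r 1).
      pose proof (re_le_Cmod (z - s)) as Hre. change (Re (z - s)) with (Re z - Re s) in Hre.
      pose proof (Rle_abs (Re z - Re s)).
      assert (Hz3 : Re z <= 3) by lra.
      assert (E1 : seg (hbase z) z 1 = z) by (unfold seg; ring).
      assert (Hbnz : f (hbase z) <> RtoC 0).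
      { destruct (HG (hbase z)) as [_ E]; [simpl; unfold Re; simpl; lra|]. rewrite <- E. apply Cexp_nz. }
      pose proof (HU J0 z 1 (Nat.le_refl _) ltac:(lra) Hz3 ltac:(lra)) as HU1. rewrite E1 in HU1.
      split; [|exact HU1].
      unfold G. destruct (Rlt_dec 1 (Re z)) as [L|L].
      - apply (seg_unique G0 (hlift f G0 J0) (hbase z) z).
        + intros t Ht. destruct (HU J0 z t (Nat.le_refl _) ltac:(lra) Hz3 Ht) as [U1 U2].
          assert (Hs1 : 1 < Re (seg (hbase z) z t)) by (rewrite hseg_pt; simpl; unfold Re in *; simpl; nra).
          destruct (HG _ Hs1) as [G1 G2]. split; [assumption|]. split; [assumption|]. now rewrite G2, U2.
        + symmetry. now apply hlift_base.
      - assert (Hlim : limit z (hlift f G0 J0 z)).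
        { exists J0. intros J HJ. apply (seg_unique (hlift f G0 J) (hlift f G0 J0) (hbase z) z).
          - intros t Ht. destruct (HU J z t HJ ltac:(lra) Hz3 Ht) as [V1 V2].
            destruct (HU J0 z t (Nat.le_refl _) ltac:(lra) Hz3 Ht) as [U1 U2].
            split; [assumption|]. split; [assumption|]. now rewrite V2, U2.
          - rewrite !hlift_base by (assumption || lia). reflexivity. }
        assert (Hsp : limit z (epsilon (inhabits (RtoC 0)) (limit z))) by (apply epsilon_spec; eauto).
        destruct Hlim as [J1 H1']. destruct Hsp as [J2 H2'].
        rewrite <- (H1' (J1 + J2)%nat), <- (H2' (J1 + J2)%nat) by lia. reflexivity. }
    intros s Hs. destruct (Rlt_dec 1 (Re s)) as [L|L].
    + destruct (HG s L) as [C1 E1]. rewrite Hright2 by assumption. split; [|assumption].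
      apply (ccont_ext_loc G0 G s (Re s - 1)); [lra| |assumption].
      intros z Hz. symmetry; apply Hright2.
      pose proof (re_le_Cmod (z - s)) as Hre. change (Re (z - s)) with (Re z - Re s) in Hre.
      pose proof (Rabs_maj2 (Re z - Re s)). lra.
    + destruct (Hloc s Hs ltac:(lra)) as [r [J [Hr H]]].
      assert (Z0 : Cmod (s - s) < r) by (replace (s - s)%C with (RtoC 0) by ring; now rewrite Cmod_0).
      destruct (H s Z0) as [E1 [C1 E2]]. rewrite E1. split; [|assumption].
      apply (ccont_ext_loc (hlift f G0 J) G s r Hr); [|assumption]. intros z Hz. symmetry; now apply H.
Qed.

(** * Mean values over the exceptional characters *)

Lemma rsum_single_le {A} (l : list A) f a : In a l -> (forall b, In b l -> 0 <= f b) -> f a <= rsum l f.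
Proof.
  intros Ha Hf. apply Rle_trans with (rsum [a] f); [unfold rsum; simpl; lra|].
  apply rsum_incl; [repeat constructor; intros []| |assumption]. intros x [<-|[]]; assumption.
Qed.

Lemma characters_upto_filter Q E b : characters_upto Q E -> characters_upto Q (filter b E).
Proof.
  intros [H1 H2]. split; [now apply NoDup_filter|]. intros chi H. apply filter_In in H. apply H2, H.
Qed.

(** The rectangle is cut into squares of side 1/(8 Lm), small enough for [large_sieve_points]. There
    are at most 25 Lm times 17 T Lm of them, whence the factor T Lm^2. *)
Theorem mean_value_rect eps : 0 < eps -> exists K, 0 < K /\
  forall Q E M (a : nat -> C) (s : (Z -> C) -> C) (u T Lm : R),
  (0 < Q)%nat -> characters_upto Q E -> 1 <= Lm ->
  (forall m, (1 <= m <= M)%nat -> ln (INR m) <= Lm) ->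
  0 <= u <= 1 -> 1 <= T ->
  (forall chi, In chi E -> 1 - u <= Re (s chi) <= 3 /\ Rabs (Im (s chi)) <= T) ->
  rsum E (fun chi => Cmod (csum (seq 1 M) (fun m => a m * gchar chi (s chi) m))%C ^ 2)
  <= K * T * Lm ^ 2 * (INR M + Rpower (INR Q) (2 + eps))
     * rsum (seq 1 M) (fun m => Cmod (a m) ^ 2 * Rpower (INR m) (- 2 * (1 - u))).
Proof.
  intros He. destruct (large_sieve_points eps He) as [K0 [HK0 LS]].
  exists (K0 * 500). split; [lra|].
  intros Q E M a s u T Lm HQ HE HLm HL Hu HT Hs.
  set (h := / (8 * Lm)). assert (Hh : 0 < h) by (apply Rinv_0_lt_compat; lra).
  assert (Hh8 : h * (8 * Lm) = 1) by (unfold h; apply Rinv_l; lra).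
  destruct (nfloor_ex (24 * Lm)) as [n1 [Hn1 Hn1']]; [lra|].
  destruct (nfloor_ex (16 * T * Lm)) as [n2 [Hn2 Hn2']]; [nra|].
  set (c := fun i j : nat => ((1 - u + INR i * h, - T + INR j * h) : C)).
  set (inc := fun (i j : nat) chi => if excluded_middle_informative
     (Re (c i j) <= Re (s chi) <= Re (c i j) + h /\ Im (c i j) <= Im (s chi) <= Im (c i j) + h) then true else false).
  set (F := fun chi => Cmod (csum (seq 1 M) (fun m => a m * gchar chi (s chi) m))%C ^ 2).
  set (W := (INR M + Rpower (INR Q) (2 + eps)) * rsum (seq 1 M) (fun m => Cmod (a m) ^ 2 * Rpower (INR m) (- 2 * (1 - u)))).
  assert (HMQ : 0 <= INR M + Rpower (INR Q) (2 + eps)) by (pose proof (pos_INR M); assert (0 < Rpower (INR Q) (2 + eps)) by apply exp_pos; lra).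
  assert (Hcell : forall i j, rsum (filter (inc i j) E) F <= K0 * W).
  { intros i j. apply Rle_trans with (K0 * (INR M + Rpower (INR Q) (2 + eps)) *
      rsum (seq 1 M) (fun m => Cmod (a m) ^ 2 * Rpower (INR m) (- 2 * Re (c i j)))).
    - unfold F. rewrite (rsum_ext _ _ (fun chi => Cmod (csum (seq 1 M) (fun m => a m * chi (Z.of_nat m) / npow m (s chi)))%C ^ 2)).
      + apply (LS Q _ M a (c i j) s Lm HQ); [now apply characters_upto_filter|assumption|].
        intros chi Hchi. apply filter_In in Hchi. destruct Hchi as [_ Hin]. unfold inc in Hin.
        destruct (excluded_middle_informative _) as [[H1 H2]|]; [|discriminate].
        apply Rle_trans with (2 * h * Lm); [|lra]. apply Rmult_le_compat_r; [lra|].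
        eapply Rle_trans; [apply Cmod_le_sum|].
        change (Re (s chi - c i j)) with (Re (s chi) - Re (c i j)). change (Im (s chi - c i j)) with (Im (s chi) - Im (c i j)).
        rewrite !Rabs_pos_eq by lra. lra.
      + intros chi _. do 2 f_equal. apply csum_ext; intros; unfold gchar, Cdiv; ring.
    - unfold W. rewrite Rmult_assoc. apply Rmult_le_compat_l; [lra|]. apply Rmult_le_compat_l; [assumption|].
      apply rsum_le. intros m Hm. apply in_seq in Hm. apply Rmult_le_compat_l; [apply pow2_ge_0|].
      apply Rle_Rpower; [apply (le_INR 1); lia|].
      change (Re (c i j)) with (1 - u + INR i * h). pose proof (pos_INR i). assert (0 <= INR i * h) by (apply Rmult_le_pos; lra). lra. }
  assert (HF : forall chi, 0 <= F chi) by (intros; apply pow2_ge_0).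
  assert (Hcover : forall chi, In chi E -> F chi <= rsum (seq 0 (S n1)) (fun i => rsum (seq 0 (S n2)) (fun j => if inc i j chi then F chi else 0))).
  { intros chi Hchi. destruct (Hs chi Hchi) as [[R1 R2] I1]. apply Rabs_le_between in I1.
    assert (Hfl : forall x n, 0 <= x -> x <= INR n * h + h -> exists i, (i < S n)%nat /\ INR i * h <= x <= INR i * h + h).
    { intros x n Hx Hxn. destruct (nfloor_ex (x / h)) as [i [Hi1 Hi2]]; [apply Rmult_le_pos; [assumption|left; now apply Rinv_0_lt_compat]|].
      assert (A1 : INR i * h <= x).
      { apply Rmult_le_compat_r with (r := h) in Hi1; [|lra]. replace (x / h * h) with x in Hi1 by (field; lra). lra. }
      assert (A2 : x < INR i * h + h).
      { apply Rmult_lt_compat_r with (r := h) in Hi2; [|lra]. replace (x / h * h) with x in Hi2 by (field; lra). lra. }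
      destruct (le_lt_dec i n); [exists i; split; [lia|lra]|].
      exists n. split; [lia|]. assert (INR n + 1 <= INR i) by (rewrite <- S_INR; apply le_INR; lia). split; [nra|lra]. }
    destruct (Hfl (Re (s chi) - (1 - u)) n1) as [i [Hi Hi']]; [lra|nra|].
    destruct (Hfl (Im (s chi) + T) n2) as [j [Hj Hj']]; [lra|nra|].
    assert (Hin : inc i j chi = true).
    { unfold inc. destruct (excluded_middle_informative _) as [|N]; [reflexivity|]. exfalso; apply N.
      change (Re (c i j)) with (1 - u + INR i * h). change (Im (c i j)) with (- T + INR j * h). lra. }
    apply Rle_trans with (rsum (seq 0 (S n2)) (fun j => if inc i j chi then F chi else 0)).
    - pose proof (rsum_single_le (seq 0 (S n2)) (fun j => if inc i j chi then F chi else 0) j) as P. cbv beta in P.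
      rewrite Hin in P. apply P; [apply in_seq; lia|]. intros b _. destruct (inc i b chi); [apply HF|lra].
    - apply (rsum_single_le (seq 0 (S n1)) (fun i => rsum (seq 0 (S n2)) (fun j => if inc i j chi then F chi else 0))); [apply in_seq; lia|].
      intros b _. apply rsum_ge0. intros b' _. destruct (inc b b' chi); [apply HF|lra]. }
  apply Rle_trans with (rsum (seq 0 (S n1)) (fun i => rsum (seq 0 (S n2)) (fun j => K0 * W))).
  - eapply Rle_trans; [apply rsum_le; exact Hcover|]. rewrite rsum_swap. apply rsum_le; intros i _.
    rewrite rsum_swap. apply rsum_le; intros j _. rewrite <- rsum_filter. apply Hcell.
  - rewrite !rsum_const, !length_seq, !S_INR.
    assert (HW : 0 <= K0 * W).
    { apply Rmult_le_pos; [lra|]. apply Rmult_le_pos; [assumption|]. apply rsum_ge0; intros.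
      apply Rmult_le_pos; [apply pow2_ge_0|left; apply exp_pos]. }
    replace (K0 * 500 * T * Lm ^ 2 * (INR M + Rpower (INR Q) (2 + eps)) * rsum (seq 1 M) (fun m => Cmod (a m) ^ 2 * Rpower (INR m) (-2 * (1 - u))))
      with (500 * T * Lm ^ 2 * (K0 * W)) by (unfold W; ring).
    rewrite <- Rmult_assoc. apply Rmult_le_compat_r; [assumption|].
    apply Rle_trans with ((25 * Lm) * (17 * T * Lm)).
    + apply Rmult_le_compat; [pose proof (pos_INR n1); lra|pose proof (pos_INR n2); lra|lra|nra].
    + assert (0 <= T * Lm ^ 2) by (apply Rmult_le_pos; [lra|apply pow2_ge_0]).
      replace (25 * Lm * (17 * T * Lm)) with (425 * (T * Lm ^ 2)) by ring. lra.
Qed.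

(** * Products with a mollifier and their dyadic blocks *)

Definition moll (l : list nat) (X : nat) (chi : Z -> C) (s : C) : C :=
  csum (mtrunc l X) (fun de => RtoC (snd de) * gchar chi s (fst de))%C.

Lemma mtrunc_length l X : NoDup l -> (forall p, In p l -> nprime p) -> (length (mtrunc l X) <= X)%nat.
Proof.
  intros Hn Hl. rewrite <- (length_map fst), <- (length_seq X 1) at 1. rewrite length_seq.
  transitivity (length (seq 1 X)); [|now rewrite length_seq].
  apply NoDup_incl_length.
  - assert (E : forall L : list (nat * R), map fst (filter (fun de => Nat.leb (fst de) X) L) = filter (fun d => Nat.leb d X) (map fst L)).
    { induction L as [|de L IH]; [reflexivity|]. simpl. destruct (Nat.leb (fst de) X); simpl; now rewrite IH. }
    unfold mtrunc. rewrite E. now apply NoDup_filter, mob_NoDup.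
  - intros d Hd. apply in_map_iff in Hd. destruct Hd as [de [<- Hd]]. apply filter_In in Hd. destruct Hd as [H1 H2].
    apply Nat.leb_le in H2. apply in_seq.
    assert ((0 < fst de)%nat); [|lia]. apply (mob_pos l); [|assumption]. intros q Hq. apply Hl, nprime_ge2 in Hq; lia.
Qed.

(** For each d of the mollifier, L is replaced by its partial sum up to Z/d. The error is O(q
    (Z/d)^-sigma), and the factor d^-sigma makes it independent of d, so the at most X values of d
    cost a factor X. *)
Theorem moll_error Q q chi l X Z s T :
  (q <= Q)%nat -> dirichlet_character q chi -> ~ principal chi ->
  NoDup l -> (forall p, In p l -> nprime p) -> (1 <= X <= Z)%nat ->
  / 2 <= Re s <= 3 -> Rabs (Im s) <= T -> 1 <= T ->
  Cmod (moll l X chi s * dirichlet_L chi s - csum (seq 1 Z) (fun n => RtoC (mcoef l X n) * gchar chi s n))%C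
  <= 104 * T * INR X * INR Q * Rpower (INR Z) (- Re s).
Proof.
  intros HqQ HC HN Hn Hl HX Hs HI HT. pose proof (gchar_gdom q chi s HC) as Hg.
  assert (Hpos : forall p, In p l -> (0 < p)%nat) by (intros p Hp; apply Hl, nprime_ge2 in Hp; lia).
  rewrite <- (mollified_sum (gchar chi s) l X Z (proj1 Hg) Hpos).
  unfold moll. rewrite Cmult_comm, <- csum_scal, <- csum_minus.
  eapply Rle_trans; [apply Cmod_csum|].
  apply Rle_trans with (rsum (mtrunc l X) (fun _ => 104 * T * INR Q * Rpower (INR Z) (- Re s))).
  - apply rsum_le. intros [d e] Hde. unfold mtrunc in Hde. apply filter_In in Hde. destruct Hde as [H1 H2]. simpl fst in *; simpl snd in *.
    apply Nat.leb_le in H2. pose proof (mob_pos l Hpos _ H1) as Hd. simpl in Hd.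
    pose proof (mob_sign l _ H1) as Hsg. simpl in Hsg.
    replace (dirichlet_L chi s * (RtoC e * gchar chi s d) - RtoC e * gchar chi s d * csum (seq 1 (Z / d)) (gchar chi s))%C
      with (RtoC e * gchar chi s d * (dirichlet_L chi s - csum (seq 1 (Z / d)) (gchar chi s)))%C by ring.
    rewrite !Cmod_mult, Cmod_R, Hsg, Rmult_1_l.
    assert (HY : (1 <= Z / d)%nat) by (apply Nat.div_le_lower_bound; lia).
    pose proof (dirichlet_L_approx q chi s (Z / d) HC HN ltac:(lra) HY) as HA.
    destruct Hg as [_ Hg]. specialize (Hg d ltac:(lia)).
    assert (Hms : Cmod s <= 3 + T).
    { eapply Rle_trans; [apply Cmod_le_sum|]. rewrite (Rabs_pos_eq (Re s)) by lra. lra. }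
    assert (Hinv : / Re s <= 2) by (rewrite <- (Rinv_inv 2); apply Rinv_le_contravar; lra).
    assert (Hinv0 : 0 < / Re s) by (apply Rinv_0_lt_compat; lra).
    assert (Hc : 1 + Cmod s * (1 + / Re s) <= 13 * T).
    { assert (Cmod s * (1 + / Re s) <= (3 + T) * 3) by (apply Rmult_le_compat; try apply Cmod_ge_0; lra). lra. }
    assert (Hc0 : 0 <= 1 + Cmod s * (1 + / Re s)).
    { assert (0 <= Cmod s * (1 + / Re s)) by (apply Rmult_le_pos; [apply Cmod_ge_0|lra]). lra. }
    assert (Hq : INR q <= INR Q) by (now apply le_INR).
    assert (Pd : 0 < INR d) by (apply lt_0_INR; lia). assert (PZ : 0 < INR Z) by (apply lt_0_INR; lia).
    (* The integer part of Z/d is at least Z/(2d), and 2^sigma <= 8 because sigma <= 3. *)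
    assert (Hpow : Rpower (INR (Z / d)) (- Re s) <= 8 * (Rpower (INR d) (Re s) * Rpower (INR Z) (- Re s))).
    { assert (Hfl : INR Z / (2 * INR d) <= INR (Z / d)).
      { apply Rmult_le_reg_r with (2 * INR d); [lra|]. unfold Rdiv. rewrite Rmult_assoc, Rinv_l, Rmult_1_r by lra.
        replace (INR (Z / d) * (2 * INR d)) with (INR (2 * d * (Z / d))) by (rewrite !mult_INR; simpl (INR 2); ring).
        apply le_INR. pose proof (Nat.div_mod Z d ltac:(lia)). pose proof (Nat.mod_upper_bound Z d ltac:(lia)). nia. }
      eapply Rle_trans; [apply (Rpower_le_base_neg (INR Z / (2 * INR d))); [apply Rdiv_lt_0_compat; lra|exact Hfl|lra]|].
      replace (Rpower (INR Z / (2 * INR d)) (- Re s)) with (Rpower 2 (Re s) * (Rpower (INR d) (Re s) * Rpower (INR Z) (- Re s))).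
      - apply Rmult_le_compat_r; [apply Rmult_le_pos; left; apply exp_pos|].
        apply Rle_trans with (Rpower 2 3); [apply Rle_Rpower; lra|].
        replace 3 with (INR 3) by (simpl; ring). rewrite Rpower_pow by lra. simpl; lra.
      - unfold Rpower. rewrite ln_div by lra. rewrite ln_mult by lra. rewrite <- !exp_plus. f_equal. ring. }
    eapply Rle_trans; [apply Rmult_le_compat; [apply Cmod_ge_0|apply Cmod_ge_0|exact Hg|exact HA]|].
    set (P := Rpower (INR d) (- Re s)). set (P' := Rpower (INR d) (Re s)) in *.
    assert (EP : P * P' = 1) by (unfold P, P'; rewrite <- Rpower_plus, Rplus_opp_l; apply Rpower_O; assumption).
    assert (HP : 0 < P) by apply exp_pos. set (R := Rpower (INR Z) (- Re s)) in *. assert (HR : 0 < R) by apply exp_pos.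
    apply Rle_trans with (P * (INR Q * (13 * T) * (8 * (P' * R)))).
    + apply Rmult_le_compat_l; [lra|]. apply Rmult_le_compat; [|left; apply exp_pos| |assumption].
      * apply Rmult_le_pos; [apply pos_INR|assumption].
      * apply Rmult_le_compat; [apply pos_INR|assumption|assumption|assumption].
    + replace (P * (INR Q * (13 * T) * (8 * (P' * R)))) with (104 * T * INR Q * R * (P * P')) by ring. rewrite EP. lra.
  - rewrite rsum_const. pose proof (mtrunc_length l X Hn Hl) as HL. apply le_INR in HL.
    assert (0 <= 104 * T * INR Q * Rpower (INR Z) (- Re s)).
    { apply Rmult_le_pos; [|left; apply exp_pos]. apply Rmult_le_pos; [lra|apply pos_INR]. }
    replace (104 * T * INR X * INR Q * Rpower (INR Z) (- Re s)) with (INR X * (104 * T * INR Q * Rpower (INR Z) (- Re s))) by ring.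
    now apply Rmult_le_compat_r.
Qed.

Definition blk (i : nat) (c : nat -> C) : C := csum (seq (S (2 ^ i)) (2 ^ i)) c.

Lemma dyadic_sum I c : csum (seq 1 (2 ^ I)) c = (c 1%nat + csum (seq 0 I) (fun i => blk i c))%C.
Proof.
  induction I as [|I IH]; [unfold csum; simpl; ring|].
  replace (2 ^ S I)%nat with (2 ^ I + 2 ^ I)%nat by (simpl; lia).
  rewrite csum_seq_add, IH, csum_seq_S. simpl (0 + I)%nat. unfold blk at 3.
  replace (1 + 2 ^ I)%nat with (S (2 ^ I)) by lia. ring.
Qed.

Lemma INR_pow2 i : INR (2 ^ i) = 2 ^ i.
Proof. rewrite pow_INR. reflexivity. Qed.

Lemma ln_le_pow2 m i : (1 <= m <= 2 ^ i)%nat -> ln (INR m) <= INR i.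
Proof.
  intros [H1 H2]. apply le_INR in H1, H2. change (INR 1) with 1 in H1. rewrite INR_pow2 in H2.
  apply Rle_trans with (ln (2 ^ i)); [apply ln_le; lra|]. rewrite ln_pow by lra.
  pose proof ln_lt_2. pose proof (pos_INR i).
  assert (ln 2 <= 1).
  { rewrite <- (ln_exp 1). apply ln_le; [lra|]. pose proof (exp_ineq1_le 1). lra. }
  nra.
Qed.

(** The coefficients are bounded by the divisor function, whose mean square costs only powers of i.
    What remains is (N + Q^(2+eps)) N^(2u-1) with N = 2^i. *)
Theorem block_mean eps : 0 < eps -> exists K, 0 < K /\
  forall Q E l X i (s : (Z -> C) -> C) (u T : R),
  (0 < Q)%nat -> characters_upto Q E -> NoDup l -> (forall p, In p l -> nprime p) ->
  0 <= u <= 1 -> 1 <= T ->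
  (forall chi, In chi E -> 1 - u <= Re (s chi) <= 3 /\ Rabs (Im (s chi)) <= T) ->
  rsum E (fun chi => Cmod (blk i (fun n => RtoC (mcoef l X n) * gchar chi (s chi) n))%C ^ 2)
  <= K * T * (INR i + 3) ^ 5 * (2 ^ i + Rpower (INR Q) (2 + eps)) * Rpower (2 ^ i) (2 * u - 1).
Proof.
  intros He. destruct (mean_value_rect eps He) as [K0 [HK0 MV]]. exists (4 * K0). split; [lra|].
  intros Q E l X i s u T HQ HE Hn Hl Hu HT Hs.
  set (a := fun m => if le_lt_dec m (2 ^ i) then RtoC 0 else RtoC (mcoef l X m)).
  assert (P2 : 0 < 2 ^ i) by (apply pow_lt; lra).
  assert (HM : rsum E (fun chi => Cmod (blk i (fun n => RtoC (mcoef l X n) * gchar chi (s chi) n))%C ^ 2)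
     = rsum E (fun chi => Cmod (csum (seq 1 (2 ^ S i)) (fun m => a m * gchar chi (s chi) m))%C ^ 2)).
  { apply rsum_ext. intros chi _. do 2 f_equal.
    replace (2 ^ S i)%nat with (2 ^ i + 2 ^ i)%nat by (simpl; lia). rewrite csum_seq_add.
    rewrite (csum_ext (seq 1 (2 ^ i)) _ (fun _ => RtoC 0)), csum_0, Cplus_0_l.
    - unfold blk. replace (1 + 2 ^ i)%nat with (S (2 ^ i)) by lia. apply csum_ext. intros m Hm. apply in_seq in Hm.
      unfold a. destruct (le_lt_dec m (2 ^ i)); [lia|reflexivity].
    - intros m Hm. apply in_seq in Hm. unfold a. destruct (le_lt_dec m (2 ^ i)); [ring|lia]. }
  rewrite HM. eapply Rle_trans; [apply (MV Q E (2 ^ S i)%nat a s u T (INR i + 1) HQ HE)|]; try assumption.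
  - pose proof (pos_INR i); lra.
  - intros m Hm. rewrite <- S_INR. now apply ln_le_pow2.
  - assert (HS : rsum (seq 1 (2 ^ S i)) (fun m => Cmod (a m) ^ 2 * Rpower (INR m) (- 2 * (1 - u)))
        <= Rpower (2 ^ i) (- 2 * (1 - u)) * (2 * 2 ^ i * (INR i + 3) ^ 3)).
    { apply Rle_trans with (rsum (seq 1 (2 ^ S i)) (fun m => Rpower (2 ^ i) (- 2 * (1 - u)) * dcount m ^ 2)).
      - apply rsum_le. intros m Hm. apply in_seq in Hm. unfold a. destruct (le_lt_dec m (2 ^ i)) as [L|L].
        + rewrite Cmod_0. replace (0 ^ 2 * Rpower (INR m) (-2 * (1 - u))) with 0 by ring.
          apply Rmult_le_pos; [left; apply exp_pos|apply pow2_ge_0].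
        + rewrite Rmult_comm. apply Rmult_le_compat; [left; apply exp_pos|apply pow2_ge_0| |].
          * replace (-2 * (1 - u)) with (- (2 * (1 - u))) by ring. apply Rpower_le_base_neg; [lra| |lra].
            rewrite <- INR_pow2. apply le_INR; lia.
          * apply pow_incr. split; [apply Cmod_ge_0|]. rewrite Cmod_R. apply mcoef_le; [assumption|assumption|lia].
      - rewrite rsum_scal. apply Rmult_le_compat_l; [left; apply exp_pos|].
        eapply Rle_trans; [apply dcount_sqr_sum|]. rewrite INR_pow2. simpl (2 ^ S i).
        apply Rmult_le_compat_l; [lra|]. apply pow_incr. split.
        + assert (0 <= ln (INR (S (2 ^ S i)))); [|lra]. rewrite <- ln_1. apply ln_le; [lra|]. apply (le_INR 1); lia.
        + assert (ln (INR (S (2 ^ S i))) <= INR (S (S i))).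
          { apply ln_le_pow2. split; [lia|]. pose proof (Nat.pow_nonzero 2 (S i) ltac:(lia)).
            rewrite (Nat.pow_succ_r' 2 (S i)). lia. }
          rewrite (S_INR (S i)), (S_INR i) in H. lra. }
    rewrite INR_pow2. set (R := Rpower (INR Q) (2 + eps)) in *. assert (HR : 0 < R) by apply exp_pos.
    assert (ER : Rpower (2 ^ i) (2 * u - 1) = Rpower (2 ^ i) (- 2 * (1 - u)) * 2 ^ i).
    { rewrite <- (Rpower_1 (2 ^ i)) at 3 by lra. rewrite <- Rpower_plus. f_equal; ring. }
    rewrite ER. set (P := Rpower (2 ^ i) (- 2 * (1 - u))) in *. assert (HP : 0 < P) by apply exp_pos.
    pose proof (pos_INR i) as Pi.
    assert (HKT : 0 <= K0 * T) by (apply Rmult_le_pos; lra).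
    apply Rle_trans with (K0 * T * (INR i + 3) ^ 2 * (2 * (2 ^ i + R)) * (P * (2 * 2 ^ i * (INR i + 3) ^ 3))).
    + apply Rmult_le_compat.
      * apply Rmult_le_pos; [apply Rmult_le_pos; [exact HKT|apply pow2_ge_0]|]. change (2 ^ S i) with (2 * 2 ^ i). lra.
      * apply rsum_ge0; intros. apply Rmult_le_pos; [apply pow2_ge_0|left; apply exp_pos].
      * change (2 ^ S i) with (2 * 2 ^ i).
        apply Rmult_le_compat; [apply Rmult_le_pos; [exact HKT|apply pow2_ge_0]|lra| |lra].
        apply Rmult_le_compat_l; [exact HKT|]. apply pow_incr; lra.
      * exact HS.
    + apply Req_le. ring.
Qed.

Lemma plist_prime_divisor B k p m : nprime p -> In m (plist B k) -> Nat.divide p m -> exists n, In n B /\ Nat.divide p n.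
Proof.
  intros Hp. revert m; induction k as [|k IH]; intros m Hm Hd; simpl in Hm.
  - destruct Hm as [<-|[]]. apply Nat.divide_1_r in Hd. apply nprime_ge2 in Hp. lia.
  - apply in_flat_map in Hm. destruct Hm as [n [Hn Hm]]. apply in_map_iff in Hm. destruct Hm as [m' [<- Hm']].
    apply nprime_mult in Hd; [|assumption]. destruct Hd; eauto.
Qed.

(* The k-th power of a block of rough integers is a Dirichlet polynomial whose
   coefficients count factorizations into k rough parts. *)
Theorem rough_power_mean eps : 0 < eps -> exists K, 0 < K /\
  forall Q E l N k w (y : R) (s : (Z -> C) -> C) (u T Lm : R),
  (0 < Q)%nat -> characters_upto Q E -> NoDup l -> (forall p, nprime p -> INR p <= y -> In p l) ->
  (1 <= N)%nat -> (1 <= k)%nat -> 0 < y -> (2 * INR N) ^ k < y ^ S w ->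
  1 <= Lm -> INR k * ln (2 * INR N) <= Lm ->
  0 <= u <= 1 -> 1 <= T ->
  (forall chi, In chi E -> 1 - u <= Re (s chi) <= 3 /\ Rabs (Im (s chi)) <= T) ->
  rsum E (fun chi => Cmod (csum (filter (rough l) (seq (S N) N)) (gchar chi (s chi))) ^ (2 * k))
  <= K * T * Lm ^ 2 * ((2 * INR N) ^ k + Rpower (INR Q) (2 + eps))
     * (INR k ^ w * INR N ^ k * Rpower (INR N ^ k) (- 2 * (1 - u))).
Proof.
  intros He. destruct (mean_value_rect eps He) as [K [HK MV]]. exists K. split; [assumption|].
  intros Q E l N k w y s u T Lm HQ HE Hn Hl HN Hk Hy Hw HLm HLm2 Hu HT Hs.
  set (B := filter (rough l) (seq (S N) N)). set (PL := plist B k). set (M := ((2 * N) ^ k)%nat).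
  set (cnt := fun m => count_occ Nat.eq_dec PL m).
  assert (HBr : forall n, In n B -> (N < n <= 2 * N)%nat).
  { intros n Hin. apply filter_In in Hin. destruct Hin as [Hin _]. apply in_seq in Hin. lia. }
  pose proof (plist_range B k N HN HBr) as HPL. fold PL in HPL.
  assert (EM : INR M = (2 * INR N) ^ k) by (unfold M; rewrite pow_INR, mult_INR; reflexivity).
  assert (N1 : 1 <= INR N) by (apply (le_INR 1); lia).
  assert (HPow : rsum E (fun chi => Cmod (csum B (gchar chi (s chi))) ^ (2 * k))
     = rsum E (fun chi => Cmod (csum (seq 1 M) (fun m => RtoC (INR (cnt m)) * gchar chi (s chi) m))%C ^ 2)).
  { apply rsum_ext. intros chi Hchi. destruct (proj2 HE chi Hchi) as [q [_ [HC _]]].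
    pose proof (gchar_gdom q chi (s chi) HC) as [Hg _].
    assert (HTr : forall m, In m PL -> (1 <= m <= M)%nat) by (intros m Hm; specialize (HPL m Hm); unfold M; lia).
    pose proof (csum_count (gchar chi (s chi)) PL M HTr) as Hcc. fold cnt in Hcc.
    unfold cnt. rewrite <- Hcc. unfold PL. rewrite (plist_csum _ B k Hg).
    - rewrite Cmod_pow, <- pow_mult. f_equal. lia.
    - intros n Hin. apply HBr in Hin. lia. }
  rewrite HPow. eapply Rle_trans; [apply (MV Q E M (fun m => RtoC (INR (cnt m))) s u T Lm HQ HE HLm)|]; try assumption.
  - intros m Hm. eapply Rle_trans; [|exact HLm2].
    rewrite <- ln_pow by lra. apply ln_le; [apply lt_0_INR; lia|]. rewrite <- EM. apply le_INR; lia.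
  - rewrite EM. apply Rmult_le_compat_l.
    { apply Rmult_le_pos; [apply Rmult_le_pos; [apply Rmult_le_pos; lra|apply pow2_ge_0]|].
      assert (0 < Rpower (INR Q) (2 + eps)) by apply exp_pos. assert (0 < (2 * INR N) ^ k) by (apply pow_lt; lra). lra. }
    assert (Nk : 1 <= INR N ^ k) by (apply pow_R1_Rle; lra).
    assert (K1 : 1 <= INR k) by (apply (le_INR 1); lia).
    (* Of the two factors in the square of a multiplicity, one is bounded by k^w and the other is
       kept, to be summed to the total number of k-fold products. *)
    apply Rle_trans with (rsum (seq 1 M) (fun m => (INR k ^ w * Rpower (INR N ^ k) (- 2 * (1 - u))) * INR (cnt m))).
    + apply rsum_le. intros m Hm. apply in_seq in Hm. rewrite Cmod_RtoC_nonneg by apply pos_INR.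
      destruct (in_dec Nat.eq_dec m PL) as [Hin|Hin].
      * assert (Hc : INR (cnt m) <= INR k ^ w).
        { eapply Rle_trans; [apply count_occ_plist|].
          - now apply NoDup_filter, seq_NoDup.
          - intros n Hn'. apply HBr in Hn'. lia.
          - lia.
          - apply (tau_rough_le k y w m Hk Hy); [lia| |].
            + intros p Hp Hd. destruct (plist_prime_divisor B k p m Hp Hin Hd) as [n [HnB Hdn]].
              apply Rnot_le_lt; intros Hle. apply filter_In in HnB. destruct HnB as [_ HR].
              unfold rough in HR. rewrite forallb_forall in HR. specialize (HR p (Hl p Hp Hle)).
              apply nprime_ge2 in Hp. apply dvb_iff in Hdn; [|lia]. rewrite Hdn in HR. discriminate.
            + eapply Rle_lt_trans; [|exact Hw]. rewrite <- EM. apply le_INR. unfold M. apply HPL, Hin. }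
        assert (Hr : Rpower (INR m) (- 2 * (1 - u)) <= Rpower (INR N ^ k) (- 2 * (1 - u))).
        { replace (-2 * (1 - u)) with (- (2 * (1 - u))) by ring. apply Rpower_le_base_neg; [lra| |lra].
          rewrite <- pow_INR. apply le_INR, HPL, Hin. }
        pose proof (pos_INR (cnt m)). assert (0 < Rpower (INR m) (- 2 * (1 - u))) by apply exp_pos.
        replace (INR (cnt m) ^ 2 * Rpower (INR m) (-2 * (1 - u))) with (INR (cnt m) * Rpower (INR m) (-2 * (1 - u)) * INR (cnt m)) by ring.
        apply Rmult_le_compat_r; [assumption|]. apply Rmult_le_compat; lra.
      * unfold cnt. rewrite (proj1 (count_occ_not_In Nat.eq_dec PL m) Hin). simpl. lra.
    + rewrite rsum_scal. unfold cnt. rewrite rsum_count_total.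
      * unfold PL. rewrite plist_length, pow_INR.
        assert (HBl : INR (length B) <= INR N).
        { apply le_INR. unfold B. etransitivity; [apply filter_length_le|]. now rewrite length_seq. }
        assert (INR (length B) ^ k <= INR N ^ k) by (apply pow_incr; split; [apply pos_INR|assumption]).
        assert (0 <= INR k ^ w * Rpower (INR N ^ k) (-2 * (1 - u))) by (apply Rmult_le_pos; [apply pow_le; lra|left; apply exp_pos]).
        apply Rle_trans with (INR k ^ w * Rpower (INR N ^ k) (-2 * (1 - u)) * INR N ^ k); [now apply Rmult_le_compat_l|]. lra.
      * intros m Hm. specialize (HPL m Hm). unfold M. lia.
Qed.

(** Chebyshev's inequality in each block, with an exponent that may change from block to block. *)
Lemma pigeonhole {A} (E : list A) I (f : nat -> A -> R) (th : nat -> R) (k : nat -> nat) :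
  (forall i, 0 < th i) -> (forall i x, 0 <= f i x) ->
  (forall x, In x E -> exists i, (i < I)%nat /\ th i < f i x) ->
  INR (length E) <= rsum (seq 0 I) (fun i => rsum E (fun x => f i x ^ (2 * k i)) / th i ^ (2 * k i)).
Proof.
  intros Hth Hf HE.
  rewrite <- (Rmult_1_r (INR (length E))), <- rsum_const.
  rewrite (rsum_ext (seq 0 I) _ (fun i => rsum E (fun x => / th i ^ (2 * k i) * f i x ^ (2 * k i))))
    by (intros; rewrite rsum_scal; unfold Rdiv; ring).
  rewrite rsum_swap. apply rsum_le. intros x Hx. destruct (HE x Hx) as [i [Hi Hlt]].
  assert (Hp : forall j, 0 < th j ^ (2 * k j)) by (intros; now apply pow_lt).
  eapply Rle_trans; [|apply (rsum_single_le (seq 0 I) (fun i => / th i ^ (2 * k i) * f i x ^ (2 * k i)) i)].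
  - apply Rmult_le_reg_l with (th i ^ (2 * k i)); [apply Hp|].
    rewrite Rmult_1_r, <- Rmult_assoc, Rinv_r, Rmult_1_l by (apply Rgt_not_eq, Hp).
    apply pow_incr. split; [left; apply Hth|lra].
  - apply in_seq; lia.
  - intros j _. apply Rmult_le_pos; [left; apply Rinv_0_lt_compat, Hp|apply pow_le, Hf].
Qed.

Lemma poly_exp C m c : 0 < c -> exists L0, 1 <= L0 /\ forall L, L0 <= L -> C * L ^ m <= exp (c * L).
Proof.
  intros Hc.
  assert (H1 : forall L, 0 <= L -> (c / INR (S m) * L) ^ S m <= exp (c * L)).
  { intros L HL. assert (P : 0 < INR (S m)) by (apply lt_0_INR; lia).
    replace (exp (c * L)) with (exp (c / INR (S m) * L) ^ S m).
    - apply pow_incr. split.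
      + apply Rmult_le_pos; [apply Rlt_le, Rdiv_lt_0_compat; assumption|assumption].
      + pose proof (exp_ineq1_le (c / INR (S m) * L)). lra.
    - rewrite <- Rpower_pow by apply exp_pos. unfold Rpower. rewrite ln_exp. f_equal. field. lra. }
  set (b := (c / INR (S m)) ^ S m). assert (Hb : 0 < b) by (apply pow_lt, Rdiv_lt_0_compat; [assumption|apply lt_0_INR; lia]).
  exists (Rmax 1 (Rabs C / b)). split; [apply Rmax_l|]. intros L HL.
  assert (L1 : 1 <= L) by (eapply Rle_trans; [apply Rmax_l|exact HL]).
  assert (L2 : Rabs C / b <= L) by (eapply Rle_trans; [apply Rmax_r|exact HL]).
  eapply Rle_trans; [|apply H1; lra]. rewrite Rpow_mult_distr. fold b. simpl (L ^ S m).
  assert (P : 0 < L ^ m) by (apply pow_lt; lra).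
  apply Rle_trans with (Rabs C * L ^ m); [apply Rmult_le_compat_r; [lra|apply Rle_abs]|].
  rewrite <- Rmult_assoc. apply Rmult_le_compat_r; [lra|].
  apply Rmult_le_compat_r with (r := b) in L2; [|lra]. replace (Rabs C / b * b) with (Rabs C) in L2 by (field; lra). lra.
Qed.

(** * Zero density *)

Lemma Rpower_exp a b : Rpower (exp a) b = exp (b * a).
Proof. unfold Rpower. now rewrite ln_exp. Qed.

Lemma ln_2_bounds : / 2 < ln 2 <= 1.
Proof.
  split; [apply ln_lt_2|]. rewrite <- (ln_exp 1). apply ln_le; [lra|]. pose proof (exp_ineq1_le 1). lra.
Qed.

Lemma pow2_exp i : 2 ^ i = exp (INR i * ln 2).
Proof. rewrite <- Rpower_pow by lra. reflexivity. Qed.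

(** Lengths are rounded up to powers of two, so that they are exhausted by dyadic blocks. *)
Lemma pow2_between x : 0 <= x -> exists J, exp x <= 2 ^ J <= 2 * exp x /\ INR J <= 2 * x + 1.
Proof.
  intros Hx. pose proof ln_2_bounds as [A B].
  destruct (nfloor_ex (x / ln 2)) as [n [H1 H2]]; [apply Rmult_le_pos; [lra|left; apply Rinv_0_lt_compat; lra]|].
  assert (E : x / ln 2 * ln 2 = x) by (field; lra).
  assert (G1 : INR n * ln 2 <= x) by (rewrite <- E; apply Rmult_le_compat_r; lra).
  assert (G2 : x <= (INR n + 1) * ln 2) by (rewrite <- E at 1; apply Rmult_le_compat_r; lra).
  exists (S n). split; [split|].
  - rewrite pow2_exp, S_INR. now apply exp_le.
  - change (2 ^ S n) with (2 * 2 ^ n). apply Rmult_le_compat_l; [lra|]. rewrite pow2_exp. now apply exp_le.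
  - rewrite S_INR. pose proof (pos_INR n). nra.
Qed.

(** For log Q < L0 the crude count of all characters is bounded by a constant, so a density estimate
    need only be proved for large Q. *)
Lemma count_all_Q (B : nat -> (Z -> C) -> Prop) delta L0 : 0 <= delta ->
  (forall Q E, (16 <= Q)%nat -> L0 <= ln (INR Q) -> characters_upto Q E -> (forall chi, In chi E -> B Q chi) ->
     INR (length E) <= Rpower (INR Q) delta) ->
  exists K, 0 < K /\ forall Q E, (16 <= Q)%nat -> characters_upto Q E -> (forall chi, In chi E -> B Q chi) ->
     INR (length E) <= K * Rpower (INR Q) delta.
Proof.
  intros Hd H. exists (1 + 6 * exp (4 * L0)). split; [pose proof (exp_pos (4 * L0)); lra|].
  intros Q E HQ HE HB. pose proof (exp_pos (4 * L0)) as P. assert (Q1 : 1 <= INR Q) by (apply (le_INR 1); lia).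
  assert (D1 : 1 <= Rpower (INR Q) delta).
  { rewrite <- (Rpower_O (INR Q)) at 1 by lra. now apply Rle_Rpower. }
  destruct (Rle_lt_dec L0 (ln (INR Q))) as [HL|HL].
  - eapply Rle_trans; [apply (H Q E); assumption|]. nra.
  - eapply Rle_trans; [apply (number_of_characters Q E); [lia|assumption]|].
    assert (INR Q ^ 4 <= exp (4 * L0)).
    { replace (INR Q ^ 4) with (exp (4 * ln (INR Q))); [apply exp_le; lra|].
      rewrite <- Rpower_pow by lra. unfold Rpower. f_equal. simpl; ring. }
    apply Rle_trans with ((1 + 6 * exp (4 * L0)) * 1); [lra|]. apply Rmult_le_compat_l; lra.
Qed.

Lemma blk_rough l X i g : NoDup l -> (forall p, In p l -> nprime p) -> (2 ^ S i <= X)%nat ->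
  blk i (fun n => RtoC (mcoef l X n) * g n)%C = csum (filter (rough l) (seq (S (2 ^ i)) (2 ^ i))) g.
Proof.
  intros Hn Hl HX. unfold blk. rewrite csum_filter. apply csum_ext. intros n H. apply in_seq in H.
  simpl in HX. rewrite mcoef_rough by (assumption || lia). destruct (rough l n); ring.
Qed.

Lemma rough_block_nil N n0 m : (2 <= n0)%nat -> (n0 + m <= S N)%nat -> filter (rough (primesN N)) (seq n0 m) = [].
Proof.
  intros H0 Hm. destruct (filter (rough (primesN N)) (seq n0 m)) as [|n r] eqn:E; [reflexivity|exfalso].
  assert (Hin : In n (filter (rough (primesN N)) (seq n0 m))) by (rewrite E; now left).
  apply filter_In in Hin. destruct Hin as [A B]. apply in_seq in A.
  destruct (rough_primesN N n ltac:(lia) B); lia.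
Qed.

Lemma mollified_unit l X chi s q : dirichlet_character q chi -> NoDup l -> (forall p, In p l -> nprime p) -> (1 <= X)%nat ->
  (RtoC (mcoef l X 1) * gchar chi s 1 = RtoC 1)%C.
Proof.
  intros HC Hn Hl HX. rewrite mcoef_rough by (assumption || lia).
  assert (E : rough l 1 = true).
  { unfold rough. apply forallb_forall. intros p Hp.
    destruct (dvb p 1) eqn:D; [|reflexivity]. exfalso. apply Hl, nprime_ge2 in Hp. apply dvb_iff in D; [|lia].
    apply Nat.divide_1_r in D. lia. }
  rewrite E, (proj1 (proj1 (gchar_gdom q chi s HC))). ring.
Qed.

Lemma Cmod_csum_lt_le {A} (l : list A) f c : (forall a, In a l -> Cmod (f a) <= c) -> Cmod (csum l f) <= INR (length l) * c.
Proof.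
  intros H. eapply Rle_trans; [apply Cmod_csum|]. rewrite <- rsum_const. now apply rsum_le.
Qed.

Definition zero_near (delta : R) (Q : nat) (chi : Z -> C) : Prop :=
  ~ principal chi /\ exists s, 1 - delta / 7 <= Re s <= 1 /\ Rabs (Im s) <= 2 * ln (INR Q) ^ 3 /\ dirichlet_L chi s = RtoC 0.

(* A zero makes the mollified product vanish, so the coefficients past the leading 1
   must cancel it: some dyadic block is large. *)
Theorem zero_density delta : 0 < delta < 7 / 2 -> exists K, 0 < K /\
  forall Q E, (16 <= Q)%nat -> characters_upto Q E -> (forall chi, In chi E -> zero_near delta Q chi) ->
  INR (length E) <= K * Rpower (INR Q) delta.
Proof.
  intros Hd. set (u := delta / 7). assert (Hu : 0 < u < / 2) by (unfold u; lra).
  assert (Hu2 : 0 < u ^ 2) by (apply pow_lt; lra).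
  destruct (block_mean (u ^ 2) Hu2) as [K0 [HK0 BM]].
  destruct (poly_exp (32 * K0 * 3 * 11 ^ 8) 11 (u ^ 2)) as [L1 [HL1 PE1]]; [assumption|].
  destruct (poly_exp 832 3 (u ^ 2 * (1 - u))) as [L2 [HL2 PE2]]; [nra|].
  apply count_all_Q with (L0 := Rmax L1 L2); [lra|].
  intros Q E HQ HL HE HB. set (L := ln (INR Q)) in *.
  assert (HLa : L1 <= L) by (eapply Rle_trans; [apply Rmax_l|exact HL]).
  assert (HLb : L2 <= L) by (eapply Rle_trans; [apply Rmax_r|exact HL]).
  assert (Q1 : 16 <= INR Q) by (replace 16 with (INR 16) by (simpl; ring); apply le_INR; lia).
  assert (EQ : INR Q = exp L) by (unfold L; rewrite exp_ln; lra).
  (* X is about Q^(2-3u): from there on Q^(2+u^2) N^(2u-1) is at most Q^(7u-u^2). The length of the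
     sum is about Q^(3+u^2), so that the truncation error, of order X Q times this length to the
     power -(1-u), is Q^(-u^2(1-u)) up to logarithms, while N^(2u) remains O(Q^(7u-u^2)) for the
     last block. *)
  destruct (pow2_between ((2 - 3 * u) * L)) as [J [[J1 J2] J3]]; [nra|].
  destruct (pow2_between ((3 + u ^ 2) * L)) as [I [[I1 I2] I3]]; [nra|].
  set (X := (2 ^ J)%nat). set (Z0 := (2 ^ I)%nat). set (l := primesN X).
  assert (Hln : NoDup l) by apply primesN_NoDup.
  assert (Hlp : forall p, In p l -> nprime p) by apply primesN_prime.
  set (T := 2 * L ^ 3). assert (L3 : 1 <= L ^ 3) by (apply pow_R1_Rle; lra).
  assert (HT : 1 <= T) by (unfold T; lra).
  assert (HJI : (J <= I)%nat).
  { apply Nat.nlt_ge. intros Hlt. assert (2 ^ S I <= 2 ^ J) by (apply Rle_pow; [lra|lia]).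
    assert (exp ((2 - 3 * u) * L) < exp ((3 + u ^ 2) * L)) by (apply exp_increasing, Rmult_lt_compat_r; lra).
    simpl in H. lra. }
  assert (HXZ : (1 <= X <= Z0)%nat).
  { split; [pose proof (Nat.pow_nonzero 2 J); lia|]. apply Nat.pow_le_mono_r; lia. }
  set (s := fun chi => epsilon (inhabits (RtoC 0)) (fun s : C => 1 - u <= Re s <= 1 /\ Rabs (Im s) <= T /\ dirichlet_L chi s = RtoC 0)).
  assert (Hs : forall chi, In chi E -> 1 - u <= Re (s chi) <= 1 /\ Rabs (Im (s chi)) <= T /\ dirichlet_L chi (s chi) = RtoC 0).
  { intros chi Hchi. unfold s. apply epsilon_spec. apply HB, Hchi. }
  assert (Ipos : 1 <= INR I).
  { apply (le_INR 1). destruct I; [|lia]. exfalso. change (2 ^ 0) with 1 in I1.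
    assert (exp 0 < exp ((3 + u ^ 2) * L)) by (apply exp_increasing, Rmult_lt_0_compat; lra). rewrite exp_0 in H. lra. }
  (* Blocks below J are empty, because l holds all primes up to X = 2^J. The value 0 makes their
     moments trivial. *)
  set (f := fun i chi => if le_lt_dec J i then Cmod (blk i (fun n => RtoC (mcoef l X n) * gchar chi (s chi) n))%C else 0).
  eapply Rle_trans; [apply (pigeonhole E I f (fun _ => / (4 * INR I)) (fun _ => 1%nat))|].
  - intros _. apply Rinv_0_lt_compat. lra.
  - intros i chi. unfold f. destruct (le_lt_dec J i); [apply Cmod_ge_0|lra].
  - intros chi Hchi. apply NNPP. intros Hno.
    assert (Hall : forall i, (i < I)%nat -> Cmod (blk i (fun n => RtoC (mcoef l X n) * gchar chi (s chi) n))%C <= / (4 * INR I)).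
    { intros i Hi. destruct (le_lt_dec J i) as [HJ|HJ].
      - apply Rnot_lt_le. intros Hlt. apply Hno. exists i. split; [assumption|]. unfold f.
        destruct (le_lt_dec J i); [assumption|lia].
      - rewrite blk_rough by (try assumption; unfold X; apply Nat.pow_le_mono_r; lia).
        unfold l. rewrite rough_block_nil.
        + unfold csum; simpl. rewrite Cmod_0. left; apply Rinv_0_lt_compat; lra.
        + pose proof (Nat.pow_nonzero 2 i). lia.
        + assert (2 ^ S i <= X)%nat by (unfold X; apply Nat.pow_le_mono_r; lia). simpl in H. lia. }
    destruct (proj2 HE chi Hchi) as [q [Hq [HC _]]]. destruct (Hs chi Hchi) as [[R1 R2] [R3 R4]].
    pose proof (moll_error Q q chi l X Z0 (s chi) T Hq HC (proj1 (HB chi Hchi)) Hln Hlp HXZ ltac:(lra) R3 HT) as ME.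
    rewrite R4, Cmult_0_r in ME. unfold Z0 in ME. rewrite dyadic_sum, (mollified_unit l X chi (s chi) q) in ME by (assumption || lia).
    set (S0 := csum (seq 0 I) (fun i => blk i (fun n => RtoC (mcoef l X n) * gchar chi (s chi) n))%C) in ME.
    assert (HS0 : Cmod S0 <= / 4).
    { eapply Rle_trans; [apply (Cmod_csum_lt_le (seq 0 I) _ (/ (4 * INR I)))|].
      - intros i Hi. apply in_seq in Hi. apply Hall. lia.
      - rewrite length_seq. right. field. lra. }
    assert (HE0 : 104 * T * INR X * INR Q * Rpower (INR (2 ^ I)) (- Re (s chi)) <= / 2).
    { assert (P1 : Rpower (INR (2 ^ I)) (- Re (s chi)) <= exp (- (3 + u ^ 2) * (1 - u) * L)).
      { rewrite INR_pow2. apply Rle_trans with (Rpower (exp ((3 + u ^ 2) * L)) (- Re (s chi))).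
        - apply Rpower_le_base_neg; [apply exp_pos|assumption|lra].
        - rewrite Rpower_exp. apply exp_le.
          assert (0 <= (3 + u ^ 2) * L) by (apply Rmult_le_pos; lra).
          replace (- (3 + u ^ 2) * (1 - u) * L) with (- (1 - u) * ((3 + u ^ 2) * L)) by ring.
          apply Rmult_le_compat_r; lra. }
      assert (P2 : INR X <= 2 * exp ((2 - 3 * u) * L)) by (unfold X; rewrite INR_pow2; assumption).
      rewrite EQ.
      apply Rle_trans with (104 * T * (2 * exp ((2 - 3 * u) * L)) * exp L * exp (- (3 + u ^ 2) * (1 - u) * L)).
      - apply Rmult_le_compat; [|left; apply exp_pos| |exact P1].
        + apply Rmult_le_pos; [|left; apply exp_pos]. apply Rmult_le_pos; [lra|apply pos_INR].
        + apply Rmult_le_compat_r; [left; apply exp_pos|]. apply Rmult_le_compat_l; [lra|exact P2].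
      - replace (104 * T * (2 * exp ((2 - 3 * u) * L)) * exp L * exp (- (3 + u ^ 2) * (1 - u) * L))
          with (/ 2 * (832 * L ^ 3) * (exp ((2 - 3 * u) * L) * exp L * exp (- (3 + u ^ 2) * (1 - u) * L)))
          by (unfold T; field).
        rewrite <- !exp_plus.
        replace ((2 - 3 * u) * L + L + - (3 + u ^ 2) * (1 - u) * L) with (- (u ^ 2 * (1 - u) * L)) by ring.
        rewrite exp_Ropp. pose proof (PE2 L HLb) as PE. pose proof (exp_pos (u ^ 2 * (1 - u) * L)) as Pp.
        apply Rmult_le_reg_r with (exp (u ^ 2 * (1 - u) * L)); [assumption|].
        rewrite Rmult_assoc, Rinv_l, Rmult_1_r by lra. lra. }
    assert (Cmod (RtoC 1) <= Cmod (RtoC 0 - (RtoC 1 + S0))%C + Cmod S0).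
    { replace (RtoC 1) with (- (RtoC 0 - (RtoC 1 + S0)) + - S0)%C by ring.
      eapply Rle_trans; [apply Cmod_triangle|]. rewrite !Cmod_opp.
      replace (RtoC 0 - (- (RtoC 0 - (RtoC 1 + S0)) + - S0 + S0))%C with (RtoC 0 - (RtoC 1 + S0))%C by ring. lra. }
    rewrite Cmod_1 in H. lra.
  - assert (Hinv : forall x, x / (/ (4 * INR I)) ^ (2 * 1) = 16 * INR I ^ 2 * x) by (intros x; simpl; field; lra).
    assert (HI8 : INR I + 3 <= 11 * L).
    { assert (u ^ 2 <= / 2 * / 2) by (simpl; rewrite Rmult_1_r; apply Rmult_le_compat; lra).
      assert (u ^ 2 * L <= / 4 * L) by (apply Rmult_le_compat_r; lra). lra. }
    pose proof (exp_pos ((7 * u - u ^ 2) * L)) as PP.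
    apply Rle_trans with (rsum (seq 0 I) (fun _ => 16 * INR I ^ 2 * (K0 * T * (11 * L) ^ 5 * (3 * exp ((7 * u - u ^ 2) * L))))).
    + apply rsum_le. intros i Hi. apply in_seq in Hi. rewrite Hinv.
      apply Rmult_le_compat_l; [apply Rmult_le_pos; [lra|apply pow2_ge_0]|].
      assert (HR0 : 0 <= K0 * T * (11 * L) ^ 5 * (3 * exp ((7 * u - u ^ 2) * L))).
      { apply Rmult_le_pos; [|lra]. apply Rmult_le_pos; [apply Rmult_le_pos; lra|apply pow_le; lra]. }
      unfold f. destruct (le_lt_dec J i) as [HJ|HJ].
      2:{ rewrite (rsum_ext _ _ (fun _ => 0)) by (intros; simpl; ring). now rewrite rsum_0. }
      eapply Rle_trans; [apply (BM Q E l X i s u T); try assumption; try lia; try lra|].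
      { intros chi Hchi. destruct (Hs chi Hchi) as [? [? _]]. split; [lra|assumption]. }
      pose proof (pos_INR i) as Pi. assert (INR i <= INR I) by (apply le_INR; lia).
      rewrite (Rmult_assoc (K0 * T * (INR i + 3) ^ 5)).
      assert (P2i : 0 < 2 ^ i) by (apply pow_lt; lra).
      apply Rmult_le_compat.
      * apply Rmult_le_pos; [apply Rmult_le_pos; lra|apply pow_le; lra].
      * apply Rmult_le_pos; [|left; apply exp_pos]. assert (0 < Rpower (INR Q) (2 + u ^ 2)) by apply exp_pos. lra.
      * apply Rmult_le_compat_l; [apply Rmult_le_pos; lra|]. apply pow_incr; lra.
      * rewrite Rmult_plus_distr_r.
        assert (B1 : 2 ^ i * Rpower (2 ^ i) (2 * u - 1) <= 2 * exp ((7 * u - u ^ 2) * L)).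
        { rewrite <- (Rpower_1 (2 ^ i)) at 1 by assumption. rewrite <- Rpower_plus.
          replace (1 + (2 * u - 1)) with (2 * u) by ring.
          apply Rle_trans with (Rpower (2 * exp ((3 + u ^ 2) * L)) (2 * u)).
          - apply Rle_Rpower_l; [lra|]. split; [assumption|]. eapply Rle_trans; [|exact I2]. apply Rle_pow; [lra|lia].
          - rewrite <- Rpower_mult_distr by (lra || apply exp_pos).
            apply Rmult_le_compat; try (left; apply exp_pos).
            + rewrite <- (Rpower_1 2) at 3 by lra. apply Rle_Rpower; lra.
            + rewrite Rpower_exp. apply exp_le. rewrite <- Rmult_assoc. apply Rmult_le_compat_r; [lra|].
              assert (u * u < / 2 * / 2) by (apply Rmult_le_0_lt_compat; lra).
              assert (u * (u * u) <= u * / 4) by (apply Rmult_le_compat_l; lra).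
              assert (u * u <= u * / 2) by (apply Rmult_le_compat_l; lra). simpl. lra. }
        assert (B2 : Rpower (INR Q) (2 + u ^ 2) * Rpower (2 ^ i) (2 * u - 1) <= exp ((7 * u - u ^ 2) * L)).
        { rewrite EQ, Rpower_exp.
          apply Rle_trans with (exp ((2 + u ^ 2) * L) * exp (- (1 - 2 * u) * ((2 - 3 * u) * L))).
          - apply Rmult_le_compat_l; [left; apply exp_pos|]. rewrite <- Rpower_exp.
            replace (2 * u - 1) with (- (1 - 2 * u)) by ring. apply Rpower_le_base_neg; [apply exp_pos| |lra].
            eapply Rle_trans; [exact J1|]. apply Rle_pow; [lra|lia].
          - rewrite <- exp_plus. apply exp_le.
            replace ((2 + u ^ 2) * L + - (1 - 2 * u) * ((2 - 3 * u) * L)) with ((7 * u - 5 * u ^ 2) * L) by ring.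
            apply Rmult_le_compat_r; lra. }
        lra.
    + rewrite rsum_const, length_seq. rewrite EQ, Rpower_exp.
      replace (delta * L) with ((7 * u - u ^ 2) * L + u ^ 2 * L) by (unfold u; field). rewrite exp_plus.
      pose proof (PE1 L HLa) as PE. apply Rmult_le_compat_l with (r := exp ((7 * u - u ^ 2) * L)) in PE; [|lra].
      eapply Rle_trans; [|exact PE].
      apply Rle_trans with ((11 * L) * (16 * (11 * L) ^ 2 * (K0 * T * (11 * L) ^ 5 * (3 * exp ((7 * u - u ^ 2) * L))))).
      * assert (W : 0 <= K0 * T * (11 * L) ^ 5 * (3 * exp ((7 * u - u ^ 2) * L))).
        { apply Rmult_le_pos; [|lra]. apply Rmult_le_pos; [apply Rmult_le_pos; lra|apply pow_le; lra]. }
        assert (W2 : INR I ^ 2 <= (11 * L) ^ 2) by (apply pow_incr; lra).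
        pose proof (pow2_ge_0 (INR I)).
        apply Rmult_le_compat; [lra| |lra|].
        -- apply Rmult_le_pos; lra.
        -- apply Rmult_le_compat_r; lra.
      * unfold T. right. ring.
Qed.

(** * Approximation by the Euler product *)

Lemma mob_abs_sum l c : (forall p, In p l -> (0 < p)%nat) ->
  rsum (mob l) (fun de => Rpower (INR (fst de)) (- c)) <= exp (rsum l (fun p => Rpower (INR p) (- c))).
Proof.
  induction l as [|p l IH]; intros Hl.
  - unfold rsum; simpl. rewrite exp_0. unfold Rpower. rewrite ln_1, Rmult_0_r, exp_0. lra.
  - cbn [mob]. rewrite rsum_app, rsum_map, rsum_cons, exp_plus.
    assert (Hl' : forall q, In q l -> (0 < q)%nat) by (intros q Hq; apply Hl; now right).
    assert (Pp : 0 < INR p) by (apply lt_0_INR, Hl; now left).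
    rewrite (rsum_ext (mob l) (fun a => Rpower (INR (fst ((p * fst a)%nat, - snd a))) (- c))
      (fun de => Rpower (INR p) (- c) * Rpower (INR (fst de)) (- c))).
    + rewrite rsum_scal. specialize (IH Hl').
      pose proof (exp_ineq1_le (Rpower (INR p) (- c))). assert (0 < Rpower (INR p) (- c)) by apply exp_pos.
      set (S0 := rsum (mob l) _) in *. set (x := Rpower (INR p) (- c)) in *.
      apply Rle_trans with ((1 + x) * exp (rsum l (fun p => Rpower (INR p) (- c)))); [|apply Rmult_le_compat_r; [left; apply exp_pos|lra]].
      replace (S0 + x * S0) with ((1 + x) * S0) by ring. apply Rmult_le_compat_l; lra.
    + intros de Hde. cbn [fst]. rewrite mult_INR. rewrite Rpower_mult_distr; [reflexivity|assumption|].
      apply lt_0_INR, (mob_pos l Hl' de Hde).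
Qed.

(* Rankin's trick. *)
Lemma euler_moll_diff q chi s l X b c : dirichlet_character q chi -> (forall p, In p l -> (0 < p)%nat) ->
  0 <= b -> c + b <= Re s -> (0 < X)%nat ->
  Cmod (cprod l (fun p => RtoC 1 - gchar chi s p) - moll l X chi s)%C
  <= Rpower (INR X) (- b) * exp (rsum l (fun p => Rpower (INR p) (- c))).
Proof.
  intros HC Hl Hb Hc HX. destruct (gchar_gdom q chi s HC) as [Hg Hd].
  rewrite (mob_prod _ l Hg Hl). unfold moll, mtrunc. rewrite csum_filter, <- csum_minus.
  eapply Rle_trans; [apply Cmod_csum|].
  apply Rle_trans with (rsum (mob l) (fun de => Rpower (INR X) (- b) * Rpower (INR (fst de)) (- c))).
  2:{ rewrite rsum_scal. apply Rmult_le_compat_l; [left; apply exp_pos|]. now apply mob_abs_sum. }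
  apply rsum_le. intros de Hde. pose proof (mob_pos l Hl de Hde) as P.
  assert (P1 : 1 <= INR (fst de)) by (apply (le_INR 1); lia).
  assert (PX : 0 < INR X) by (now apply lt_0_INR).
  destruct (Nat.leb (fst de) X) eqn:E.
  - replace (RtoC (snd de) * gchar chi s (fst de) - RtoC (snd de) * gchar chi s (fst de))%C with (RtoC 0) by ring.
    rewrite Cmod_0. apply Rmult_le_pos; left; apply exp_pos.
  - apply Nat.leb_gt in E. replace (RtoC (snd de) * gchar chi s (fst de) - RtoC 0)%C with (RtoC (snd de) * gchar chi s (fst de))%C by ring.
    rewrite Cmod_mult, Cmod_R, (mob_sign l de Hde), Rmult_1_l.
    eapply Rle_trans; [apply Hd; lia|]. eapply Rle_trans; [apply (Rle_Rpower (INR (fst de)) (- Re s) (- b + - c)); lra|].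
    rewrite Rpower_plus. apply Rmult_le_compat_r; [left; apply exp_pos|].
    apply Rpower_le_base_neg; [assumption|apply le_INR; lia|assumption].
Qed.

(** Primes are replaced by all integers at the cost of a logarithm. This is harmless: in the
    application y^v = L^(7/8), which together with the logarithm is still o(L). *)
Lemma prime_power_sum N y v : 0 <= v -> INR N <= y ->
  rsum (primesN N) (fun p => Rpower (INR p) (- (1 - v))) <= Rpower y v * (1 + ln (INR (S N))).
Proof.
  intros Hv Hy.
  apply Rle_trans with (rsum (seq 1 N) (fun n => Rpower y v * / INR n)).
  - apply Rle_trans with (rsum (primesN N) (fun n => Rpower y v * / INR n)).
    + apply rsum_le. intros p Hp. apply in_primesN in Hp. destruct Hp as [Hp HN]. apply nprime_ge2 in Hp.
      assert (P : 0 < INR p) by (apply lt_0_INR; lia). assert (INR p <= INR N) by (now apply le_INR).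
      replace (- (1 - v)) with (v + - (1)) by ring. rewrite Rpower_plus, Rpower_Ropp, Rpower_1 by assumption.
      apply Rmult_le_compat_r; [left; now apply Rinv_0_lt_compat|]. apply Rle_Rpower_l; lra.
    + apply rsum_incl; [apply primesN_NoDup| |].
      * intros p Hp. apply in_primesN in Hp. destruct Hp as [Hp HN]. apply nprime_ge2 in Hp. apply in_seq; lia.
      * intros n Hn. apply in_seq in Hn. apply Rmult_le_pos; [left; apply exp_pos|].
        left. apply Rinv_0_lt_compat, lt_0_INR. lia.
  - rewrite rsum_scal. apply Rmult_le_compat_l; [left; apply exp_pos|apply harmonic_le].
Qed.

(** The partial sum of length Q is estimated by n^-sigma <= Q^u / n, and the tail beyond Q is
    O(Q^u). *)
Lemma dirichlet_L_real_bound Q q chi sigma u : (1 <= Q)%nat -> (q <= Q)%nat -> dirichlet_character q chi -> ~ principal chi ->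
  0 <= u -> / 2 <= 1 - u <= sigma -> sigma <= 3 ->
  Cmod (dirichlet_L chi (RtoC sigma)) <= Rpower (INR Q) u * (12 + ln (INR Q)).
Proof.
  intros HQ Hq HC HN Hu Hs Hs3. assert (Q1 : 1 <= INR Q) by (apply (le_INR 1); lia).
  pose proof (dirichlet_L_approx q chi (RtoC sigma) Q HC HN) as HA.
  change (Re (RtoC sigma)) with sigma in HA. specialize (HA ltac:(lra) HQ).
  set (S0 := csum (seq 1 Q) _) in HA.
  assert (HS : Cmod S0 <= Rpower (INR Q) u * (2 + ln (INR Q))).
  { eapply Rle_trans; [apply Cmod_csum|].
    apply Rle_trans with (rsum (seq 1 Q) (fun n => Rpower (INR Q) u * / INR n)).
    - apply rsum_le. intros n Hn. apply in_seq in Hn. assert (1 <= INR n) by (apply (le_INR 1); lia).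
      destruct (gchar_gdom q chi (RtoC sigma) HC) as [_ Hd]. eapply Rle_trans; [apply Hd; lia|].
      change (Re (RtoC sigma)) with sigma.
      eapply Rle_trans; [apply (Rle_Rpower (INR n) (- sigma) (u + - (1))); lra|].
      rewrite Rpower_plus, Rpower_Ropp, Rpower_1 by lra.
      apply Rmult_le_compat_r; [left; apply Rinv_0_lt_compat; lra|]. apply Rle_Rpower_l; [assumption|].
      split; [lra|]. apply le_INR; lia.
    - rewrite rsum_scal. apply Rmult_le_compat_l; [left; apply exp_pos|].
      eapply Rle_trans; [apply harmonic_le|].
      assert (ln (INR (S Q)) <= ln (2 * INR Q)) by (apply ln_le; [apply lt_0_INR; lia|rewrite S_INR; lra]).
      rewrite ln_mult in H by lra. pose proof ln_2_bounds. lra. }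
  assert (HB : INR q * (1 + Cmod (RtoC sigma) * (1 + / sigma)) * Rpower (INR Q) (- sigma) <= 10 * Rpower (INR Q) u).
  { rewrite Cmod_R, Rabs_pos_eq by lra.
    replace (sigma * (1 + / sigma)) with (sigma + 1) by (field; lra).
    assert (HR : INR Q * Rpower (INR Q) (- sigma) <= Rpower (INR Q) u).
    { rewrite <- (Rpower_1 (INR Q)) at 1 by lra. rewrite <- Rpower_plus. apply Rle_Rpower; lra. }
    assert (0 < Rpower (INR Q) (- sigma)) by apply exp_pos.
    apply Rle_trans with (INR Q * 10 * Rpower (INR Q) (- sigma)); [|lra].
    apply Rmult_le_compat_r; [lra|]. apply Rmult_le_compat; [apply pos_INR|lra|now apply le_INR|lra]. }
  replace (dirichlet_L chi (RtoC sigma)) with ((dirichlet_L chi (RtoC sigma) - S0) + S0)%C by ring.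
  eapply Rle_trans; [apply Cmod_triangle|]. lra.
Qed.

(* n = log N for a block (N, 2N] whose k-th power has length at least Q^(2+u). The first,
   second and fourth summands are about 9, 8.3 and 8.4 times u L, the others are small. *)
Lemma rough_exponents u L n : 0 < u <= / 8 -> 10 <= ln L -> 0 < L -> ln L / (2 * u) - ln 2 <= n <= 2 * L ->
  exists k w, (1 <= k)%nat /\ (2 + u) * L <= INR k * n /\ INR k * (n + ln 2) < INR (S w) * (ln L / (2 * u)) /\
  INR k * (n + ln 2) <= 6 * L /\
  2 * INR k * ln L + 2 * u * (INR k * n) + 2 * INR k * (u / 20 * n) + INR w * ln (INR k) + (INR k + 1) * ln 2
  <= 27 * u * L + 2 * ln L + 3.
Proof.
  intros Hu Hlam HL Hn. set (la := ln L) in *. pose proof ln_2_bounds as HB.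
  assert (HLlam : la <= L).
  { unfold la. pose proof (exp_ineq1_le (ln L)). rewrite exp_ln in H by assumption. lra. }
  set (ly := la / (2 * u)). assert (Ely : ly * (2 * u) = la) by (unfold ly; field; lra).
  fold ly in Hn.
  assert (Hly : 40 <= ly) by (apply Rmult_le_reg_r with (2 * u); [lra|rewrite Ely; lra]).
  assert (Hn0 : 19 * ly <= 20 * n) by lra.
  (* With k = k0 + 1 the product k n lies between (2+u) L and (2+u) L + n, hence below (4+u) L. *)
  destruct (nfloor_ex ((2 + u) * L / n)) as [k0 [K1 K2]].
  { apply Rmult_le_pos; [apply Rmult_le_pos; lra|left; apply Rinv_0_lt_compat; lra]. }
  assert (Ek : (2 + u) * L / n * n = (2 + u) * L) by (field; lra).
  assert (K1' : INR k0 * n <= (2 + u) * L) by (rewrite <- Ek; apply Rmult_le_compat_r; lra).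
  assert (K2' : (2 + u) * L <= (INR k0 + 1) * n) by (rewrite <- Ek; apply Rmult_le_compat_r; lra).
  set (k := INR k0 + 1) in *. assert (Hk0 : 0 <= INR k0) by apply pos_INR.
  assert (HuL : 0 < u * L) by (apply Rmult_lt_0_compat; lra).
  assert (HuuL : u * (u * L) <= / 8 * (u * L)) by (apply Rmult_le_compat_r; lra).
  (* Here ly is log y and la = 2 u ly. From n >= 19/20 ly and k0 n <= (2+u) L one gets k0 la <= 2u
     (20/19) (2+u) L, and u <= 1/8. *)
  assert (A1 : INR k0 * la <= 4.48 * (u * L)).
  { rewrite <- Ely. assert (INR k0 * (19 * ly) <= INR k0 * (20 * n)) by (apply Rmult_le_compat_l; lra).
    assert (B : INR k0 * ly <= 20 / 19 * ((2 + u) * L)) by lra.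
    assert (INR k0 * ly * (2 * u) <= 20 / 19 * ((2 + u) * L) * (2 * u)) by (apply Rmult_le_compat_r; lra). lra. }
  assert (A2 : INR k0 * 10 <= INR k0 * la) by (apply Rmult_le_compat_l; lra).
  assert (A3 : k * n <= (4 + u) * L) by (unfold k; lra).
  assert (A4 : k <= 0.448 * (u * L) + 1) by (unfold k; lra).
  assert (A5 : k * ln 2 <= k * 1) by (apply Rmult_le_compat_l; unfold k; lra).
  assert (HuL8 : u * L <= / 8 * L) by (apply Rmult_le_compat_r; lra).
  assert (A6 : k <= L) by lra.
  (* w + 1 exceeds the quotient of log (2N)^k by log y, so that an integer up to (2N)^k has at most
     w prime factors above y. *)
  destruct (nfloor_ex (k * (n + ln 2) / ly)) as [w [W1 W2]].
  { apply Rmult_le_pos; [apply Rmult_le_pos; unfold k; lra|left; apply Rinv_0_lt_compat; lra]. }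
  assert (Ew : k * (n + ln 2) / ly * ly = k * (n + ln 2)) by (field; lra).
  assert (W2' : k * (n + ln 2) < (INR w + 1) * ly) by (rewrite <- Ew; apply Rmult_lt_compat_r; lra).
  assert (W1' : INR w * ly <= k * (n + ln 2)) by (rewrite <- Ew; apply Rmult_le_compat_r; lra).
  exists (S k0), w. rewrite !S_INR. fold k. split; [lia|]. split; [assumption|]. split; [assumption|]. split; [lra|].
  assert (W3 : INR w * ln k <= 8.25 * (u * L) + 0.25 * k).
  { assert (ln k <= la) by (apply ln_le; unfold k in *; lra).
    apply Rle_trans with (INR w * la); [apply Rmult_le_compat_l; [apply pos_INR|assumption]|].
    rewrite <- Ely. assert (INR w * ly * (2 * u) <= k * (n + ln 2) * (2 * u)) by (apply Rmult_le_compat_r; lra).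
    assert (k * n * (2 * u) <= (4 + u) * L * (2 * u)) by (apply Rmult_le_compat_r; lra).
    assert (k * ln 2 * (2 * u) <= k * 1 * (2 * u)) by (apply Rmult_le_compat_r; lra).
    assert (k * u <= k * / 8) by (apply Rmult_le_compat_l; unfold k; lra). lra. }
  assert (A7 : u * (k * n) <= u * ((4 + u) * L)) by (apply Rmult_le_compat_l; lra).
  replace (2 * k * la) with (2 * (INR k0 * la) + 2 * la) by (unfold k; ring).
  replace (2 * k * (u / 20 * n)) with (/ 10 * (u * (k * n))) by field. lra.
Qed.

Definition eventually_large (P : R -> Prop) : Prop := exists L0, forall L, L0 <= L -> P L.

Lemma eventually_large_and P P' : eventually_large P -> eventually_large P' -> eventually_large (fun L => P L /\ P' L).
Proof.
  intros [a Ha] [b Hb]. exists (Rmax a b). intros L HL. split.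
  - apply Ha. eapply Rle_trans; [apply Rmax_l|exact HL].
  - apply Hb. eapply Rle_trans; [apply Rmax_r|exact HL].
Qed.

Lemma eventually_poly_exp C m c : 0 < c -> eventually_large (fun L => C * L ^ m <= exp (c * L)).
Proof. intros Hc. destruct (poly_exp C m c Hc) as [L0 [_ H]]. now exists L0. Qed.

Lemma eventually_ln P : eventually_large P -> eventually_large (fun L => P (ln L)).
Proof.
  intros [a Ha]. exists (exp a). intros L HL. apply Ha. rewrite <- (ln_exp a). apply ln_le; [apply exp_pos|assumption].
Qed.

Lemma pigeonhole_bound {A} (E : list A) I (f : nat -> A -> R) (th : nat -> R) W :
  (forall i, 0 < th i) -> (forall i x, 0 <= f i x) ->
  (forall x, In x E -> exists i, (i < I)%nat /\ th i < f i x) ->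
  (forall i, (i < I)%nat -> exists k, rsum E (fun x => f i x ^ (2 * k)) / th i ^ (2 * k) <= W) ->
  INR (length E) <= INR I * W.
Proof.
  intros Hth Hf HE HW.
  set (k := fun i => epsilon (inhabits 0%nat) (fun k => rsum E (fun x => f i x ^ (2 * k)) / th i ^ (2 * k) <= W)).
  eapply Rle_trans; [apply (pigeonhole E I f th k Hth Hf HE)|].
  rewrite <- (length_seq I 0) at 2. rewrite <- rsum_const. apply rsum_le.
  intros i Hi. apply in_seq in Hi. unfold k. apply (epsilon_spec (inhabits 0%nat)). apply HW. lia.
Qed.

Lemma geometric_sum_le r I : 0 <= r < 1 -> rsum (seq 0 I) (fun i => r ^ i) <= / (1 - r).
Proof.
  intros Hr. assert (H : rsum (seq 0 I) (fun i => r ^ i) * (1 - r) = 1 - r ^ I).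
  { induction I as [|I IH]; [unfold rsum; simpl; ring|]. rewrite rsum_seq_S. simpl (0 + I)%nat.
    rewrite Rmult_plus_distr_r, IH. simpl; ring. }
  apply Rmult_le_reg_r with (1 - r); [lra|]. rewrite H, Rinv_l by lra. pose proof (pow_le r I). lra.
Qed.

Lemma exp_pow x k : exp x ^ k = exp (INR k * x).
Proof. rewrite <- Rpower_pow by apply exp_pos. apply Rpower_exp. Qed.

Lemma floor_nat_spec y : 0 <= y -> INR (Z.to_nat (Zfloor y)) <= y < INR (Z.to_nat (Zfloor y)) + 1.
Proof.
  intros Hy. pose proof (Zfloor_bound y) as B.
  assert (0 <= Zfloor y)%Z by (apply Zfloor_lub; simpl; assumption).
  rewrite INR_IZR_INZ, Z2Nat.id by assumption. lra.
Qed.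

(** A block below Q^2 is too short for the large sieve. Its k-th power, with k from
    [rough_exponents], has length at least Q^(2+u), and its 2k-th moment is compared with the
    threshold 2^(-iu/20) / L. The hypothesis y <= 2^(S i) keeps k of order L / log L. *)
Lemma rough_block_bound u : 0 < u <= / 8 -> exists K, 0 < K /\
  forall Q E y i (s : (Z -> C) -> C),
  (16 <= Q)%nat -> characters_upto Q E -> 10 <= ln (ln (INR Q)) -> 1 <= ln (INR Q) ->
  y = exp (ln (ln (INR Q)) / (2 * u)) -> y <= 2 ^ S i -> INR i * ln 2 <= 2 * ln (INR Q) ->
  (forall chi, In chi E -> 1 - u <= Re (s chi) <= 3 /\ Im (s chi) = 0) ->
  exists k, rsum E (fun chi => Cmod (csum (filter (rough (primesN (Z.to_nat (Zfloor y)))) (seq (S (2 ^ i)) (2 ^ i))) (gchar chi (s chi))) ^ (2 * k))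
    / (/ ln (INR Q) * exp (- (u / 20) * ln 2) ^ i) ^ (2 * k)
  <= K * ln (INR Q) ^ 2 * exp (27 * u * ln (INR Q) + 2 * ln (ln (INR Q)) + 3).
Proof.
  intros Hu. destruct (rough_power_mean u ltac:(lra)) as [K [HK RP]].
  exists (36 * K). split; [lra|]. intros Q E y i s HQ HE Hll HL Ey Hy Hi Hs.
  set (L := ln (INR Q)) in *. set (n := INR i * ln 2).
  assert (Q1 : 16 <= INR Q) by (replace 16 with (INR 16) by (simpl; ring); apply le_INR; lia).
  assert (EQ : INR Q = exp L) by (unfold L; rewrite exp_ln; lra).
  assert (EN : INR (2 ^ i) = exp n) by (rewrite INR_pow2; apply pow2_exp).
  assert (Hn : ln L / (2 * u) - ln 2 <= n).
  { assert (ln y <= ln (2 ^ S i)) by (apply ln_le; [rewrite Ey; apply exp_pos|assumption]).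
    rewrite ln_pow, Ey, ln_exp, S_INR in H by lra. unfold n. lra. }
  destruct (rough_exponents u L n Hu Hll ltac:(lra) (conj Hn Hi)) as [k [w [Hk [H1 [H2 [H3 H4]]]]]].
  exists k. pose proof ln_2_bounds as HB2.
  assert (E2 : 2 * INR (2 ^ i) = exp (n + ln 2)) by (rewrite EN, exp_plus, exp_ln by lra; ring).
  assert (k1 : 1 <= INR k) by (apply (le_INR 1); lia).
  assert (Hsum := RP Q E (primesN (Z.to_nat (Zfloor y))) (2 ^ i)%nat k w y s u 1 (6 * L)).
  rewrite E2, EN, !exp_pow, EQ, !Rpower_exp in Hsum.
  assert (Ypos : 0 < y) by (rewrite Ey; apply exp_pos).
  assert (Hth : (/ L * exp (- (u / 20) * ln 2) ^ i) ^ (2 * k) = exp (- (2 * INR k * ln L + 2 * INR k * (u / 20 * n)))).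
  { rewrite exp_pow. rewrite <- (exp_ln L) at 1 by lra. rewrite <- exp_Ropp, <- exp_plus, exp_pow, mult_INR.
    f_equal. unfold n. simpl (INR 2). ring. }
  rewrite Hth. unfold Rdiv. rewrite <- exp_Ropp, Ropp_involutive.
  set (D := 2 * INR k * ln L + 2 * INR k * (u / 20 * n)) in *.
  apply Rle_trans with (K * 1 * (6 * L) ^ 2 * (exp (INR k * (n + ln 2)) + exp ((2 + u) * L)) *
     (INR k ^ w * exp (INR k * n) * exp (-2 * (1 - u) * (INR k * n))) * exp D).
  - apply Rmult_le_compat_r; [left; apply exp_pos|]. apply Hsum; try assumption; try lra; try lia.
    + apply primesN_NoDup.
    + intros p Hp Hle. apply in_primesN. split; [assumption|].
      destruct (floor_nat_spec y) as [_ F]; [lra|]. apply Nat.lt_succ_r, INR_lt. rewrite S_INR. lra.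
    + pose proof (Nat.pow_nonzero 2 i). lia.
    + rewrite Ey, exp_pow. apply exp_increasing. exact H2.
    + rewrite ln_exp. assumption.
    + intros chi Hchi. destruct (Hs chi Hchi) as [A B]. rewrite B, Rabs_R0. lra.
  - assert (Ew : INR k ^ w = exp (INR w * ln (INR k))).
    { rewrite <- Rpower_pow by lra. reflexivity. }
    assert (G : exp (INR k * (n + ln 2)) + exp ((2 + u) * L) <= exp (INR k * (n + ln 2) + ln 2)).
    { rewrite (exp_plus _ (ln 2)), exp_ln by lra. assert (exp ((2 + u) * L) <= exp (INR k * (n + ln 2))); [|lra].
      apply exp_le. assert (0 <= INR k * ln 2) by (apply Rmult_le_pos; lra). lra. }
    rewrite Ew.
    set (B := exp (INR w * ln (INR k)) * exp (INR k * n) * exp (-2 * (1 - u) * (INR k * n))).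
    assert (HB : 0 <= B) by (apply Rmult_le_pos; [apply Rmult_le_pos|]; left; apply exp_pos).
    replace (K * 1 * (6 * L) ^ 2) with (36 * K * L ^ 2) by ring.
    assert (HKL : 0 <= 36 * K * L ^ 2) by (apply Rmult_le_pos; [lra|apply pow2_ge_0]).
    apply Rle_trans with (36 * K * L ^ 2 * exp (INR k * (n + ln 2) + ln 2) * B * exp D).
    + apply Rmult_le_compat_r; [left; apply exp_pos|]. apply Rmult_le_compat_r; [assumption|].
      now apply Rmult_le_compat_l.
    + replace (36 * K * L ^ 2 * exp (INR k * (n + ln 2) + ln 2) * B * exp D)
        with (36 * K * L ^ 2 * (exp (INR k * (n + ln 2) + ln 2) * B * exp D)) by ring.
      apply Rmult_le_compat_l; [assumption|]. unfold B.
      rewrite <- !exp_plus. apply exp_le. unfold D. lra.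
Qed.

(** From length Q^2 on, the second moment suffices: N^(2u) with N up to about Q^4 costs Q^(8u), well
    within the exponent 27u, and the smaller factors fit in what is left. *)
Lemma high_block_bound u : 0 < u <= / 8 -> exists K, 0 < K /\
  forall Q E l X i (s : (Z -> C) -> C),
  (16 <= Q)%nat -> characters_upto Q E -> 1 <= ln (INR Q) -> NoDup l -> (forall p, In p l -> nprime p) ->
  2 * ln (INR Q) <= INR i * ln 2 <= 4 * ln (INR Q) + 1 -> INR i + 3 <= 11 * ln (INR Q) ->
  (forall chi, In chi E -> 1 - u <= Re (s chi) <= 3 /\ Im (s chi) = 0) ->
  rsum E (fun chi => Cmod (blk i (fun n => RtoC (mcoef l X n) * gchar chi (s chi) n))%C ^ (2 * 1))
    / (/ ln (INR Q) * exp (- (u / 20) * ln 2) ^ i) ^ (2 * 1)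
  <= K * ln (INR Q) ^ 5 * exp (27 * u * ln (INR Q) + 2 * ln (ln (INR Q)) + 3).
Proof.
  intros Hu. destruct (block_mean u ltac:(lra)) as [K [HK BM]].
  exists (K * 11 ^ 5). split; [lra|]. intros Q E l X i s HQ HE HL Hl Hlp Hi Hi3 Hs.
  set (L := ln (INR Q)) in *. set (n := INR i * ln 2) in *.
  assert (Q1 : 16 <= INR Q) by (replace 16 with (INR 16) by (simpl; ring); apply le_INR; lia).
  assert (EQ : INR Q = exp L) by (unfold L; rewrite exp_ln; lra).
  assert (Hsum := BM Q E l X i s u 1). rewrite pow2_exp in Hsum. fold n in Hsum. rewrite EQ, !Rpower_exp in Hsum.
  assert (Hth : (/ L * exp (- (u / 20) * ln 2) ^ i) ^ (2 * 1) = exp (- (2 * ln L + 2 * (u / 20 * n)))).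
  { rewrite exp_pow. rewrite <- (exp_ln L) at 1 by lra. rewrite <- exp_Ropp, <- exp_plus, exp_pow.
    f_equal. unfold n. simpl (INR (2 * 1)). ring. }
  rewrite Hth. unfold Rdiv. rewrite <- exp_Ropp, Ropp_involutive.
  set (D := 2 * ln L + 2 * (u / 20 * n)) in *. simpl (2 * 1)%nat.
  apply Rle_trans with (K * 1 * (INR i + 3) ^ 5 * (exp n + exp ((2 + u) * L)) * exp ((2 * u - 1) * n) * exp D).
  - apply Rmult_le_compat_r; [left; apply exp_pos|]. apply Hsum; try assumption; try lra; try lia.
    intros chi Hchi. destruct (Hs chi Hchi) as [A B]. rewrite B, Rabs_R0. lra.
  - pose proof (pos_INR i) as Pi. assert (HuL : 0 < u * L) by (apply Rmult_lt_0_compat; lra).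
    assert (G : exp n + exp ((2 + u) * L) <= exp (n + u * L + 1)).
    { rewrite (exp_plus _ 1). pose proof (exp_ineq1_le 1). pose proof (exp_pos (n + u * L)) as Pn.
      assert (exp n <= exp (n + u * L)) by (apply exp_le; lra).
      assert (exp ((2 + u) * L) <= exp (n + u * L)) by (apply exp_le; lra).
      assert (exp (n + u * L) * 2 <= exp (n + u * L) * exp 1) by (apply Rmult_le_compat_l; lra). lra. }
    apply Rle_trans with (K * 11 ^ 5 * L ^ 5 * exp (n + u * L + 1) * exp ((2 * u - 1) * n) * exp D).
    + apply Rmult_le_compat_r; [left; apply exp_pos|].
      apply Rmult_le_compat_r; [left; apply exp_pos|].
      apply Rmult_le_compat; [apply Rmult_le_pos; [lra|apply pow_le; lra]| | |assumption].
      * pose proof (exp_pos n). pose proof (exp_pos ((2 + u) * L)). lra.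
      * rewrite Rmult_1_r, Rmult_assoc. rewrite <- Rpow_mult_distr. apply Rmult_le_compat_l; [lra|].
        apply pow_incr. lra.
    + replace (K * 11 ^ 5 * L ^ 5 * exp (n + u * L + 1) * exp ((2 * u - 1) * n) * exp D)
        with (K * 11 ^ 5 * L ^ 5 * (exp (n + u * L + 1) * exp ((2 * u - 1) * n) * exp D)) by ring.
      apply Rmult_le_compat_l; [apply Rmult_le_pos; [lra|apply pow_le; lra]|].
      rewrite <- !exp_plus. apply exp_le. unfold D.
      assert (u * n <= u * (4 * L + 1)) by (apply Rmult_le_compat_l; lra). lra.
Qed.

Definition euler_prod (delta : R) (Q : nat) (chi : Z -> C) (s : C) : C :=
  cprod (primes_le (Rpower (ln (INR Q)) (14 / delta))) (fun p => RtoC 1 - gchar chi s p)%C.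

Definition euler_far (delta K : R) (Q : nat) (chi : Z -> C) : Prop :=
  ~ principal chi /\ exists sigma, 1 - delta / 28 <= sigma <= 3 /\
    K / ln (INR Q) < Cmod (dirichlet_L chi (RtoC sigma) * euler_prod delta Q chi (RtoC sigma) - RtoC 1)%C.

(** The error from [euler_moll_diff] with b = 3u/4, c = 1 - 7u/4 and X = Q^2, multiplied by the
    bound for L. The saving 3uL/2 beats uL, and the sum over primes is L^(7/8) times a logarithm. *)
Lemma eventually_rankin u : 0 < u <= / 8 -> eventually_large (fun L => 10 <= ln L ->
  (12 + L) * exp (u * L - 3 / 4 * u * (2 * L) + exp (7 / 8 * ln L) * (2 + ln L / (2 * u))) <= / L).
Proof.
  intros Hu.
  destruct (eventually_large_and _ _
    (eventually_large_and _ _ (eventually_poly_exp 13 2 (u / 4) ltac:(lra))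
      (eventually_ln _ (eventually_poly_exp (4 / u * (2 + / (2 * u))) 1 (/ 8) ltac:(lra))))
    (ex_intro _ 1 (fun L HL => HL))) as [L0 H].
  exists L0. intros L HL Hll. destruct (H L HL) as [[H1 H2] H3]. rewrite pow_1 in H2.
  set (la := ln L) in *.
  assert (EL : exp la = L) by (unfold la; apply exp_ln; lra).
  assert (S1 : exp (7 / 8 * la) * (2 + la / (2 * u)) <= u / 4 * L).
  { apply Rle_trans with (exp (7 / 8 * la) * (u / 4 * exp (/ 8 * la))).
    - apply Rmult_le_compat_l; [left; apply exp_pos|].
      assert (I2 : 0 < / (2 * u)) by (apply Rinv_0_lt_compat; lra).
      apply Rle_trans with (u / 4 * (4 / u * (2 + / (2 * u)) * la)); [|apply Rmult_le_compat_l; lra].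
      replace (u / 4 * (4 / u * (2 + / (2 * u)) * la)) with ((2 + / (2 * u)) * la) by (field; lra).
      unfold Rdiv. assert (0 <= la * / (2 * u)) by (apply Rmult_le_pos; lra). lra.
    - right. rewrite <- EL. replace la with (7 / 8 * la + / 8 * la) at 3 by field. rewrite exp_plus. ring. }
  apply Rle_trans with ((12 + L) * exp (- (u / 4 * L))).
  - apply Rmult_le_compat_l; [lra|]. apply exp_le. lra.
  - rewrite exp_Ropp. pose proof (exp_pos (u / 4 * L)) as P.
    apply Rmult_le_reg_r with (exp (u / 4 * L) * L); [apply Rmult_lt_0_compat; lra|].
    replace ((12 + L) * / exp (u / 4 * L) * (exp (u / 4 * L) * L)) with ((12 + L) * L) by (field; lra).
    replace (/ L * (exp (u / 4 * L) * L)) with (exp (u / 4 * L)) by (field; lra).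
    assert (1 * L <= L * L) by (apply Rmult_le_compat_r; lra). simpl in H1. lra.
Qed.

(** Write P for the finite product and M for its truncation: L P - S = L (P - M) + (M L - S). The
    first part is Rankin's error, the second the error of truncating the Dirichlet series, about Q^3
    Q^(-4(1-u)). *)
Lemma euler_approx_error u : 0 < u < / 8 -> eventually_large (fun L => 10 <= ln L -> 1 <= L ->
  forall Q q chi sigma y X Z0,
  (16 <= Q)%nat -> L = ln (INR Q) -> (q <= Q)%nat -> dirichlet_character q chi -> ~ principal chi -> 1 - u <= sigma <= 3 ->
  y = exp (ln L / (2 * u)) -> (1 <= X <= Z0)%nat ->
  exp (2 * L) <= INR X <= 2 * exp (2 * L) -> exp (4 * L) <= INR Z0 ->
  let l := primesN (Z.to_nat (Zfloor y)) in
  Cmod (dirichlet_L chi (RtoC sigma) * cprod l (fun p => RtoC 1 - gchar chi (RtoC sigma) p)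
     - csum (seq 1 Z0) (fun n => RtoC (mcoef l X n) * gchar chi (RtoC sigma) n))%C <= 2 / L).
Proof.
  intros Hu. destruct (eventually_large_and _ _ (eventually_rankin u ltac:(lra)) (eventually_poly_exp 208 1 (/ 2) ltac:(lra))) as [L0 H].
  exists L0. intros L HL Hll L1 Q q chi sigma y X Z0 HQ EL Hq HC HN Hs Ey HXZ HX HZ l.
  destruct (H L HL) as [HR HP]. specialize (HR Hll). rewrite pow_1 in HP.
  assert (Q1 : 16 <= INR Q) by (replace 16 with (INR 16) by (simpl; ring); apply le_INR; lia).
  assert (EQ : INR Q = exp L) by (rewrite EL, exp_ln; lra).
  assert (Hlp : forall p, In p l -> nprime p) by apply primesN_prime.
  assert (Hlpos : forall p, In p l -> (0 < p)%nat) by apply primesN_pos.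
  assert (Ypos : 0 < y) by (rewrite Ey; apply exp_pos).
  destruct (floor_nat_spec y) as [F1 F2]; [lra|].
  set (D := dirichlet_L chi (RtoC sigma)). set (P := cprod l _). set (M := moll l X chi (RtoC sigma)). set (S0 := csum (seq 1 Z0) _).
  replace (D * P - S0)%C with (D * (P - M) + (M * D - S0))%C by ring.
  eapply Rle_trans; [apply Cmod_triangle|]. rewrite Cmod_mult.
  assert (A1 : Cmod D <= exp (u * L) * (12 + L)).
  { rewrite EL, <- Rpower_exp, <- EL, <- EQ. rewrite EL.
    apply (dirichlet_L_real_bound Q q chi sigma u); try assumption; try lra; try lia. }
  assert (A2 : Cmod (P - M)%C <= exp (- (3 / 4 * u * (2 * L)) + exp (7 / 8 * ln L) * (2 + ln L / (2 * u)))).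
  { eapply Rle_trans; [apply (euler_moll_diff q chi (RtoC sigma) l X (3 / 4 * u) (1 - 7 / 4 * u) HC Hlpos); try lia; try lra|].
    { change (Re (RtoC sigma)) with sigma. lra. }
    rewrite exp_plus. apply Rmult_le_compat; try (left; apply exp_pos).
    - eapply Rle_trans; [apply (Rpower_le_base_neg (exp (2 * L))); [apply exp_pos|apply HX|lra]|].
      rewrite Rpower_exp. right. f_equal. ring.
    - apply exp_le. eapply Rle_trans; [apply (prime_power_sum _ y); [lra|exact F1]|].
      rewrite Ey at 1. rewrite Rpower_exp. replace (7 / 4 * u * (ln L / (2 * u))) with (7 / 8 * ln L) by (field; lra).
      apply Rmult_le_compat_l; [left; apply exp_pos|].
      assert (Y1 : 1 <= y). { rewrite Ey, <- exp_0. apply exp_le. apply Rmult_le_pos; [lra|left; apply Rinv_0_lt_compat; lra]. }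
      assert (ln (INR (S (Z.to_nat (Zfloor y)))) <= ln (2 * y)).
      { apply ln_le; [apply lt_0_INR; lia|]. rewrite S_INR. lra. }
      rewrite ln_mult, Ey, ln_exp in H0 by lra. rewrite <- Ey in H0. pose proof ln_2_bounds. lra. }
  assert (A3 : Cmod (M * D - S0)%C <= / L).
  { eapply Rle_trans; [apply (moll_error Q q chi l X Z0 (RtoC sigma) 1 Hq HC HN (primesN_NoDup _) Hlp HXZ)|].
    - change (Re (RtoC sigma)) with sigma. lra.
    - change (Im (RtoC sigma)) with 0. rewrite Rabs_R0. lra.
    - lra.
    - change (Re (RtoC sigma)) with sigma. rewrite EQ.
      apply Rle_trans with (104 * 1 * (2 * exp (2 * L)) * exp L * exp (- (1 - u) * (4 * L))).
      + apply Rmult_le_compat; [|left; apply exp_pos| |].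
        * apply Rmult_le_pos; [|left; apply exp_pos]. apply Rmult_le_pos; [lra|apply pos_INR].
        * apply Rmult_le_compat_r; [left; apply exp_pos|]. apply Rmult_le_compat_l; [lra|apply HX].
        * rewrite <- Rpower_exp. eapply Rle_trans; [apply (Rpower_le_base_neg (exp (4 * L))); [apply exp_pos|assumption|lra]|].
          rewrite !Rpower_exp. apply exp_le. apply Rmult_le_compat_r; lra.
      + replace (104 * 1 * (2 * exp (2 * L)) * exp L * exp (- (1 - u) * (4 * L)))
          with (208 * (exp (2 * L) * exp L * exp (- (1 - u) * (4 * L)))) by ring.
        rewrite <- !exp_plus. apply Rle_trans with (208 * exp (- (/ 2 * L))).
        * apply Rmult_le_compat_l; [lra|]. apply exp_le.
          assert (u * L <= / 8 * L) by (apply Rmult_le_compat_r; lra). lra.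
        * rewrite exp_Ropp. pose proof (exp_pos (/ 2 * L)) as Pp.
          apply Rmult_le_reg_r with (exp (/ 2 * L) * L); [apply Rmult_lt_0_compat; lra|].
          replace (208 * / exp (/ 2 * L) * (exp (/ 2 * L) * L)) with (208 * L) by (field; lra).
          replace (/ L * (exp (/ 2 * L) * L)) with (exp (/ 2 * L)) by (field; lra). assumption. }
  assert (A4 : Cmod D * Cmod (P - M)%C <= / L).
  { eapply Rle_trans; [|exact HR].
    replace (u * L - 3 / 4 * u * (2 * L) + exp (7 / 8 * ln L) * (2 + ln L / (2 * u)))
      with (u * L + (- (3 / 4 * u * (2 * L)) + exp (7 / 8 * ln L) * (2 + ln L / (2 * u)))) by ring.
    rewrite exp_plus, <- Rmult_assoc, (Rmult_comm (12 + L)). apply Rmult_le_compat; try apply Cmod_ge_0; assumption. }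
  unfold Rdiv. lra.
Qed.

(* If the mollified sum is not close to 1 at a point then one of its dyadic blocks is
   large there; blocks of rough integers are raised to a power of length about Q^2. *)
Theorem euler_density delta : 0 < delta < 7 / 2 -> exists K0 K, 0 < K0 /\ 0 < K /\
  forall Q E, (16 <= Q)%nat -> characters_upto Q E -> (forall chi, In chi E -> euler_far delta K0 Q chi) ->
  INR (length E) <= K * Rpower (INR Q) delta.
Proof.
  intros Hd. set (u := delta / 28). assert (Hu : 0 < u < / 8) by (unfold u; lra).
  destruct (rough_block_bound u ltac:(lra)) as [K1 [HK1 RB]].
  destruct (high_block_bound u ltac:(lra)) as [K2 [HK2 HB]].
  (* Thresholds that decay like r^i = 2^(-iu/20) add up to O(1/L). Equal ones would have to be about
     1/L^2, as there are about L blocks, and would square the cost L^(2k). *)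
  set (r := exp (- (u / 20) * ln 2)). pose proof ln_2_bounds as HB2.
  assert (Hr : 0 <= r < 1).
  { split; [left; apply exp_pos|]. rewrite <- exp_0. apply exp_increasing.
    assert (0 < u / 20 * ln 2) by (apply Rmult_lt_0_compat; lra). lra. }
  set (G := / (1 - r)). assert (HG : 0 < G) by (apply Rinv_0_lt_compat; lra).
  destruct (eventually_large_and _ _ (eventually_large_and _ _ (euler_approx_error u Hu)
     (eventually_poly_exp (11 * (K1 + K2) * exp 3) 8 u ltac:(lra)))
     (eventually_ln _ (ex_intro _ 10 (fun L HL => HL)))) as [L0 HL0].
  exists (3 + G).
  destruct (count_all_Q (euler_far delta (3 + G)) delta (Rmax 1 L0)) as [K [HK HKb]]; [lra| |exists K; split; [lra|split; assumption]].
  intros Q E HQ HL HE HBad. set (L := ln (INR Q)) in *.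
  assert (L1 : 1 <= L) by (eapply Rle_trans; [apply Rmax_l|exact HL]).
  destruct (HL0 L) as [[HA HC] Hll]; [eapply Rle_trans; [apply Rmax_r|exact HL]|]. clear HL0.
  specialize (HA Hll L1).
  assert (Q1 : 16 <= INR Q) by (replace 16 with (INR 16) by (simpl; ring); apply le_INR; lia).
  assert (EQ : INR Q = exp L) by (unfold L; rewrite exp_ln; lra).
  (* X is about Q^2, beyond which blocks are long enough for the sieve. The sum runs up to about
     Q^4, which makes its truncation error at most a power Q^(-1/2) up to constants. *)
  destruct (pow2_between (2 * L)) as [J [[J1 J2] J3]]; [lra|].
  destruct (pow2_between (4 * L)) as [I [[I1 I2] I3]]; [lra|].
  set (X := (2 ^ J)%nat). set (Z0 := (2 ^ I)%nat). set (y := exp (ln L / (2 * u))).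
  assert (Ypos : 0 < y) by apply exp_pos.
  assert (Ey : Rpower L (14 / delta) = y) by (unfold Rpower, y; f_equal; unfold u; field; lra).
  set (N := Z.to_nat (Zfloor y)). set (l := primesN N).
  destruct (floor_nat_spec y) as [F1 F2]; [lra|]. fold N in F1, F2.
  assert (Hln : NoDup l) by apply primesN_NoDup.
  assert (Hlp : forall p, In p l -> nprime p) by apply primesN_prime.
  assert (HJI : (J <= I)%nat).
  { apply Nat.nlt_ge. intros Hlt. assert (2 ^ S I <= 2 ^ J) by (apply Rle_pow; [lra|lia]).
    assert (exp (2 * L) < exp (4 * L)) by (apply exp_increasing; lra).
    change (2 ^ S I) with (2 * 2 ^ I) in H. lra. }
  assert (HXZ : (1 <= X <= Z0)%nat).
  { split; [pose proof (Nat.pow_nonzero 2 J); lia|]. apply Nat.pow_le_mono_r; lia. }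
  assert (EX : INR X = 2 ^ J) by apply INR_pow2. assert (EZ : INR Z0 = 2 ^ I) by apply INR_pow2.
  set (bad := fun chi sigma => 1 - u <= sigma <= 3 /\
     (3 + G) / L < Cmod (dirichlet_L chi (RtoC sigma) * euler_prod delta Q chi (RtoC sigma) - RtoC 1)%C).
  set (sg := fun chi => epsilon (inhabits 0) (bad chi)).
  assert (Hsg : forall chi, In chi E -> bad chi (sg chi)).
  { intros chi Hchi. unfold sg. apply epsilon_spec. apply HBad, Hchi. }
  set (s := fun chi => RtoC (sg chi)).
  assert (Hs : forall chi, In chi E -> 1 - u <= Re (s chi) <= 3 /\ Im (s chi) = 0).
  { intros chi Hchi. destruct (Hsg chi Hchi) as [A _]. split; [exact A|reflexivity]. }
  set (f := fun i chi => Cmod (blk i (fun n => RtoC (mcoef l X n) * gchar chi (s chi) n))%C).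
  set (th := fun i => / L * r ^ i).
  assert (IL : 0 < / L) by (apply Rinv_0_lt_compat; lra).
  assert (Hth : forall i, 0 < th i) by (intros i; apply Rmult_lt_0_compat; [assumption|apply pow_lt, exp_pos]).
  set (W := (K1 + K2) * L ^ 5 * exp (27 * u * L + 2 * ln L + 3)).
  assert (HW : forall k m, 0 <= k <= K1 + K2 -> (m <= 5)%nat -> k * L ^ m * exp (27 * u * L + 2 * ln L + 3) <= W).
  { intros k m Hk Hm. unfold W. apply Rmult_le_compat_r; [left; apply exp_pos|].
    apply Rmult_le_compat; [lra|apply pow_le; lra|lra|apply Rle_pow; [lra|assumption]]. }
  assert (HW0 : 0 <= W) by (eapply Rle_trans; [|apply (HW 0 0%nat); [lra|lia]]; right; ring).
  apply Rle_trans with (INR I * W).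
  - apply (pigeonhole_bound E I f th W Hth); [intros; apply Cmod_ge_0| |].
    + intros chi Hchi. apply NNPP. intros Hno.
      assert (Hall : forall i, (i < I)%nat -> f i chi <= th i).
      { intros i Hi. apply Rnot_lt_le. intros Hlt. apply Hno. now exists i. }
      destruct (proj2 HE chi Hchi) as [q [Hq [HCq _]]]. destruct (Hsg chi Hchi) as [R1 R2].
      specialize (HA Q q chi (sg chi) y X Z0 HQ eq_refl Hq HCq (proj1 (HBad chi Hchi)) R1 eq_refl HXZ).
      rewrite EX, EZ in HA. specialize (HA (conj J1 J2) I1). cbv zeta in HA. fold N in HA. fold l in HA.
      unfold euler_prod in R2. fold L in R2. rewrite Ey in R2. change (primes_le y) with l in R2.
      unfold Z0 in HA. rewrite dyadic_sum in HA. fold (s chi) in HA, R2.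
      rewrite (mollified_unit l X chi (s chi) q) in HA by (assumption || lia).
      set (S0 := csum (seq 0 I) _) in HA. set (D := (dirichlet_L chi (s chi) * _)%C) in HA, R2.
      assert (HS0 : Cmod S0 <= G / L).
      { eapply Rle_trans; [apply Cmod_csum|]. apply Rle_trans with (rsum (seq 0 I) th).
        - apply rsum_le. intros i Hi. apply in_seq in Hi. apply Hall. lia.
        - unfold th. rewrite rsum_scal. unfold Rdiv. rewrite (Rmult_comm G). apply Rmult_le_compat_l; [lra|].
          now apply geometric_sum_le. }
      assert (Cmod (D - RtoC 1)%C <= Cmod (D - (RtoC 1 + S0))%C + Cmod S0).
      { replace (D - RtoC 1)%C with ((D - (RtoC 1 + S0)) + S0)%C by ring. apply Cmod_triangle. }
      unfold Rdiv in *. lra.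
    + intros i Hi.
      assert (Zero : forall k, (1 <= k)%nat -> (forall chi, In chi E -> f i chi = 0) -> rsum E (fun x => f i x ^ (2 * k)) / th i ^ (2 * k) <= W).
      { intros k Hk Hz. rewrite (rsum_ext _ _ (fun _ => 0)), rsum_0.
        - unfold Rdiv. rewrite Rmult_0_l. assumption.
        - intros chi Hchi. rewrite Hz by assumption. apply pow_i. lia. }
      destruct (le_lt_dec J i) as [HJ|HJ].
      * exists 1%nat. eapply Rle_trans; [apply (HB Q E l X i s HQ HE L1 Hln Hlp)|].
        -- fold L. split.
           ++ apply Rle_trans with (INR J * ln 2).
              ** rewrite <- (ln_exp (2 * L)), <- ln_pow by lra. apply ln_le; [apply exp_pos|assumption].
              ** apply Rmult_le_compat_r; [lra|now apply le_INR].
           ++ rewrite <- ln_pow by lra. apply Rle_trans with (ln (2 * exp (4 * L))).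
              ** apply ln_le; [apply pow_lt; lra|]. eapply Rle_trans; [|exact I2]. apply Rle_pow; [lra|lia].
              ** rewrite ln_mult, ln_exp by (lra || apply exp_pos). lra.
        -- fold L. assert (INR i + 1 <= INR I) by (rewrite <- S_INR; apply le_INR; lia). lra.
        -- assumption.
        -- fold L. apply HW; [lra|lia].
      * assert (HSX : (2 ^ S i <= X)%nat) by (apply Nat.pow_le_mono_r; lia).
        assert (Ef : forall chi, f i chi = Cmod (csum (filter (rough l) (seq (S (2 ^ i)) (2 ^ i))) (gchar chi (s chi)))).
        { intros chi. unfold f. now rewrite blk_rough. }
        destruct (le_lt_dec (2 ^ S i) N) as [HN|HN].
        (* The whole block lies below y, where no integer above 1 is free of primes up to y. *)
        -- exists 1%nat. apply Zero; [lia|]. intros chi _. rewrite Ef. unfold l. rewrite rough_block_nil.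
           ++ apply Cmod_0.
           ++ pose proof (Nat.pow_nonzero 2 i). lia.
           ++ simpl in HN. lia.
        -- assert (Y2 : y <= 2 ^ S i).
           { rewrite <- INR_pow2. apply Rlt_le. eapply Rlt_le_trans; [exact F2|]. rewrite <- S_INR. apply le_INR. lia. }
           destruct (RB Q E y i s HQ HE Hll L1 eq_refl Y2) as [k Hk].
           ++ fold L. rewrite <- ln_pow by lra. rewrite <- (ln_exp (2 * L)). apply ln_le; [apply pow_lt; lra|].
              apply le_INR in HSX. rewrite EX, INR_pow2 in HSX. change (2 ^ S i) with (2 * 2 ^ i) in HSX. lra.
           ++ assumption.
           ++ exists k. fold L in Hk. fold r in Hk. fold N in Hk. fold l in Hk.
              rewrite (rsum_ext E _ (fun chi => Cmod (csum (filter (rough l) (seq (S (2 ^ i)) (2 ^ i))) (gchar chi (s chi))) ^ (2 * k)))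
                by (intros; now rewrite Ef).
              eapply Rle_trans; [exact Hk|]. apply HW; [lra|lia].
  - apply Rle_trans with (11 * L * W); [apply Rmult_le_compat_r; lra|].
    unfold W. replace (27 * u * L + 2 * ln L + 3) with (27 * u * L + ln L + ln L + 3) by ring.
    rewrite !exp_plus, exp_ln by lra.
    rewrite EQ, Rpower_exp. replace (delta * L) with (27 * u * L + u * L) by (unfold u; field). rewrite exp_plus.
    apply Rle_trans with (exp (27 * u * L) * (11 * (K1 + K2) * exp 3 * L ^ 8)); [right; ring|].
    apply Rmult_le_compat_l; [left; apply exp_pos|assumption].
Qed.

(** * The exceptional set and the logarithm *)

(** The exceptional set must be a list, while being exceptional is a predicate. A bound on all its
    duplicate-free lists yields a maximal one, and maximality makes it complete. *)
Lemma maximal_list {A} (P : A -> Prop) B :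
  (forall l, NoDup l -> (forall x, In x l -> P x) -> (length l <= B)%nat) ->
  exists E, NoDup E /\ forall x, In x E <-> P x.
Proof.
  intros HB.
  assert (H : forall k l, NoDup l -> (forall x, In x l -> P x) -> (B <= length l + k)%nat ->
    exists E, NoDup E /\ forall x, In x E <-> P x).
  { induction k as [|k IH]; intros l Hn Hl Hk.
    - exists l. split; [assumption|]. intros x. split; [apply Hl|]. intros Hx. apply NNPP. intros Hni.
      assert (length (x :: l) <= B)%nat; [|simpl in *; lia].
      apply HB; [now constructor|]. intros z [<-|Hz]; auto.
    - destruct (classic (forall x, P x -> In x l)) as [H|H].
      + exists l. split; [assumption|]. intros x. split; auto.
      + apply not_all_ex_not in H. destruct H as [x H]. apply imply_to_and in H. destruct H as [Hx Hni].
        apply (IH (x :: l)); [now constructor| |simpl; lia]. intros z [<-|Hz]; auto. }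
  apply (H B []); [constructor|intros _ []|simpl; lia].
Qed.

Lemma principal_primitive_unique q chi q' psi :
  primitive_character q chi -> primitive_character q' psi -> principal chi -> principal psi -> chi = psi.
Proof.
  intros HC HP P1 P2. apply (primitive_agree q chi q' psi HC HP). intros n Hn.
  assert (chi n <> RtoC 0 /\ psi n <> RtoC 0) as [A B]; [|now rewrite P1, P2].
  split.
  - apply (chi_support _ _ (proj1 HC)). apply rel_prime_sym. apply rel_prime_sym in Hn.
    apply (rel_prime_div (Z.of_nat q * Z.of_nat q')); [assumption|apply Z.divide_factor_l].
  - apply (chi_support _ _ (proj1 HP)). apply rel_prime_sym. apply rel_prime_sym in Hn.
    apply (rel_prime_div (Z.of_nat q * Z.of_nat q')); [assumption|apply Z.divide_factor_r].
Qed.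

Lemma split_disjunction {A} (P1 P2 : A -> Prop) (l : list A) : NoDup l ->
  (forall x, In x l -> P1 x \/ P2 x) ->
  exists l1 l2, NoDup l1 /\ NoDup l2 /\ incl l1 l /\ incl l2 l /\
  (forall x, In x l1 -> P1 x) /\ (forall x, In x l2 -> P2 x) /\ length l = (length l1 + length l2)%nat.
Proof.
  intros Hn H.
  set (f := fun x => if excluded_middle_informative (P1 x) then true else false).
  exists (filter f l), (filter (fun x => negb (f x)) l).
  split; [now apply NoDup_filter|]. split; [now apply NoDup_filter|].
  split; [apply incl_filter|]. split; [apply incl_filter|].
  split; [|split].
  - intros x Hx. apply filter_In in Hx. destruct Hx as [_ Hx]. unfold f in Hx.
    destruct (excluded_middle_informative (P1 x)); [assumption|discriminate].
  - intros x Hx. apply filter_In in Hx. destruct Hx as [Hin Hx]. unfold f in Hx.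
    destruct (excluded_middle_informative (P1 x)); [discriminate|]. destruct (H x Hin); tauto.
  - symmetry. apply filter_length.
Qed.

(** The bound 4 K0 ensures K0 / log Q <= 1/4 for the remaining characters, which is what
    [Clog1_bound] and [log_branch_real] ask for. *)
Definition exceptional (delta K0 : R) (Q : nat) (chi : Z -> C) : Prop :=
  (exists q, (q <= Q)%nat /\ primitive_character q chi) /\
  ((ln (INR Q) < 4 * K0 \/ principal chi) \/ (zero_near delta Q chi \/ euler_far delta K0 Q chi)).

Lemma ln_Q_ge_2 Q : (16 <= Q)%nat -> 2 <= ln (INR Q).
Proof.
  intros HQ. apply le_INR in HQ. replace (INR 16) with (2 ^ 4) in HQ by (simpl; ring).
  assert (ln (2 ^ 4) <= ln (INR Q)) by (apply ln_le; lra). rewrite ln_pow in H by lra.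
  pose proof ln_2_bounds. simpl in H. lra.
Qed.

Theorem exceptional_count delta : 0 < delta < 7 / 2 -> exists K0 K, 0 < K0 /\ 0 < K /\
  forall Q, (16 <= Q)%nat -> exists E, NoDup E /\ (forall chi, In chi E <-> exceptional delta K0 Q chi) /\
  INR (length E) <= K * Rpower (INR Q) delta.
Proof.
  intros Hd. destruct (zero_density delta Hd) as [K1 [HK1 H1]].
  destruct (euler_density delta Hd) as [K0 [K2 [HK0 [HK2 H2]]]].
  (* Once log Q >= 4 K0 this kind reduces to principal characters, and only one of them is
     primitive. *)
  destruct (count_all_Q (fun Q chi => ln (INR Q) < 4 * K0 \/ principal chi) delta (4 * K0)) as [K3 [HK3 H3]]; [lra| |].
  { intros Q E HQ HL HE HB. pose proof (ln_Q_ge_2 Q HQ) as HQ2.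
    apply Rle_trans with 1.
    - apply (le_INR _ 1). destruct E as [|chi [|psi E]]; simpl; try lia. exfalso.
      destruct HE as [Hn HE]. inversion Hn as [|? ? Hni _]; subst. apply Hni. left.
      destruct (HE chi) as [q [_ Hq]]; [now left|]. destruct (HE psi) as [q' [_ Hq']]; [right; now left|].
      assert (Hp : forall chi', In chi' (chi :: psi :: E) -> principal chi').
      { intros chi' Hc. destruct (HB chi' Hc); [lra|assumption]. }
      symmetry. apply (principal_primitive_unique q chi q' psi); try assumption; apply Hp; [now left|right; now left].
    - assert (1 <= INR Q) by (apply (le_INR 1); lia). rewrite <- (Rpower_O (INR Q)) by lra. apply Rle_Rpower; lra. }
  exists K0, (K3 + (K1 + K2)). split; [assumption|]. split; [lra|]. intros Q HQ.
  assert (HB : forall l, NoDup l -> (forall x, In x l -> exceptional delta K0 Q x) ->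
     INR (length l) <= (K3 + (K1 + K2)) * Rpower (INR Q) delta).
  { intros l Hn Hl.
    destruct (split_disjunction (fun chi => ln (INR Q) < 4 * K0 \/ principal chi)
      (fun chi => zero_near delta Q chi \/ euler_far delta K0 Q chi) l Hn) as [l1 [l2 [N1 [N2 [I1 [I2 [A1 [A2 E1]]]]]]]].
    { intros x Hx. apply (Hl x Hx). }
    destruct (split_disjunction (zero_near delta Q) (euler_far delta K0 Q) l2 N2 A2)
      as [l3 [l4 [N3 [N4 [I3 [I4 [A3 [A4 E2]]]]]]]].
    rewrite E1, E2, !plus_INR. rewrite !Rmult_plus_distr_r.
    assert (HU : forall l', NoDup l' -> incl l' l -> characters_upto Q l').
    { intros l' Hn' Hi. split; [assumption|]. intros chi Hchi. apply (Hl chi (Hi chi Hchi)). }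
    apply Rplus_le_compat; [|apply Rplus_le_compat].
    - apply H3; auto.
    - apply H1; auto. apply HU; [assumption|]. now apply incl_tran with l2.
    - apply H2; auto. apply HU; [assumption|]. now apply incl_tran with l2. }
  destruct (nfloor_ex ((K3 + (K1 + K2)) * Rpower (INR Q) delta)) as [B [_ HB2]].
  { apply Rmult_le_pos; [lra|left; apply exp_pos]. }
  destruct (maximal_list (exceptional delta K0 Q) B) as [E [HE1 HE2]].
  { intros l Hn Hl. specialize (HB l Hn Hl). apply Nat.lt_succ_r, INR_lt. rewrite S_INR. lra. }
  exists E. split; [assumption|]. split; [assumption|]. apply HB; [assumption|]. intros x; apply HE2.
Qed.

Lemma region_nonzero delta K0 Q q chi : 0 < delta -> (16 <= Q)%nat -> (q <= Q)%nat -> primitive_character q chi ->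
  ~ exceptional delta K0 Q chi -> forall s, region delta Q s -> dirichlet_L chi s <> RtoC 0.
Proof.
  intros Hd HQ Hq HC HE s Hs.
  assert (HN : ~ principal chi) by (intros H; apply HE; split; [now exists q|tauto]).
  assert (HZ : ~ zero_near delta Q chi) by (intros H; apply HE; split; [now exists q|tauto]).
  pose proof (ln_Q_ge_2 Q HQ) as HL. assert (HL3 : 0 < ln (INR Q) ^ 3) by (apply pow_lt; lra).
  intros E. destruct (Rlt_le_dec 1 (Re s)) as [H1|H1].
  - rewrite <- (log_series_exp q) in E by (apply HC || assumption). now apply Cexp_nz in E.
  - destruct Hs as [H2|[H2 H3]].
    + assert (R1 : Re s = 1) by lra. destruct (Req_dec (Im s) 0) as [H0|H0].
      (* The point s = 1 is not treated by the 3-4-1 argument: a zero there simply makes chi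
         exceptional. *)
      * apply HZ. split; [assumption|]. exists s. rewrite H0, Rabs_R0. repeat split; try lra; assumption.
      * apply (dirichlet_L_line_nonzero q chi (Im s) (proj1 HC) HN H0). rewrite <- E. f_equal.
        destruct s; simpl in *; now subst.
    + apply HZ. split; [assumption|]. exists s. repeat split; try lra; assumption.
Qed.

(** The neighbourhoods behind [open] are squares of the product topology, hence the radius r/2. *)
Lemma open_of_balls (U : C -> Prop) :
  (forall s, U s -> exists r, 0 < r /\ forall z, Cmod (z - s)%C < r -> U z) -> open U.
Proof.
  intros H s Hs. destruct (H s Hs) as [r [Hr Hz]].
  assert (Hr2 : 0 < r / 2) by lra. exists (mkposreal _ Hr2). intros z [B1 B2]. apply Hz.
  eapply Rle_lt_trans; [apply Cmod_le_sum|].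
  change (Rabs (Re z - Re s) < r / 2) in B1. change (Rabs (Im z - Im s) < r / 2) in B2.
  change (Re (z - s)%C) with (Re z - Re s). change (Im (z - s)%C) with (Im z - Im s). lra.
Qed.

(** The open set around D is that of all points with a zero-free ray to the right. A continuous
    logarithm of a holomorphic function on it is holomorphic by [log_holomorphic]. *)
Lemma log_branch_exists (D : C -> Prop) q chi : dirichlet_character q chi -> ~ principal chi ->
  (forall s, D s -> hfree (dirichlet_L chi) s) ->
  exists G, is_log_L D chi G /\ forall s, D s -> ccont G s.
Proof.
  intros HC HN HD. destruct (dirichlet_L_entire q chi HC HN) as [HE _].
  destruct (hlift_exists (dirichlet_L chi) (log_series chi)) as [HO [G [HG1 HG2]]].
  - intros z. apply holomorphic_cont, HE.
  - intros z Hz. split; [now apply (ccont_log_series q)|now apply (log_series_exp q)].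
  - exists G. split; [split; [|split]|].
    + exists (hfree (dirichlet_L chi)). split; [|split; [assumption|]].
      * apply open_of_balls. exact HO.
      * intros s Hs. destruct (HO s Hs) as [r [Hr Hz]]. apply (log_holomorphic (dirichlet_L chi) G s r Hr).
        -- intros z Hzr. now apply HG1, Hz.
        -- now apply HG1.
        -- apply HE.
    + intros s Hs. now apply HG1, HD.
    + exact HG2.
    + intros s Hs. now apply HG1, HD.
Qed.

Lemma Cexp_1_small h : Cexp h = RtoC 1 -> Cmod h < 2 -> h = RtoC 0.
Proof.
  intros E H. destruct (Cexp_1_inv h E) as [H1 H2]. apply C_ext; [exact H1|]. change (Im (RtoC 0)) with 0.
  pose proof (Im_le_Cmod h) as HI. pose proof PI2_1 as HP.
  assert (B : - (2) < Im h < 2) by (apply Rabs_lt_between; lra).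
  destruct (Rtotal_order (Im h) 0) as [L|[L|L]]; [|assumption|].
  - assert (0 < sin (- Im h)) by (apply sin_gt_0; lra). rewrite sin_neg in H0. lra.
  - assert (0 < sin (Im h)) by (apply sin_gt_0; lra). lra.
Qed.

Lemma euler_factor_inv q chi s p : dirichlet_character q chi -> / 2 < Re s -> nprime p ->
  (Cexp (lam (gchar chi s p)) * (RtoC 1 - gchar chi s p))%C = RtoC 1 /\ (RtoC 1 - gchar chi s p)%C <> RtoC 0.
Proof.
  intros HC Hs Hp. pose proof (gchar_prime_le_half q chi s p HC Hs Hp) as H.
  pose proof (lam_exp (gchar chi s p) ltac:(lra)) as E. split; [assumption|].
  intros Z0. rewrite Z0, Cmult_0_r in E. apply (f_equal Re) in E. simpl in E. lra.
Qed.

Lemma Clog1_bound w : Cmod (w - RtoC 1)%C <= / 4 -> Cmod (Clog1 w) <= 2 * Cmod (w - RtoC 1)%C.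
Proof.
  intros H. unfold Clog1. rewrite Cmod_opp. rewrite Cmod_minus_sym in H |- *.
  eapply Rle_trans; [apply lam_bound; lra|]. pose proof (Cmod_ge_0 (RtoC 1 - w)%C) as P.
  unfold Rdiv. rewrite Rmult_comm. apply Rmult_le_compat_r; [assumption|].
  rewrite <- (Rinv_inv 2). apply Rinv_le_contravar; lra.
Qed.

(* Both sides are logarithms of L that vary continuously on the segment from 3 to sigma,
   and they agree at 3. *)
Theorem log_branch_real (D : C -> Prop) q chi G N sigma :
  dirichlet_character q chi -> ~ principal chi -> is_log_L D chi G -> (forall s, D s -> ccont G s) ->
  / 2 < sigma <= 3 -> (1 <= N)%nat -> (forall x, sigma <= x <= 3 -> D (RtoC x)) ->
  let P := fun s => cprod (primesN N) (fun p => RtoC 1 - gchar chi s p)%C in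
  (forall x, sigma <= x <= 3 -> Cmod (dirichlet_L chi (RtoC x) * P (RtoC x) - RtoC 1)%C <= / 4) ->
  G (RtoC sigma) = (Clog1 (dirichlet_L chi (RtoC sigma) * P (RtoC sigma)) + csum (primesN N) (fun p => lam (gchar chi (RtoC sigma) p)))%C.
Proof.
  intros HC HN [_ [HG1 HG2]] HGc Hs HN1 HD P HP.
  set (b := fun s => (Clog1 (dirichlet_L chi s * P s) + csum (primesN N) (fun p => lam (gchar chi s p)))%C).
  change (G (RtoC sigma) = b (RtoC sigma)).
  assert (Hb : forall x, sigma <= x <= 3 -> Cexp (b (RtoC x)) = dirichlet_L chi (RtoC x)).
  { intros x Hx. unfold b. rewrite Cexp_plus, Clog1_exp by (rewrite Cmod_minus_sym; specialize (HP x Hx); lra).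
    rewrite Cexp_csum, <- Cmult_assoc. unfold P. rewrite (cprod_inv (primesN N)); [ring|].
    intros p Hp. rewrite Cmult_comm. apply (euler_factor_inv q); [assumption| |now apply primesN_prime in Hp].
    change (Re (RtoC x)) with x. lra. }
  apply (seg_unique G b (RtoC 3) (RtoC sigma)).
  - intros t Ht. assert (E : seg (RtoC 3) (RtoC sigma) t = RtoC (3 + t * (sigma - 3))).
    { unfold seg. apply C_ext; simpl; ring. }
    rewrite E. set (x := 3 + t * (sigma - 3)).
    assert (Hx : sigma <= x <= 3).
    { assert (0 <= t * (3 - sigma)) by (apply Rmult_le_pos; lra).
      assert (t * (3 - sigma) <= 1 * (3 - sigma)) by (apply Rmult_le_compat_r; lra). unfold x. lra. }
    split; [apply HGc, HD, Hx|]. split.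
    + unfold b. apply ccont_plus.
      * apply (ccont_comp (fun s => dirichlet_L chi s * P s)%C Clog1).
        -- apply ccont_mult; [apply holomorphic_cont, (dirichlet_L_entire q chi HC HN)|].
           apply (ccont_cprod (primesN N) (fun p s => RtoC 1 - gchar chi s p)%C). intros p _.
           apply (ccont_ext (fun s => RtoC 1 + (- RtoC 1) * gchar chi s p)%C); [intros; ring|].
           apply ccont_plus; [apply ccont_const|]. apply ccont_mult; [apply ccont_const|apply ccont_gchar].
        -- apply ccont_Clog1. rewrite Cmod_minus_sym. specialize (HP x Hx). lra.
      * apply (ccont_csum (primesN N) (fun p s => lam (gchar chi s p))). intros p Hp.
        apply (ccont_comp (fun s => gchar chi s p) lam); [apply ccont_gchar|]. apply ccont_lam.
        apply primesN_prime in Hp. pose proof (gchar_prime_le_half q chi (RtoC x) p HC) as H.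
        change (Re (RtoC x)) with x in H. specialize (H ltac:(lra) Hp). lra.
    + rewrite Hb by assumption. apply HG1, HD, Hx.
  (* At 3 the two logarithms differ by a multiple of 2 pi i. The tail of the prime sum is at most 1
     and the logarithm near 1 at most 1/2, so the multiple is 0. *)
  - assert (E0 : Cexp (G (RtoC 3) - b (RtoC 3))%C = RtoC 1).
    { rewrite Cexp_minus, Hb by lra. rewrite HG1 by (apply HD; lra). unfold Cdiv. apply Cinv_r.
      rewrite <- HG1 by (apply HD; lra). apply Cexp_nz. }
    apply Cexp_1_small in E0.
    + replace (G (RtoC 3)) with ((G (RtoC 3) - b (RtoC 3)) + b (RtoC 3))%C by ring. rewrite E0. ring.
    + rewrite HG2 by (simpl; lra). rewrite log_series_lseries.
      pose proof (gchar_gdom q chi (RtoC 3) HC) as Hg. change (Re (RtoC 3)) with 3 in Hg.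
      destruct (lseries_cser 3 _ Hg ltac:(lra)) as [_ HT]. specialize (HT N HN1).
      assert (HNp : Rpower (INR N) (1 - 3) <= 1).
      { assert (1 <= INR N) by (apply (le_INR 1); lia).
        apply Rle_trans with (Rpower (INR N) 0); [apply Rle_Rpower; lra|]. rewrite Rpower_O by lra. lra. }
      pose proof (HP 3 ltac:(lra)) as HP3. pose proof (Clog1_bound _ HP3) as HC1.
      unfold b. set (A := lseries _) in *. set (B := csum _ _) in *. set (W := Clog1 _) in *.
      replace (A - (W + B))%C with ((A - B) + - W)%C by ring.
      eapply Rle_lt_trans; [apply Cmod_triangle|]. rewrite Cmod_opp. lra.
Qed.

(** From delta < 7/2 one has y >= L^4 and 2 sigma - 1 >= 3/4, so the tail is O(y^(-3/4)) = O(L^-3),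
    more than enough. *)
Lemma C_sum_tail_bound delta L y q chi sigma : 0 < delta < 7 / 2 -> 1 <= L -> dirichlet_character q chi ->
  y = Rpower L (14 / delta) -> 1 - delta / 28 <= sigma ->
  Cmod (C_sum sigma chi - csum (primes_le y) (fun p => lam (gchar chi (RtoC sigma) p) - gchar chi (RtoC sigma) p))%C <= 11 / L.
Proof.
  intros Hd HL HC Ey Hs. destruct (floor_nat_spec y) as [F1 F2]; [rewrite Ey; left; apply exp_pos|].
  assert (Y4 : L ^ 4 <= y).
  { rewrite Ey, <- Rpower_pow by lra. apply Rle_Rpower; [assumption|].
    apply Rmult_le_reg_r with delta; [lra|]. unfold Rdiv. rewrite Rmult_assoc, Rinv_l by lra. simpl. lra. }
  change (primes_le y) with (primesN (Z.to_nat (Zfloor y))). set (N := Z.to_nat (Zfloor y)) in *.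
  assert (L4 : 1 <= L ^ 4) by (apply pow_R1_Rle; assumption).
  assert (N1 : (1 <= N)%nat) by (apply Nat.nlt_ge; intros Hlt; replace N with 0%nat in F2 by lia; simpl in F2; lra).
  assert (N1' : 1 <= INR N) by (apply (le_INR 1); assumption).
  eapply Rle_trans; [apply (C_sum_approx q); [assumption|lra|assumption]|].
  assert (B : Rpower (INR N) (1 - 2 * sigma) <= 2 / L).
  { apply Rle_trans with (Rpower (INR N) (- (3 / 4))); [apply Rle_Rpower; lra|].
    apply Rle_trans with (Rpower (L ^ 4 / 2) (- (3 / 4))); [apply Rpower_le_base_neg; lra|].
    apply Rle_trans with (Rpower (L ^ 4) (- (3 / 4)) * Rpower 2 (3 / 4)).
    { right. unfold Rpower. rewrite ln_div by lra. rewrite <- exp_plus. f_equal. ring. }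
    unfold Rdiv. rewrite Rmult_comm. apply Rmult_le_compat; try (left; apply exp_pos).
    - rewrite <- (Rpower_1 2) at 2 by lra. apply Rle_Rpower; lra.
    - rewrite <- (Rpower_pow 4) by lra. rewrite Rpower_mult.
      apply Rle_trans with (Rpower L (- (1))); [apply Rle_Rpower; simpl; lra|].
      rewrite Rpower_Ropp, Rpower_1 by lra. lra. }
  assert (B2 : / (2 * sigma - 1) <= 4 / 3).
  { replace (4 / 3) with (/ (3 / 4)) by field. apply Rinv_le_contravar; lra. }
  assert (0 < / (2 * sigma - 1)) by (apply Rinv_0_lt_compat; lra).
  assert (0 < / L) by (apply Rinv_0_lt_compat; lra).
  assert (Rpower (INR N) (1 - 2 * sigma) * / (2 * sigma - 1) <= 2 / L * (4 / 3)).
  { apply Rmult_le_compat; [left; apply exp_pos|lra|assumption|assumption]. }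
  unfold Rdiv in *. lra.
Qed.

(** All errors obtained are O(1/L). They fit into the stated error because e^a log L >= log 2 >=
    1/2. *)
Lemma err_lower_bound a L : 2 <= L -> 0 <= a -> / L <= 2 * (exp a * ln L / L).
Proof.
  intros HL Ha. pose proof ln_2_bounds. assert (ln 2 <= ln L) by (apply ln_le; lra).
  pose proof (exp_ineq1_le a). assert (0 < / L) by (apply Rinv_0_lt_compat; lra).
  assert (1 * / 2 <= exp a * ln L) by (apply Rmult_le_compat; lra).
  unfold Rdiv. assert (/ 2 * / L <= exp a * ln L * / L) by (apply Rmult_le_compat_r; lra). lra.
Qed.

Theorem theorem4 (delta : R) (hdelta : 0 < delta < 7 / 2) :
  exists K : R, 0 < K /\
  forall Q : nat, (16 <= Q)%nat ->
  exists E : list (Z -> C),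
    NoDup E /\
    (forall chi : Z -> C, In chi E ->
       exists q : nat, (q <= Q)%nat /\ primitive_character q chi) /\
    INR (length E) <= K * Rpower (INR Q) delta /\
    forall (q : nat) (chi : Z -> C),
      (q <= Q)%nat -> primitive_character q chi -> ~ In chi E ->
      (forall s : C, region delta Q s -> dirichlet_L chi s <> RtoC 0) /\
      exists log_L : C -> C,
        is_log_L (region delta Q) chi log_L /\
        forall a : R, 0 <= 28 * a < delta * ln (INR Q) ->
          let sigma := 1 - a / ln (INR Q) in
          let y := Rpower (ln (INR Q)) (14 / delta) in
          let err := exp a * ln (ln (INR Q)) / ln (INR Q) in
          Cmod (log_L (RtoC sigma)
                - (prime_sum y (fun p => chi (Z.of_nat p) / npow p (RtoC sigma))
                   + C_sum sigma chi))%C <= K * err /\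
          exists theta : C, Cmod theta <= K * err /\
            dirichlet_L chi (RtoC sigma) =
              ((1 + theta)
               * prime_prod y
                   (fun p => / (1 - chi (Z.of_nat p) / npow p (RtoC sigma))))%C.
Proof.
  destruct (exceptional_count delta hdelta) as [K0 [K [HK0 [HK HE]]]].
  (* K bounds the exceptional set, 2 K0 comes from the logarithm of a number within K0/L of 1, and
     11 from cutting the sum C at y. The outer factor 2 is that of [err_lower_bound]. *)
  exists (K + 2 * (2 * K0 + 11)). split; [lra|]. intros Q HQ.
  destruct (HE Q HQ) as [E [HE1 [HE2 HE3]]]. exists E.
  assert (HP : 0 < Rpower (INR Q) delta) by apply exp_pos.
  split; [assumption|]. split; [intros chi Hchi; apply HE2 in Hchi; apply Hchi|]. split.
  { eapply Rle_trans; [exact HE3|]. apply Rmult_le_compat_r; lra. }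
  intros q chi Hq Hprim Hni. rewrite HE2 in Hni. pose proof (proj1 Hprim) as HC.
  pose proof (region_nonzero delta K0 Q q chi (proj1 hdelta) HQ Hq Hprim Hni) as HR.
  split; [assumption|].
  assert (HL4 : 4 * K0 <= ln (INR Q)) by (apply Rnot_lt_le; intros H; apply Hni; split; [now exists q|tauto]).
  assert (HN : ~ principal chi) by (intros H; apply Hni; split; [now exists q|tauto]).
  pose proof (ln_Q_ge_2 Q HQ) as HL2.
  assert (HF : forall x, 1 - delta / 28 <= x <= 3 ->
     Cmod (dirichlet_L chi (RtoC x) * euler_prod delta Q chi (RtoC x) - RtoC 1)%C <= K0 / ln (INR Q)).
  { intros x Hx. apply Rnot_lt_le. intros H. apply Hni. split; [now exists q|]. right. right.
    split; [assumption|]. now exists x. }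
  destruct (log_branch_exists (region delta Q) q chi HC HN) as [G [HG HGc]].
  (* The region contains with each point the horizontal ray to its right, so absence of zeros in it
     gives [hfree]. *)
  { intros s Hs x Hx. apply HR. unfold region in *. change (Re (x, Im s)) with x. change (Im (x, Im s)) with (Im s).
    destruct Hs as [Hs|[Hs1 Hs2]]; [left; lra|]. destruct (Rle_lt_dec 1 x); [now left|right; split; [lra|assumption]]. }
  exists G. split; [assumption|]. intros a Ha sigma y err.
  set (L := ln (INR Q)) in *.
  assert (IL : 0 < / L) by (apply Rinv_0_lt_compat; lra).
  assert (HaL : 0 <= a / L < delta / 28).
  { split; [apply Rmult_le_pos; lra|]. apply Rmult_lt_reg_r with L; [lra|]. unfold Rdiv at 1.
    rewrite Rmult_assoc, Rinv_l by lra. lra. }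
  assert (Hs : 1 - delta / 28 <= sigma <= 1) by (unfold sigma; lra).
  assert (HK4 : K0 / L <= / 4).
  { apply Rmult_le_reg_r with L; [lra|]. unfold Rdiv. rewrite Rmult_assoc, Rinv_l by lra. lra. }
  assert (Herr : / L <= 2 * err) by (apply err_lower_bound; lra).
  assert (HKe : forall c, 0 <= c <= 2 * K0 + 11 -> c / L <= (K + 2 * (2 * K0 + 11)) * err).
  { intros c Hc. assert (c * / L <= (2 * K0 + 11) * (2 * err)) by (apply Rmult_le_compat; lra).
    assert (0 <= K * err) by (apply Rmult_le_pos; lra). unfold Rdiv. lra. }
  set (w := (dirichlet_L chi (RtoC sigma) * euler_prod delta Q chi (RtoC sigma))%C).
  assert (Hw : Cmod (w - RtoC 1)%C <= K0 / L) by (apply HF; lra).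
  assert (Hy : 1 <= y).
  { unfold y. rewrite <- (Rpower_O L) by lra. apply Rle_Rpower; [lra|].
    left. apply Rdiv_lt_0_compat; lra. }
  split.
  - assert (HG0 : G (RtoC sigma) = (Clog1 w + csum (primes_le y) (fun p => lam (gchar chi (RtoC sigma) p)))%C).
    { unfold w, euler_prod. fold L. fold y.
      apply (log_branch_real (region delta Q) q chi G (Z.to_nat (Zfloor y)) sigma HC HN HG HGc); [lra| | |].
      - destruct (floor_nat_spec y) as [_ F2]; [lra|]. apply Nat.nlt_ge. intros Hlt.
        replace (Z.to_nat (Zfloor y)) with 0%nat in F2 by lia. simpl in F2. lra.
      - intros x Hx. unfold region. change (Re (RtoC x)) with x. change (Im (RtoC x)) with 0. rewrite Rabs_R0.
        destruct (Rle_lt_dec 1 x); [now left|right]. split; [lra|]. apply Rmult_le_pos; [lra|apply pow_le; fold L; lra].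
      - intros x Hx. eapply Rle_trans; [|exact HK4]. apply HF. lra. }
    pose proof (C_sum_tail_bound delta L y q chi sigma hdelta ltac:(lra) HC eq_refl (proj1 Hs)) as HT.
    rewrite csum_minus in HT. rewrite HG0.
    change (prime_sum y (fun p => (chi (Z.of_nat p) / npow p (RtoC sigma))%C)) with (csum (primes_le y) (gchar chi (RtoC sigma))).
    set (A := csum _ (fun p => lam _)) in *. set (B := csum (primes_le y) (gchar chi (RtoC sigma))) in *. change (csum (primes_le y) (fun p => gchar chi (RtoC sigma) p)) with B in HT. set (S0 := C_sum sigma chi) in *.
    replace (Clog1 w + A - (B + S0))%C with (Clog1 w + - (S0 - (A - B)))%C by ring.
    eapply Rle_trans; [apply Cmod_triangle|]. rewrite Cmod_opp.
    pose proof (Clog1_bound w ltac:(lra)) as HCl.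
    apply Rle_trans with ((2 * K0 + 11) / L); [unfold Rdiv in *; lra|]. apply HKe. lra.
  - exists (w - RtoC 1)%C. split; [eapply Rle_trans; [exact Hw|]; apply HKe; lra|].
    replace (RtoC 1 + (w - RtoC 1))%C with w by ring. unfold w, euler_prod. fold L. fold y.
    change (prime_prod y (fun p => (/ (1 - chi (Z.of_nat p) / npow p (RtoC sigma)))%C))
      with (cprod (primes_le y) (fun p => / (RtoC 1 - gchar chi (RtoC sigma) p))%C).
    rewrite <- Cmult_assoc, (cprod_inv (primes_le y)); [ring|].
    intros p Hp. apply Cinv_r. apply (euler_factor_inv q chi (RtoC sigma) p HC).
    + change (Re (RtoC sigma)) with sigma. lra.
    + apply (primesN_prime (Z.to_nat (Zfloor y)) p Hp).
Qed.
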